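(* Let $u^0\in L^1(\Omega)$ satisfy $\Phi(u^0)<+\infty$. For $\tau>0$ let $(u^n)_{n\ge 0}$ be generated from $u^0$ by the minimizing movement scheme with step $\tau$, and set $u_\tau(t):=u^{\lfloor t/\tau\rfloor}$ for $t\ge 0$. Then there exist $u\in C^0([0,+\infty);L^1(\Omega))$ and a subsequence $\tau_k\to 0$ such that $u_{\tau_k}\to u$ in $L^\infty([0,T];L^1(\Omega))$ for all $T>0$, and $$\|u(s)-u(t)\|_1\le \sqrt{2\Phi(u^0)}\,\sqrt{|t-s|}\qquad\text{for all } s,t\ge 0 .$$
   Context: $\Omega\subset\mathbb R^d$ is a bounded, connected, open set. $F:\mathbb R^d\to[0,+\infty]$ is convex and lower semicontinuous, with $F(0)=0$ and $F(\xi)\ge c|\xi|-c'$ for some $c>0$, $c'\ge 0$. $F^*$ is the convex conjugate of $F$ and $F^\infty(p)=\sup\{q\cdot p: F^*(q)<+\infty\}$ is the recession function of $F$. Functional $\Phi:L^1(\Omega)\to[0,+\infty]$, with one of two boundary conditions. (Neumann) $\Phi(u)=\int_\Omega F(\nabla u)\,dx+\int_\Omega F^\infty\big(\tfrac{D^su}{|D^su|}\big)\,d|D^su|$ if $u\in BV(\Omega)$, where $Du=\nabla u\,dx+D^su$ is the Radon–Nikodým decomposition, and $\Phi(u)=+\infty$ otherwise (if $F$ is superlinear, $\Phi(u)<+\infty$ forces $u\in W^{1,1}(\Omega)$). (Dirichlet) $\Omega$ is moreover Lipschitz, $g\in L^1(\partial\Omega)$ is the boundary datum (the trace of $u^0$),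 assumed to have an extension $\tilde g\in W^{1,1}(\Omega)$ with $\int_\Omega F(tD\tilde g)\,dx<+\infty$ for some $t>1$, and $\Phi(u)=\int_\Omega F(\nabla u)\,dx+\int_\Omega F^\infty\big(\tfrac{D^su}{|D^su|}\big)\,d|D^su|+\int_{\partial\Omega}F^\infty((g-u)\nu_\Omega)\,d\mathcal H^{d-1}$ ($\nu_\Omega$ the outer normal) if $u\in BV(\Omega)$, where $Du=\nabla u\,dx+D^su$ is the Radon–Nikodým decomposition, and $\Phi(u)=+\infty$ otherwise (if $F$ is superlinear, $\Phi(u)<+\infty$ forces $u\in W^{1,1}(\Omega)$ and $u=g$ on $\partial\Omega$). Minimizing movement scheme: given $u^0$ and $\tau>0$, for each $n\ge1$, $u^n$ is a minimizer over $u\in L^1(\Omega)$ of $\Phi(u)+\frac1{2\tau}\|u-u^{n-1}\|_1^2$. $\|\cdot\|_1$ is the $L^1(\Omega)$ norm and $\lfloor\cdot\rfloor$ is the integer part. *)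

(* Defs.v *)
From HB Require Import structures.
From mathcomp Require Import all_boot all_order all_algebra.
From mathcomp Require Import all_classical all_reals all_analysis.
From mathcomp Require Import measurable_realfun.

Set Implicit Arguments.
Unset Strict Implicit.
Unset Printing Implicit Defensive.

Import Order.TTheory GRing.Theory Num.Theory.
Import numFieldNormedType.Exports.

Local Open Scope classical_set_scope.
Local Open Scope ring_scope.

(* The library norm on ['rV[R]_d] is the sup norm. *)
Definition dotv (R : realType) (d : nat) (x y : 'rV[R]_d) : R :=
  \sum_(i < d) x 0 i * y 0 i.

Definition enorm (R : realType) (d : nat) (x : 'rV[R]_d) : R :=
  Num.sqrt (dotv x x).

Section borel_rV.
Variables (R : realType) (d : nat).

Definition borel_rV : set (set 'rV[R]_d) := <<s @open 'rV[R]_d >>.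

Let borel_rV0 : borel_rV set0.
Proof. exact: sigma_algebra0. Qed.

Let borel_rVC A : borel_rV A -> borel_rV (~` A).
Proof. exact: sigma_algebraC. Qed.

Let borel_rV_bigcup (F : (set 'rV[R]_d)^nat) : (forall i, borel_rV (F i)) ->
  borel_rV (\bigcup_i F i).
Proof. exact: sigma_algebra_bigcup. Qed.

Definition borel_rV_display : measure_display.
Proof. exact. Qed.

HB.instance Definition _ := @isMeasurable.Build borel_rV_display
  'rV[R]_d borel_rV borel_rV0 borel_rVC borel_rV_bigcup.

Lemma open_measurable_rV (U : set 'rV[R]_d) : open U -> measurable U.
Proof. by move=> oU; exact: sub_sigma_algebra. Qed.

End borel_rV.

Section lebesgue_rV.
Variable R : realType.

Definition cons_rV (n : nat) (p : R * 'rV[R]_n) : 'rV[R]_n.+1 :=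
  row_mx (p.1)%:M p.2.

Definition uncons_rV (n : nat) (x : 'rV[R]_n.+1) : R * 'rV[R]_n :=
  (x 0 0, rsubmx (x : 'rV[R]_(1 + n))).

Lemma cons_rVK n : cancel (@cons_rV n) (@uncons_rV n).
Proof.
move=> [a v]; rewrite /cons_rV /uncons_rV /= row_mxKr; congr pair.
by rewrite mxE; case: splitP => [j _|[]//]; rewrite ord1 mxE eqxx mulr1n.
Qed.

Lemma measurable_cons_rV n : measurable_fun setT (@cons_rV n).
Proof.
apply: (measurability (@open 'rV[R]_n.+1)) => //.
move=> _ [U oU <-]; rewrite setTI.
pose B (a : rat * 'rV[rat]_n * nat) : set (R * 'rV[R]_n) :=
  ball (ratr a.1.1 : R) a.2.+1%:R^-1 `*`
  ball (map_mx ratr a.1.2 : 'rV[R]_n) a.2.+1%:R^-1.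
pose D := [set a | B a `<=` @cons_rV n @^-1` U].
have mB a : measurable (B a).
  by apply: measurableX; [apply: open_measurable|apply: open_measurable_rV];
    exact: ball_open.
rewrite (_ : _ @^-1` _ = \bigcup_(a in D) B a); last first.
  apply/seteqP; split => [[x v] /= Uxv|p [a Da /Da]//].
  have /nbhs_ballP[e /= e0 eU] := open_nbhs_nbhs (conj oU Uxv).
  have [k ke] : exists k, k.+1%:R^-1 < e / 2.
    have e20 : 0 < e / 2 by rewrite divr_gt0.
    exists (Num.truncn (e / 2)^-1); rewrite invf_plt ?posrE ?ltr0n//.
    by rewrite truncnS_gt.
  have k0 : 0 < k.+1%:R^-1 :> R by rewrite invr_gt0 ltr0n.
  have dq (y : R) : exists q : rat, ball (ratr q : R) k.+1%:R^-1 y.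
    have [z [yz [q _ qz]]] : ball y k.+1%:R^-1 `&` range (@ratr R) !=set0.
      by apply: dense_rat; [exists y; exact: ballxx|exact: ball_open].
    by exists q; apply: ball_sym; rewrite qz.
  have [q hq] := dq x.
  have [w hw] := choice (fun j => dq (v 0 j)).
  exists (q, \row_j w j, k) => /=; last first.
    split => //=; split => // i j; rewrite !mxE (ord1 i); exact: hw.
  move=> [y z] [/= qy [_ wz]]; apply: eU; split => // i j.
  rewrite /cons_rV !mxE (ord1 i); case: splitP => l _ /=.
    rewrite !mxE; case: eqP => _; rewrite ?mulr1n ?mulr0n; last exact: ballxx.
    apply: (@le_ball _ _ _ (k.+1%:R^-1 + k.+1%:R^-1)).
      by rewrite [leRHS]splitr lerD// ltW.
    by apply: ball_triangle (ball_sym hq) qy.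
  apply: (@le_ball _ _ _ (k.+1%:R^-1 + k.+1%:R^-1)).
    by rewrite [leRHS]splitr lerD// ltW.
  apply: (ball_triangle (ball_sym (hw l))).
  by have := wz 0 l; rewrite !mxE.
rewrite bigcup_mkcond; apply: countable_bigcupT_measurable => [|a].
  exact: countableP.
by case: ifP.
Qed.

Lemma measurable_uncons_rV n : measurable_fun setT (@uncons_rV n).
Proof.
apply/measurable_fun_pairP; split.
  apply: (measurability _ (RGenOpens.measurableE R)) => _ [_ [a [b ->]] <-].
  rewrite setTI; apply: open_measurable_rV.
  by apply: (open_comp _ (itv_open _ _)) => // x _; exact: coord_continuous.
apply: (measurability (@open 'rV[R]_n)) => // _ [U oU <-].
rewrite setTI; apply: open_measurable_rV.
apply: open_comp oU => x _ A /= /nbhs_ballP[e /= e0 eA].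
apply/nbhs_ballP; exists e => //= y [_ xy]; apply: eA; split => // i j.
by rewrite !mxE; exact: xy.
Qed.

(* Lebesgue measure on R^n.+1 is the product of the Lebesgue measures on R and
   R^n, transported by (a, v) |-> (a, v_0, ..., v_(n-1)). *)
Section step.
Variables (n : nat) (mu : {sigma_finite_measure set 'rV[R]_n -> \bar R}).

Definition lebesgue_rVS : set 'rV[R]_n.+1 -> \bar R :=
  pushforward (@lebesgue_measure R \x mu)%E (@cons_rV n).

Let lebesgue_rVS0 : lebesgue_rVS set0 = 0%E.
Proof. by rewrite /lebesgue_rVS /pushforward preimage_set0 measure0. Qed.

Let lebesgue_rVS_ge0 A : (0 <= lebesgue_rVS A)%E.
Proof. exact: (measure_ge0 (@lebesgue_measure R \x mu)%E). Qed.

Let lebesgue_rVS_sigma_additive : semi_sigma_additive lebesgue_rVS.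
Proof.
move=> F mF tF mUF; rewrite /lebesgue_rVS /pushforward preimage_bigcup.
have mpre A : measurable A -> measurable (@cons_rV n @^-1` A).
  by move=> mA; rewrite -[X in measurable X]setTI; exact: measurable_cons_rV.
apply: measure_semi_sigma_additive.
- by move=> k; exact: mpre.
- apply/trivIsetP => i j _ _ ij; rewrite -preimage_setI.
  by move/trivIsetP : tF => /(_ _ _ _ _ ij) ->//; rewrite preimage_set0.
- by rewrite -preimage_bigcup; exact: mpre.
Qed.

HB.instance Definition _ := isMeasure.Build _ _ _ lebesgue_rVS
  lebesgue_rVS0 lebesgue_rVS_ge0 lebesgue_rVS_sigma_additive.

Let lebesgue_rVS_sigma_finite : sigma_finite setT lebesgue_rVS.
Proof.
have /sigma_finiteP[F [TF ndF Foo]] := sigma_finiteT (@lebesgue_measure R).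
have /sigma_finiteP[G [TG ndG Goo]] := sigma_finiteT mu.
exists (fun k => @uncons_rV n @^-1` (F k `*` G k)).
  rewrite -preimage_bigcup (_ : \bigcup_i _ = setT) ?preimage_setT//.
  rewrite -subTset => -[x y] _.
  have [k _ Fkx] : (\bigcup_i F i) x by rewrite -TF.
  have [l _ Gly] : (\bigcup_i G i) y by rewrite -TG.
  exists (maxn k l) => //; split => /=.
  - by move: x Fkx; exact/subsetPset/ndF/leq_maxl.
  - by move: y Gly; exact/subsetPset/ndG/leq_maxr.
move=> k; have [mF Fkoo] := Foo k; have [mG Gkoo] := Goo k; split.
  by rewrite -[X in measurable X]setTI; apply: measurable_uncons_rV => //;
    exact: measurableX.
rewrite /lebesgue_rVS /pushforward -comp_preimage.
rewrite (_ : _ \o _ = id); last by apply/funext; exact: cons_rVK.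
by rewrite preimage_id product_measure1E// lte_mul_pinfty// ge0_fin_numE.
Qed.

HB.instance Definition _ := @Measure_isSigmaFinite.Build _ _ _ lebesgue_rVS
  lebesgue_rVS_sigma_finite.

End step.

Fixpoint lebesgue_rV (n : nat) : {sigma_finite_measure set 'rV[R]_n -> \bar R} :=
  if n is m.+1 then lebesgue_rVS (lebesgue_rV m) else \d_(0 : 'rV[R]_0).

End lebesgue_rV.

Section hausdorff.
Variables (R : realType) (d k : nat).
Implicit Types A C : set 'rV[R]_d.
Local Open Scope ereal_scope.

Definition ediam C : R :=
  sup [set enorm (p.1 - p.2) | p in C `*` C].

Definition unit_ball_volume : R :=
  fine (lebesgue_rV R k [set x | (enorm x <= 1)%R]).

(* The constant makes H^k the k-dimensional area on k-dimensional surfaces;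
   [0 ^+ 0 = 1] makes H^0 the counting measure. *)
Definition hausdorff_weight C : \bar R :=
  if `[< C = set0 >] then 0
  else (unit_ball_volume * (ediam C / 2) ^+ k)%:E.

Definition delta_cover (delta : R) A : set (set 'rV[R]_d)^nat :=
  [set C | (forall i x y, C i x -> C i y -> (enorm (x - y) <= delta)%R) /\
           A `<=` \bigcup_i C i].

Definition hausdorff_delta (delta : R) A : \bar R :=
  ereal_inf [set \sum_(i <oo) hausdorff_weight (C i) | C in delta_cover delta A].

Definition hausdorff A : \bar R :=
  ereal_sup [set hausdorff_delta delta A | delta in [set delta | (0 < delta)%R]].

Let weight_ge0 C : 0 <= hausdorff_weight C.
Proof.
rewrite /hausdorff_weight; case: ifPn => // _; rewrite lee_fin.
rewrite mulr_ge0 ?fine_ge0// exprn_ge0// divr_ge0//.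
rewrite /ediam; set S := (X in sup X).
have [->|/set0P[_ [p pC _]]] := eqVneq S set0; first by rewrite sup0.
have [hS|hS] := pselect (has_sup S); last by rewrite sup_out.
apply: (@le_trans _ _ (enorm (p.1 - p.2))); first exact: sqrtr_ge0.
by apply: ub_le_sup; [exact: hS.2|exists p].
Qed.

Let delta_ge0 delta A : 0 <= hausdorff_delta delta A.
Proof.
by apply: le_ereal_inf_tmp => x [C _ <-]; exact: nneseries_ge0.
Qed.

Let delta0 delta : hausdorff_delta delta set0 = 0.
Proof.
apply/eqP; rewrite eq_le delta_ge0 andbT.
apply: ereal_inf_lbound; exists (fun=> set0); first by split.
by rewrite eseries0// => i _ _; rewrite /hausdorff_weight asboolT.
Qed.

Let delta_le delta A B :
  A `<=` B -> hausdorff_delta delta A <= hausdorff_delta delta B.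
Proof.
move=> AB; apply: ereal_inf_le_tmp => x [C [dC BC] <-]; exists C => //.
by split => //; exact: subset_trans BC.
Qed.

Let delta_sigma_subadditive delta : sigma_subadditive (hausdorff_delta delta).
Proof.
move=> A; have [[i ioo]|] := pselect (exists i, hausdorff_delta delta (A i) = +oo).
  by rewrite (eseries_pinfty _ _ ioo) ?leey// => n _;
    rewrite -ltNye (lt_le_trans _ (delta_ge0 _ _)).
rewrite -forallNE => Aoo.
suff add2e (e : {posnum R}) : hausdorff_delta delta (\bigcup_n A n) <=
    \sum_(i <oo) hausdorff_delta delta (A i) + e%:num%:E.
  by apply/lee_addgt0Pr => _/posnumP[].
rewrite (le_trans _ (epsilon_trick _ _ _))//.
pose P n (B : (set 'rV[R]_d)^nat) := delta_cover delta (A n) B /\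
  \sum_(k <oo) hausdorff_weight (B k) <=
    hausdorff_delta delta (A n) + (e%:num / (2 ^ n.+1)%:R)%:E.
have [G PG] : {G : ((set 'rV[R]_d)^nat)^nat & forall n, P n (G n)}.
  apply: (@choice _ _ P) => n; rewrite /P.
  have finA : hausdorff_delta delta (A n) \is a fin_num.
    by rewrite ge0_fin_numE// ltey; apply/eqP/Aoo.
  have en1 : (0 < e%:num / (2 ^ n.+1)%:R)%R by [].
  have [x [B AB Bx] /ltW xS] := lb_ereal_inf_adherent en1 finA.
  by exists B; split => //; rewrite Bx.
have /card_esym/ppcard_eqP[f] := card_nat2.
apply: (@le_trans _ _ (\esum_(i in setT) (hausdorff_weight \o uncurry G) i)).
  apply: ereal_inf_lbound => /=; exists (uncurry G \o f).
    split => [i x y /=|].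
      by rewrite /uncurry; case: (f i) => a b; exact: (PG a).1.1.
    move=> t [i _ /(PG i).1.2[j _ Gt]]; exists (f^-1%FUN (i, j)) => //=.
    by rewrite invK ?inE.
  rewrite -(esum_pred_image (hausdorff_weight \o uncurry G) _ xpredT)
    ?[fun=> _]set_true//.
    by rewrite image_eq.
  by move=> n _; exact: weight_ge0.
rewrite (_ : esum _ _ = \sum_(i <oo) \sum_(j <oo) hausdorff_weight (G i j)); last first.
  pose J : nat -> set (nat * nat) := fun i => [set (i, j) | j in setT].
  rewrite (_ : setT = \bigcup_k J k); last first.
    by rewrite predeqE => -[a b]; split => // _; exists a => //; exists b.
  rewrite esum_bigcupT /=; last 2 first.
    - apply/trivIsetP => i j _ _ ij.
      rewrite predeqE => -[n m] /=; split => //= -[] [_] _ [<-{n} _].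
      by move=> [m' _] [] /esym/eqP; rewrite (negbTE ij).
    - by move=> /= [n m].
  rewrite -(image_id [set: nat]) -fun_true esum_pred_image//; last first.
    by move=> n _; exact: esum_ge0.
  apply: eq_eseriesr => /= j _.
  rewrite -(esum_pred_image (hausdorff_weight \o uncurry G) (pair j) predT)//=; last first.
    by move=> ? ? _ _; exact: (@can_inj _ _ _ snd).
  by congr esum; rewrite predeqE => -[a b]; split; move=> [i _ <-]; exists i.
apply: lee_nneseries => [i _ _|i _]; first exact: nneseries_ge0.
by have [_] := PG i.
Qed.

Let hausdorff0 : hausdorff set0 = 0.
Proof.
apply/eqP; rewrite eq_le; apply/andP; split.
  by apply: ge_ereal_sup => _ [delta _ <-]; rewrite delta0.
by apply: ereal_sup_ubound; exists 1%R; rewrite ?delta0//=.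
Qed.

Let hausdorff_ge0 A : 0 <= hausdorff A.
Proof.
apply: (le_trans (delta_ge0 1 A)).
by apply: ereal_sup_ubound; exists 1%R => //=.
Qed.

Let le_hausdorff : {homo hausdorff : A B / A `<=` B >-> A <= B}.
Proof.
move=> A B AB; apply: ge_ereal_sup => _ [delta d0 <-].
apply: (le_trans (delta_le delta AB)).
by apply: ereal_sup_ubound; exists delta.
Qed.

Let hausdorff_sigma_subadditive : sigma_subadditive hausdorff.
Proof.
move=> A; apply: ge_ereal_sup => _ [delta d0 <-].
apply: (le_trans (delta_sigma_subadditive _ _)).
apply: lee_nneseries => [i _ _|i _]; first exact: delta_ge0.
by apply: ereal_sup_ubound; exists delta.
Qed.

HB.instance Definition _ := isOuterMeasure.Build R 'rV[R]_d hausdorff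
  hausdorff0 hausdorff_ge0 le_hausdorff hausdorff_sigma_subadditive.

Definition hausdorff_outer : {outer_measure set 'rV[R]_d -> \bar R} := hausdorff.

(* H^k on the sigma-algebra of its Caratheodory-measurable sets *)
Definition hausdorff_measure :
    {measure set (caratheodory_type hausdorff_outer) -> \bar R} :=
  hausdorff_outer : set (caratheodory_type hausdorff_outer) -> \bar R.

End hausdorff.

Section convex_analysis.
Variables (R : realType) (d : nat).
Implicit Types (F : 'rV[R]_d -> \bar R) (p q : 'rV[R]_d).
Local Open Scope ereal_scope.

Definition econvex F := forall p q (t : R), (0 <= t <= 1)%R ->
  F (t *: p + (1 - t) *: q)%R <= t%:E * F p + (1 - t)%:E * F q.

Definition conjugate F q : \bar R :=
  ereal_sup [set (dotv q p)%:E - F p | p in [set: 'rV[R]_d]].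

Definition recession F p : \bar R :=
  ereal_sup [set (dotv q p)%:E | q in [set q | conjugate F q < +oo]].

End convex_analysis.

Section geometry.
Variables (R : realType) (d : nat).
Implicit Types (Omega : set 'rV[R]_d) (x n : 'rV[R]_d).

Definition boundary Omega : set 'rV[R]_d := closure Omega `\` Omega°.

(* Near each boundary point, [Omega] is the region below the graph of a
   Lipschitz function over the hyperplane orthogonal to [e]. *)
Definition lipschitz_domain Omega := forall x, boundary Omega x ->
  exists (e : 'rV[R]_d) (gamma : 'rV[R]_d -> R) (L r : R),
    [/\ enorm e = 1, 0 < r,
        forall y z, `|gamma y - gamma z| <= L * enorm (y - z) &
        forall y, enorm (y - x) < r ->
          Omega y <-> dotv y e < gamma (y - dotv y e *: e)].

(* Unit vector pointing out of [Omega] and orthogonal to a tangent hyperplane of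
   the boundary at [x]; at a point of differentiability of the local graph this
   is the usual outer normal. *)
Definition is_outer_normal Omega x n := enorm n = 1 /\
  forall eps : R, 0 < eps -> exists2 r, 0 < r & forall y, enorm (y - x) < r ->
    (Omega y -> dotv (y - x) n <= eps * enorm (y - x)) /\
    (~ Omega y -> - (eps * enorm (y - x)) <= dotv (y - x) n).

Definition outer_normal Omega x : 'rV[R]_d := xget 0 (is_outer_normal Omega x).

End geometry.

Section function_spaces.
Variables (R : realType) (d : nat) (Omega : set 'rV[R]_d).
Implicit Types (u phi : 'rV[R]_d -> R) (G : 'rV[R]_d -> 'rV[R]_d).
Implicit Types (A : set 'rV[R]_d).

Local Notation leb := (lebesgue_rV R d).

(* Elements of L^1(Omega) are represented by functions on R^d, of which only the
   restriction to [Omega], up to null sets, is relevant. *)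
Definition L1 u : Prop := leb.-integrable Omega (EFin \o u).

Definition L1norm u : R := \int[leb]_(x in Omega) `|u x|.

Definition partial (i : 'I_d) phi : 'rV[R]_d -> R :=
  fun x => 'D_(delta_mx 0 i) phi x.

(* C^1_c(Omega): C^1 amounts to the existence and continuity of the partial
   derivatives. *)
Definition test_function phi : Prop :=
  [/\ forall i x, derivable phi x (delta_mx 0 i),
      forall i, continuous (partial i phi),
      compact (closure [set x | phi x != 0]) &
      closure [set x | phi x != 0] `<=` Omega].

Definition weak_gradient u G : Prop :=
  (forall i, L1 (fun x => G x 0 i)) /\
  forall i phi, test_function phi ->
    \int[leb]_(x in Omega) (u x * partial i phi x) =
    - \int[leb]_(x in Omega) (phi x * G x 0 i).

Definition charge_integral (nu : {charge set 'rV[R]_d -> \bar R}) phi : R :=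
  let: exist P exN := cid (Hahn_decomposition nu) in
  let: exist N PN := cid exN in
  \int[jordan_pos PN]_x phi x - \int[jordan_neg PN]_x phi x.

Definition vector_charge := 'I_d -> {charge set 'rV[R]_d -> \bar R}.

(* The finite vector measure [Du] on [Omega] (extended by zero) is the
   distributional derivative of [u]. *)
Definition distributional_derivative u (Du : vector_charge) : Prop :=
  (forall i A, measurable A -> Du i A = Du i (A `&` Omega)) /\
  forall i phi, test_function phi ->
    \int[leb]_(x in Omega) (u x * partial i phi x) =
    - charge_integral (Du i) phi.

Definition BV u : Prop :=
  L1 u /\ exists Du, distributional_derivative u Du.

Definition charge_variation_vec (nu : vector_charge) A : \bar R :=
  ereal_sup [set (\sum_(k <oo) (enorm (\row_i fine (nu i (P k))))%:E)%E |
    P in [set P : (set 'rV[R]_d)^nat | [/\ forall k, measurable (P k),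
      trivIset setT P & \bigcup_k P k = A]]].

(* [Du = G dx + Ds] with [Ds] singular, [sigma = |Ds|] and [eta = Ds/|Ds|] *)
Definition radon_nikodym_decomposition (Du : vector_charge) G
    (Ds : vector_charge) (sigma : {measure set 'rV[R]_d -> \bar R})
    (eta : 'rV[R]_d -> 'rV[R]_d) : Prop :=
  [/\ forall i, L1 (fun x => G x 0 i),
      forall i A, measurable A ->
        (Du i A = \int[leb]_(x in A `&` Omega) (G x 0 i)%:E + Ds i A)%E,
      exists N, [/\ measurable N, leb N = 0%E &
        forall i A, measurable A -> Ds i A = Ds i (A `&` N)],
      forall A, measurable A -> sigma A = charge_variation_vec Ds A &
      forall i, sigma.-integrable setT (fun x => (eta x 0 i)%:E) /\
        forall A, measurable A ->
          Ds i A = (\int[sigma]_(x in A) (eta x 0 i)%:E)%E].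

(* Boundary trace of a BV function: approximate limit in the L^1 sense of the
   averages over [Omega] near [x]; it depends only on the class of [u]. *)
Definition is_trace u (x : 'rV[R]_d) (z : R) : Prop :=
  (fun r : R => r ^- d *
     \int[leb]_(y in Omega `&` [set y | enorm (y - x) < r]) `|u y - z|)
    @ 0^'+ --> (0 : R).

Definition trace u (x : 'rV[R]_d) : R := xget 0 (is_trace u x).

Definition has_trace u (g : 'rV[R]_d -> R) : Prop :=
  {ae hausdorff_measure R d d.-1, forall x, boundary Omega x -> is_trace u x (g x)}.

End function_spaces.

Variant boundary_condition (R : realType) (d : nat) :=
  | Neumann
  | Dirichlet of ('rV[R]_d -> R).
Arguments Neumann {R d}.

Section energy.
Variables (R : realType) (d : nat) (Omega : set 'rV[R]_d).
Variables (F : 'rV[R]_d -> \bar R) (bc : boundary_condition R d).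
Implicit Types u : 'rV[R]_d -> R.
Local Open Scope ereal_scope.

Local Notation leb := (lebesgue_rV R d).

(* For [u] in BV the decomposition exists and is unique up to null sets, so the
   infimum is over a singleton. *)
Definition bulk_energy u : \bar R :=
  ereal_inf [set e | exists Du G Ds sigma eta,
    [/\ distributional_derivative Omega u Du,
        radon_nikodym_decomposition Omega Du G Ds sigma eta &
        e = \int[leb]_(x in Omega) F (G x) +
            \int[sigma]_(x in Omega) recession F (eta x)]].

Definition boundary_energy u : \bar R :=
  if bc is Dirichlet g then
    \int[hausdorff_measure R d d.-1]_(x in boundary Omega)
      recession F ((g x - trace Omega u x) *: outer_normal Omega x)%R
  else 0.

Definition Phi u : \bar R :=
  if `[< BV Omega u >] then bulk_energy u + boundary_energy u else +oo.

Definition boundary_assumptions (u0 : 'rV[R]_d -> R) : Prop :=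
  if bc is Dirichlet g then
    [/\ lipschitz_domain Omega,
        (hausdorff_measure R d d.-1).-integrable (boundary Omega) (EFin \o g),
        has_trace Omega u0 g &
        exists gext G (t : R), [/\ L1 Omega gext /\ weak_gradient Omega gext G,
          has_trace Omega gext g, (1 < t)%R &
          \int[leb]_(x in Omega) F (t *: G x) < +oo]]
  else True.

Definition minimizing_movement (tau : R) (u0 : 'rV[R]_d -> R)
    (u : nat -> 'rV[R]_d -> R) : Prop :=
  u 0%N = u0 /\
  forall n, L1 Omega (u n.+1) /\ forall v, L1 Omega v ->
    Phi (u n.+1) +
      ((2 * tau)^-1 * L1norm Omega (fun x => u n.+1 x - u n x) ^+ 2)%:E <=
    Phi v + ((2 * tau)^-1 * L1norm Omega (fun x => v x - u n x) ^+ 2)%:E.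

End energy.

(* Main.v *)
(* The scheme gives the discrete Hoelder estimate
   [|u^n - u^m|_1 <= sqrt(2 Phi(u0)) sqrt(tau (n - m))], so everything reduces to
   the total boundedness in L^1 of all iterates [u^n] with [tau n <= t0]; a
   diagonal extraction then yields a locally uniform limit with the same modulus.

   By coercivity the iterates are bounded in BV, hence totally bounded on the
   points at distance more than [r] from the complement of Omega (mollify).  What
   remains is that no mass concentrates near the boundary.  In a Lipschitz domain
   a boundary layer has many disjoint translates inside Omega, and the BV bound
   makes the mass of [u] on each of them almost equal.  For the Neumann problem
   Omega is arbitrary and only the energy helps: [Phi] is submodular,
   [Phi(min(u, v)) + Phi(max(u, v)) <= Phi(u) + Phi(v)].  Put [m_0 = max(u0, M)]
   and [m_n = max(m_(n-1), u^n)]; comparing [u^n] with [min(u^n, m_(n-1))] gives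
   [Phi(m_n) + |m_n - m_(n-1)|_1^2 / (2 tau) <= Phi(m_(n-1))], so that
   [|m_n - m_0|_1 <= sqrt(2 t0 Phi(m_0))].  Since [Phi(max(u0, M)) -> 0] as [M]
   grows, the iterates lie below functions uniformly close in L^1 to the fixed
   function [m_0]; symmetrically from below.

   Submodularity of the relaxed energy is proved by duality.  For a finite measure
   [e], being an energy measure of [u] means [q . Du - F^*(q) dx <= e] for all [q].
   Mollifying [u] and [v] and taking a smooth minimum and maximum turns this into
   an inequality for the pair of truncations tested with two vectors [q1], [q2],
   which passes to the limit; optimizing over [q1] and [q2] pointwise recovers
   both energies by Fenchel-Moreau. *)

From HB Require Import structures.
Require Import Defs.
From mathcomp Require Import all_boot all_order all_algebra.
From mathcomp Require Import all_classical all_reals all_analysis.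
From mathcomp Require Import measurable_realfun.
From mathcomp Require Import ring lra.

Set Implicit Arguments.
Unset Strict Implicit.
Unset Printing Implicit Defensive.

Import Order.TTheory GRing.Theory Num.Theory.
Import numFieldNormedType.Exports.

Local Open Scope classical_set_scope.
Local Open Scope ring_scope.

(** * Calculus and test functions *)

(** A function is only ever seen through its pairings [Dpair] with test functions, and every
    derivative becomes a density against one finite reference measure, the sum of the energy
    measures and of Lebesgue measure on Omega. Submodularity cannot be had for minimum and maximum
    separately: smoothing only makes the two gradients complementary convex combinations of those of
    [u] and [v]. Hence the inequality carries two dual vectors at once; being linear in the
    pairings, it survives L^1 limits. The vectors decouple only at the end, when a countable family,
    dense in the graph of F^*, allows an almost everywhere supremum in each. As [bulk_energy] is an
    infimum, an energy measure exists only for a bound strictly above the energy; each comparison in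
    the tail estimate thus loses [2 * eps], and [eps] is chosen after the number of steps. Vanishing
    of the energy of high truncations uses one reference measure for all levels, which is possible
    because constants admit the zero energy measure. *)

Section calculus.
Variable (R : realType).

Lemma is_derive_lineP (V W : normedModType R) (f : V -> W) (x v : V) (t : R) (l : W) :
  is_derive t (1 : R) (fun s => f (x + s *: v)) l <-> is_derive (x + t *: v) v f l.
Proof.
have E : (fun h : R => h^-1 *: (((fun s => f (x + s *: v)) \o shift t) (h *: (1 : R)) - f (x + t *: v)))
   = (fun h : R => h^-1 *: ((f \o shift (x + t *: v)) (h *: v) - f (x + t *: v))).
  apply/funext => h /=; congr (_ *: (f _ - _)).
  by rewrite /GRing.scale /= mulr1 -/(GRing.scale _ _) scalerDl addrCA addrA.
split=> -[d1 d2]; split.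
- by move: d1; rewrite /derivable E.
- by move: d2; rewrite /derive E.
- by move: d1; rewrite /derivable -E.
- by move: d2; rewrite /derive -E.
Qed.

Lemma mvt_bound (f df : R -> R) (t w c : R) :
  (forall s : R, is_derive s (1 : R) f (df s)) ->
  (forall s, `|s| <= `|t| -> `|df s - c| <= w) ->
  `|f t - f 0 - t * c| <= w * `|t|.
Proof.
move=> fdf dfc.
have cf : continuous f.
  by move=> s; apply/differentiable_continuous/derivable1_diffP; case: (fdf s).
have H a b : a <= b -> (forall s, a <= s <= b -> `|s| <= `|t|) ->
    `|f b - f a - (b - a) * c| <= w * (b - a).
  move=> ab abt.
  have [z zab ->] := MVT_segment ab (fun s _ => fdf s) (continuous_subspaceT cf).
  rewrite mulrC -mulrBr normrM (ger0_norm (_ : 0 <= b - a)) ?subr_ge0// mulrC.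
  rewrite ler_wpM2r ?subr_ge0//; apply: dfc; apply: abt.
  by move: zab; rewrite in_itv.
have [t0|t0] := leP 0 t.
  have := H 0 t t0; rewrite subr0 (ger0_norm t0); apply.
  by move=> s /andP[s0 st]; rewrite ger0_norm.
have /(_ (ltW t0)) := H t 0; rewrite sub0r (ltr0_norm t0).
rewrite (_ : f 0 - f t - - t * c = - (f t - f 0 - t * c)); last by ring.
rewrite normrN; apply => s /andP[s0 st]; rewrite ler0_norm// lerN2//.
Qed.

Section C1.
Variable d : nat.
Implicit Types (f : 'rV[R]_d -> R) (g : 'I_d -> 'rV[R]_d -> R).

(** The notion of C^1 behind [test_function]. Keeping the gradient [g] explicit lets it be computed
    by rules, as in [has_grad_comp] and [has_grad_smin]. *)
Definition has_grad f g :=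
  (forall x i, is_derive x (delta_mx 0 i) f (g i x)) /\ forall i, continuous (g i).

Lemma has_grad_partial f g i : has_grad f g -> partial i f = g i.
Proof. by move=> [fg _]; apply/funext => x; rewrite /partial; case: (fg x i). Qed.

Lemma le_coord_norm (x : 'rV[R]_d) i : `|x 0 i| <= `|x|.
Proof.
rewrite {2}/Num.norm /= mx_normrE.
exact: (@le_bigmax _ _ _ 0 (fun ij : 'I_1 * 'I_d => `|x ij.1 ij.2|) (0, i)).
Qed.

Lemma norm_le_coord (x : 'rV[R]_d) (r : R) :
  0 <= r -> (forall i, `|x 0 i| <= r) -> `|x| <= r.
Proof.
move=> r0 xr; rewrite /Num.norm /= mx_normrE; apply: bigmax_le => // -[i j] _ /=.
by rewrite (ord1 i).
Qed.

Lemma has_grad_line f g x i t : has_grad f g ->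
  is_derive t (1 : R) (fun s => f (x + s *: delta_mx 0 i)) (g i (x + t *: delta_mx 0 i)).
Proof. by move=> [fg _]; apply/is_derive_lineP. Qed.

Lemma has_grad_estimate f g x z (w : R) : has_grad f g ->
  (forall y i, `|y| <= `|z| -> `|g i (x + y) - g i x| <= w) ->
  `|f (x + z) - f x - \sum_i z 0 i * g i x| <= w * \sum_i `|z 0 i|.
Proof.
move=> fg gw.
(* A path from 0 to [z] that changes one coordinate at a time; on each piece the one-variable mean
   value theorem applies. *)
pose zz (k : nat) : 'rV[R]_d := \row_i (if (i < k)%N then z 0 i else 0).
have zz0 : zz 0%N = 0 by apply/rowP => i; rewrite !mxE.
have zzd : zz d = z by apply/rowP => i; rewrite !mxE ltn_ord.
have zzS (i : 'I_d) : zz i.+1 = zz i + z 0 i *: delta_mx 0 i.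
  apply/rowP => j; rewrite !mxE /= ltnS.
  have [->|ij] := eqVneq j i; first by rewrite leqnn ltnn /= mulr1 add0r.
  by rewrite mulr0 addr0 leq_eqVlt (_ : val j == val i = false)//; apply/negbTE.
have -> : f (x + z) - f x = \sum_(i < d) (f (x + zz i.+1) - f (x + zz i)).
  rewrite -(big_mkord xpredT (fun k => f (x + zz k.+1) - f (x + zz k))).
  by rewrite (telescope_sumr (fun k => f (x + zz k)))// zzd zz0 addr0.
rewrite -sumrB mulr_sumr; apply: le_trans (ler_norm_sum _ _ _) _.
apply: ler_sum => i _; rewrite zzS addrA.
have := @mvt_bound _ _ (z 0 i) w (g i x)
  (fun s => has_grad_line (x + zz i) i s fg); rewrite scale0r addr0; apply.
move=> s sz; rewrite -addrA; apply: gw; apply: norm_le_coord => // j.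
rewrite !mxE /=; have [->|ij] := eqVneq j i.
  by rewrite ltnn mulr1 add0r (le_trans sz)// le_coord_norm.
by rewrite mulr0 addr0; case: ifPn => _; rewrite ?normr0// le_coord_norm.
Qed.

Lemma continuous_rVP (f : 'rV[R]_d -> R) x :
  continuous_at x f <->
  forall e, 0 < e -> exists2 r, 0 < r & forall y, `|y - x| < r -> `|f y - f x| < e.
Proof.
split=> [cf e e0|H].
  have /(@cvgrPdist_lt _ _ _ (nbhs x))/(_ _ e0)/nbhs_ballP[r /= r0 rf] := cf.
  exists r => // y yx; rewrite distrC; apply: rf.
  by rewrite -ball_normE /= distrC.
apply/(@cvgrPdist_lt _ _ _ (nbhs x)) => e e0; have [r r0 rf] := H _ e0.
apply/nbhs_ballP; exists r => // y; rewrite -ball_normE /= distrC => yx.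
by rewrite distrC rf.
Qed.

Lemma near0_dist (P : R -> Prop) : (\forall r \near 0^'+, P r) ->
  exists2 r, 0 < r & P r.
Proof.
move=> H; near (0 : R)^'+ => r; exists r; near: r => //; exact: nbhs_right_gt.
Unshelve. all: by end_near. Qed.

Lemma compact_unif_cont f (K : set 'rV[R]_d) (e : R) : compact K -> continuous f ->
  0 < e -> exists2 r, 0 < r & forall x y, K x -> `|y - x| < r -> `|f y - f x| < e.
Proof.
move=> cK cf e0.
suff /near0_dist[r r0 H] : \forall r \near (0 : R)^'+,
    K `<=` (fun x => forall y, `|y - x| < r -> `|f y - f x| < e).
  by exists r => // x y Kx; apply: H.
apply: (compact_near_coveringP K).1 => // x Kx.
have e20 : 0 < e / 2 by rewrite divr_gt0.
have /cvgrPdist_lt/(_ _ e20) := cf x.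
move=> /nbhs_ballP[r /= r0 rf].
exists (ball x (r / 2), [set s | 0 < s < r / 2]) => /=.
  split; first by apply: nbhsx_ballx; rewrite divr_gt0.
  near=> s; apply/andP; split; near: s; first exact: nbhs_right_gt.
  by apply: nbhs_right_lt; rewrite divr_gt0.
move=> [x' s] /= [xx' /andP[s0 sr]] y yx'.
rewrite (splitr e) (le_lt_trans (ler_distD (f x) _ _))// ltrD//.
  rewrite distrC; apply: rf; rewrite -ball_normE /= -(subrKA x') (splitr r).
  rewrite (le_lt_trans (ler_normD _ _))// ltrD//.
    by move: xx'; rewrite -ball_normE.
  by rewrite distrC (lt_trans yx').
apply: rf; apply: le_ball xx'.
by lra.
Unshelve. all: by end_near. Qed.

Lemma continuous_bounded_on f (K : set 'rV[R]_d) : compact K -> continuous f ->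
  exists2 M, 0 <= M & forall x, K x -> `|f x| <= M.
Proof.
move=> cK cf; have [->|/set0P K0] := eqVneq K set0; first by exists 0.
have [|c _ H] := @compact_EVT_max _ R (fun x => `|f x|) K K0 cK.
  apply: continuous_subspaceT => x; apply: continuous_comp; first exact: cf.
  exact: norm_continuous.
by exists `|f c| => // x Kx; apply: H; rewrite inE.
Qed.

Lemma compact_closed_ball (x : 'rV[R]_d) r : compact [set y | `|y - x| <= r].
Proof.
apply: bounded_closed_compact.
  exists (r + `|x|); split; first exact: num_real.
  move=> M rM y /= yx; rewrite -(subrK x y) (le_trans (ler_normD _ _))//.
  by rewrite (le_trans _ (ltW rM))// lerD2r.
rewrite (_ : [set _ | _] = (fun y : 'rV[R]_d => `|y - x|) @^-1` [set s | s <= r])//.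
apply: closed_comp; last exact: closed_le.
move=> y _; apply/continuous_rVP => e e0; exists e => // z zy.
apply: le_lt_trans zy; apply: le_trans (ler_dist_dist _ _) _.
by rewrite opprB addrA subrK.
Qed.

Lemma has_grad_continuous f g : has_grad f g -> continuous f.
Proof.
move=> fg x.
have bnd i : exists M, 0 <= M /\ forall y : 'rV[R]_d, `|y| <= 1 -> `|g i (x + y)| <= M.
  have [M M0 HM] := continuous_bounded_on (@compact_closed_ball x 1) (fg.2 i).
  by exists M; split => // y y1; apply: HM; rewrite /= addrC addKr.
have [M HM] := choice bnd.
pose B := \sum_i M i.
have B0 : 0 <= B by apply: sumr_ge0 => i _; case: (HM i).
(* The partial derivatives are at most [B] on the unit ball around [x]: [2 * B] bounds their
   oscillation and the last [B] the linear part. *)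
have lip y : `|y| <= 1 -> `|f (x + y) - f x| <= (2 * B + B) * d%:R * `|y|.
  move=> y1.
  have E := @has_grad_estimate f g x y (2 * B) fg.
  have le1 i : M i <= B.
    by rewrite /B (bigD1 i)//= lerDl sumr_ge0// => j _; case: (HM j).
  have S : \sum_(i < d) `|y 0 i| <= d%:R * `|y|.
    rewrite -[d in d%:R]card_ord -sumr_const mulr_suml; apply: ler_sum => i _.
    by rewrite mul1r le_coord_norm.
  have g1 z i : `|z| <= 1 -> `|g i (x + z)| <= B.
    by move=> z1; apply: le_trans (le1 i); case: (HM i) => _; exact.
  have g0 i : `|g i x| <= B by rewrite -(addr0 x) g1// normr0.
  rewrite -(subrK (\sum_i y 0 i * g i x) (f (x + y) - f x)).
  rewrite (le_trans (ler_normD _ _))// 2!mulrDl lerD//.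
    apply: le_trans (E _) _; last by rewrite -[leRHS]mulrA ler_wpM2l// mulr_ge0.
    move=> z i zy; rewrite (le_trans (ler_normB _ _))// mulr2n mulrDl mul1r lerD//.
    exact/g1/(le_trans zy).
  rewrite (le_trans (ler_norm_sum _ _ _))//.
  apply: (@le_trans _ _ (\sum_i B * `|y 0 i|)).
    by apply: ler_sum => i _; rewrite normrM mulrC ler_wpM2r.
  by rewrite -mulr_sumr -mulrA ler_wpM2l.
set C := (2 * B + B) * d%:R in lip.
have C0 : 0 <= C by rewrite mulr_ge0// addr_ge0// mulr_ge0.
apply/continuous_rVP => e e0.
exists (Num.min 1 (e / (C + 1))) => /=.
  by rewrite lt_min ltr01 divr_gt0// ltr_wpDl.
move=> y; rewrite lt_min => /andP[y1 ye].
rewrite -[y in f y](subrKC x) (le_lt_trans (lip _ _))//; first exact: ltW.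
rewrite ltr_pdivlMr in ye; last by rewrite ltr_wpDl.
by rewrite (le_lt_trans _ ye)// mulrC ler_wpM2l// lerDl.
Qed.

End C1.
End calculus.

Section C1b.
Variables (R : realType) (d : nat).
Implicit Types (f : 'rV[R]_d -> R) (g : 'I_d -> 'rV[R]_d -> R).

Lemma has_grad_eq f f' g g' : has_grad f g -> f =1 f' ->
  (forall i x, g i x = g' i x) -> has_grad f' g'.
Proof.
move=> fg /funext<- gg'; suff <- : g = g' by [].
by apply/funext => i; apply/funext => x; rewrite gg'.
Qed.

Lemma has_grad_cst (a : R) : has_grad (fun _ : 'rV[R]_d => a) (fun _ _ => 0).
Proof. by split=> [x i|i]; [exact: is_derive_cst|exact: cst_continuous]. Qed.

Lemma has_gradD f f' g g' : has_grad f g -> has_grad f' g' ->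
  has_grad (fun x => f x + f' x) (fun i x => g i x + g' i x).
Proof.
move=> [fg cg] [fg' cg']; split=> [x i|i x].
  exact: (@is_deriveD _ _ _ f f' x _ _ _ (fg x i) (fg' x i)).
exact: (@continuousD _ _ _ (g i) (g' i) x (cg i x) (cg' i x)).
Qed.

Lemma has_gradM f f' g g' : has_grad f g -> has_grad f' g' ->
  has_grad (fun x => f x * f' x) (fun i x => f x * g' i x + g i x * f' x).
Proof.
move=> fg0 fg0'; have cf := has_grad_continuous fg0.
have cf' := has_grad_continuous fg0'.
move: fg0 fg0' => [fg cg] [fg' cg']; split=> [x i|i x].
  have := @is_deriveM _ _ f f' x _ _ _ (fg x i) (fg' x i).
  by rewrite /GRing.scale /= [X in _ + X]mulrC.
apply: (@continuousD _ _ _ (fun x => f x * g' i x) (fun x => g i x * f' x) x).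
  exact: (@continuousM _ _ f (g' i) x (cf x) (cg' i x)).
exact: (@continuousM _ _ (g i) f' x (cg i x) (cf' x)).
Qed.

Lemma has_gradZ (a : R) f g : has_grad f g ->
  has_grad (fun x => a * f x) (fun i x => a * g i x).
Proof.
move=> fg; apply: has_grad_eq (has_gradM (has_grad_cst a) fg) _ _ => // i x.
by rewrite mul0r addr0.
Qed.

Lemma has_gradB f f' g g' : has_grad f g -> has_grad f' g' ->
  has_grad (fun x => f x - f' x) (fun i x => g i x - g' i x).
Proof.
move=> fg fg'; apply: has_grad_eq (has_gradD fg (has_gradZ (-1) fg')) _ _.
- by move=> x; rewrite mulN1r.
- by move=> i x; rewrite mulN1r.
Qed.

Lemma has_grad_comp (h dh : R -> R) f g :
  (forall t, is_derive t (1 : R) h (dh t)) -> continuous dh ->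
  has_grad f g -> has_grad (fun x => h (f x)) (fun i x => dh (f x) * g i x).
Proof.
move=> hdh cdh fg; have cf := has_grad_continuous fg; split=> [x i|i x].
  rewrite -[x in is_derive x](addr0 x) -(scale0r (delta_mx 0 i)).
  apply/is_derive_lineP.
  have := @is_derive1_comp _ h (fun s => f (x + s *: delta_mx 0 i)) 0
    (dh (f x)) (g i x).
  apply; first by rewrite scale0r addr0.
  by have := has_grad_line x i 0 fg; rewrite scale0r addr0.
apply: (@continuousM _ _ (fun x => dh (f x)) (g i) x); last exact: fg.2.
by apply: continuous_comp; [exact: cf|exact: cdh].
Qed.

Lemma has_grad_coord (j : 'I_d) :
  has_grad (fun x : 'rV[R]_d => x 0 j) (fun i _ => (i == j)%:R).
Proof.
split=> [x i|i]; last exact: cst_continuous.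
rewrite -[x in is_derive x](addr0 x) -(scale0r (delta_mx 0 i)).
apply/is_derive_lineP.
rewrite (_ : (fun s => _) = (fun s : R => x 0 j + (i == j)%:R * s)); last first.
  by apply/funext => s; rewrite !mxE /= eq_sym mulrC.
apply: is_derive_eq; rewrite add0r.
by rewrite /GRing.scale /= mulr1 mul1r.
Qed.

Lemma has_grad_shift (a : 'rV[R]_d) f g : has_grad f g ->
  has_grad (fun x => f (x + a)) (fun i x => g i (x + a)).
Proof.
move=> [fg cg]; split=> [x i|i x].
  rewrite -[x in is_derive x](addr0 x) -(scale0r (delta_mx 0 i)).
  apply/is_derive_lineP.
  rewrite (_ : (fun s => _) = (fun s : R => f (x + a + s *: delta_mx 0 i))).
    by apply/is_derive_lineP; rewrite scale0r !addr0.
  by apply/funext => s; rewrite -!addrA (addrC a).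
apply/continuous_rVP => e e0.
have /continuous_rVP/(_ _ e0)[r r0 rf] := cg i (x + a).
exists r => // y yx; apply: rf.
by rewrite opprD addrACA subrr addr0.
Qed.

Definition C1 f := exists g, has_grad f g.

Lemma C1P f : C1 f <-> has_grad f (fun i => partial i f).
Proof.
split=> [[g fg]|H]; last by exists (fun i => partial i f).
by apply: (has_grad_eq fg) => // i x; rewrite (has_grad_partial i fg).
Qed.

Lemma C1D f f' : C1 f -> C1 f' -> C1 (fun x => f x + f' x).
Proof. by move=> [g fg] [g' fg']; eexists; exact: (has_gradD fg fg'). Qed.

Lemma C1M f f' : C1 f -> C1 f' -> C1 (fun x => f x * f' x).
Proof. by move=> [g fg] [g' fg']; eexists; exact: (has_gradM fg fg'). Qed.

Lemma C1B f f' : C1 f -> C1 f' -> C1 (fun x => f x - f' x).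
Proof. by move=> [g fg] [g' fg']; eexists; exact: (has_gradB fg fg'). Qed.

Lemma C1_cst (a : R) : C1 (fun=> a).
Proof. by eexists; exact: has_grad_cst. Qed.

Lemma C1_prod (I : Type) (s : seq I) (f : I -> 'rV[R]_d -> R) :
  (forall i, C1 (f i)) -> C1 (fun x => \prod_(i <- s) f i x).
Proof.
move=> cf; elim: s => [|i s IH].
  by under eq_fun do rewrite big_nil; exact: C1_cst.
by under eq_fun do rewrite big_cons; exact: C1M.
Qed.

Lemma C1_sum (I : Type) (s : seq I) (f : I -> 'rV[R]_d -> R) :
  (forall i, C1 (f i)) -> C1 (fun x => \sum_(i <- s) f i x).
Proof.
move=> cf; elim: s => [|i s IH].
  by under eq_fun do rewrite big_nil; exact: C1_cst.
by under eq_fun do rewrite big_cons; exact: C1D.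
Qed.

End C1b.

(** * Compactly supported C^1 functions *)

Section bump.
Variable R : realType.

Lemma is_derive_quad (f : R -> R) (t l C : R) :
  (forall h, `|f (t + h) - f t - h * l| <= C * h ^+ 2) ->
  is_derive t (1 : R) f l.
Proof.
move=> H.
suff cv : h^-1 *: (f (h *: (1 : R) + t) - f t) @[h --> 0^'] --> l.
  by split; [apply/cvg_ex; exists l|exact: cvg_lim].
have C1p : 0 < `|C| + 1 by rewrite ltr_wpDl.
apply/cvgrPdist_lt => e e0; near=> h.
have h0 : h != 0 by near: h; exact: nbhs_dnbhs_neq.
have hC : `|h| < e / (`|C| + 1).
  by near: h; apply: dnbhs0_lt; rewrite divr_gt0.
rewrite {1}/GRing.scale /= {1}/GRing.scale /= mulr1.
rewrite distrC [h + t]addrC.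
have -> : h^-1 * (f (t + h) - f t) - l = h^-1 * (f (t + h) - f t - h * l).
  by rewrite [RHS]mulrBr mulKf.
rewrite normrM normfV ltr_pdivrMl ?normr_gt0//.
apply: le_lt_trans (H h) _.
rewrite ltr_pdivlMr// in hC.
rewrite -real_normK ?num_real// expr2 mulrCA ltr_pM2l ?normr_gt0//.
apply: le_lt_trans hC; rewrite mulrC ler_wpM2l// (le_trans (ler_norm C))//.
by rewrite lerDl.
Unshelve. all: by end_near. Qed.

(** The square of the positive part is C^1, which is all the regularity that [test_function] asks
    for; it takes the place of the usual exponential. *)
Definition sqpos (t : R) : R := (Num.max 0 t) ^+ 2.

Lemma is_derive_sqpos t : is_derive t (1 : R) sqpos (2 * Num.max 0 t).
Proof.
apply: (@is_derive_quad _ _ _ 1) => h; rewrite mul1r /sqpos.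
by case: (leP 0 t) => ?; case: (leP 0 (t + h)) => ?; rewrite ler_norml; nra.
Qed.

Lemma sqpos_ge0 t : 0 <= sqpos t. Proof. exact: sqr_ge0. Qed.

Lemma sqpos_gt0 t : (0 < sqpos t) = (0 < t).
Proof.
rewrite /sqpos exprn_even_gt0//=; case: (leP t 0) => t0; last by rewrite gt_eqF.
by rewrite eqxx.
Qed.

Lemma continuous_max0 : continuous (fun t : R => Num.max 0 t).
Proof.
move=> t; apply: (@continuous_max R R (fun=> 0) id t); first exact: cst_continuous.
exact: cvg_id.
Qed.

Variable d : nat.

(** A product over the coordinates, so that the bump is positive exactly on a ball of the sup norm,
    the norm of the topology on row vectors. *)
Definition bump (c : 'rV[R]_d) (r : R) (x : 'rV[R]_d) : R :=
  \prod_(i < d) sqpos (r ^+ 2 - (x 0 i - c 0 i) ^+ 2).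

Lemma bump_C1 c r : C1 (bump c r).
Proof.
apply: C1_prod => i.
have [g fg] : C1 (fun x : 'rV[R]_d => r ^+ 2 - (x 0 i - c 0 i) ^+ 2).
  apply: C1B; first exact: C1_cst.
  under eq_fun do rewrite expr2.
  by apply: C1M; (apply: C1B; [eexists; exact: has_grad_coord|exact: C1_cst]).
eexists; apply: (has_grad_comp is_derive_sqpos _ fg).
move=> t; apply: (@continuousM _ _ (fun=> 2) (fun t : R => Num.max 0 t)).
  exact: cst_continuous.
exact: continuous_max0.
Qed.

Lemma bump_ge0 c r x : 0 <= bump c r x.
Proof. by apply: prodr_ge0 => i _; exact: sqpos_ge0. Qed.

Lemma bump_gt0 c r x : 0 < r -> (0 < bump c r x) = (`|x - c| < r).
Proof.
move=> r0; have E i : (0 < sqpos (r ^+ 2 - (x 0 i - c 0 i) ^+ 2)) = (`|(x - c) 0 i| < r).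
  by rewrite sqpos_gt0 subr_gt0 !mxE -[in RHS]ltr_sqr ?nnegrE ?(ltW r0)// -normrX ger0_norm// sqr_ge0.
apply/idP/idP => [H|H].
  rewrite ltNge; apply/negP => rx.
  have [i ri] : exists i, r <= `|(x - c) 0 i|.
    apply/not_existsP => Hn; move: rx; apply/negP; rewrite -ltNge.
    rewrite /Num.norm /= mx_normrE; apply/bigmax_ltP; split => // -[i j] _ /=.
    by rewrite (ord1 i) ltNge; apply/negP/Hn.
  move: H; rewrite /bump (bigD1 i)//= => H.
  have := E i; rewrite [in RHS]ltNge ri /= => /negbT; rewrite -leNgt => le0.
  have := sqpos_ge0 (r ^+ 2 - (x 0 i - c 0 i) ^+ 2).
  rewrite le_eqVlt ltNge le0 orbF => /eqP e0.
  by move: H; rewrite -e0 mul0r ltxx.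
apply: prodr_gt0 => i _; rewrite E; apply: le_lt_trans H.
exact: le_coord_norm.
Qed.

Lemma bump_le1 c (r : R) x : 0 <= r <= 1 -> bump c r x <= 1.
Proof.
case/andP => r0 r1; apply: prodr_ile1 => i _; apply/andP; split; first exact: sqpos_ge0.
rewrite /sqpos exprn_ile1//; first by rewrite le_max lexx.
rewrite ge_max ler01/= lerBlDr; apply: (@le_trans _ _ 1); first exact: exprn_ile1.
by rewrite lerDl sqr_ge0.
Qed.

Lemma bump0N r x : bump 0 r (- x) = bump 0 r x.
Proof.
by apply: eq_bigr => i _; rewrite !mxE !oppr0 !addr0 sqrrN.
Qed.

End bump.

Section test_functions.
Variables (R : realType) (d : nat).
Implicit Types (Omega K : set 'rV[R]_d) (phi psi f : 'rV[R]_d -> R).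

Lemma test_grad Omega phi : test_function Omega phi -> has_grad phi (fun i => partial i phi).
Proof. by move=> [D C _ _]; split=> // x i; apply/derivableP/D. Qed.

Lemma test_C1 Omega phi : test_function Omega phi -> C1 phi.
Proof. by move=> /test_grad h; eexists; exact: h. Qed.

Lemma test_intro Omega phi K : C1 phi -> compact K -> K `<=` Omega ->
  (forall x, phi x != 0 -> K x) -> test_function Omega phi.
Proof.
move=> /C1P[D C] cK KO pK.
have clK : closure [set x | phi x != 0] `<=` K.
  have clK : K = closure K.
    apply/closure_id; apply: compact_closed cK.
    exact: (@norm_hausdorff R 'rV[R]_d).
  by rewrite [X in _ `<=` X]clK; apply: closure_subset => x; exact: pK.
split=> //.
- by apply: subclosed_compact cK clK; exact: closed_closure.
- exact: subset_trans KO.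
Qed.

Lemma test_supp Omega phi : test_function Omega phi ->
  exists K, [/\ compact K, K `<=` Omega, forall x, ~ K x -> phi x = 0 &
    forall i x, ~ K x -> partial i phi x = 0].
Proof.
move=> tp; have [D C cK KO] := tp; exists (closure [set x | phi x != 0]).
have z x : ~ closure [set x | phi x != 0] x -> phi x = 0.
  by move=> nK; apply/eqP/negPn/negP => px; apply: nK; exact: subset_closure.
split=> // i x nK.
have oC : open (~` closure [set x | phi x != 0]).
  by apply: closed_openC; exact: closed_closure.
have /nbhs_ballP[r /= r0 rC] : nbhs x (~` closure [set x | phi x != 0]).
  by apply: open_nbhs_nbhs; split.
apply: (cvg_lim (@norm_hausdorff _ _)).
apply/cvgrPdist_lt => e e0; near=> h.
have hr : `|h| < r by near: h; exact: dnbhs0_lt.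
rewrite /= z; last first.
  apply: rC; rewrite -ball_normE /= -normrN opprB addrK normrZ.
  apply: le_lt_trans hr; rewrite -[leRHS]mulr1 ler_wpM2l//.
  apply: norm_le_coord => // j; rewrite !mxE.
  by case: (_ && _); rewrite ?normr1 ?normr0.
by rewrite z// subrr scaler0 subrr normr0.
Unshelve. all: by end_near. Qed.

Lemma test_sub Omega Omega' phi : Omega `<=` Omega' ->
  test_function Omega phi -> test_function Omega' phi.
Proof. by move=> s [? ? ? c]; split=> //; exact: subset_trans s. Qed.

Lemma test_MC1 Omega phi f : test_function Omega phi -> C1 f ->
  test_function Omega (fun x => phi x * f x).
Proof.
move=> tp cf; have [K [cK KO K0 _]] := test_supp tp.
apply: (test_intro _ cK KO) => [|x]; first by apply: C1M => //; exact: test_C1 tp.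
by move/eqP => h; apply: contrapT => /K0 px; apply: h; rewrite px mul0r.
Qed.

Lemma test0 Omega : test_function Omega (fun=> 0).
Proof.
apply: (@test_intro _ _ set0); [exact: C1_cst|exact: compact0|by []|].
by move=> x /eqP.
Qed.

Lemma testD Omega phi psi : test_function Omega phi -> test_function Omega psi ->
  test_function Omega (fun x => phi x + psi x).
Proof.
move=> tp tq; have [K [cK KO K0 _]] := test_supp tp.
have [L [cL LO L0 _]] := test_supp tq.
apply: (@test_intro _ _ (K `|` L)).
- by apply: C1D; [exact: test_C1 tp|exact: test_C1 tq].
- exact: compactU.
- by move=> x [/KO|/LO].
- move=> x /eqP h; apply: contrapT => /not_orP[/K0 a /L0 b]; apply: h.
  by rewrite a b addr0.
Qed.

Lemma testZ Omega (a : R) phi : test_function Omega phi ->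
  test_function Omega (fun x => a * phi x).
Proof.
move=> tp; have := test_MC1 tp (C1_cst d a).
by under eq_fun do rewrite mulrC.
Qed.

Lemma testB Omega phi psi : test_function Omega phi -> test_function Omega psi ->
  test_function Omega (fun x => phi x - psi x).
Proof.
move=> tp tq; have := testD tp (testZ (-1) tq).
by under eq_fun do rewrite mulN1r.
Qed.

Lemma test_sum Omega (I : Type) (s : seq I) (f : I -> 'rV[R]_d -> R) :
  (forall i, test_function Omega (f i)) ->
  test_function Omega (fun x => \sum_(i <- s) f i x).
Proof.
move=> tf; elim: s => [|i s IH].
  by under eq_fun do rewrite big_nil; exact: test0.
by under eq_fun do rewrite big_cons; exact: testD.
Qed.

Lemma partialD i phi psi : C1 phi -> C1 psi ->
  partial i (fun x => phi x + psi x) = fun x => partial i phi x + partial i psi x.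
Proof. by move=> /C1P a /C1P b; exact: (has_grad_partial i (has_gradD a b)). Qed.

Lemma partialZ i (a : R) phi : C1 phi ->
  partial i (fun x => a * phi x) = fun x => a * partial i phi x.
Proof. by move=> /C1P b; exact: (has_grad_partial i (has_gradZ a b)). Qed.

Lemma partialM i phi psi : C1 phi -> C1 psi ->
  partial i (fun x => phi x * psi x) =
  fun x => phi x * partial i psi x + partial i phi x * psi x.
Proof. by move=> /C1P a /C1P b; exact: (has_grad_partial i (has_gradM a b)). Qed.

Lemma partial_shift i (a : 'rV[R]_d) phi : C1 phi ->
  partial i (fun x => phi (x + a)) = fun x => partial i phi (x + a).
Proof. by move=> /C1P b; exact: (has_grad_partial i (has_grad_shift a b)). Qed.

Definition cont_supp (K : set 'rV[R]_d) f :=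
  [/\ compact K, continuous f & forall x, ~ K x -> f x = 0].

Lemma cont_supp_bounded K f : cont_supp K f ->
  exists2 M, 0 <= M & forall x, `|f x| <= M.
Proof.
move=> [cK cf f0]; have [M M0 HM] := continuous_bounded_on cK cf.
exists M => // x; have [/HM//|/f0 ->] := pselect (K x).
by rewrite normr0.
Qed.

Lemma cont_supp_unif K f (e : R) : cont_supp K f -> 0 < e ->
  exists2 r, 0 < r & forall x y, `|y - x| < r -> `|f y - f x| < e.
Proof.
move=> [cK cf f0] e0; have [r r0 H] := compact_unif_cont cK cf e0.
exists r => // x y yx; have [Kx|Kx] := pselect (K x); first exact: H.
have [Ky|Ky] := pselect (K y); first by rewrite distrC; apply: H => //; rewrite distrC.
by rewrite !f0// subrr normr0.
Qed.

Lemma test_cont_supp Omega phi : test_function Omega phi ->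
  exists K, [/\ K `<=` Omega, cont_supp K phi & forall i, cont_supp K (partial i phi)].
Proof.
move=> tp; have [K [cK KO K0 K1]] := test_supp tp; exists K; split=> //.
  by split=> //; exact: (has_grad_continuous (test_grad tp)).
by move=> i; split=> //; [exact: (test_grad tp).2|exact: K1].
Qed.

Lemma compact_margin Omega K : open Omega -> compact K -> K `<=` Omega ->
  exists2 r, 0 < r & forall x y, K x -> `|y - x| < r -> Omega y.
Proof.
move=> oO cK KO.
suff /near0_dist[r r0 H] : \forall r \near (0 : R)^'+,
    K `<=` (fun x => forall y, `|y - x| < r -> Omega y).
  by exists r => // x y Kx; apply: H.
apply: (compact_near_coveringP K).1 => // x Kx.
have /nbhs_ballP[r /= r0 rf] := open_nbhs_nbhs (conj oO (KO _ Kx)).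
exists (ball x (r / 2), [set s | 0 < s < r / 2]) => /=.
  split; first by apply: nbhsx_ballx; rewrite divr_gt0.
  near=> s; apply/andP; split; near: s; first exact: nbhs_right_gt.
  by apply: nbhs_right_lt; rewrite divr_gt0.
move=> [x' s] /= [xx' /andP[s0 sr]] y yx'.
apply: rf; rewrite -ball_normE /= -(subrKA x') (splitr r).
rewrite (le_lt_trans (ler_normD _ _))// ltrD//.
  by move: xx'; rewrite -ball_normE.
by rewrite distrC (lt_trans yx').
Unshelve. all: by end_near. Qed.

Lemma compact_shift K (a : 'rV[R]_d) : compact K -> compact [set x | K (x + a)].
Proof.
move=> cK; rewrite (_ : [set _ | _] = (fun x => x - a) @` K).
  apply: continuous_compact => //; apply: continuous_subspaceT => x.
  apply: (@cvgB R 'rV[R]_d _ (nbhs x) _ id (fun=> a) x a); first exact: cvg_id.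
  exact: cvg_cst.
apply/seteqP; split=> x /=; last by move=> [y Ky <-]; rewrite subrK.
by move=> Kx; exists (x + a); rewrite ?addrK.
Qed.

Lemma test_shift Omega Omega' phi K (a : 'rV[R]_d) : test_function Omega phi ->
  compact K -> (forall x, ~ K x -> phi x = 0) ->
  (forall x, K (x + a) -> Omega' x) ->
  test_function Omega' (fun x => phi (x + a)).
Proof.
move=> tp cK K0 KO; apply: (@test_intro _ _ [set x | K (x + a)]); last 1 first.
- by move=> x /eqP h /=; apply: contrapT => /K0.
- by have /C1P h := test_C1 tp; eexists; exact: (has_grad_shift a h).
- exact: compact_shift.
- exact: KO.
Qed.

Lemma bump_test Omega c r : 0 < r -> (forall x, `|x - c| <= r -> Omega x) ->
  test_function Omega (bump c r).
Proof.
move=> r0 H; apply: (@test_intro _ _ [set x | `|x - c| <= r]) => //.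
- exact: bump_C1.
- exact: compact_closed_ball.
- move=> x px /=; rewrite ltW// -bump_gt0// lt_def px bump_ge0//.
Qed.

(** Compact support makes the partial derivatives uniformly continuous, so the first-order expansion
    is uniform in the base point. This uniformity lets the expansion be integrated. *)
Lemma test_estimate Omega phi : test_function Omega phi -> forall w : R, 0 < w ->
  exists2 r, 0 < r & forall x z, `|z| < r ->
   `|phi (x + z) - phi x - \sum_i z 0 i * partial i phi x| <= w * \sum_i `|z 0 i|.
Proof.
move=> tp w w0; have [K [KO cp cpp]] := test_cont_supp tp.
have [r rP] : {r : 'I_d -> R & forall i, 0 < r i /\ forall x y, `|y - x| < r i ->
    `|partial i phi y - partial i phi x| < w}.
  have H i : exists r, 0 < r /\ forall x y, `|y - x| < r ->
    `|partial i phi y - partial i phi x| < w.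
    by have [r r0 H] := cont_supp_unif (cpp i) w0; exists r.
  exact: choice H.
exists (\big[Num.min/1]_i r i).
  apply: lt_bigmin => // i _; by case: (rP i).
move=> x z zr; apply: (has_grad_estimate (test_grad tp)) => y i yz; apply/ltW; apply: (rP i).2; rewrite addrC addKr.
apply: le_lt_trans yz _; apply: lt_le_trans zr _.
exact: bigmin_le_cond.
Qed.

End test_functions.

(** * Smooth minimum *)

Section smooth_min.
Variable R : realType.

(** The identity [min a b = (a + b - |a - b|) / 2] with [|t|] smoothed to the root of
    [t^2 + e^2]. *)
Definition smin (e a b : R) : R := (a + b - Num.sqrt ((a - b) ^+ 2 + e ^+ 2)) / 2.

Lemma sqrt_sqrD_bounds (t e : R) : 0 <= e ->
  `|t| <= Num.sqrt (t ^+ 2 + e ^+ 2) <= `|t| + e.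
Proof.
move=> e0; apply/andP; split.
  by rewrite -sqrtr_sqr ler_wsqrtr// lerDl sqr_ge0.
have te0 : 0 <= `|t| + e by rewrite addr_ge0.
rewrite -[leRHS](ger0_norm te0) -sqrtr_sqr ler_wsqrtr//.
rewrite sqrrD real_normK ?num_real// lerD2r lerDl mulrn_wge0// mulr_ge0//.
Qed.

Lemma smin_dist (e a b : R) : 0 <= e -> `|smin e a b - Num.min a b| <= e.
Proof.
move=> e0; have /andP[] := sqrt_sqrD_bounds (a - b) e0.
rewrite /smin; set s := Num.sqrt _; move=> h1 h2.
rewrite ler_norml; case: (leP a b) => ab.
  by rewrite ler0_norm in h1 h2; rewrite ?subr_le0//; apply/andP; split; lra.
by rewrite gtr0_norm in h1 h2; rewrite ?subr_gt0//; apply/andP; split; lra.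
Qed.

Variable d : nat.

(** The weight [th] is the same in every direction, so the gradient vector is a convex combination
    of the two gradients. Nothing more precise about [th] is kept. *)
Lemma has_grad_smin (e : R) (f f' : 'rV[R]_d -> R) g g' : 0 < e ->
  has_grad f g -> has_grad f' g' -> exists2 th : 'rV[R]_d -> R,
  (forall x, 0 <= th x <= 1) &
  has_grad (fun x => smin e (f x) (f' x))
    (fun i x => th x * g i x + (1 - th x) * g' i x).
Proof.
move=> e0 fg fg'.
pose q (t : R) := Num.sqrt (t ^+ 2 + e ^+ 2).
have q0 t : 0 < t ^+ 2 + e ^+ 2 by rewrite ltr_wpDl ?sqr_ge0// exprn_gt0.
have q1 t : 0 < q t by rewrite sqrtr_gt0.
have dq (t : R) : is_derive t (1 : R) q (t / q t).
  have H : is_derive t (1 : R) (fun t : R => t ^+ 2 + e ^+ 2) (2 * t).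
    by apply: is_derive_eq; rewrite /GRing.scale /= ?expr1 ?mulr1 ?addr0 ?mulr_natl; ring.
  have := @is_derive1_comp _ (@Num.sqrt R) (fun t : R => t ^+ 2 + e ^+ 2) t _ _
    (is_derive1_sqrt (q0 t)) H.
  rewrite (_ : _ * _ = t / q t)// /q; field.
  by rewrite gt_eqF ?sqrtr_gt0.
have cq : continuous q.
  by move=> t; apply/differentiable_continuous/derivable1_diffP; case: (dq t).
have cdq : continuous (fun t : R => t / q t).
  move=> t; apply: (@continuousM _ _ id (fun t => (q t)^-1)); first exact: cvg_id.
  by apply: continuousV; [rewrite gt_eqF|exact: cq].
have G := has_gradZ 2^-1 (has_gradB (has_gradD fg fg')
  (has_grad_comp dq cdq (has_gradB fg fg'))).
(* [t / q t] is the derivative of the smoothed absolute value and lies in [-1, 1]. *)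
exists (fun x => (1 - (f x - f' x) / q (f x - f' x)) / 2).
  move=> x; set t := f x - f' x.
  have : `|t / q t| <= 1.
    rewrite normrM normfV ler_pdivrMr ?normr_gt0 ?gt_eqF// mul1r.
    rewrite (gtr0_norm (q1 t)).
    by have /andP[] := sqrt_sqrD_bounds t (ltW e0).
  by rewrite ler_norml => /andP[? ?]; apply/andP; split; lra.
apply: (has_grad_eq G) => [x|i x]; first by rewrite /smin /q mulrC.
field.
by rewrite gt_eqF.
Qed.

End smooth_min.

(** * Measures and integrals *)

Section push_dens.
Local Open Scope ereal_scope.
Context d1 d2 (T1 : measurableType d1) (T2 : measurableType d2) (R : realType).
Variables (m : {measure set T1 -> \bar R}).

Section push.
Variables (f : T1 -> T2) (mf : measurable_fun [set: T1] f).

(** The measurability of [f] is an argument, so that the measure structure can be attached to the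
    set function itself; likewise for [mdens]. *)
Definition mpush of measurable_fun [set: T1] f : set T2 -> \bar R :=
  fun A => m (f @^-1` A).

Let mpush0 : mpush mf set0 = 0.
Proof. by rewrite /mpush preimage_set0 measure0. Qed.

Let mpush_ge0 A : 0 <= mpush mf A.
Proof. exact: measure_ge0. Qed.

Let mpush_sigma_additive : semi_sigma_additive (mpush mf).
Proof.
move=> F mF tF mUF; rewrite /mpush preimage_bigcup.
have mpre A : measurable A -> measurable (f @^-1` A).
  by move=> mA; rewrite -[X in measurable X]setTI; exact: mf.
apply: measure_semi_sigma_additive.
- by move=> k; exact: mpre.
- apply/trivIsetP => i j _ _ ij; rewrite -preimage_setI.
  by move/trivIsetP : tF => /(_ _ _ _ _ ij) ->//; rewrite preimage_set0.
- by rewrite -preimage_bigcup; exact: mpre.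
Qed.

HB.instance Definition _ := isMeasure.Build _ _ _ (mpush mf)
  mpush0 mpush_ge0 mpush_sigma_additive.

Lemma ge0_integral_mpush (g : T2 -> \bar R) :
  measurable_fun setT g -> (forall y, 0 <= g y) ->
  \int[mpush mf]_y g y = \int[m]_x g (f x).
Proof.
move=> mg g0; have := @ge0_integral_pushforward _ _ _ _ _ f mf m setT g measurableT mg
  (fun y _ => g0 y).
by rewrite preimage_setT => <-; apply: eq_measure_integral.
Qed.

End push.

Section dens.
Variables (f : T1 -> \bar R) (mf : measurable_fun [set: T1] f) (f0 : forall x, 0 <= f x).

Definition mdens of measurable_fun [set: T1] f & (forall x, 0 <= f x) : set T1 -> \bar R :=
  fun A => \int[m]_(x in A) f x.

Let mdens0 : mdens mf f0 set0 = 0.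
Proof. by rewrite /mdens integral_set0. Qed.

Let mdens_ge0 A : 0 <= mdens mf f0 A.
Proof. exact: integral_ge0. Qed.

Let mdens_sigma_additive : semi_sigma_additive (mdens mf f0).
Proof. exact: semi_sigma_additive_nng_induced. Qed.

HB.instance Definition _ := isMeasure.Build _ _ _ (mdens mf f0)
  mdens0 mdens_ge0 mdens_sigma_additive.

End dens.
End push_dens.

Section rV_measurability.
Variables (R : realType).

Lemma measurable_coord n (i : 'I_n) :
  measurable_fun setT (fun x : 'rV[R]_n => x 0 i).
Proof.
apply: (measurability _ (RGenOpens.measurableE R)) => _ [_ [a [b ->]] <-].
rewrite setTI; apply: open_measurable_rV.
by apply: (open_comp _ (itv_open _ _)) => // x _; exact: coord_continuous.
Qed.

Lemma continuous_measurable_rV n (f : 'rV[R]_n -> R) :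
  continuous f -> measurable_fun setT f.
Proof.
move=> cf; apply: (measurability _ (RGenOpens.measurableE R)) => _ [_ [a [b ->]] <-].
rewrite setTI; apply: open_measurable_rV.
by apply: (open_comp _ (itv_open _ _)) => // x _; exact: cf.
Qed.

(** Borel sets of row vectors are generated by open sets, not by boxes; the induction goes through
    [cons_rV], whose measurability contains the countable base argument. *)
Lemma measurable_rV d (T : measurableType d) n (f : T -> 'rV[R]_n) :
  (forall i, measurable_fun setT (fun x => f x 0 i)) -> measurable_fun setT f.
Proof.
elim: n f => [|n IH] f mf.
  move=> _ A mA; rewrite setTI.
  have [A0|A0] := pselect (A 0).
    rewrite (_ : _ @^-1` _ = setT)//; apply/seteqP; split => // x _ /=.
    by rewrite (_ : f x = 0)//; apply/rowP => -[].
  rewrite (_ : _ @^-1` _ = set0)//; apply/seteqP; split => // x /=.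
  by rewrite (_ : f x = 0)//; apply/rowP => -[].
pose g x := (f x 0 0, \row_i f x 0 (lift 0 i)).
have mg : measurable_fun setT g.
  apply/measurable_fun_pairP; split; first exact: mf.
  apply: IH => i; rewrite (_ : (fun _ => _) = (fun x => f x 0 (lift 0 i))).
    exact: mf.
  by apply/funext => x; rewrite mxE.
rewrite (_ : f = @cons_rV R n \o g).
  by apply: measurableT_comp => //; exact: measurable_cons_rV.
apply/funext => x; apply/rowP => i; rewrite /g /cons_rV /= mxE.
case: splitP => j ij; rewrite mxE.
  by rewrite (ord1 j) eqxx mulr1n; congr (f x 0 _); apply/val_inj; rewrite /= ij (ord1 j).
by congr (f x 0 _); apply/val_inj; rewrite /= ij.
Qed.

Lemma measurable_addr n (a : 'rV[R]_n) : measurable_fun setT (fun x : 'rV[R]_n => x + a).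
Proof.
apply: measurable_rV => i; under eq_fun do rewrite mxE.
by apply: measurable_funD => //; exact: measurable_coord.
Qed.

Lemma measurable_subr2 n :
  measurable_fun setT (fun p : 'rV[R]_n * 'rV[R]_n => p.2 - p.1).
Proof.
apply: measurable_rV => i; under eq_fun do rewrite !mxE.
apply: measurable_funB.
- by apply: measurableT_comp (measurable_coord i) _.
- by apply: measurableT_comp (measurable_coord i) _.
Qed.

End rV_measurability.

Section leb.
Variable R : realType.
Local Notation leb := (lebesgue_rV R).

Lemma lebesgue_measure_shift (a : R) (A : set R) : measurable A ->
  lebesgue_measure ((fun x : R => x + a) @^-1` A) = lebesgue_measure A :> \bar R.
Proof.
move=> mA; have mf : measurable_fun setT (fun x : measurableTypeR R => (x + a : measurableTypeR R)).
  exact: measurable_funD.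
apply/esym; apply: (@lebesgue_measure_unique R (mpush (@lebesgue_measure R) mf)) mA.
move=> X [[x y] _ <-]; rewrite /= /mpush.
rewrite (_ : _ @^-1` _ = `]x - a, y - a]%classic).
  rewrite !lebesgue_measure_itv /= !lte_fin ltrD2r; case: ifP => // _.
  by rewrite -!EFinB; congr EFin; ring.
by apply/seteqP; split => z /=; rewrite !in_itv/= ltrBlDr lerBrDr.
Qed.

(** The recursion defining [lebesgue_rV] is followed: a translation acts on head and tail
    separately, and a product measure is determined by rectangles. *)
Lemma leb_shift n (a : 'rV[R]_n) A : measurable A ->
  leb n ((fun x => x + a) @^-1` A) = leb n A.
Proof.
elim: n a A => [|n IH] a A mA.
  by rewrite (_ : _ @^-1` _ = A)//; apply/seteqP; split => x /=;
     rewrite (_ : x + a = x)//; apply/rowP => -[].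
pose a' := rsubmx (a : 'rV[R]_(1 + n)).
pose tau (p : R * 'rV[R]_n) := (p.1 + a 0 0, p.2 + a').
have mtau : measurable_fun setT (tau : measurableTypeR R * 'rV[R]_n -> measurableTypeR R * 'rV[R]_n).
  apply/measurable_fun_pairP; split.
    by apply: measurable_funD.
  by apply: measurableT_comp (measurable_addr a') _.
rewrite /= /lebesgue_rVS /pushforward.
rewrite (_ : _ @^-1` (_ @^-1` _) = tau @^-1` (@cons_rV R n @^-1` A)).
  apply/esym/(@product_measure_unique _ _ _ _ R lebesgue_measure (leb n)
    (mpush (lebesgue_measure \x leb n)%E mtau)).
    move=> X Y mX mY; rewrite /= /mpush.
    rewrite (_ : _ @^-1` _ = ((fun x : R => x + a 0 0) @^-1` X) `*` ((fun x => x + a') @^-1` Y))//.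
    rewrite product_measure1E.
    - by congr (_ * _)%E; [exact: lebesgue_measure_shift|exact: IH].
    - by rewrite -[X in measurable X]setTI; apply: measurable_funD.
    - by rewrite -[X in measurable X]setTI; apply: measurable_addr.
  by rewrite -[X in measurable X]setTI; exact: measurable_cons_rV.
apply/seteqP; split => -[x v] /=; rewrite (_ : cons_rV (x, v) + a = cons_rV (tau (x, v)))//;
  apply/rowP => i; rewrite /cons_rV /= !mxE; case: splitP => j ij; rewrite !mxE.
- by rewrite (ord1 j) eqxx !mulr1n; congr (_ + a 0 _); apply/val_inj; rewrite /= ij (ord1 j).
- by congr (_ + a 0 _); apply/val_inj; rewrite /= ij.
- by rewrite (ord1 j) eqxx !mulr1n; congr (_ + a 0 _); apply/val_inj; rewrite /= ij (ord1 j).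
- by congr (_ + a 0 _); apply/val_inj; rewrite /= ij.
Qed.

Lemma measurable_cube n (r : R) :
  measurable [set x : 'rV[R]_n | forall i, `|x 0 i| < r].
Proof.
have -> : [set x : 'rV[R]_n | forall i, `|x 0 i| < r] =
    \bigcap_(i in [set: 'I_n]) ((fun x : 'rV[R]_n => x 0 i) @^-1` `]-r, r[).
  by apply/seteqP; split => x /= h i; [move=> _|have := h i I]; rewrite /= in_itv /= -ltr_norml.
apply: fin_bigcap_measurable; first exact: finite_finset.
by move=> i _; rewrite -[X in measurable X]setTI; exact: measurable_coord.
Qed.

Lemma leb_ball n (r : R) : 0 < r ->
  (0 < leb n [set x | forall i, (`|x 0 i| < r)%R] < +oo)%E.
Proof.
move=> r0; elim: n => [|n IH].
  by rewrite /= diracE mem_set ?lte01 ?ltry//= => -[].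
have mn k : measurable [set x : 'rV[R]_k | forall i, (`|x 0 i| < r)%R].
  exact: measurable_cube.
rewrite /= /lebesgue_rVS /pushforward.
rewrite (_ : (lebesgue_measure \x leb n)%E _ = (lebesgue_measure \x leb n)%E
    (`]-r, r[%classic `*` [set x : 'rV[R]_n | forall i, (`|x 0 i| < r)%R])).
  have E1 : lebesgue_measure (`]-r, r[%classic : set R) = (r + r)%:E :> \bar R.
    by rewrite lebesgue_measure_itv /= lte_fin gtrN// -EFinB opprK.
  rewrite product_measure1E; [|exact: measurable_itv|exact: mn].
  rewrite [X in (0 < X * _ < _)%E](_ : _ = (r + r)%:E); last exact: E1.
  case/andP: IH => p q.
  by rewrite mule_gt0 ?lte_fin ?addr_gt0//= lte_mul_pinfty// ?lee_fin ?addr_ge0 ?ltW.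
congr ((lebesgue_measure \x leb n)%E _); apply/seteqP; split => -[x v] /=.
  move=> H; split.
    by have := H 0; rewrite /cons_rV mxE /=; case: splitP => [j _|//]; rewrite mxE (ord1 j) eqxx mulr1n /= in_itv /= ltr_norml.
  move=> i; have := H (lift 0 i); rewrite /cons_rV mxE /=; case: splitP => [j|j ij].
    by rewrite (ord1 j).
  by rewrite (_ : i = j)//; apply/val_inj; case: ij.
move=> [xr vr] i; rewrite /cons_rV mxE /=; case: splitP => j ij; last exact: vr.
by rewrite mxE (ord1 j) eqxx mulr1n ltr_norml; move: xr; rewrite in_itv.
Qed.

Lemma leb_bounded n (A : set 'rV[R]_n) : measurable A -> bounded_set A ->
  (leb n A < +oo)%E.
Proof.
move=> mA [M [_ HM]].
have r0 : 0 < Num.max 1 (M + 1) + 1 by rewrite ltr_wpDl// le_max ler01.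
have /andP[_] := leb_ball n r0; apply: le_lt_trans.
apply: le_measure; rewrite ?inE//.
  exact: measurable_cube.
move=> x Ax /= i; apply: le_lt_trans (le_coord_norm _ _) _.
have := HM (Num.max 1 (M + 1)) _ x Ax; rewrite lt_max ltrDl ltr01 orbT => /(_ isT) h.
by rewrite (le_lt_trans h)// ltrDl.
Qed.

End leb.

Section real_sequences.
Variable R : realType.

Lemma cvgnP (u : nat -> R) (l : R) : u @ \oo --> l <->
  forall e, 0 < e -> exists N, forall n, (N <= n)%N -> `|u n - l| < e.
Proof.
split=> [/cvgrPdist_lt h e e0|h].
  by have [N _ HN] := h _ e0; exists N => n Nn; rewrite distrC; apply: HN.
by apply/cvgrPdist_lt => e e0; have [N HN] := h _ e0; exists N => // n /= Nn; rewrite distrC HN.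
Qed.

Lemma cvgn_le (u v : nat -> R) (l : R) N :
  (forall n, (N <= n)%N -> `|u n - l| <= v n) ->
  v @ \oo --> (0 : R) -> u @ \oo --> l.
Proof.
move=> uv /cvgnP v0; apply/cvgnP => e e0; have [M HM] := v0 _ e0.
exists (maxn N M) => n; rewrite geq_max => /andP[Nn Mn].
by rewrite (le_lt_trans (uv _ Nn))// (le_lt_trans _ (HM _ Mn))// subr0 ler_norm.
Qed.

End real_sequences.

Section integ.
Context d (T : measurableType d) (R : realType).
Implicit Types (f g : T -> R).

Definition integ (mu : {measure set T -> \bar R}) f := mu.-integrable setT (EFin \o f).

Section any.
Variable mu : {measure set T -> \bar R}.
Local Notation integ := (integ mu).

Lemma integ_meas f : integ f -> measurable_fun setT f.
Proof. by move=> /(measurable_int mu)/measurable_EFinP. Qed.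

Lemma integD f g : integ f -> integ g -> integ (fun x => f x + g x).
Proof.
move=> h1 h2; have := integrableD measurableT h1 h2.
by apply: eq_integrable => // x _; rewrite /= EFinD.
Qed.

Lemma integB f g : integ f -> integ g -> integ (fun x => f x - g x).
Proof.
move=> h1 h2; have := integrableB measurableT h1 h2.
by apply: eq_integrable => // x _; rewrite /= EFinB.
Qed.

Lemma integZ (k : R) f : integ f -> integ (fun x => k * f x).
Proof.
move=> h1; have := integrableZl measurableT k h1.
by apply: eq_integrable => // x _; rewrite /= EFinM.
Qed.

Lemma integ_norm f : integ f -> integ (fun x => `|f x|).
Proof. exact: integrable_norm. Qed.

Lemma integ0 : integ (fun=> 0).
Proof. exact: integrable0. Qed.

Lemma integ_sum (I : Type) (s : seq I) (h : I -> T -> R) :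
  (forall i, integ (h i)) -> integ (fun x => \sum_(i <- s) h i x).
Proof.
move=> ih; elim: s => [|i s IH].
  by under eq_fun do rewrite big_nil; exact: integ0.
by under eq_fun do rewrite big_cons; exact: integD.
Qed.

Lemma integ_le f g : measurable_fun setT f -> integ g ->
  (forall x, `|f x| <= `|g x|) -> integ f.
Proof.
move=> mf ig fg; apply: (le_integrable measurableT _ _ ig).
  exact/measurable_EFinP.
by move=> x _; rewrite !abse_EFin lee_fin.
Qed.

Lemma integMb f g (M : R) : integ f -> measurable_fun setT g ->
  (forall x, `|g x| <= M) -> integ (fun x => f x * g x).
Proof.
move=> fi mg gM; apply: (@integ_le _ (fun x => M * f x)).
- by apply: measurable_funM => //; exact: integ_meas.
- exact: integZ.
- move=> x; rewrite !normrM mulrC ler_wpM2r// (le_trans (gM x))//.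
  exact: ler_norm.
Qed.

Lemma RintD f g : integ f -> integ g ->
  \int[mu]_x (f x + g x) = \int[mu]_x f x + \int[mu]_x g x.
Proof. exact: RintegralD. Qed.

Lemma RintB f g : integ f -> integ g ->
  \int[mu]_x (f x - g x) = \int[mu]_x f x - \int[mu]_x g x.
Proof. exact: RintegralB. Qed.

Lemma RintZ (k : R) f : integ f -> \int[mu]_x (k * f x) = k * \int[mu]_x f x.
Proof. exact: RintegralZl. Qed.

Lemma Rint_sum (I : Type) (s : seq I) (h : I -> T -> R) :
  (forall i, integ (h i)) ->
  \int[mu]_x (\sum_(i <- s) h i x) = \sum_(i <- s) \int[mu]_x h i x.
Proof.
move=> ih; elim: s => [|i s IH].
  by under eq_Rintegral do rewrite big_nil; rewrite big_nil /Rintegral integral0.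
under eq_Rintegral do rewrite big_cons; rewrite big_cons RintD ?IH//.
exact: integ_sum.
Qed.

Lemma Rint_le f g : integ f -> integ g -> (forall x, f x <= g x) ->
  \int[mu]_x f x <= \int[mu]_x g x.
Proof. by move=> h1 h2 fg; apply: le_Rintegral. Qed.

Lemma Rint_ge0 f : (forall x, 0 <= f x) -> 0 <= \int[mu]_x f x.
Proof. by move=> f0; apply: Rintegral_ge0. Qed.

Lemma Rint_norm f : integ f -> `|\int[mu]_x f x| <= \int[mu]_x `|f x|.
Proof. exact: le_normr_Rintegral. Qed.

Lemma Rint_normB f g : integ f -> integ g ->
  `|\int[mu]_x f x - \int[mu]_x g x| <= \int[mu]_x `|f x - g x|.
Proof. by move=> h1 h2; rewrite -RintB//; apply: Rint_norm; exact: integB. Qed.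

Lemma Rint_triangle f g h : integ f -> integ g -> integ h ->
  \int[mu]_x `|f x - h x| <= \int[mu]_x `|f x - g x| + \int[mu]_x `|g x - h x|.
Proof.
move=> h1 h2 h3; rewrite -RintD.
- apply: Rint_le.
  + by apply: integ_norm; exact: integB.
  + by apply: integD; apply: integ_norm; exact: integB.
  + by move=> x; exact: ler_distD.
- by apply: integ_norm; exact: integB.
- by apply: integ_norm; exact: integB.
Qed.

Lemma Rint_EFin f : integ f -> (\int[mu]_x f x)%:E = (\int[mu]_x (f x)%:E)%E.
Proof. by move=> h; rewrite /Rintegral fineK// integrable_fin_num. Qed.

Lemma Rint_dct (f_ : nat -> T -> R) f g :
  (forall n, measurable_fun setT (f_ n)) -> measurable_fun setT f -> integ g ->
  (forall n x, `|f_ n x| <= g x) ->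
  (forall x, f_ n x @[n --> \oo] --> f x) ->
  [/\ integ f, (fun n => \int[mu]_x `|f_ n x - f x|) @ \oo --> (0 : R) &
    (fun n => \int[mu]_x f_ n x) @ \oo --> \int[mu]_x f x].
Proof.
move=> mf_ mf ig fg ff.
have [] := @dominated_convergence _ _ _ mu setT measurableT (fun n => EFin \o f_ n)
  (EFin \o f) (EFin \o g) _ _ _ ig _.
- by move=> n; exact/measurable_EFinP.
- exact/measurable_EFinP.
- by apply: aeW => x _; apply: cvg_EFin; [exact: nearW|exact: ff].
- by apply: aeW => x n _; rewrite /= lee_fin.
move=> fi H1 H2.
have f_i n : integ (f_ n).
  by apply: (integ_le (mf_ n) ig) => x; rewrite (le_trans (fg n x))// ler_norm.
split=> //.
- exact: (fine_cvg H1).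
- apply: (@fine_cvg _ _ _ _ _ (\int[mu]_x f x)).
  by rewrite Rint_EFin.
Qed.

End any.

Lemma integ_bounded (mu : {finite_measure set T -> \bar R}) f (M : R) :
  measurable_fun setT f -> (forall x, `|f x| <= M) -> integ mu f.
Proof.
move=> mf fM; apply: (@integ_le _ _ (fun=> M)) => //.
  exact: finite_measure_integrable_cst.
by move=> x; rewrite (le_trans (fM x))// ler_norm.
Qed.

Lemma Rint_cst (mu : {finite_measure set T -> \bar R}) (r : R) :
  \int[mu]_x r = r * fine (mu setT).
Proof. by rewrite Rintegral_cst. Qed.

Lemma Rint_indic (mu : {finite_measure set T -> \bar R}) (A : set T) :
  measurable A -> \int[mu]_x \1_A x = fine (mu A).
Proof. by move=> mA; rewrite /Rintegral integral_indic// setIT. Qed.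

Lemma Rint_bound (mu : {finite_measure set T -> \bar R}) f (M : R) :
  measurable_fun setT f -> (forall x, `|f x| <= M) ->
  `|\int[mu]_x f x| <= M * fine (mu setT).
Proof.
move=> mf fM; have fi := integ_bounded mu mf fM.
apply: le_trans (Rint_norm fi) _; rewrite -Rint_cst.
apply: Rint_le fM; first exact: integ_norm.
exact: finite_measure_integrable_cst.
Qed.

Lemma step_approx (f : T -> R) (M : R) (n : nat) :
  measurable_fun setT f -> (forall x, 0 <= f x <= M) ->
  exists (K : nat) (A : nat -> set T), (forall k, measurable (A k)) /\
    forall x, `|f x - \sum_(k < K) (k%:R / n.+1%:R) * \1_(A k) x| <= n.+1%:R^-1.
Proof.
move=> mf fM.
pose A (k : nat) := f @^-1` `[k%:R / n.+1%:R, k.+1%:R / n.+1%:R[.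
pose K := (Num.truncn (M * n.+1%:R)).+1.
pose s (m : nat) (x : T) : R := \sum_(k < m) (k%:R / n.+1%:R) * \1_(A k) x.
exists K, A; split => [k|x].
  by rewrite -[X in measurable X]setTI; exact: mf.
rewrite -/(s K x).
have /andP[f0 fMx] := fM x.
pose k := Num.truncn (f x * n.+1%:R).
have kf : k%:R / n.+1%:R <= f x < k.+1%:R / n.+1%:R.
  have /truncn_itv : 0 <= f x * n.+1%:R by rewrite mulr_ge0.
  by rewrite ler_pdivrMr// ltr_pdivlMr.
have kK : (k < K)%N.
  by rewrite ltnS le_truncn// ler_wpM2r.
have sE : s K x = k%:R / n.+1%:R.
  rewrite /s (bigD1 (Ordinal kK))//= big1 ?addr0.
    rewrite indicE mem_set ?mulr1// /A /= in_itv/=.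
  move=> j jk; rewrite indicE memNset ?mulr0// /A /= in_itv/=.
  move=> /andP[j1 j2]; move/eqP: jk; apply; apply/val_inj => /=.
  have /andP[k1 k2] := kf.
  have := le_lt_trans j1 k2; have := le_lt_trans k1 j2.
  rewrite !ltr_pM2r ?invr_gt0// !ltr_nat !ltnS => h1 h2.
  by apply/eqP; rewrite eqn_leq h1 h2.
rewrite sE; have /andP[k1 k2] := kf.
rewrite ger0_norm ?subr_ge0// lerBlDr (le_trans (ltW k2))//.
by rewrite -natr1 mulrDl mul1r addrC.
Qed.

(* Approximate uniformly by step functions. *)
Lemma functional_ge0 (J : (T -> R) -> R) (C : R) :
  (forall f g M, measurable_fun setT f -> measurable_fun setT g ->
    (forall x, `|f x| <= M) -> (forall x, `|g x| <= M) ->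
    J (fun x => f x + g x) = J f + J g) ->
  (forall f k M, measurable_fun setT f -> (forall x, `|f x| <= M) ->
    J (fun x => k * f x) = k * J f) ->
  (forall f M, measurable_fun setT f -> (forall x, `|f x| <= M) -> `|J f| <= C * M) ->
  (forall A, measurable A -> 0 <= J \1_A) ->
  forall f M, measurable_fun setT f -> (forall x, 0 <= f x <= M) -> 0 <= J f.
Proof.
move=> JD JZ JC JA f M mf fM.
have C0 : 0 <= C.
  have := JC (fun=> 0) 1 _ _; rewrite mulr1 => H.
  by apply: le_trans (normr_ge0 _) (H _ _) => // x; rewrite normr0.
rewrite leNgt; apply/negP => Jlt.
have [n nC] : exists n : nat, C / (- J f) < n.+1%:R.
  by exists (Num.truncn (C / (- J f))); rewrite truncnS_gt.
have [K [A [mA fs]]] := step_approx n mf fM.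
pose s (m : nat) (x : T) : R := \sum_(k < m) (k%:R / n.+1%:R) * \1_(A k) x.
have ms m : measurable_fun setT (s m).
  apply: measurable_sum => k; apply: measurable_funM => //.
have bA k x : `|\1_(A k) x| <= 1 :> R.
  by rewrite indicE; case: (_ \in _); rewrite ?normr1 ?normr0.
have sbnd m : exists B : R, forall x, `|s m x| <= B.
  exists (\sum_(k < m) k%:R / n.+1%:R) => x; apply: le_trans (ler_norm_sum _ _ _) _.
  apply: ler_sum => k _; rewrite normrM ger0_norm ?divr_ge0// ler_piMr ?divr_ge0//.
have Js m : 0 <= J (s m).
  elim: m => [|m IH].
    rewrite (_ : s 0%N = fun x => 0 * \1_(A 0%N) x); last first.
      by apply/funext => x; rewrite /s big_ord0 mul0r.
    by rewrite (JZ _ _ 1)// mul0r.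
  rewrite (_ : s m.+1 = fun x => s m x + (m%:R / n.+1%:R) * \1_(A m) x); last first.
    by apply/funext => x; rewrite /s big_ord_recr.
  have [B HB] := sbnd m; pose B' := Num.max B (m%:R / n.+1%:R).
  rewrite (JD _ _ B')//.
  - rewrite (JZ _ _ 1)// addr_ge0// mulr_ge0 ?divr_ge0//; exact: JA.
  - by apply: measurable_funM.
  - by move=> x; rewrite le_max HB.
  - move=> x; rewrite le_max; apply/orP; right.
    by rewrite normrM ger0_norm ?divr_ge0// ler_piMr ?divr_ge0.
have [B HB] := sbnd K; pose B' := Num.max B M.
have H1 : J (fun x => s K x + -1 * f x) = J (s K) - J f.
  rewrite (JD _ _ B')//.
  - rewrite (JZ _ _ M)// ?mulN1r// => x; have /andP[? ?] := fM x.
    by rewrite ger0_norm.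
  - by apply: measurable_funM.
  - by move=> x; rewrite le_max HB.
  - move=> x; rewrite le_max; apply/orP; right; have /andP[? ?] := fM x.
    by rewrite mulN1r normrN ger0_norm.
have H2 : `|J (fun x => s K x + -1 * f x)| <= C * n.+1%:R^-1.
  apply: JC => [|x]; last by rewrite mulN1r distrC.
  by apply: measurable_funD => //; apply: measurable_funM.
have : - J f <= C / n.+1%:R.
  by apply: le_trans H2; rewrite H1 (le_trans _ (ler_norm _))// lerDr.
rewrite leNgt => /negP; apply.
by rewrite ltr_pdivrMr// mulrC -ltr_pdivrMr// oppr_gt0.
Qed.

End integ.

(** * Approximation by test functions *)

Lemma mul01_dist (R : realDomainType) (a b a' b' : R) : 0 <= a <= 1 -> 0 <= b' <= 1 ->
  `|a * b - a' * b'| <= `|a - a'| + `|b - b'|.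
Proof.
move=> /andP[a0 a1] /andP[b0 b1].
rewrite (_ : a * b - a' * b' = (a - a') * b' + a * (b - b')); last by ring.
rewrite (le_trans (ler_normD _ _))// lerD// normrM.
  by rewrite (ger0_norm b0) ler_piMr.
by rewrite (ger0_norm a0) ler_piMl.
Qed.

Section density.
Variables (R : realType) (d : nat) (Omega : set 'rV[R]_d).
Hypothesis oO : open Omega.
Implicit Types (phi psi : 'rV[R]_d -> R) (A : set 'rV[R]_d).

Lemma test_meas W phi : test_function W phi -> measurable_fun setT phi.
Proof.
by move=> tp; apply: continuous_measurable_rV; exact: (has_grad_continuous (test_grad tp)).
Qed.

(** A soft union: it keeps values in [0, 1], and as [phi + psi * (1 - phi)] it is again compactly
    supported in [W]. *)
Lemma test_or W phi psi : test_function W phi -> test_function W psi ->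
  test_function W (fun x => 1 - (1 - phi x) * (1 - psi x)).
Proof.
move=> tp tq; have cp := test_C1 tp.
have := testD tp (test_MC1 tq (C1B (C1_cst d 1) cp)).
by congr test_function; apply/funext => x; ring.
Qed.

Lemma test_or_seq W (I : Type) (s : seq I) (f : I -> 'rV[R]_d -> R) :
  (forall i, test_function W (f i)) ->
  test_function W (fun x => 1 - \prod_(i <- s) (1 - f i x)).
Proof.
move=> tf; elim: s => [|i s IH].
  by under eq_fun do rewrite big_nil subrr; exact: test0.
under eq_fun do rewrite big_cons.
have := test_or (tf i) IH; congr test_function.
by apply/funext => x; rewrite subKr.
Qed.

(** The rational balls whose closure lies in [U] cover [U]; the soft unions of their bumps, suitably
    sharpened, tend to the indicator at every point. *)
Lemma open_test_seq (U : set 'rV[R]_d) : open U ->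
  exists phi : nat -> 'rV[R]_d -> R,
  [/\ forall n, test_function U (phi n), forall n x, 0 <= phi n x <= 1 &
      forall x, phi n x @[n --> \oo] --> (\1_U x : R)].
Proof.
move=> oU.
pose I := ('rV[rat]_d * nat)%type.
pose good (a : I) := `[< forall x : 'rV[R]_d,
  `|x - map_mx ratr a.1| <= a.2.+1%:R^-1 -> U x >].
pose chi (a : I) : 'rV[R]_d -> R :=
  if good a then bump (map_mx ratr a.1) a.2.+1%:R^-1 else fun=> 0.
have r0 n : 0 < n.+1%:R^-1 :> R by rewrite invr_gt0.
have r1 n : n.+1%:R^-1 <= 1 :> R by rewrite invf_le1// ler1n.
have tchi a : test_function U (chi a).
  rewrite /chi; case: ifPn => [/asboolP ga|_]; last exact: test0.
  exact: bump_test.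
have chi01 a x : 0 <= chi a x <= 1.
  rewrite /chi; case: ifPn => _; last by rewrite lexx ler01.
  by rewrite bump_ge0 bump_le1// ltW//= r1.
pose ch (j : nat) : 'rV[R]_d -> R := if unpickle j is Some a then chi a else fun=> 0.
have tch j : test_function U (ch j).
  by rewrite /ch; case: unpickle => [a|]; [exact: tchi|exact: test0].
have ch01 j x : 0 <= ch j x <= 1.
  by rewrite /ch; case: unpickle => [a|]; [exact: chi01|rewrite lexx ler01].
have pw n j x : 1 - \prod_(i < n) (1 - ch j x) = 1 - (1 - ch j x) ^+ n.
  by rewrite prodr_const card_ord.
(* The inner product turns a bump value [b] into [1 - (1 - b)^n], which tends to 1 if [b > 0]; the
   outer one is the soft union of the first [n] bumps. *)
pose phi n x := 1 - \prod_(j < n) (1 - (1 - \prod_(i < n) (1 - ch j x))).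
have q01 n j x : 0 <= \prod_(i < n) (1 - ch j x) <= 1.
  have /andP[c0 c1] := ch01 j x.
  rewrite prodr_const card_ord exprn_ge0 ?subr_ge0//= exprn_ile1 ?subr_ge0//.
  by rewrite lerBlDr lerDl.
exists phi; split.
- by move=> n; apply: test_or_seq => j; exact: test_or_seq.
- move=> n x.
  have : 0 <= \prod_(j < n) (1 - (1 - \prod_(i < n) (1 - ch j x))) <= 1.
    rewrite prodr_ge0/= => [|j _]; last by rewrite subKr; case/andP: (q01 n j x).
    by apply: prodr_ile1 => j _; rewrite subKr q01.
  by move=> /andP[? ?]; rewrite /phi subr_ge0 lerBlDr lerDl; apply/andP.
- move=> x; rewrite indicE; case: (boolP (x \in U)) => [xU|xU]; last first.
    apply: cvg_near_cst; apply: nearW => n.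
    have ch0 j : ch j x = 0.
      have [K [_ KU K0 _]] := test_supp (tch j); apply: K0 => /KU.
      by move/mem_set; apply/negP.
    by rewrite /phi big1 ?subrr// => j _; rewrite subKr big1// => i _; rewrite ch0 subr0.
  rewrite inE in xU.
  have /nbhs_ballP[e /= e0 eU] := open_nbhs_nbhs (conj oU xU).
  have [k ke] : exists k, k.+1%:R^-1 < e / 2.
    have e20 : 0 < e / 2 by rewrite divr_gt0.
    exists (Num.truncn (e / 2)^-1); rewrite invf_plt ?posrE ?ltr0n//.
    by rewrite truncnS_gt.
  have dq (y : R) : exists q : rat, ball (ratr q : R) k.+1%:R^-1 y.
    have [z [yz [q _ qz]]] : ball y k.+1%:R^-1 `&` range (@ratr R) !=set0.
      by apply: dense_rat; [exists y; exact: ballxx|exact: ball_open].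
    by exists q; apply: ball_sym; rewrite qz.
  have [w hw] := choice (fun j => dq (x 0 j)).
  pose c : 'rV[R]_d := map_mx ratr (\row_j w j).
  have xc : `|x - c| < k.+1%:R^-1.
    rewrite distrC; have : ball c k.+1%:R^-1 x.
      by split => // i j; rewrite !mxE (ord1 i); exact: hw.
    by rewrite -ball_normE.
  pose a : I := (\row_j w j, k).
  have ga : good a.
    apply/asboolP => y yc; apply: eU; rewrite -ball_normE /=.
    rewrite -(subrKA c) (le_lt_trans (ler_normD _ _))// (splitr e) ltrD//.
      exact: lt_trans ke.
    by rewrite distrC (le_lt_trans yc).
  have chp : 0 < ch (pickle a) x <= 1.
    rewrite /ch pickleK /chi ga bump_gt0// xc/=.
    by rewrite bump_le1// ltW//= r1.
  set b := ch (pickle a) x in chp; case/andP: chp => b0 b1.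
  have phib n : (pickle a < n)%N -> 1 - (1 - b) ^+ n <= phi n x.
    move=> an; rewrite lerD2l lerN2 (bigD1 (Ordinal an))//= subKr.
    rewrite prodr_const card_ord -/b ler_piMr ?exprn_ge0 ?subr_ge0//.
    by apply: prodr_ile1 => j _; rewrite subKr q01.
  apply: (@cvgn_le _ _ (fun n => (1 - b) ^+ n) _ (pickle a).+1) => [n an|].
    rewrite distrC ger0_norm ?lerBlDr.
      by rewrite addrC -lerBlDr phib.
    rewrite subr_ge0 /phi lerBlDr lerDl; apply: prodr_ge0 => j _.
    by rewrite subKr; case/andP: (q01 n j x).
  apply: cvg_expr; rewrite ger0_norm ?subr_ge0//.
  by rewrite ltrBlDr ltrDl.
Qed.

Section approx.
Variable mu : {finite_measure set 'rV[R]_d -> \bar R}.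

Let mO : measurable Omega := open_measurable_rV oO.

Lemma integ01 (f : 'rV[R]_d -> R) : measurable_fun setT f ->
  (forall x, 0 <= f x <= 1) -> integ mu f.
Proof.
move=> mf f01; apply: (@integ_bounded _ _ _ _ _ 1) => // x.
by have /andP[? ?] := f01 x; rewrite ger0_norm.
Qed.

Lemma indic01 (A : set 'rV[R]_d) x : 0 <= (\1_A x : R) <= 1.
Proof. by rewrite indicE; case: (_ \in _); rewrite ?lexx ?ler01. Qed.

Lemma integ_ind A : measurable A -> integ mu \1_A.
Proof. by move=> mA; apply: integ01 => // x; exact: indic01. Qed.

(** The good sets: they form a sigma-algebra containing the open sets. Values of [phi] in [0, 1]
    make products and soft unions 1-Lipschitz in each factor, so that errors simply add. *)
Definition approx A := measurable A /\ forall e : R, 0 < e -> exists phi,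
  [/\ test_function Omega phi, forall x, 0 <= phi x <= 1 &
   \int[mu]_x `|phi x - \1_(A `&` Omega) x| <= e].

Let approx_open U : open U -> approx U.
Proof.
move=> oU; split; first exact: open_measurable_rV.
move=> e e0; have [phi [tp p01 pc]] := open_test_seq (openI oU oO).
have mU : measurable (U `&` Omega) by apply: open_measurable_rV; exact: openI.
have [||//|||_ /cvgnP/(_ _ e0)[N /(_ N (leqnn N)) HN] _] :=
    @Rint_dct _ _ _ mu phi \1_(U `&` Omega) (fun=> 1).
- by move=> n; exact: test_meas (tp n).
- exact: measurable_indic.
- by apply: integ01 => // x; rewrite ler01 lexx.
- by move=> n x; have /andP[? ?] := p01 n x; rewrite ger0_norm.
- exact: pc.
exists (phi N); split=> //.
  by apply: test_sub (tp N) => x [].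
by move: HN; rewrite subr0 => /ltW; apply: le_trans; exact: ler_norm.
Qed.

Let int_diff_integ phi A : test_function Omega phi -> measurable A ->
  integ mu (fun x => `|phi x - \1_(A `&` Omega) x|).
Proof.
move=> tp mA; apply: integ_norm; apply: integB.
  have [K [_ cK _]] := test_cont_supp tp; have [M _ HM] := cont_supp_bounded cK.
  by apply: (integ_bounded _ (test_meas tp) HM).
by apply: integ_ind; exact: measurableI.
Qed.

Let approxT : approx setT. Proof. by apply: approx_open; exact: openT. Qed.

Let approxC A : approx A -> approx (~` A).
Proof.
move=> [mA hA]; split; first exact: measurableC.
move=> e e0; have e20 : 0 < e / 2 by rewrite divr_gt0.
have [phi [tp p01 pA]] := hA _ e20.
have [psi [tq q01 qA]] := approxT.2 _ e20.
(* [1 - phi] has no compact support in Omega; [psi], an approximation of Omega itself, cuts it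
   off. *)
exists (fun x => psi x * (1 - phi x)); split.
- by apply: test_MC1 => //; apply: C1B; [exact: C1_cst|exact: test_C1 tp].
- move=> x; have /andP[a b] := p01 x; have /andP[a' b'] := q01 x.
  by rewrite mulr_ge0 ?subr_ge0//= mulr_ile1 ?subr_ge0// lerBlDr lerDl.
- rewrite (splitr e); apply: le_trans (lerD qA pA).
  rewrite -RintD; [|exact: int_diff_integ|exact: int_diff_integ].
  apply: Rint_le.
  + apply: int_diff_integ; last exact: measurableC.
    by apply: test_MC1 => //; apply: C1B; [exact: C1_cst|exact: test_C1 tp].
  + by apply: integD; exact: int_diff_integ.
  + move=> x; have /andP[a b] := p01 x; have /andP[a' b'] := q01 x.
    rewrite setTI !indicE !in_setI in_setC.
    set i := (_ && _)%:R; set j := (_ && _)%:R; set k := (_ && _)%:R.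
    have kE : k = (x \in Omega)%:R.
      by rewrite /k; case: pselect => h; [rewrite mem_set|rewrite memNset].
    have -> : i = k * (1 - j).
      by rewrite kE /i /j; case: (x \in Omega); case: (x \in A) => /=; ring.
    rewrite (_ : `|phi x - j| = `|1 - phi x - (1 - j)|); last first.
      by rewrite -normrN; congr `|_|; ring.
    apply: mul01_dist; rewrite ?a' ?b'//.
    by rewrite /j; case: ((x \in A) && _); rewrite ?subrr ?subr0 ?lexx ?ler01.
Qed.

Let approxU A B : approx A -> approx B -> approx (A `|` B).
Proof.
move=> [mA hA] [mB hB]; split; first exact: measurableU.
move=> e e0; have e20 : 0 < e / 2 by rewrite divr_gt0.
have [phi [tp p01 pA]] := hA _ e20.
have [psi [tq q01 qA]] := hB _ e20.
exists (fun x => 1 - (1 - phi x) * (1 - psi x)); split.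
- exact: test_or.
- move=> x; have /andP[a b] := p01 x; have /andP[a' b'] := q01 x.
  by apply/andP; split; nra.
- rewrite (splitr e); apply: le_trans (lerD pA qA).
  rewrite -RintD; [|exact: int_diff_integ|exact: int_diff_integ].
  apply: Rint_le.
  + by apply: int_diff_integ; [exact: test_or|exact: measurableU].
  + by apply: integD; exact: int_diff_integ.
  + move=> x; have /andP[a b] := p01 x; have /andP[a' b'] := q01 x.
    rewrite !indicE !in_setI in_setU.
    set i := (_ && _)%:R; set j := (_ && _)%:R; set k := (_ && _)%:R.
    have -> : i = 1 - (1 - j) * (1 - k).
      by rewrite /i /j /k; case: (x \in Omega); case: (x \in A); case: (x \in B) => /=; ring.
    rewrite (_ : `|phi x - j| = `|1 - phi x - (1 - j)|); last first.
      by rewrite -normrN; congr `|_|; ring.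
    rewrite (_ : `|psi x - k| = `|1 - psi x - (1 - k)|); last first.
      by rewrite -normrN; congr `|_|; ring.
    rewrite (_ : `|_ - (1 - _)| = `|(1 - phi x) * (1 - psi x) - (1 - j) * (1 - k)|); last first.
      by rewrite -normrN; congr `|_|; ring.
    apply: mul01_dist; rewrite ?subr_ge0 ?lerBlDr ?lerDl ?a' ?b' ?a ?b//.
    by rewrite /k; case: ((x \in B) && _); rewrite ?lexx ?ler01.
Qed.

Let approx0 : approx set0. Proof. by apply: approx_open; exact: open0. Qed.

Let approx_bigcup (F : (set 'rV[R]_d)^nat) : (forall n, approx (F n)) ->
  approx (\bigcup_n F n).
Proof.
move=> hF; pose G n := \big[setU/set0]_(j < n) F j.
have aG n : approx (G n).
  elim: n => [|n IH]; first by rewrite /G big_ord0; exact: approx0.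
  by rewrite /G big_ord_recr; exact: approxU.
have mF : measurable (\bigcup_n F n).
  by apply: bigcup_measurable => n _; case: (hF n).
split=> // e e0; have e20 : 0 < e / 2 by rewrite divr_gt0.
have mGO n : measurable (G n `&` Omega) by apply: measurableI => //; case: (aG n).
have mFO : measurable ((\bigcup_n F n) `&` Omega) by exact: measurableI.
have [||//|||_ /cvgnP/(_ _ e20)[N /(_ N (leqnn N)) HN] _] :=
    @Rint_dct _ _ _ mu (fun n => \1_(G n `&` Omega)) \1_((\bigcup_n F n) `&` Omega) (fun=> 1).
- by move=> n; exact: measurable_indic.
- exact: measurable_indic.
- by apply: integ01 => // x; rewrite ler01 lexx.
- by move=> n x; have /andP[? ?] := indic01 (G n `&` Omega) x; rewrite ger0_norm.
- move=> x; rewrite [X in _ --> X]indicE; case: (boolP (x \in _)) => h.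
    move: h; rewrite inE => -[[k _ Fkx] Ox].
    apply: (@cvg_near_cst _ _ _ _ _ _); exists k.+1 => // n /= kn.
    rewrite indicE mem_set//; split=> //; rewrite /G -bigcup_mkord.
    by exists k.
  apply: cvg_near_cst; apply: nearW => n; rewrite indicE memNset// => -[Gx Ox].
  move/negP: h; apply; rewrite inE; split=> //.
  by move: Gx; rewrite /G -bigcup_mkord => -[k _ Fk]; exists k.
have [phi [tp p01 pG]] := (aG N).2 _ e20.
exists phi; split=> //; rewrite (splitr e).
apply: (@le_trans _ _ (\int[mu]_x `|phi x - \1_(G N `&` Omega) x| +
   \int[mu]_x `|\1_(G N `&` Omega) x - \1_((\bigcup_n F n) `&` Omega) x|)).
  apply: Rint_triangle; [|exact: integ_ind|exact: integ_ind].
  by apply: integ01 => //; exact: test_meas tp.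
apply: lerD => //; move: HN; rewrite subr0 => /ltW; apply: le_trans; exact: ler_norm.
Qed.

Theorem test_dense A (e : R) : measurable A -> 0 < e -> exists phi,
  [/\ test_function Omega phi, forall x, 0 <= phi x <= 1 &
   \int[mu]_x `|phi x - \1_(A `&` Omega) x| <= e].
Proof.
move=> mA e0; suff [_ H] : approx A by exact: H.
apply: (@smallest_sub _ (sigma_algebra setT) (@open 'rV[R]_d) approx) mA.
  split; [exact: approx0| |exact: approx_bigcup].
  by move=> B aB; rewrite setTD; exact: approxC.
by move=> U /approx_open.
Qed.

End approx.
End density.

(** * Measures with a density, and Lebesgue measure on Omega *)

Section density_measure.
Context d (T : measurableType d) (R : realType).
Variables (m : {measure set T -> \bar R}) (k : T -> R).
Hypotheses (mk : measurable_fun setT (EFin \o k)) (k0 : forall x, (0 <= (EFin \o k) x)%E).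
Local Open Scope ereal_scope.

Import HBNNSimple.

Let integral_mdens_indic E : measurable E ->
  \int[mdens m mk k0]_x (\1_E x)%:E = \int[m]_x ((\1_E x)%:E * (k x)%:E).
Proof.
move=> mE; rewrite integral_indic// setIT /= /mdens integral_mkcond.
apply: eq_integral => x _; rewrite patchE indicE.
by case: (x \in E); rewrite ?mul1e ?mul0e.
Qed.

Let mk' : measurable_fun setT k. Proof. exact/measurable_EFinP. Qed.

Let integral_mdens_nnsfun (h : {nnsfun T >-> R}) :
  \int[mdens m mk k0]_x (h x)%:E = \int[m]_x ((h x)%:E * (k x)%:E).
Proof.
under [LHS]eq_integral do rewrite fimfunE -fsumEFin//.
rewrite [LHS]ge0_integral_fsum//; last 2 first.
  - by move=> r; exact/measurable_EFinP/measurableT_comp.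
  - by move=> n x _; rewrite EFinM nnfun_muleindic_ge0.
under [RHS]eq_integral.
  move=> x xD; rewrite fimfunE -fsumEFin// muleC ge0_mule_fsumr; last first.
    by move=> r; rewrite EFinM nnfun_muleindic_ge0.
  over.
rewrite [RHS]ge0_integral_fsum//; last 2 first.
  - move=> r; apply/measurable_EFinP; apply: measurable_funM => //.
    exact: measurable_funM.
  - by move=> n x _; rewrite EFinM mule_ge0 ?k0// nnfun_muleindic_ge0.
apply: eq_fsbigr => r _.
have [r0|r0] := ltP r 0%R.
  have E : (h @^-1` [set r]) = set0.
    by apply/seteqP; split => // x /= hx; have : (0 <= h x)%R by []; rewrite hx leNgt r0.
  under eq_integral do rewrite E indic0 mulr0.
  under [RHS]eq_integral do rewrite E indic0 mulr0 mule0.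
  by rewrite !integral0.
under eq_integral do rewrite EFinM.
under [RHS]eq_integral do rewrite EFinM muleCA.
rewrite !ge0_integralZl//; last first.
- exact/measurable_EFinP.
- by move=> x _; rewrite mule_ge0 ?k0// lee_fin indicE.
- by apply/measurable_EFinP; apply: measurable_funM.
rewrite integral_mdens_indic//; congr (_ * _); apply: eq_integral => x _.
by rewrite muleC.
Qed.

Lemma ge0_integral_mdens (g : T -> \bar R) : measurable_fun setT g ->
  (forall x, 0 <= g x) ->
  \int[mdens m mk k0]_x g x = \int[m]_x (g x * (k x)%:E).
Proof.
move=> mg g0; pose f_ := nnsfun_approx measurableT mg.
transitivity (limn (fun n => \int[mdens m mk k0]_x (f_ n x)%:E)).
  rewrite -monotone_convergence//=.
  - apply: eq_integral => x _; apply/esym/cvg_lim => //=.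
    exact: cvg_nnsfun_approx.
  - by move=> n; apply: measurableT_comp => //; exact: measurable_funTS.
  - by move=> n x _; rewrite lee_fin.
  - by move=> x _ a b ab; rewrite lee_fin//; exact/lefP/nd_nnsfun_approx.
rewrite (_ : \int[m]_x _ =
    limn (fun n => \int[m]_x ((f_ n x)%:E * (k x)%:E))); last first.
  rewrite -monotone_convergence//=.
  - apply: eq_integral => x _; apply/esym/cvg_lim => //.
    apply: cvgeZr => //; exact: cvg_nnsfun_approx.
  - by move=> n; apply/measurable_EFinP; apply: measurable_funM.
  - by move=> n x _; rewrite mule_ge0 ?k0// lee_fin.
  - move=> x _ a b ab; rewrite lee_wpmul2r ?k0// lee_fin.
    exact/lefP/nd_nnsfun_approx.
by congr (limn _); apply/funext => n; exact: integral_mdens_nnsfun.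
Qed.

Lemma mdens_finite : m.-integrable setT (EFin \o k) -> fin_num_fun (mdens m mk k0).
Proof.
move=> ik A mA; rewrite /mdens; apply: integrable_fin_num => //.
exact: integrableS ik.
Qed.

Lemma integ_mdens f : measurable_fun setT f ->
  integ (mdens m mk k0) f <-> integ m (fun x => f x * k x)%R.
Proof.
move=> mf; have E : \int[mdens m mk k0]_x `|(f x)%:E| = \int[m]_x `|(f x * k x)%:E|.
  rewrite ge0_integral_mdens//; last by apply: measurableT_comp => //; exact/measurable_EFinP.
  apply: eq_integral => x _; rewrite EFinM abseM; congr (_ * _).
  by rewrite gee0_abs// k0.
split=> /integrableP[h1 h2]; apply/integrableP; split.
- by apply/measurable_EFinP; exact: measurable_funM.
- by rewrite -E.
- exact/measurable_EFinP.
- by rewrite E.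
Qed.

Lemma Rint_mdens (f : T -> R) : measurable_fun setT f -> (forall x, (0 <= f x)%R) ->
  (\int[mdens m mk k0]_x f x = \int[m]_x (f x * k x))%R.
Proof.
move=> mf f0; rewrite /Rintegral ge0_integral_mdens//; first exact/measurable_EFinP.
Qed.

End density_measure.

Section Rint_density.
Context d (T : measurableType d) (R : realType).
Variables (m : {measure set T -> \bar R}) (k : T -> R).
Hypotheses (mk : measurable_fun setT (EFin \o k)) (k0 : forall x, (0 <= (EFin \o k) x)%E).

Lemma Rint_mdens_integ f : integ (mdens m mk k0) f ->
  \int[mdens m mk k0]_x f x = \int[m]_x (f x * k x).
Proof.
move=> fi; have mf := integ_meas fi.
have mfp : measurable_fun setT (fun x => Num.max (f x) 0) by exact: measurable_maxr.
have mfn : measurable_fun setT (fun x => Num.max (- f x) 0).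
  by apply: measurable_maxr => //; exact: measurableT_comp.
have ip : integ (mdens m mk k0) (fun x => Num.max (f x) 0).
  by apply: (integ_le mfp fi) => x; case: (leP (f x) 0); rewrite ?normr0.
have iN : integ (mdens m mk k0) (fun x => Num.max (- f x) 0).
  by apply: (integ_le mfn fi) => x; case: (leP (- f x) 0); rewrite ?normr0 ?normrN.
have fE x : f x = Num.max (f x) 0 - Num.max (- f x) 0.
  by case: (leP (f x) 0) => h; case: (leP (- f x) 0) => h'; lra.
under eq_Rintegral do rewrite fE.
rewrite RintB// !Rint_mdens//.
- rewrite -RintB; [|exact/integ_mdens|exact/integ_mdens].
  by apply: eq_Rintegral => x _; rewrite -mulrBl -fE.
- by move=> x; rewrite le_max lexx orbT.
- by move=> x; rewrite le_max lexx orbT.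
Qed.

End Rint_density.

Section Omega_measure.
Variables (R : realType) (d : nat) (Omega : set 'rV[R]_d).
Hypotheses (oO : open Omega) (bO : bounded_set Omega).
Local Notation leb := (lebesgue_rV R d).

Let mO : measurable Omega := open_measurable_rV oO.

Lemma Omega_finite : (leb Omega < +oo)%E.
Proof. exact: leb_bounded. Qed.

(** A finite measure on the whole space, so that integrals over Omega become total integrals and the
    results for finite measures apply. *)
Definition lamO : set 'rV[R]_d -> \bar R := mfrestr mO Omega_finite.

HB.instance Definition _ := FiniteMeasure.on lamO.

Lemma lamOE A : lamO A = leb (A `&` Omega).
Proof. by []. Qed.

Lemma lamO_compl : lamO (~` Omega) = 0%E.
Proof. by rewrite lamOE setICl measure0. Qed.

Lemma int_lamO_patch (f : 'rV[R]_d -> \bar R) :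
  (\int[leb]_(x in Omega) f x = \int[lamO]_x (f \_ Omega) x)%E.
Proof.
rewrite -integral_mkcond; apply: eq_measure_integral => A mA AO.
by rewrite [RHS]lamOE setIidl.
Qed.

Lemma Rint_lamO_patch (f : 'rV[R]_d -> R) :
  \int[leb]_(x in Omega) f x = \int[lamO]_x (f \_ Omega) x.
Proof.
rewrite /Rintegral int_lamO_patch; congr fine; apply: eq_integral => x _.
by rewrite !patchE; case: ifPn.
Qed.

Lemma int_lamO (f : 'rV[R]_d -> \bar R) : measurable_fun setT f ->
  (forall x, (0 <= f x)%E) ->
  (\int[leb]_(x in Omega) f x = \int[lamO]_x f x)%E.
Proof.
move=> mf f0; rewrite int_lamO_patch -integral_mkcond.
rewrite [RHS](@ge0_negligible_integral _ _ _ _ _ (~` Omega))//.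
- by rewrite setTD setCK.
- exact: measurableC.
- exact: lamO_compl.
Qed.

Lemma L1_integP (f : 'rV[R]_d -> R) : measurable_fun setT f ->
  L1 Omega f <-> integ lamO f.
Proof.
move=> mf; have E : (\int[leb]_(x in Omega) `|(f x)%:E| = \int[lamO]_x `|(f x)%:E|)%E.
  by apply: int_lamO => //; apply: measurableT_comp => //; exact/measurable_EFinP.
split=> /integrableP[h1 h2]; apply/integrableP; split.
- exact/measurable_EFinP.
- by rewrite -E.
- by apply: measurable_funTS; exact/measurable_EFinP.
- by rewrite E.
Qed.

Lemma Rint_lamO (f : 'rV[R]_d -> R) : integ lamO f ->
  \int[leb]_(x in Omega) f x = \int[lamO]_x f x.
Proof.
move=> fi; rewrite Rint_lamO_patch -Rintegral_mkcond /Rintegral; congr fine.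
rewrite [RHS](@negligible_integral _ _ _ _ _ (~` Omega))//.
- by rewrite setTD setCK.
- exact: measurableC.
- exact: lamO_compl.
Qed.

Lemma L1_patch (f : 'rV[R]_d -> R) : L1 Omega f -> integ lamO (f \_ Omega).
Proof.
move=> fL; have mf : measurable_fun setT (f \_ Omega).
  apply/(measurable_restrictT _ mO); have := measurable_int _ fL.
  by move/measurable_EFinP.
apply/L1_integP => //; apply: eq_integrable fL => // x xO.
by rewrite /= patchE xO.
Qed.

Lemma L1norm_lamO (f : 'rV[R]_d -> R) : integ lamO f ->
  L1norm Omega f = \int[lamO]_x `|f x|.
Proof. by move=> fi; rewrite /L1norm Rint_lamO//; exact: integ_norm. Qed.

Lemma L1norm_eq (f g : 'rV[R]_d -> R) : {in Omega, f =1 g} ->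
  L1norm Omega f = L1norm Omega g.
Proof. by move=> fg; apply: eq_Rintegral => x xO; rewrite fg. Qed.

End Omega_measure.

Lemma dist01 (R : realDomainType) (a b : R) : 0 <= a <= 1 -> 0 <= b <= 1 -> `|a - b| <= 1.
Proof.
move=> /andP[a0 a1] /andP[b0 b1]; rewrite ler_norml; apply/andP; split.
  by rewrite lerNl opprB lerBlDr (le_trans b1)// lerDl.
by rewrite lerBlDr (le_trans a1)// lerDl.
Qed.

Section signed.
Context d (T : measurableType d) (R : realType).

Lemma Rint_split (m : {measure set T -> \bar R}) (f : T -> R) : integ m f ->
  [/\ integ m (fun x => Num.max (f x) 0), integ m (fun x => Num.max (- f x) 0) &
  \int[m]_x f x = \int[m]_x Num.max (f x) 0 - \int[m]_x Num.max (- f x) 0].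
Proof.
move=> fi; have mf := integ_meas fi.
have mfp : measurable_fun setT (fun x => Num.max (f x) 0) by exact: measurable_maxr.
have mfn : measurable_fun setT (fun x => Num.max (- f x) 0).
  by apply: measurable_maxr => //; exact: measurableT_comp.
have ip : integ m (fun x => Num.max (f x) 0).
  by apply: (integ_le mfp fi) => x; case: (leP (f x) 0); rewrite ?normr0.
have iN : integ m (fun x => Num.max (- f x) 0).
  by apply: (integ_le mfn fi) => x; case: (leP (- f x) 0); rewrite ?normr0 ?normrN.
split=> //; rewrite -RintB//; apply: eq_Rintegral => x _.
by case: (leP (f x) 0) => h; case: (leP (- f x) 0) => h'; lra.
Qed.

End signed.

(** * Translations and integration by parts *)

Section translation.
Variables (R : realType) (d : nat).
Local Notation leb := (lebesgue_rV R d).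
Implicit Types (u phi f : 'rV[R]_d -> R) (a w : 'rV[R]_d).

Lemma integral_leb_shift (g : 'rV[R]_d -> \bar R) a : measurable_fun setT g ->
  (forall y, (0 <= g y)%E) -> (\int[leb]_x g (x + a)%R = \int[leb]_x g x)%E.
Proof.
move=> mg g0; rewrite -(ge0_integral_mpush _ (measurable_addr a))//.
by apply: eq_measure_integral => A mA _; exact: leb_shift.
Qed.

Lemma integ_shift f a : integ leb f -> integ leb (fun x => f (x + a)).
Proof.
move=> fi; have mf := integ_meas fi; apply/integrableP; split.
  by apply/measurable_EFinP; apply: measurableT_comp mf (measurable_addr a).
have := @integral_leb_shift (fun x => `|(f x)%:E|%E) a; move=> -> //.
  by case/integrableP: fi.
by apply: measurableT_comp => //; exact/measurable_EFinP.
Qed.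

Lemma Rint_shift f a : integ leb f -> \int[leb]_x f (x + a) = \int[leb]_x f x.
Proof.
move=> fi; have [i1 i2 ->] := Rint_split fi.
have [_ _ ->] := Rint_split (integ_shift a fi).
congr (_ - _); rewrite /Rintegral; congr fine.
  apply: (@integral_leb_shift (fun x => (Num.max (f x) 0)%:E) a) => [|y].
    by apply/measurable_EFinP; exact: integ_meas i1.
  by rewrite lee_fin le_max lexx orbT.
apply: (@integral_leb_shift (fun x => (Num.max (- f x) 0)%:E) a) => [|y].
  by apply/measurable_EFinP; exact: integ_meas i2.
by rewrite lee_fin le_max lexx orbT.
Qed.

Lemma compact_leb_finite (K : set 'rV[R]_d) : compact K ->
  measurable K /\ (leb K < +oo)%E.
Proof.
move=> cK; have clK : closed K.
  by apply: compact_closed cK; exact: (@norm_hausdorff R 'rV[R]_d).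
have mK : measurable K.
  by rewrite -(setCK K); apply: measurableC; apply: open_measurable_rV; exact: closed_openC.
by split=> //; apply: leb_bounded => //; exact: compact_bounded.
Qed.

Lemma integ_cont_supp K f : cont_supp K f -> integ leb f.
Proof.
move=> cs; have [cK cf f0] := cs; have [M M0 HM] := cont_supp_bounded cs.
have [mK Koo] := compact_leb_finite cK.
have mf := continuous_measurable_rV cf.
apply: (@integ_le _ _ _ _ _ (fun x => M * \1_K x)) => //.
  apply: integZ; apply/integrableP; split; first exact/measurable_EFinP.
  rewrite (eq_integral (fun x => (\1_K x)%:E)); last first.
    by move=> x _; rewrite gee0_abs// lee_fin indicE.
  by rewrite integral_indic// setIT.
move=> x; rewrite normrM (ger0_norm M0) indicE; case: (boolP (x \in K)) => xK.
  by rewrite normr1 mulr1.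
by rewrite f0 ?normr0 ?mulr0//; move/negP: xK; rewrite inE.
Qed.

Lemma integ_test (Omega : set 'rV[R]_d) phi : test_function Omega phi -> integ leb phi.
Proof. by move=> /test_cont_supp[K [_ cs _]]; exact: integ_cont_supp cs. Qed.

Lemma integ_partial (Omega : set 'rV[R]_d) phi i :
  test_function Omega phi -> integ leb (partial i phi).
Proof. by move=> /test_cont_supp[K [_ _ cs]]; exact: integ_cont_supp (cs i). Qed.

(** By translation invariance the integral of a difference quotient vanishes. The quotients converge
    uniformly by [test_estimate], with supports in one set of finite measure. *)
Lemma Rint_partial0 (Omega : set 'rV[R]_d) phi i : test_function Omega phi ->
  \int[leb]_x partial i phi x = 0.
Proof.
move=> tp; have [K [KO cs csp]] := test_cont_supp tp; have [cK cf f0] := cs.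
pose B := [set x : 'rV[R]_d | exists2 y, K y & `|x - y| <= 1].
have [M HM] : exists M, forall x, K x -> `|x| <= M.
  have [M [_ HM]] := compact_bounded cK.
  by exists (M + 1) => x Kx; apply: (HM (M + 1)) => //; rewrite ltrDl.
(* The margin 1 absorbs the shift [z] chosen below, whose norm is at most [h <= 1]. *)
pose L := [set x : 'rV[R]_d | `|x - 0| <= M + 1].
have cL : compact L by exact: compact_closed_ball.
have [mL Loo] := compact_leb_finite cL.
have iL : integ leb \1_L.
  apply/integrableP; split; first exact/measurable_EFinP.
  rewrite (eq_integral (fun x => (\1_L x)%:E)); last first.
    by move=> x _; rewrite gee0_abs// lee_fin indicE.
  by rewrite integral_indic// setIT.
apply/eqP; rewrite -normr_le0; apply/ler_addgt0Pr => e e0; rewrite add0r.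
set C := \int[leb]_x \1_L x.
have C0 : 0 <= C by apply: Rint_ge0 => x; rewrite indicE.
have w0 : 0 < e / (C + 1) by rewrite divr_gt0// ltr_wpDl.
have [r r0 H] := test_estimate tp w0.
pose h := Num.min (r / 2) 1.
have h0 : 0 < h by rewrite lt_min divr_gt0//=.
have h1 : h <= 1 by rewrite ge_min lexx orbT.
have hr : h < r by rewrite gt_min; apply/orP; left; lra.
pose z : 'rV[R]_d := h *: delta_mx 0 i.
have zi j : z 0 j = if j == i then h else 0.
  by rewrite !mxE /=; case: eqP => _; rewrite ?mulr1 ?mulr0.
have zh : `|z| <= h.
  apply: norm_le_coord => [|j]; first exact: ltW.
  by rewrite zi; case: ifP => _; rewrite ?normr0 ?(ltW h0)// gtr0_norm.
have sz : \sum_j `|z 0 j| = h.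
  rewrite (bigD1 i)//= zi eqxx gtr0_norm// big1 ?addr0// => j ji.
  by rewrite zi (negbTE ji) normr0.
have sp x : \sum_j z 0 j * partial j phi x = h * partial i phi x.
  rewrite (bigD1 i)//= zi eqxx big1 ?addr0// => j ji.
  by rewrite zi (negbTE ji) mul0r.
have i1 := integ_test tp; have i2 := integ_partial i tp.
have i3 := integ_shift z i1.
have E : \int[leb]_x (phi (x + z) - phi x - h * partial i phi x) =
    - (h * \int[leb]_x partial i phi x).
  rewrite RintB; [|exact: integB|exact: integZ].
  by rewrite RintB// Rint_shift// subrr sub0r RintZ.
have : h * `|\int[leb]_x partial i phi x| <= h * e.
  rewrite -{1}(gtr0_norm h0) -normrM -normrN -E.
  apply: le_trans (Rint_norm _) _; first by apply: integB; [exact: integB|exact: integZ].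
  apply: (@le_trans _ _ (\int[leb]_x (e / (C + 1) * h * \1_L x))).
    apply: Rint_le.
    - by apply: integ_norm; apply: integB; [exact: integB|exact: integZ].
    - exact: integZ.
    - move=> x; rewrite indicE; case: (boolP (x \in L)) => xL.
        by rewrite mulr1 -sp -[X in _ <= _ * X]sz; apply: H; exact: le_lt_trans hr.
      have nL : ~ L x by move/negP: xL; rewrite inE.
      have nK y : `|y| <= h -> ~ K (x + y).
        move=> yh Kx; apply: nL; rewrite /L /= subr0.
        rewrite -(addrK y x) (le_trans (ler_normB _ _))// lerD ?HM//.
        exact: le_trans h1.
      rewrite mulr0 f0; last exact: nK.
      have nKx : ~ K x by rewrite -(addr0 x); apply: nK; rewrite normr0 ltW.
      rewrite f0// (_ : partial i phi x = 0); last by case: (csp i) => _ _ ->.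
      by rewrite mulr0 !subrr normr0.
  rewrite RintZ// -/C mulrAC mulrC ler_wpM2l ?(ltW h0)//.
  rewrite mulrAC ler_pdivrMr ?ltr_wpDl// ler_wpM2l ?(ltW e0)// lerDl.
  exact: ler01.
by rewrite ler_pM2l.
Qed.

Lemma Rint_by_parts (Omega : set 'rV[R]_d) phi f i : test_function Omega phi -> C1 f ->
  \int[leb]_x (f x * partial i phi x) = - \int[leb]_x (partial i f x * phi x).
Proof.
move=> tp cf; have := Rint_partial0 i (test_MC1 tp cf).
have [K [_ cs csp]] := test_cont_supp tp.
have /C1P fg := cf; have cf' := has_grad_continuous fg; have [_ cdf] := fg.
rewrite partialM//; last exact: test_C1 tp.
rewrite (_ : \int[leb]_x _ =
    \int[leb]_x (f x * partial i phi x + partial i f x * phi x)); last first.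
  by apply: eq_Rintegral => x _; ring.
rewrite RintD.
- by move/eqP; rewrite addr_eq0 => /eqP.
- apply: (@integ_cont_supp K); case: (csp i) => cK c0 z0; split=> // x.
    exact: (@continuousM _ _ f (partial i phi) x (cf' x) (c0 x)).
  by move=> nK; rewrite z0// mulr0.
- apply: (@integ_cont_supp K); case: cs => cK c0 z0; split=> // x.
    exact: (@continuousM _ _ (partial i f) phi x (cdf i x) (c0 x)).
  by move=> nK; rewrite z0// mulr0.
Qed.

(** The sign of [f] on [U] is approximated by [p - q], where [p] and [q] approximate the indicators
    of the parts of [U] on which [f] is nonnegative and negative. *)
Lemma L1_dual (m : {measure set 'rV[R]_d -> \bar R}) f (U : set 'rV[R]_d) (C : R) :
  open U -> integ m f ->
  (forall phi, test_function U phi -> (forall x, `|phi x| <= 1) ->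
     `|\int[m]_x (f x * phi x)| <= C) ->
  \int[m]_x (`|f x| * \1_U x) <= C.
Proof.
move=> oU fi HC; have mf := integ_meas fi.
pose nf x := `|f x|.
have mnf : measurable_fun setT (EFin \o nf).
  by apply/measurable_EFinP; exact: measurableT_comp.
have nf0 x : (0 <= (EFin \o nf) x)%E by rewrite lee_fin normr_ge0.
have fin := mdens_finite mnf nf0 (integ_norm fi).
(* Density of test functions is used for the measure [|f| m], because an error in the sign is
   weighted by [|f|]. *)
pose mu : {finite_measure set 'rV[R]_d -> \bar R} :=
  HB.pack (mdens m mnf nf0) (Measure_isFinite.Build _ _ _ (mdens m mnf nf0) fin).
have mP : measurable [set x | 0 <= f x].
  rewrite (_ : [set _ | _] = f @^-1` `[0, +oo[).
    by rewrite -[X in measurable X]setTI; exact: mf.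
  by apply/seteqP; split => x /=; rewrite in_itv /= andbT.
have mU := open_measurable_rV oU.
apply/ler_addgt0Pr => e e0.
have e20 : 0 < e / 2 by rewrite divr_gt0.
have [p [tp p01 Hp]] := test_dense oU mu mP e20.
have [q [tq q01 Hq]] := test_dense oU mu (measurableC mP) e20.
have intm (g : 'rV[R]_d -> R) : measurable_fun setT g -> (forall x, `|g x| <= 1) ->
    integ m (fun x => f x * g x).
  by move=> mg g1; exact: integMb g1.
have Hmu (t : 'rV[R]_d -> R) A : test_function U t -> (forall x, 0 <= t x <= 1) -> measurable A ->
    \int[mu]_x `|t x - \1_(A `&` U) x| = \int[m]_x (`|t x - \1_(A `&` U) x| * `|f x|).
  move=> tt t01 mA; rewrite /mu /=; apply: Rint_mdens => //.
  apply: measurableT_comp => //; apply: measurable_funB; first exact: test_meas tt.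
  by apply: measurable_indic; exact: measurableI.
pose phi x := p x - q x.
have tphi : test_function U phi by exact: testB.
have phi1 x : `|phi x| <= 1.
  exact: dist01.
have iphi : integ m (fun x => f x * phi x) by apply: intm => //; exact: test_meas tphi.
have iU : integ m (fun x => `|f x| * \1_U x).
  apply: (integMb (M := 1)); [exact: integ_norm|exact: measurable_indic|].
  by move=> x; rewrite indicE; case: (_ \in _); rewrite ?normr1 ?normr0.
have ipq t A : test_function U t -> (forall x, 0 <= t x <= 1) -> measurable A ->
    integ m (fun x => `|t x - \1_(A `&` U) x| * `|f x|).
  move=> tt t01 mA; under eq_fun do rewrite -normrM mulrC.
  apply: integ_norm; apply: intm.
    apply: measurable_funB; first exact: test_meas tt.
    by apply: measurable_indic; exact: measurableI.
  by move=> x; apply: dist01 => //; exact: indic01.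
have : \int[m]_x (`|f x| * \1_U x) <= \int[m]_x (f x * phi x +
   (`|p x - \1_([set x | 0 <= f x] `&` U) x| * `|f x| +
    `|q x - \1_((~` [set x | 0 <= f x]) `&` U) x| * `|f x|)).
  apply: Rint_le => //.
    apply: integD => //; apply: integD; apply: ipq => //.
    exact: measurableC.
  move=> x; rewrite -!normrM /phi.
  set a := \1_([set x | 0 <= f x] `&` U) x.
  set b := \1_((~` [set x | 0 <= f x]) `&` U) x.
  have -> : `|f x| * \1_U x = f x * (a - b).
    rewrite /a /b !indicE !in_setI in_setC.
    have [f0|f0] := leP 0 (f x).
      have -> : x \in [set x | 0 <= f x] by rewrite inE.
      by rewrite /= subr0 ger0_norm.
    have -> : x \in [set x | 0 <= f x] = false.
      by apply/negbTE; rewrite notin_setE /=; apply/negP; rewrite -ltNge.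
    by rewrite /= sub0r mulrN ltr0_norm// mulNr.
  have h1 : f x * (a - p x) <= `|(p x - a) * f x|.
    by rewrite (le_trans (ler_norm _))// -normrN -mulrN opprB mulrC.
  have h2 : f x * (q x - b) <= `|(q x - b) * f x|.
    by rewrite (le_trans (ler_norm _))// mulrC.
  rewrite (_ : f x * (a - b) = f x * (p x - q x) + (f x * (a - p x) + f x * (q x - b))).
    by rewrite lerD2l lerD.
  by ring.
rewrite RintD//; last by apply: integD; apply: ipq => //; exact: measurableC.
rewrite RintD; [|by apply: ipq|by apply: ipq => //; exact: measurableC].
rewrite -!Hmu//; last exact: measurableC.
move=> h; apply: le_trans h _; rewrite lerD//.
  by apply: le_trans (ler_norm _) (HC _ tphi phi1).
by rewrite (splitr e) lerD.
Qed.

(* In terms of measures: [|D_i u|(Omega) <= K] for every [i]. *)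
Definition var_le (Omega : set 'rV[R]_d) u (K : R) :=
  forall i phi M, test_function Omega phi -> (forall x, `|phi x| <= M) ->
    `|\int[leb]_x (u x * partial i phi x)| <= K * M.

(** Duality moves the translation onto [phi]: the increment becomes [g 1 - g 0], cut into short
    steps on which [phi] is expanded to first order, so [u] is never smoothed. The translates of
    [phi] stay test functions because whole segments from [A] lie in Omega. *)
Lemma translation_L1 (Omega A : set 'rV[R]_d) u K w :
  integ leb u -> 0 <= K -> var_le Omega u K -> open A ->
  (forall x s, A x -> 0 <= s <= 1 -> Omega (x + s *: w)) ->
  \int[leb]_x (`|u (x + w) - u x| * \1_A x) <= K * \sum_i `|w 0 i|.
Proof.
move=> iu K0 vu oA AO.
have iuw := integ_shift w iu.
apply: L1_dual => //; first exact: integB.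
move=> phi tp p1; have mp := test_meas tp.
have ib (g : 'rV[R]_d -> R) M : measurable_fun setT g -> (forall x, `|g x| <= M) ->
   integ leb (fun x => u x * g x) by move=> mg; exact: integMb.
have [L [LA csL _]] := test_cont_supp tp; have [cL _ L0] := csL.
set S := \sum_i `|w 0 i|.
have S0 : 0 <= S by apply: sumr_ge0.
pose g (s : R) := \int[leb]_x (u x * phi (x - s *: w)).
have mps s : measurable_fun setT (fun x : 'rV[R]_d => phi (x - s *: w)).
  by apply: measurableT_comp mp (measurable_addr _).
have ips s : integ leb (fun x => u x * phi (x - s *: w)).
  by apply: (ib _ 1) => // x; exact: p1.
have E : \int[leb]_x ((u (x + w) - u x) * phi x) = g 1 - g 0.
  under eq_Rintegral do rewrite mulrBl.
  rewrite RintB; [|by apply: (integMb _ mp p1)|by apply: (integMb _ mp p1)].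
  congr (_ - _); rewrite /g.
    rewrite -(Rint_shift w (f := fun x => u x * phi (x - 1 *: w))).
      by apply: eq_Rintegral => x _; rewrite scale1r addrK.
    exact: ips.
  by apply: eq_Rintegral => x _; rewrite scale0r subr0.
rewrite E; apply/ler_addgt0Pr => e e0.
set N1 := \int[leb]_x `|u x|.
have N10 : 0 <= N1 by exact: Rint_ge0.
(* The expansion error of a step of length [h] is then at most [h * e], and the steps have total
   length 1. *)
have w0 : 0 < e / (S * N1 + 1) by rewrite divr_gt0// ltr_wpDl ?mulr_ge0.
have [r r0 Hr] := test_estimate tp w0.
have [N Nr] : exists N : nat, `|w| / r < N.+1%:R.
  by exists (Num.truncn (`|w| / r)); rewrite truncnS_gt.
pose h : R := N.+1%:R^-1.
have h0 : 0 < h by rewrite invr_gt0.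
have hw : `|- h *: w| < r.
  by rewrite normrZ normrN gtr0_norm// mulrC ltr_pdivrMr// mulrC -ltr_pdivrMr.
have -> : g 1 - g 0 = \sum_(k < N.+1) (g (k.+1%:R * h) - g (k%:R * h)).
  rewrite -(big_mkord xpredT (fun k => g (k.+1%:R * h) - g (k%:R * h))).
  rewrite (telescope_sumr (fun k : nat => g (k%:R * h)) (leq0n N.+1)) mul0r.
  by rewrite (_ : N.+1%:R * h = 1)// /h mulfV.
apply: le_trans (ler_norm_sum _ _ _) _.
apply: (@le_trans _ _ (\sum_(k < N.+1) h * (K * S + e))); last first.
  by rewrite sumr_const card_ord -mulr_natl mulrA mulfV// mul1r.
apply: ler_sum => k _; set s := k%:R * h.
have s01 : 0 <= s <= 1.
  by rewrite mulr_ge0 ?(ltW h0)//= ler_pdivrMr// mul1r ler_nat ltnW.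
pose psi x := phi (x - s *: w).
have tpsi : test_function Omega psi.
  apply: (test_shift tp cL L0) => x Lx.
  by rewrite -(subrK (s *: w) x); apply: AO => //; exact: LA.
have psi1 x : `|psi x| <= 1 by exact: p1.
have ipar i : integ leb (fun x => u x * partial i psi x).
  have [K' [_ _ csp]] := test_cont_supp tpsi.
  have [M _ HM] := cont_supp_bounded (csp i).
  by apply: (ib _ M) => //; apply: continuous_measurable_rV; case: (csp i).
have E2 : g (k.+1%:R * h) - g s = \int[leb]_x (u x * (phi (x - (k.+1%:R * h) *: w) - psi x)).
  under [RHS]eq_Rintegral do rewrite mulrBr.
  by rewrite RintB; [|exact: ips|exact: ips].
have iD : integ leb (fun x => \sum_i (- h * w 0 i) * (u x * partial i psi x)).
  by apply: integ_sum => i; exact: integZ.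
have idd : integ leb (fun x => u x * (phi (x - (k.+1%:R * h) *: w) - psi x)).
  under eq_fun do rewrite mulrBr.
  by apply: integB; exact: ips.
have nh : `|- h| = h by rewrite normrN gtr0_norm.
have pt x : `|u x * (phi (x - (k.+1%:R * h) *: w) - psi x) -
     \sum_i (- h * w 0 i) * (u x * partial i psi x)| <= e / (S * N1 + 1) * (h * S) * `|u x|.
  have -> : x - (k.+1%:R * h) *: w = (x - s *: w) + (- h *: w).
    rewrite -[in RHS]addrA; congr (_ + _); apply/rowP => j.
    by rewrite !mxE /s -natr1; ring.
  have -> : \sum_i (- h * w 0 i) * (u x * partial i psi x) =
      u x * \sum_i (- h *: w) 0 i * partial i phi (x - s *: w).
    rewrite mulr_sumr; apply: eq_bigr => i _.
    by rewrite /psi partial_shift ?mxE; [ring|exact: test_C1 tp].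
  rewrite -mulrBr normrM mulrC ler_wpM2r//; apply: le_trans (Hr _ _ hw) _.
  rewrite ler_wpM2l ?(ltW w0)// mulr_sumr; apply: ler_sum => i _.
  by rewrite mxE normrM nh.
have B1 : `|\int[leb]_x (\sum_i (- h * w 0 i) * (u x * partial i psi x))| <= h * (K * S).
  rewrite Rint_sum; last by move=> i; exact: integZ.
  apply: le_trans (ler_norm_sum _ _ _) _.
  rewrite /S !mulr_sumr; apply: ler_sum => i _.
  rewrite RintZ// 2!normrM nh -[leLHS]mulrA ler_wpM2l ?(ltW h0)//.
  rewrite mulrC ler_wpM2r//; have := vu i psi 1 tpsi psi1; by rewrite mulr1.
rewrite E2 -(subrK (\int[leb]_x (\sum_i (- h * w 0 i) * (u x * partial i psi x)))
   (\int[leb]_x (u x * _))).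
apply: le_trans (ler_normD _ _) _; rewrite mulrDr addrC lerD//.
apply: le_trans (Rint_normB idd iD) _.
apply: (@le_trans _ _ (\int[leb]_x (e / (S * N1 + 1) * (h * S) * `|u x|))).
  apply: Rint_le pt; first by apply: integ_norm; exact: integB.
  by apply: integZ; exact: integ_norm.
rewrite RintZ; last exact: integ_norm.
rewrite -/N1 (_ : _ * _ = h * (e * (S * N1 / (S * N1 + 1)))); last by ring.
rewrite ler_wpM2l ?(ltW h0)// ler_piMr ?(ltW e0)// ler_pdivrMr ?mul1r ?lerDl//.
by rewrite ltr_wpDl ?mulr_ge0.
Qed.

End translation.

(** * Mollification *)

Lemma is_derive_modulus (R : realType) (f : R -> R) (t l : R) :
  (forall w, 0 < w -> exists2 r, 0 < r &
    forall h, `|h| < r -> `|f (t + h) - f t - h * l| <= w * `|h|) ->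
  is_derive t (1 : R) f l.
Proof.
move=> H.
suff cv : h^-1 *: (f (h *: (1 : R) + t) - f t) @[h --> 0^'] --> l.
  by split; [apply/cvg_ex; exists l|exact: cvg_lim].
apply/cvgrPdist_lt => e e0; have e20 : 0 < e / 2 by rewrite divr_gt0.
have [r r0 Hr] := H _ e20.
near=> h.
have h0 : h != 0 by near: h; exact: nbhs_dnbhs_neq.
have hr : `|h| < r by near: h; apply: dnbhs0_lt.
rewrite {1}/GRing.scale /= {1}/GRing.scale /= mulr1.
rewrite distrC [h + t]addrC.
have -> : h^-1 * (f (t + h) - f t) - l = h^-1 * (f (t + h) - f t - h * l).
  by rewrite [RHS]mulrBr mulKf.
rewrite normrM normfV ltr_pdivrMl ?normr_gt0//.
apply: le_lt_trans (Hr _ hr) _; rewrite mulrC ltr_pM2l ?normr_gt0//.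
by rewrite ltr_pdivrMr// ltr_pMr// ltr1n.
Unshelve. all: by end_near. Qed.

Section mollifier.
Variables (R : realType) (d : nat).
Local Notation leb := (lebesgue_rV R d).
Implicit Types (u phi f : 'rV[R]_d -> R) (x y : 'rV[R]_d).

Lemma bump_test_ball (e : R) : 0 < e -> test_function setT (@bump R d 0 e).
Proof. by move=> e0; apply: bump_test. Qed.

Lemma Rint_bump_gt0 (e : R) : 0 < e -> 0 < \int[leb]_x @bump R d 0 e x.
Proof.
move=> e0; have tb := bump_test_ball e0; have ib := integ_test tb.
rewrite lt_def Rint_ge0 ?andbT; last by move=> x; exact: bump_ge0.
apply/eqP => I0.
have mb := test_meas tb.
have : (\int[leb]_x `|(@bump R d 0 e x)%:E| = 0)%E.
  rewrite (eq_integral (fun x => (@bump R d 0 e x)%:E)); last first.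
    by move=> x _; rewrite gee0_abs// lee_fin bump_ge0.
  by rewrite -Rint_EFin// I0.
move/(ae_eq_integral_abs leb measurableT ((measurable_EFinP _ _).2 mb)).
move=> [N [mN N0 subN]].
have /andP[+ _] := @leb_ball R d _ e0; rewrite ltNge => /negP; apply.
rewrite -N0; apply: le_measure; rewrite ?inE//; first exact: measurable_cube.
move=> x xe; apply: subN => /= /(_ I) /eqP; apply/negP.
rewrite eqe gt_eqF// bump_gt0// subr0.
rewrite /Num.norm /= mx_normrE; apply/bigmax_ltP; split => // -[i j] _ /=.
by rewrite (ord1 i).
Qed.

Definition rho (e : R) x : R := bump 0 e x / \int[leb]_y bump 0 e y.

Section eps.
Variables (e : R) (e0 : 0 < e).

Lemma rho_ge0 x : 0 <= rho e x.
Proof. by rewrite divr_ge0 ?bump_ge0// ltW// Rint_bump_gt0. Qed.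

Lemma rhoN x : rho e (- x) = rho e x.
Proof. by rewrite /rho bump0N. Qed.

Lemma rho_subC x y : rho e (y - x) = rho e (x - y).
Proof. by rewrite -rhoN opprB. Qed.

Lemma rho_supp x : e <= `|x| -> rho e x = 0.
Proof.
move=> ex; have := bump_gt0 0 x e0; rewrite subr0 ltNge => h.
rewrite /rho (_ : bump 0 e x = 0) ?mul0r//; apply/eqP.
by rewrite eq_le bump_ge0 andbT leNgt ltNge h ltNge ex.
Qed.

Lemma rho_test : test_function setT (rho e).
Proof.
have := testZ (\int[leb]_y bump 0 e y)^-1 (bump_test_ball e0).
by congr test_function; apply/funext => x; rewrite mulrC.
Qed.

Lemma rho_test_shift (Omega : set 'rV[R]_d) x : (forall y, `|y - x| <= e -> Omega y) ->
  test_function Omega (fun y => rho e (y - x)).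
Proof.
move=> xO; have cB := @compact_closed_ball R d 0 e.
apply: (test_shift (a := - x) rho_test cB) => [y /negP|y /=]; rewrite subr0.
  by rewrite -ltNge => /ltW/rho_supp.
exact: xO.
Qed.

Lemma integ_rho x : integ leb (fun y => rho e (y - x)).
Proof. exact: (integ_shift (- x) (integ_test rho_test)). Qed.

Lemma Rint_rho x : \int[leb]_y rho e (y - x) = 1.
Proof.
rewrite (Rint_shift (- x) (integ_test rho_test)) /rho.
under eq_Rintegral do rewrite mulrC.
rewrite RintZ; last exact: integ_test (bump_test_ball e0).
by rewrite mulVf// gt_eqF// Rint_bump_gt0.
Qed.

Lemma Rint_rho_l y : \int[leb]_x rho e (y - x) = 1.
Proof. by under eq_Rintegral do rewrite rho_subC; exact: Rint_rho. Qed.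

Lemma rho_bounded : exists2 M, 0 <= M & forall x, `|rho e x| <= M.
Proof.
by have [K [_ cs _]] := test_cont_supp rho_test; exact: cont_supp_bounded cs.
Qed.

Lemma measurable_rho_shift x : measurable_fun setT (fun y => rho e (y - x)).
Proof. exact: integ_meas (integ_rho x). Qed.

(** Written with the kernel [rho e (y - x)], a test function of [y] once [x] is fixed; as [rho] is
    even this is the usual convolution. *)
Definition moll u x := \int[leb]_y (rho e (y - x) * u y).

Lemma integ_moll u x : integ leb u -> integ leb (fun y => rho e (y - x) * u y).
Proof.
move=> iu; have [M _ HM] := rho_bounded.
under eq_fun do rewrite mulrC.
by apply: (integMb (M := M)) => //; exact: measurable_rho_shift.
Qed.

(** The first-order expansion of the kernel is uniform, so integrating it against [u] only costs the
    factor [N1], the L^1 norm of [u]. *)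
Lemma has_grad_moll u : integ leb u ->
  has_grad (moll u) (fun i x => - \int[leb]_y (partial i (rho e) (y - x) * u y)).
Proof.
move=> iu; set N1 := \int[leb]_x `|u x|.
have N10 : 0 <= N1 by exact: Rint_ge0.
have [K [_ cs csp]] := test_cont_supp rho_test.
have ip i x : integ leb (fun y => partial i (rho e) (y - x) * u y).
  have [M _ HM] := cont_supp_bounded (csp i).
  under eq_fun do rewrite mulrC.
  apply: (integMb (M := M)) => //.
  have := integ_cont_supp (csp i).
  by move=> /(integ_shift (- x))/integ_meas.
split=> [x i|i x].
  rewrite -[x in is_derive x](addr0 x) -(scale0r (delta_mx 0 i)).
  apply/is_derive_lineP; apply: is_derive_modulus => w w0.
  have w10 : 0 < w / (N1 + 1) by rewrite divr_gt0// ltr_wpDl.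
  have [r r0 Hr] := test_estimate rho_test w10.
  exists r => // h hr; rewrite add0r scale0r addr0.
  set z := h *: delta_mx 0 i.
  have zi j : (- z) 0 j = if j == i then - h else 0.
    by rewrite !mxE /=; case: eqP => _; rewrite ?mulr1 ?mulr0 ?oppr0.
  have zh : `|- z| < r.
    apply: le_lt_trans hr; apply: norm_le_coord => // j.
    by rewrite zi; case: ifP => _; rewrite ?normr0 ?normrN.
  have sz : \sum_j `|(- z) 0 j| = `|h|.
    rewrite (bigD1 i)//= zi eqxx normrN big1 ?addr0// => j ji.
    by rewrite zi (negbTE ji) normr0.
  have sp y : \sum_j (- z) 0 j * partial j (rho e) y = - (h * partial i (rho e) y).
    rewrite (bigD1 i)//= zi eqxx big1 ?addr0 ?mulNr// => j ji.
    by rewrite zi (negbTE ji) mul0r.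
  rewrite mulrN -RintZ// opprK /moll -RintB; [|exact: integ_moll|exact: integ_moll].
  rewrite -RintD; [|by apply: integB; exact: integ_moll|exact: integZ].
  apply: le_trans (Rint_norm _) _.
    by apply: integD; [apply: integB; exact: integ_moll|exact: integZ].
  apply: (@le_trans _ _ (\int[leb]_y (w / (N1 + 1) * `|h| * `|u y|))).
    apply: Rint_le.
    - apply: integ_norm; apply: integD; last exact: integZ.
      by apply: integB; exact: integ_moll.
    - by apply: integZ; exact: integ_norm.
    - move=> y; have := Hr (y - x) (- z) zh; rewrite sp sz opprK => H.
      rewrite mulrA -mulrBl -mulrDl normrM ler_wpM2r//.
      by rewrite opprD addrA.
  rewrite RintZ; last exact: integ_norm.
  rewrite -/N1 mulrAC ler_wpM2r// mulrAC ler_pdivrMr ?ltr_wpDl// ler_wpM2l ?(ltW w0)//.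
  by rewrite lerDl.
apply/continuous_rVP => w w0.
have w10 : 0 < w / (N1 + 1) by rewrite divr_gt0// ltr_wpDl.
have [r r0 Hr] := cont_supp_unif (csp i) w10.
exists r => // x' xx'; rewrite -opprD normrN -RintB//.
apply: (@le_lt_trans _ _ (\int[leb]_y (w / (N1 + 1) * `|u y|))).
  apply: le_trans (Rint_norm _) _; first exact: integB.
  apply: Rint_le.
  - by apply: integ_norm; exact: integB.
  - by apply: integZ; exact: integ_norm.
  - move=> y; rewrite -mulrBl normrM ler_wpM2r// ltW//; apply: Hr.
    by rewrite opprB addrC addrA subrK -normrN opprB.
rewrite RintZ; last exact: integ_norm.
rewrite -/N1 mulrAC ltr_pdivrMr ?ltr_wpDl// ltr_pM2l// ltrDl.
exact: ltr01.
Qed.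

Lemma moll_meas u : integ leb u -> measurable_fun setT (moll u).
Proof.
move=> iu; apply: continuous_measurable_rV.
exact: (has_grad_continuous (has_grad_moll iu)).
Qed.

(** The right-hand side is the distributional derivative of [u] paired with the kernel centred at
    [x]: inequalities known against test functions become pointwise for the mollification. *)
Lemma partial_moll u i x : integ leb u -> partial i (moll u) x =
  - \int[leb]_y (u y * partial i (fun y => rho e (y - x)) y).
Proof.
move=> iu; rewrite (has_grad_partial i (has_grad_moll iu)); congr (- _).
have E := partial_shift i (- x) (test_C1 rho_test).
by apply: eq_Rintegral => y _; rewrite E mulrC.
Qed.

Lemma measurable_rho2 : measurable_fun setT (fun p : 'rV[R]_d * 'rV[R]_d => rho e (p.2 - p.1)).
Proof.
by apply: measurableT_comp (@measurable_subr2 R d); exact: test_meas rho_test.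
Qed.

Lemma rho_tonelli (m : {sigma_finite_measure set 'rV[R]_d -> \bar R}) (f g : 'rV[R]_d -> R) :
  measurable_fun setT f -> measurable_fun setT g ->
  (forall x, 0 <= f x) -> (forall x, 0 <= g x) ->
  (\int[leb]_x \int[m]_y (f x * (rho e (y - x) * g y))%:E =
   \int[m]_y \int[leb]_x (f x * (rho e (y - x) * g y))%:E)%E.
Proof.
move=> mf mg f0 g0.
apply: (@fubini_tonelli _ _ _ _ R leb m
  (fun p : 'rV[R]_d * 'rV[R]_d => (f p.1 * (rho e (p.2 - p.1) * g p.2))%:E)).
  apply/measurable_EFinP; apply: measurable_funM.
    by apply: measurableT_comp mf _.
  apply: measurable_funM; first exact: measurable_rho2.
  by apply: measurableT_comp mg _.
by move=> p; rewrite lee_fin mulr_ge0// mulr_ge0// rho_ge0.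
Qed.

Lemma moll_L1 u : integ leb u -> integ leb (moll u) /\
  \int[leb]_x `|moll u x| <= \int[leb]_x `|u x|.
Proof.
move=> iu; have mu := integ_meas iu.
have mnu : measurable_fun setT (fun y => `|u y|) by exact: measurableT_comp.
have T := rho_tonelli leb (f := fun=> 1) (g := fun y => `|u y|) (measurable_cst _) mnu
  (fun=> ler01) (fun y => normr_ge0 _).
have E : (\int[leb]_x \int[leb]_y (1 * (rho e (y - x) * `|u y|))%:E =
    \int[leb]_y (`|u y|)%:E)%E.
  rewrite T; apply: eq_integral => y _.
  rewrite -Rint_EFin; last first.
    under eq_fun do rewrite mul1r mulrC.
    by apply: integZ; under eq_fun do rewrite rho_subC; exact: integ_rho.
  under eq_Rintegral do rewrite mul1r mulrC.
  rewrite RintZ ?Rint_rho_l ?mulr1//.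
  by under eq_fun do rewrite rho_subC; exact: integ_rho.
have ptw x : (`|(moll u x)%:E| <= \int[leb]_y (1 * (rho e (y - x) * `|u y|))%:E)%E.
  rewrite abse_EFin -Rint_EFin; last first.
    by under eq_fun do rewrite mul1r; apply: integ_moll; exact: integ_norm.
  rewrite lee_fin; apply: le_trans (Rint_norm (integ_moll x iu)) _.
  under [leRHS]eq_Rintegral do rewrite mul1r.
  by under eq_Rintegral do rewrite normrM (ger0_norm (rho_ge0 _)).
have le : (\int[leb]_x `|(moll u x)%:E| <= \int[leb]_y (`|u y|)%:E)%E.
  rewrite -E; apply: ge0_le_integral => //.
  - by apply: measurableT_comp => //; apply/measurable_EFinP; exact: moll_meas.
  - apply: (measurable_fun_fubini_tonelli_F
      (fun p : 'rV[R]_d * 'rV[R]_d => (1 * (rho e (p.2 - p.1) * `|u p.2|))%:E)).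
      apply/measurable_EFinP; apply: measurable_funM => //.
      apply: measurable_funM; first exact: measurable_rho2.
      by apply: measurableT_comp mnu _.
    by move=> p; rewrite lee_fin mul1r mulr_ge0// rho_ge0.
have im : integ leb (moll u).
  apply/integrableP; split; first by apply/measurable_EFinP; exact: moll_meas.
  apply: le_lt_trans le _; rewrite -Rint_EFin ?ltry//; exact: integ_norm.
split=> //; rewrite -lee_fin Rint_EFin; last exact: integ_norm.
by rewrite Rint_EFin; last exact: integ_norm.
Qed.

Lemma moll_unif f w : integ leb f -> 0 <= w ->
  (forall x y, `|y - x| < e -> `|f y - f x| <= w) ->
  forall x, `|moll f x - f x| <= w.
Proof.
move=> fi w0 H x.
have ir := integ_rho x.
have -> : f x = \int[leb]_y (f x * rho e (y - x)) by rewrite RintZ// Rint_rho mulr1.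
rewrite -[leRHS]mulr1 -(Rint_rho x) -RintZ//.
rewrite /moll -RintB; [|exact: integ_moll|exact: integZ].
apply: le_trans (Rint_norm _) _; first by apply: integB; [exact: integ_moll|exact: integZ].
apply: Rint_le.
- by apply: integ_norm; apply: integB; [exact: integ_moll|exact: integZ].
- exact: integZ.
- move=> y; rewrite mulrC -mulrBl normrM (ger0_norm (rho_ge0 _)).
  have [yx|yx] := ltP `|y - x| e; last by rewrite rho_supp// !mulr0.
  by rewrite ler_wpM2r ?rho_ge0// H.
Qed.

(** Tonelli and the evenness of the kernel: mollifying the measure [m] and integrating [f] is the
    same as mollifying [f] and integrating against [m]. *)
Lemma Rint_moll_measure (m : {finite_measure set 'rV[R]_d -> \bar R}) f :
  integ leb f -> (forall x, 0 <= f x) -> integ m (moll f) ->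
  integ leb (fun x => f x * \int[m]_y rho e (y - x)) /\
  \int[leb]_x (f x * \int[m]_y rho e (y - x)) = \int[m]_y moll f y.
Proof.
move=> fi f0 imf; have mf := integ_meas fi.
have [M M0 HM] := rho_bounded.
have irm x : integ m (fun y => rho e (y - x)).
  by apply: (integ_bounded _ (measurable_rho_shift x)) => y; exact: HM.
have T := rho_tonelli m (f := f) (g := fun=> 1) mf (measurable_cst _) f0 (fun=> ler01).
have E1 x : (\int[m]_y (f x * (rho e (y - x) * 1))%:E = (f x * \int[m]_y rho e (y - x))%:E)%E.
  rewrite -Rint_EFin; last by apply: integZ; under eq_fun do rewrite mulr1.
  by rewrite RintZ; [under eq_Rintegral do rewrite mulr1|under eq_fun do rewrite mulr1].
have E2 y : (\int[leb]_x (f x * (rho e (y - x) * 1))%:E = (moll f y)%:E)%E.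
  have i2 : integ leb (fun x => f x * (rho e (y - x) * 1)).
    apply: eq_integrable (integ_moll y fi) => // x _ /=.
    by rewrite mulr1 rho_subC mulrC.
  rewrite -Rint_EFin//; congr EFin; apply: eq_Rintegral => x _.
  by rewrite mulr1 rho_subC mulrC.
have EE : (\int[leb]_x (f x * \int[m]_y rho e (y - x))%:E = \int[m]_y (moll f y)%:E)%E.
  transitivity (\int[leb]_x \int[m]_y (f x * (rho e (y - x) * 1))%:E)%E.
    by apply: eq_integral => x _; rewrite E1.
  by rewrite T; apply: eq_integral => y _; rewrite E2.
have mm : measurable_fun setT (fun x => f x * \int[m]_y rho e (y - x)).
  apply/measurable_EFinP.
  have := @measurable_fun_fubini_tonelli_F _ _ _ _ R m
      (fun p : 'rV[R]_d * 'rV[R]_d => (f p.1 * (rho e (p.2 - p.1) * 1))%:E).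
  rewrite /fubini_F /= => H.
  rewrite (_ : EFin \o _ = (fun x => \int[m]_y (f x * (rho e (y - x) * 1))%:E)%E); last first.
    by apply/funext => x; rewrite /= E1.
  apply: H.
  - apply/measurable_EFinP; apply: measurable_funM.
      by apply: measurableT_comp mf _.
    apply: measurable_funM => //; exact: measurable_rho2.
  - by move=> p; rewrite lee_fin mulr_ge0// mulr1 rho_ge0.
have pos x : 0 <= f x * \int[m]_y rho e (y - x).
  by rewrite mulr_ge0//; apply: Rint_ge0 => y; exact: rho_ge0.
split; last by rewrite /Rintegral EE.
apply/integrableP; split; first exact/measurable_EFinP.
rewrite (eq_integral (fun x => (f x * \int[m]_y rho e (y - x))%:E)); last first.
  by move=> x _; rewrite gee0_abs// lee_fin.
by rewrite EE -Rint_EFin// ltry.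
Qed.

End eps.
End mollifier.

Section L1_density.
Variables (R : realType) (d : nat) (Omega : set 'rV[R]_d).
Hypotheses (oO : open Omega) (bO : bounded_set Omega).
Local Notation leb := (lebesgue_rV R d).
Implicit Types (u v f : 'rV[R]_d -> R).

(** The normal form of an element of L^1(Omega). For it, integrals against Lebesgue measure and
    against [lamO] agree, and translations and mollifications make sense on the whole space. *)
Definition zero_off u := forall x, ~ Omega x -> u x = 0.

Lemma zero_off_patch u : zero_off u -> u \_ Omega = u.
Proof.
move=> u0; apply/funext => x; rewrite patchE; case: ifPn => // xO.
by rewrite u0//; move/negP: xO; rewrite inE.
Qed.

Lemma Rint_zero_off f : zero_off f -> \int[leb]_x f x = \int[lamO oO bO]_x f x.
Proof.
move=> f0; rewrite -[in LHS](zero_off_patch f0) -Rintegral_mkcond.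
by rewrite Rint_lamO_patch zero_off_patch.
Qed.

Lemma integ_zero_off f : zero_off f -> integ leb f <-> integ (lamO oO bO) f.
Proof.
move=> f0; have E : (\int[leb]_x `|(f x)%:E| = \int[lamO oO bO]_x `|(f x)%:E|)%E.
  have P : (fun x => `|(f x)%:E|%E) = (fun x => `|(f x)%:E|%E) \_ Omega.
    apply/funext => x; rewrite patchE; case: ifPn => // xO.
    by rewrite f0 ?abse0//; move/negP: xO; rewrite inE.
  by rewrite [in LHS]P -integral_mkcond int_lamO_patch -P.
by split=> /integrableP[h1 h2]; apply/integrableP; split=> //; rewrite ?E// -E.
Qed.

Lemma integ_bounded_zero_off f M : zero_off f -> measurable_fun setT f ->
  (forall x, `|f x| <= M) -> integ leb f.
Proof. by move=> f0 mf fM; apply/integ_zero_off => //; exact: integ_bounded fM. Qed.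

Lemma test_zero_off phi : test_function Omega phi -> zero_off phi.
Proof.
move=> tp x nx; have [K [_ KO K0 _]] := test_supp tp.
by apply: K0 => /KO.
Qed.

Let L1lim u := forall w : R, 0 < w -> exists2 psi, test_function Omega psi &
   \int[leb]_x `|u x - psi x| <= w.

Let ge0_dense u : integ leb u -> zero_off u -> (forall x, 0 <= u x) -> L1lim u.
Proof.
move=> iu uz u0 w w0; have mu := integ_meas iu.
pose A (n k : nat) := u @^-1` `[k%:R / n.+1%:R, k.+1%:R / n.+1%:R[.
have mA n k : measurable (A n k).
  by rewrite -[X in measurable X]setTI; exact: mu.
(* Steps of width [1 / (n + 1)] up to the height [n + 1], and 0 above it; thus [0 <= s n <= u] and
   dominated convergence applies to an unbounded [u]. *)
pose s n x : R := \sum_(k < n.+1 * n.+1) (k%:R / n.+1%:R) * \1_(A n k) x.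
have ms n : measurable_fun setT (s n).
  by apply: measurable_sum => k; apply: measurable_funM.
have Ax n k x : A n k x -> k = Num.truncn (u x * n.+1%:R).
  rewrite /A /= in_itv /= => /andP[h1 h2]; apply/esym/truncn_def.
  by rewrite -ler_pdivrMr// -ltr_pdivlMr// h1 h2.
have At n x : A n (Num.truncn (u x * n.+1%:R)) x.
  rewrite /A /= in_itv /= ler_pdivrMr// ltr_pdivlMr//.
  by apply: truncn_itv; rewrite mulr_ge0.
have sE n x : s n x = if (Num.truncn (u x * n.+1%:R) < n.+1 * n.+1)%N
    then (Num.truncn (u x * n.+1%:R))%:R / n.+1%:R else 0.
  case: ifPn => [kK|kK].
    rewrite /s (bigD1 (Ordinal kK))//= big1 ?addr0.
      by rewrite indicE mem_set ?mulr1.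
    move=> j jk; rewrite indicE memNset ?mulr0// => /Ax jE.
    by move/eqP: jk; apply; apply/val_inj.
  rewrite /s big1// => j _; rewrite indicE memNset ?mulr0// => /Ax jE.
  by move: kK; rewrite -jE ltn_ord.
have sle n x : 0 <= s n x <= u x.
  rewrite sE; case: ifPn => _; last by rewrite lexx u0.
  rewrite divr_ge0//=; have := At n x; rewrite /A /= in_itv /=.
  by case/andP.
have sl x : s n x @[n --> \oo] --> u x.
  apply: (@cvgn_le _ _ (fun n => n.+1%:R^-1) _ (Num.truncn (u x)).+1); last first.
    exact: cvg_harmonic.
  move=> n ux; rewrite sE.
  have -> : (Num.truncn (u x * n.+1%:R) < n.+1 * n.+1)%N.
    rewrite truncn_lt_nat ?mulr_ge0// natrM ltr_pM2r//.
    have := truncnS_gt (u x) => /lt_le_trans; apply.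
    by rewrite ler_nat (leq_trans ux).
  have := At n x; rewrite /A /= in_itv /= => /andP[h1 h2].
  rewrite distrC ger0_norm ?subr_ge0// lerBlDr (le_trans (ltW h2))//.
  by rewrite -natr1 mulrDl mul1r addrC.
have w20 : 0 < w / 2 by rewrite divr_gt0.
have [|_ /cvgnP/(_ _ w20)[N /(_ N (leqnn N)) HN] _] := @Rint_dct _ _ _ leb s u u ms mu iu _ sl.
  by move=> n x; have /andP[h1 h2] := sle n x; rewrite ger0_norm.
have C0 : 0 < w / 2 / (\sum_(k < N.+1 * N.+1) (k%:R / N.+1%:R) + 1) :> R.
  by rewrite divr_gt0// ltr_wpDl// sumr_ge0// => k _; rewrite divr_ge0.
have H k := test_dense oO (lamO oO bO) (mA N k) C0.
have [psi Hpsi] := choice H.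
have int_psi k : integ leb (fun x => `|psi k x - \1_(A N k `&` Omega) x|).
  have [tp p01 _] := Hpsi k.
  apply: integ_norm; apply: (@integ_bounded_zero_off _ 1).
  - move=> x nx; rewrite (test_zero_off tp nx) indicE memNset ?subrr//.
    by case.
  - apply: measurable_funB; first exact: test_meas tp.
    by apply: measurable_indic; apply: measurableI => //; exact: open_measurable_rV.
  - by move=> x; apply: dist01 => //; exact: indic01.
exists (fun x => \sum_(k < N.+1 * N.+1) (k%:R / N.+1%:R) * psi k x).
  by apply: test_sum => k; apply: testZ; case: (Hpsi k).
have tS : test_function Omega (fun x => \sum_(k < N.+1 * N.+1) (k%:R / N.+1%:R) * psi k x).
  by apply: test_sum => k; apply: testZ; case: (Hpsi k).
have isN : integ leb (s N).
  apply: (integ_le (ms N) iu) => x; have /andP[h1 h2] := sle N x.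
  by rewrite !ger0_norm.
apply: le_trans (Rint_triangle iu isN (integ_test tS)) _.
rewrite (splitr w) lerD//.
  have -> : \int[leb]_x `|u x - s N x| = \int[leb]_x `|s N x - u x|.
    by apply: eq_Rintegral => x _; rewrite distrC.
  by move: HN; rewrite subr0 => /ltW; apply: le_trans; exact: ler_norm.
apply: (@le_trans _ _ (\int[leb]_x \sum_(k < N.+1 * N.+1) (k%:R / N.+1%:R) *
    `|psi k x - \1_(A N k `&` Omega) x|)).
  apply: Rint_le.
  - by apply: integ_norm; apply: integB => //; exact: integ_test tS.
  - by apply: integ_sum => k; apply: integZ.
  - move=> x; rewrite /s -sumrB; apply: le_trans (ler_norm_sum _ _ _) _.
    apply: ler_sum => k _; rewrite -mulrBr normrM ger0_norm ?divr_ge0//.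
    (* The level set of index 0 contains the complement of Omega, but its coefficient is 0; the
       others lie in Omega because [u] vanishes outside. *)
    have [->|k0] := eqVneq (val k) 0%N; first by rewrite mul0r !mul0r.
    rewrite ler_wpM2l ?divr_ge0// distrC.
    suff -> : A N k `&` Omega = A N k by [].
    apply/setIidl => y; rewrite /A /= in_itv /= => /andP[ky _].
    apply: contrapT => /uz uy; move: ky; rewrite uy; apply/negP; rewrite -ltNge.
    by rewrite divr_gt0// ltr0n lt0n.
rewrite Rint_sum; last by move=> k; apply: integZ.
set C := w / 2 / _ in C0 H Hpsi.
apply: (@le_trans _ _ (\sum_(k < N.+1 * N.+1) (k%:R / N.+1%:R) * C)).
  apply: ler_sum => k _; rewrite RintZ// ler_wpM2l ?divr_ge0//.
  have [tp p01 Hk] := Hpsi k.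
  rewrite Rint_zero_off// => x nx.
  by rewrite (test_zero_off tp nx) indicE memNset ?subrr ?normr0// => -[].
rewrite -mulr_suml /C mulrCA ler_piMr ?(ltW w20)// ler_pdivrMr ?mul1r ?lerDl//.
by rewrite ltr_wpDl// sumr_ge0// => k _; rewrite divr_ge0.
Qed.

Lemma test_dense_L1 u : integ leb u -> zero_off u -> L1lim u.
Proof.
move=> iu uz w w0; have w20 : 0 < w / 2 by rewrite divr_gt0.
have [ip iN _] := Rint_split iu.
have [||p tp Hp] := ge0_dense ip _ _ w20.
- by move=> x /uz ->; rewrite maxxx.
- by move=> x; rewrite le_max lexx orbT.
have [||q tq Hq] := ge0_dense iN _ _ w20.
- by move=> x /uz ->; rewrite oppr0 maxxx.
- by move=> x; rewrite le_max lexx orbT.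
exists (fun x => p x - q x); first exact: testB.
rewrite (splitr w); apply: le_trans (lerD Hp Hq).
have ip' := integ_test tp; have iq' := integ_test tq.
rewrite -RintD; [|by apply: integ_norm; exact: integB|by apply: integ_norm; exact: integB].
apply: Rint_le.
- by apply: integ_norm; apply: integB => //; exact: integB.
- by apply: integD; apply: integ_norm; exact: integB.
- move=> x; rewrite [X in `|X|](_ : _ = (Num.max (u x) 0 - p x) - (Num.max (- u x) 0 - q x)).
    exact: ler_normB.
  by case: (leP (u x) 0) => h; case: (leP (- u x) 0) => h'; lra.
Qed.

Lemma moll_cvg_L1 u (w : R) : integ leb u -> zero_off u -> 0 < w ->
  exists2 r, 0 < r & forall e, 0 < e < r ->
    \int[lamO oO bO]_x `|moll e u x - u x| <= w.
Proof.
move=> iu uz w0; have w30 : 0 < w / 3 by rewrite divr_gt0.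
have [p tp Hp] := test_dense_L1 iu uz w30.
set V := fine (lamO oO bO setT).
have V0 : 0 <= V by rewrite fine_ge0.
have wV : 0 < w / 3 / (V + 1) by rewrite divr_gt0// ltr_wpDl.
have [K [_ cs _]] := test_cont_supp tp.
have [r r0 Hr] := cont_supp_unif cs wV.
have ip := integ_test tp.
have iup := integB iu ip.
exists r => // e /andP[e0 er].
have [im1 Hm1] := moll_L1 e0 iup.
have [im2 _] := moll_L1 e0 ip.
have [im3 _] := moll_L1 e0 iu.
have toO f : integ leb f -> integ (lamO oO bO) f.
  move=> fi; apply/L1_integP; first exact: integ_meas fi.
  by apply: integrableS fi => //; exact: open_measurable_rV.
have leO f : integ leb f -> (forall x, 0 <= f x) -> \int[lamO oO bO]_x f x <= \int[leb]_x f x.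
  move=> fi f0; rewrite -Rint_lamO; last exact: toO.
  rewrite Rintegral_mkcond.
  apply: Rint_le => //.
    have := integrableS measurableT (open_measurable_rV oO) (@subsetT _ _) fi.
    by move=> /(integrable_mkcond _ (open_measurable_rV oO)); apply: eq_integrable => // x _;
      rewrite /= !patchE; case: ifP.
  by move=> x; rewrite patchE; case: ifP.
have mollB x : moll e (fun x => u x - p x) x = moll e u x - moll e p x.
  rewrite /moll -RintB; [|exact: integ_moll|exact: integ_moll].
  by apply: eq_Rintegral => y _; rewrite mulrBr.
apply: (@le_trans _ _ (\int[lamO oO bO]_x (`|moll e (fun x => u x - p x) x| +
    (`|moll e p x - p x| + `|u x - p x|)))).
  apply: Rint_le.
  - by apply: integ_norm; apply: integB; exact: toO.
  - apply: integD; first by apply: integ_norm; exact: toO.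
    by apply: integD; apply: integ_norm; apply: integB; exact: toO.
  - move=> x; rewrite mollB.
    rewrite [X in `|X|](_ : _ = (moll e u x - moll e p x) + ((moll e p x - p x) - (u x - p x))).
      by rewrite (le_trans (ler_normD _ _))// lerD2l ler_normB.
    by ring.
rewrite RintD; last 2 first.
- by apply: integ_norm; exact: toO.
- by apply: integD; apply: integ_norm; apply: integB; exact: toO.
rewrite RintD; last 2 first.
- by apply: integ_norm; apply: integB; exact: toO.
- by apply: integ_norm; apply: integB; exact: toO.
have -> : w = w / 3 + (w / 3 + w / 3) by lra.
apply: lerD.
  by apply: le_trans (leO _ (integ_norm im1) _) (le_trans Hm1 Hp).
apply: lerD; last first.
  by apply: le_trans (leO _ (integ_norm iup) _) Hp.
have H x : `|moll e p x - p x| <= w / 3 / (V + 1).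
  apply: moll_unif => //; first exact: ltW.
  by move=> a b ab; apply/ltW/Hr; exact: lt_trans er.
apply: (@le_trans _ _ (\int[lamO oO bO]_x (w / 3 / (V + 1)))).
  apply: Rint_le H; first by apply: integ_norm; apply: integB; exact: toO.
  exact: finite_measure_integrable_cst.
rewrite Rint_cst -/V mulrAC ler_pdivrMr ?ltr_wpDl// ler_wpM2l ?(ltW w30)//.
by rewrite lerDl.
Qed.

End L1_density.

(** * Compactness in L^1 *)

Section total_boundedness.
Variables (R : realType) (d : nat) (Omega : set 'rV[R]_d).
Hypotheses (oO : open Omega) (bO : bounded_set Omega).
Local Notation leb := (lebesgue_rV R d).
Local Notation lam := (lamO oO bO).
Implicit Types (u v f : 'rV[R]_d -> R).

(** Asking for a radius [s] strictly above [r] makes the set open and keeps shifts by at most [r]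
    inside Omega. *)
Definition inner (r : R) : set 'rV[R]_d :=
  [set x | exists2 s, r < s & forall y, `|y - x| < s -> Omega y].

Lemma inner_open r : open (inner r).
Proof.
rewrite openE => x [s rs sO]; apply/nbhs_ballP; exists ((s - r) / 2) => /=.
  by rewrite divr_gt0 ?subr_gt0.
move=> y; rewrite -ball_normE /= => xy; exists ((s + r) / 2); first by lra.
move=> z zy; apply: sO; rewrite -(subrKA y) (le_lt_trans (ler_normD _ _))//.
by rewrite distrC in xy; lra.
Qed.

Lemma inner_sub r : 0 <= r -> inner r `<=` Omega.
Proof. by move=> r0 x [s rs]; apply; rewrite subrr normr0 (le_lt_trans r0). Qed.

Definition BVbounded (B : R) u :=
  [/\ integ leb u, zero_off Omega u, \int[leb]_x `|u x| <= B & var_le Omega u B].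

(** [moll e u x - u x] is the average of the increments [u (x + z) - u x] with the weight [rho e z]
    of mass 1; Tonelli integrates in [x] first. *)
Lemma moll_translation (A : set 'rV[R]_d) (e B : R) u : 0 < e -> integ leb u ->
  measurable A ->
  (forall z, `|z| < e -> \int[leb]_x (`|u (x + z) - u x| * \1_A x) <= B) ->
  \int[leb]_x (`|moll e u x - u x| * \1_A x) <= B.
Proof.
move=> e0 iu mA H; have mu := integ_meas iu.
have B0 : 0 <= B.
  have := H 0; rewrite normr0 e0 => /(_ isT); apply: le_trans.
  by apply: Rint_ge0 => x; rewrite mulr_ge0// indicE.
have ind1 x : `|\1_A x| <= 1 :> R by rewrite indicE; case: (_ \in _); rewrite ?normr1 ?normr0.
have iz z : integ leb (fun x => `|u (x + z) - u x| * \1_A x).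
  apply: (integMb (M := 1)) => //.
  by apply: integ_norm; apply: integB => //; exact: integ_shift.
have irho : integ leb (rho e) := integ_test (rho_test d e0).
have irs x : integ leb (fun z => rho e z * u (x + z)).
  have := integ_shift x (integ_moll e0 x iu).
  by apply: eq_integrable => // z _ /=; rewrite addrK addrC.
have irc x : integ leb (fun z => rho e z * u x).
  by under eq_fun do rewrite mulrC; exact: integZ.
have mE x : moll e u x - u x = \int[leb]_z (rho e z * (u (x + z) - u x)).
  under [RHS]eq_Rintegral do rewrite mulrBr.
  rewrite RintB//; congr (_ - _).
    rewrite /moll -(Rint_shift x (integ_moll e0 x iu)).
    by apply: eq_Rintegral => z _; rewrite addrK addrC.
  under eq_Rintegral do rewrite mulrC.
  rewrite RintZ//; have := @Rint_rho R d e e0 0; under eq_Rintegral do rewrite subr0.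
  by move=> ->; rewrite mulr1.
pose F (p : 'rV[R]_d * 'rV[R]_d) : \bar R :=
  (rho e p.2 * (`|u (p.1 + p.2) - u p.1| * \1_A p.1))%:E.
have F0 p : (0 <= F p)%E.
  by rewrite /F lee_fin mulr_ge0 ?rho_ge0// mulr_ge0// indicE.
have mF : measurable_fun setT F.
  apply/measurable_EFinP; apply: measurable_funM.
    by apply: measurableT_comp (test_meas (rho_test d e0)) _.
  apply: measurable_funM; last by apply: measurableT_comp (measurable_indic mA) _.
  apply: measurableT_comp => //; apply: measurable_funB.
    apply: measurableT_comp mu _; apply: measurable_rV => i.
    under eq_fun do rewrite mxE.
    apply: measurable_funD.
      by apply: measurableT_comp (measurable_coord i) _.
    by apply: measurableT_comp (measurable_coord i) _.
  by apply: measurableT_comp mu _.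
have T := @fubini_tonelli _ _ _ _ R leb leb F mF F0.
have E2 : (\int[leb]_x \int[leb]_z F (x, z) <= B%:E)%E.
  rewrite T {T}.
  apply: (@le_trans _ _ (\int[leb]_z (B * rho e z)%:E)%E).
    apply: ge0_le_integral.
    - exact: measurableT.
    - by move=> z _; exact: integral_ge0.
    - exact: (measurable_fun_fubini_tonelli_G F).
    - by apply/measurable_EFinP; exact: integ_meas (integZ B irho).
    - move=> z _; rewrite /F /= -Rint_EFin; last exact: integZ.
      rewrite lee_fin (RintZ _ (iz z)); have [ze|ze] := ltP `|z| e.
        by rewrite mulrC; apply: ler_wpM2r; [exact: rho_ge0|exact: H].
      by rewrite (rho_supp e0 ze) mul0r mulr0.
  rewrite -Rint_EFin; last exact: integZ.
  rewrite lee_fin (RintZ _ irho).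
  have := @Rint_rho R d e e0 0; under eq_Rintegral do rewrite subr0.
  by move=> ->; rewrite mulr1.
have [im _] := moll_L1 e0 iu.
have iL : integ leb (fun x => `|moll e u x - u x| * \1_A x).
  apply: (integMb (M := 1)); [|exact: measurable_indic|exact: ind1].
  by apply: integ_norm; exact: integB.
rewrite -lee_fin; apply: le_trans E2; rewrite (Rint_EFin iL).
apply: ge0_le_integral.
- exact: measurableT.
- by move=> x _; rewrite lee_fin mulr_ge0// indicE.
- by apply/measurable_EFinP; exact: integ_meas iL.
- exact: (measurable_fun_fubini_tonelli_F F).
- move=> x _; rewrite mE.
  have i3 : integ leb (fun z => rho e z * (u (x + z) - u x)).
    by under eq_fun do rewrite mulrBr; exact: integB.
  have i4 : integ leb (fun z => `|rho e z * (u (x + z) - u x)| * \1_A x).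
    by under eq_fun do rewrite mulrC; apply: integZ; exact: integ_norm.
  have -> : (\int[leb]_z F (x, z) = \int[leb]_z (`|rho e z * (u (x + z) - u x)| * \1_A x)%:E)%E.
    by apply: eq_integral => z _; rewrite /F /= normrM (ger0_norm (rho_ge0 _ _))// mulrA.
  rewrite -Rint_EFin// lee_fin.
  under [leRHS]eq_Rintegral do rewrite mulrC.
  rewrite RintZ; last exact: integ_norm.
  by rewrite mulrC ler_wpM2l ?indicE// Rint_norm.
Qed.

Lemma sum_coord_le (z : 'rV[R]_d) : \sum_i `|z 0 i| <= d%:R * `|z|.
Proof.
rewrite -[d in d%:R]card_ord -sumr_const mulr_suml; apply: ler_sum => i _.
by rewrite mul1r le_coord_norm.
Qed.

Lemma moll_inner (e r B : R) u : 0 < e <= r -> BVbounded B u -> 0 <= B ->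
  \int[leb]_x (`|moll e u x - u x| * \1_(inner r) x) <= B * (d%:R * e).
Proof.
move=> /andP[e0 er] [iu uz _ vu] B0; apply: moll_translation => //.
  by apply: open_measurable_rV; exact: inner_open.
move=> z ze; have T := @translation_L1 R d Omega (inner r) u B z iu B0 vu (@inner_open r).
apply: le_trans (T _) _.
  move=> x s [t rt tO] /andP[s0 s1]; apply: tO.
  rewrite addrC addKr normrZ (ger0_norm s0).
  rewrite (le_lt_trans _ (le_lt_trans er rt))// (le_trans _ (ltW ze))//.
  by rewrite ler_piMl.
rewrite ler_wpM2l// (le_trans (sum_coord_le z))// ler_wpM2l//; exact: ltW.
Qed.

Lemma grid_net (r : R) : 0 < r -> exists (I : finType) (p : I -> 'rV[R]_d),
  forall x, Omega x -> exists i, `|x - p i| < r.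
Proof.
move=> r0; have [M [_ HM]] := bO.
pose L := Num.max 0 (M + 1).
have L0 : 0 <= L by rewrite le_max lexx.
have OL x : Omega x -> `|x| <= L.
  move=> Ox; have : `|x| <= M + 1 by apply: (HM (M + 1)) => //; rewrite ltrDl.
  by rewrite le_max orbC => ->.
pose h := r / 2; have h0 : 0 < h by rewrite divr_gt0.
pose m := (Num.truncn (2 * L / h)).+1.
exists {ffun 'I_d -> 'I_m}, (fun k : {ffun 'I_d -> 'I_m} => \row_i (- L + (k i)%:R * h)) => x Ox.
have xi i : - L <= x 0 i <= L.
  by rewrite -ler_norml (le_trans (le_coord_norm x i))// OL.
have km (i : 'I_d) : (Num.truncn ((x 0%R i + L) / h)%R < m)%N.
  have /andP[x1 x2] := xi i.
  by rewrite ltnS le_truncn// ler_pM2r ?invr_gt0// mulr2n mulrDl mul1r lerD2r.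
exists [ffun i => Ordinal (km i)].
apply: (@le_lt_trans _ _ h); last by rewrite /h; lra.
apply: norm_le_coord => [|i]; first exact: ltW.
rewrite !mxE ffunE /=.
have /andP[x1 x2] := xi i.
have : 0 <= (x 0 i + L) / h by rewrite divr_ge0 ?(ltW h0)// -lerBlDr sub0r.
move=> /truncn_itv; rewrite ler_pdivlMr// ltr_pdivrMr// => /andP[h1 h2].
rewrite -natr1 mulrDl mul1r in h2.
by rewrite ler_norml; apply/andP; split; lra.
Qed.

(** The colour of [u] is the list of rounded values of its mollification on a finite net. The kernel
    makes mollifications of functions bounded in L^1 bounded and equicontinuous, so equal colours
    force uniform closeness; the mollification errors account for two thirds of [delta]. *)
Lemma label_inner (r B delta : R) : 0 < r -> 0 <= B -> 0 < delta ->
  exists (I : finType) (c : ('rV[R]_d -> R) -> I),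
  forall u v, BVbounded B u -> BVbounded B v -> c u = c v ->
    \int[leb]_x (`|u x - v x| * \1_(inner r) x) <= delta.
Proof.
move=> r0 B0 delta0.
have d30 : 0 < delta / 3 by rewrite divr_gt0.
pose e := Num.min r (delta / 3 / (B * d%:R + 1)).
have C0 : 0 < B * d%:R + 1 by rewrite ltr_wpDl// mulr_ge0.
have e0 : 0 < e by rewrite lt_min r0 divr_gt0.
have er : e <= r by rewrite ge_min lexx.
have eB : B * (d%:R * e) <= delta / 3.
  have : e <= delta / 3 / (B * d%:R + 1) by rewrite ge_min lexx orbT.
  rewrite ler_pdivlMr// => h; apply: le_trans h; rewrite mulrA mulrC ler_wpM2l ?(ltW e0)//.
  by rewrite lerDl.
set V := fine (leb Omega).
have V0 : 0 <= V by rewrite fine_ge0.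
pose eta := delta / 3 / (V + 1).
have eta0 : 0 < eta by rewrite divr_gt0// ltr_wpDl.
have eta30 : 0 < eta / 3 by rewrite divr_gt0.
have w0 : 0 < eta / 3 / (B + 1) by rewrite divr_gt0// ltr_wpDl.
have [K [_ cs _]] := test_cont_supp (rho_test d e0).
have [r1 r10 Hr1] := cont_supp_unif cs w0.
have [M M0 HM] := rho_bounded d e0.
have [J [p Hp]] := grid_net r10.
pose Q := (Num.truncn (2 * (M * B) / (eta / 3))).+1.
pose q u j := Num.truncn ((moll e u (p j) + M * B) / (eta / 3)).
(* Only functions bounded in BV are known to have [q u j < Q]; on the others [inord] returns a
   colour without meaning. *)
exists {ffun J -> 'I_Q}, (fun u => [ffun j => inord (q u j)]).
move=> u v bu bv cuv.
have mollb w x : BVbounded B w -> `|moll e w x| <= M * B.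
  move=> [iw _ wB _]; apply: le_trans (Rint_norm (integ_moll e0 x iw)) _.
  apply: (@le_trans _ _ (\int[leb]_y (M * `|w y|))).
    apply: Rint_le; first by apply: integ_norm; exact: integ_moll.
      by apply: integZ; exact: integ_norm.
    by move=> y; rewrite normrM ler_wpM2r.
  by rewrite RintZ; [rewrite ler_wpM2l|exact: integ_norm].
have mollc w x y : BVbounded B w -> `|x - y| < r1 -> `|moll e w x - moll e w y| <= eta / 3.
  move=> [iw _ wB _] xy.
  apply: le_trans (Rint_normB (integ_moll e0 x iw) (integ_moll e0 y iw)) _.
  apply: (@le_trans _ _ (\int[leb]_z (eta / 3 / (B + 1) * `|w z|))).
    apply: Rint_le.
    - by apply: integ_norm; apply: integB; exact: integ_moll.
    - by apply: integZ; exact: integ_norm.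
    - move=> z; rewrite -mulrBl normrM ler_wpM2r// ltW// Hr1//.
      by rewrite opprB addrC addrA subrK -normrN opprB.
  rewrite RintZ; last exact: integ_norm.
  rewrite mulrAC ler_pdivrMr ?ltr_wpDl// ler_wpM2l ?(ltW eta30)//.
  by rewrite (le_trans wB)// lerDl.
have qQ w j : BVbounded B w -> (q w j < Q)%N.
  move=> bw; rewrite ltnS le_truncn// ler_pM2r ?invr_gt0//.
  have := mollb w (p j) bw; rewrite ler_norml => /andP[_]; lra.
have q_itv w j : BVbounded B w -> (q w j)%:R * (eta / 3) <= moll e w (p j) + M * B < (q w j).+1%:R * (eta / 3).
  move=> bw; rewrite -ler_pdivlMr// -ltr_pdivrMr//; apply: truncn_itv.
  rewrite divr_ge0 ?(ltW eta30)//.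
  by have := mollb w (p j) bw; rewrite ler_norml => /andP[+ _]; lra.
have close j : `|moll e u (p j) - moll e v (p j)| <= eta / 3.
  have quv : q u j = q v j.
    have /ffunP/(_ j) := cuv; rewrite !ffunE => /(congr1 val) /=.
    by rewrite !inordK ?qQ.
  have := q_itv u j bu; have := q_itv v j bv; rewrite -quv -[(q u j).+1%:R]natr1 mulrDl mul1r.
  move=> /andP[a1 a2] /andP[b1 b2]; rewrite ler_norml; apply/andP; split; lra.
have pw x : Omega x -> `|moll e u x - moll e v x| <= eta.
  move=> Ox; have [j xj] := Hp x Ox.
  rewrite (_ : _ - _ = (moll e u x - moll e u (p j)) + ((moll e u (p j) - moll e v (p j)) +
     (moll e v (p j) - moll e v x))); last by ring.
  have -> : eta = eta / 3 + (eta / 3 + eta / 3) by lra.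
  rewrite (le_trans (ler_normD _ _))// lerD//; first exact: mollc.
  by rewrite (le_trans (ler_normD _ _))// lerD// distrC; exact: mollc.
have [iu uz _ _] := bu; have [iv vz _ _] := bv.
have [imu _] := moll_L1 e0 iu; have [imv _] := moll_L1 e0 iv.
have minn : measurable (inner r) by apply: open_measurable_rV; exact: inner_open.
have ii f : integ leb f -> integ leb (fun x => `|f x| * \1_(inner r) x).
  move=> fi; apply: (integMb (M := 1)) => //; first exact: integ_norm.
  by move=> x; rewrite indicE; case: (_ \in _); rewrite ?normr1 ?normr0.
apply: (@le_trans _ _ (\int[leb]_x (`|moll e u x - u x| * \1_(inner r) x +
   (`|moll e v x - v x| * \1_(inner r) x + `|moll e u x - moll e v x| * \1_(inner r) x)))).
  apply: Rint_le.
  - by apply: (ii (fun x => u x - v x)); exact: integB.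
  - apply: integD; first by apply: (ii (fun x => moll e u x - u x)); exact: integB.
    apply: integD; first by apply: (ii (fun x => moll e v x - v x)); exact: integB.
    by apply: (ii (fun x => moll e u x - moll e v x)); exact: integB.
  - move=> x; rewrite -!mulrDl ler_wpM2r ?indicE//.
    rewrite (_ : u x - v x = - (moll e u x - u x) + ((moll e v x - v x) + (moll e u x - moll e v x))).
      rewrite (le_trans (ler_normD _ _))// normrN lerD2l.
      exact: ler_normD.
    by ring.
rewrite RintD; last 2 first.
- by apply: (ii (fun x => moll e u x - u x)); exact: integB.
- apply: integD; first by apply: (ii (fun x => moll e v x - v x)); exact: integB.
  by apply: (ii (fun x => moll e u x - moll e v x)); exact: integB.
rewrite RintD; last 2 first.
- by apply: (ii (fun x => moll e v x - v x)); exact: integB.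
- by apply: (ii (fun x => moll e u x - moll e v x)); exact: integB.
have -> : delta = delta / 3 + (delta / 3 + delta / 3) by lra.
apply: lerD; first by apply: le_trans (moll_inner _ bu B0) eB; rewrite e0.
apply: lerD; first by apply: le_trans (moll_inner _ bv B0) eB; rewrite e0.
have mO := open_measurable_rV oO.
have iO : integ leb \1_Omega.
  apply/integrableP; split; first exact/measurable_EFinP.
  rewrite (eq_integral (fun x => (\1_Omega x)%:E)); last first.
    by move=> x _; rewrite gee0_abs// lee_fin indicE.
  by rewrite integral_indic// setIT; exact: Omega_finite.
apply: (@le_trans _ _ (\int[leb]_x (eta * \1_Omega x))).
  apply: Rint_le; [|exact: integZ|].
    by apply: (ii (fun x => moll e u x - moll e v x)); exact: integB.
  move=> x; rewrite !indicE; case: (boolP (x \in inner r)) => xr.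
    have Ox : Omega x by apply: (inner_sub (ltW r0)); move: xr; rewrite inE.
    by rewrite mulr1 mem_set// mulr1 pw.
  by rewrite mulr0 mulr_ge0 ?(ltW eta0).
rewrite RintZ//.
have -> : \int[leb]_x \1_Omega x = V by rewrite /Rintegral integral_indic// setIT.
rewrite /eta mulrAC ler_pdivrMr ?ltr_wpDl// ler_wpM2l ?(ltW d30)//.
by rewrite lerDl.
Qed.

(* Total boundedness in L^1, expressed through a colouring with finitely many
   colours whose classes have small diameter. *)
Lemma label_tight (S : set ('rV[R]_d -> R)) (B : R) : 0 <= B ->
  (forall u, S u -> BVbounded B u) ->
  (forall delta, 0 < delta -> exists2 r, 0 < r &
     forall u, S u -> \int[leb]_x (`|u x| * \1_(Omega `\` inner r) x) <= delta) ->
  forall delta, 0 < delta -> exists (I : finType) (c : ('rV[R]_d -> R) -> I),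
    forall u v, S u -> S v -> c u = c v -> \int[leb]_x `|u x - v x| <= delta.
Proof.
move=> B0 SB tight delta delta0; have d30 : 0 < delta / 3 by rewrite divr_gt0.
have [r r0 Hr] := tight _ d30.
have [I [c Hc]] := label_inner r0 B0 d30.
exists I, c => u v Su Sv cuv.
have [iu uz _ _] := SB _ Su; have [iv vz _ _] := SB _ Sv.
have mO := open_measurable_rV oO.
have minn : measurable (inner r) by apply: open_measurable_rV; exact: inner_open.
have ii A f : measurable A -> integ leb f -> integ leb (fun x => `|f x| * \1_A x).
  move=> mA fi; apply: (integMb (M := 1)) => //; first exact: integ_norm.
  by move=> x; rewrite indicE; case: (_ \in _); rewrite ?normr1 ?normr0.
have mD : measurable (Omega `\` inner r) by exact: measurableD.
have iuv := integB iu iv.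
apply: (@le_trans _ _ (\int[leb]_x (`|u x - v x| * \1_(inner r) x +
  (`|u x| * \1_(Omega `\` inner r) x + `|v x| * \1_(Omega `\` inner r) x)))).
  apply: Rint_le; first exact: integ_norm.
    apply: integD; first exact: (ii _ (fun x => u x - v x)).
    by apply: integD; exact: ii.
  move=> x; rewrite !indicE in_setD.
  have [xO|xO] := boolP (x \in Omega); last first.
    have nO : ~ Omega x by move/negP: xO; rewrite inE.
    by rewrite uz// vz// subrr normr0 !mul0r !addr0.
  case: (x \in inner r) => /=; first by rewrite !mulr1 !mulr0 !addr0.
  by rewrite !mulr1 mulr0 add0r ler_normB.
rewrite RintD; last 2 first.
- exact: (ii _ (fun x => u x - v x)).
- by apply: integD; exact: ii.
rewrite RintD; [|exact: ii|exact: ii].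
have -> : delta = delta / 3 + (delta / 3 + delta / 3) by lra.
by apply: lerD; [apply: Hc => //; exact: SB|apply: lerD; exact: Hr].
Qed.

End total_boundedness.

(** * Completeness of L^1 and limits of trajectories *)

Section L1_complete.
Context d (T : measurableType d) (R : realType).
Variable mu : {measure set T -> \bar R}.

Lemma sum_half_lt (k m : nat) : \sum_(k <= j < m) (2^-1 : R) ^+ j <= 2 * 2^-1 ^+ k.
Proof.
have H n : (k <= n)%N -> \sum_(k <= j < n) (2^-1 : R) ^+ j = 2 * 2^-1 ^+ k - 2 * 2^-1 ^+ n.
  elim: n => [|n IH] kn.
    by rewrite (_ : k = 0%N) ?big_geq ?subrr//; apply/eqP; rewrite -leqn0.
  move: kn; rewrite leq_eqVlt => /predU1P[->|]; first by rewrite big_geq ?subrr.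
  rewrite ltnS => kn; rewrite big_nat_recr//= IH// exprS mulrA mulfV ?mul1r//; lra.
have [km|mk] := leqP k m; last first.
  by rewrite big_geq ?mulr_ge0 ?exprn_ge0 ?invr_ge0// ltnW.
by rewrite H// lerBlDr lerDl mulr_ge0// exprn_ge0// invr_ge0.
Qed.

(** The series of increments converges absolutely off the null set where [g] is infinite, and the
    sequence is dominated there by [|f 0| + g]. *)
Lemma L1_complete (f : nat -> T -> R) : (forall k, integ mu (f k)) ->
  (forall k, \int[mu]_x `|f k.+1 x - f k x| <= 2^-1 ^+ k) ->
  exists h, [/\ integ mu h, forall k, \int[mu]_x `|f k x - h x| <= 2 * 2^-1 ^+ k &
    forall x, (forall k, f k x = 0) -> h x = 0].
Proof.
move=> fi fc.
have idf k : integ mu (fun x => `|f k.+1 x - f k x|) by apply: integ_norm; exact: integB.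
pose g x : \bar R := (\sum_(k <oo) (`|f k.+1 x - f k x|)%:E)%E.
have mg : measurable_fun setT g.
  apply: (@ge0_emeasurable_sum _ _ _ _ (fun k x => (`|f k.+1 x - f k x|)%:E) xpredT).
    by move=> k x _ _; rewrite lee_fin.
  by move=> k _; apply/measurable_EFinP; exact: integ_meas (idf k).
have g0 x : (0 <= g x)%E by apply: nneseries_ge0 => k _ _; rewrite lee_fin.
have ig : (\int[mu]_x g x <= 2%:E)%E.
  rewrite integral_nneseries//; last first.
  - by move=> n; apply/measurable_EFinP; exact: integ_meas (idf n).
  apply: lime_le.
    by apply: is_cvg_nneseries => k _ _; exact: integral_ge0.
  apply: nearW => n.
  have -> : (\sum_(0 <= k < n) \int[mu]_x (`|f k.+1 x - f k x|)%:E =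
     (\sum_(0 <= k < n) \int[mu]_x `|f k.+1 x - f k x|)%R%:E)%E.
    by rewrite -sumEFin; apply: eq_bigr => k _; rewrite Rint_EFin.
  rewrite lee_fin; apply: (@le_trans _ _ (\sum_(0 <= k < n) (2^-1 : R) ^+ k)).
    by apply: ler_sum => k _; exact: fc.
  by have := sum_half_lt 0 n; rewrite expr0 mulr1.
have gint : mu.-integrable setT g.
  apply/integrableP; split=> //; apply: le_lt_trans (ltry 2).
  by rewrite (eq_integral g)// => x _; rewrite gee0_abs.
pose G := [set x | g x \is a fin_num].
have mG : measurable G by rewrite -[G]setTI; exact: emeasurable_fin_num.
have aeG : mu (~` G) = 0%E.
  have [N [mN N0 subN]] := integrable_ae measurableT gint.
  apply/eqP; rewrite -measure_le0 -N0 le_measure ?inE//; first exact: measurableC.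
  by move=> x /= nG; apply: subN => /= /(_ I).
(* Cutting off on [G] makes the sequence converge at every point, so that the limit is measurable
   and vanishes wherever all [f k] do. *)
pose h_ k x : R := f k x * \1_G x.
have part k x : G x -> \sum_(0 <= j < k) `|f j.+1 x - f j x| <= fine (g x).
  move=> Gx; rewrite -lee_fin fineK// -sumEFin.
  by apply: nneseries_lim_ge => j _; rewrite lee_fin.
have fpart k x : f k x = f 0%N x + \sum_(0 <= j < k) (f j.+1 x - f j x).
  by rewrite (telescope_sumr (fun j => f j x))// subrKC.
have hc x : exists l : R, h_ k x @[k --> \oo] --> l.
  have [Gx|nGx] := pselect (G x); last first.
    exists 0; apply: cvg_near_cst; apply: nearW => k.
    by rewrite /h_ indicE memNset ?mulr0.
  have c1 : cvgn (series (fun j => f j.+1 x - f j x)).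
    apply: normed_cvg; apply: nondecreasing_is_cvgn.
      by apply: nondecreasing_series => j _ _; exact: normr_ge0.
    by exists (fine (g x)) => _ [k _ <-]; exact: part.
  exists (f 0%N x + lim (series (fun j => f j.+1 x - f j x) @ \oo)).
  have -> : (fun k => h_ k x) = (fun k => f 0%N x + series (fun j => f j.+1 x - f j x) k).
    by apply/funext => k; rewrite /h_ indicE mem_set// mulr1 fpart.
  by apply: cvgD; [exact: cvg_cst|exact: c1].
have [h Hh] := choice hc.
have mh_ k : measurable_fun setT (h_ k).
  by apply: measurable_funM; [exact: integ_meas|exact: measurable_indic].
have mh : measurable_fun setT h.
  by apply: (measurable_fun_cvg mh_) => x _; exact: Hh.
have mfg : measurable_fun setT (fun x => fine (g x)) by exact: measurableT_comp.
have ifg : integ mu (fun x => fine (g x)).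
  apply: (le_integrable measurableT _ _ gint); first exact/measurable_EFinP.
  by move=> x _ /=; case: (g x) => [r| |] /=; rewrite ?normr0 ?lexx ?leey.
have idom : integ mu (fun x => `|f 0%N x| + fine (g x)).
  by apply: integD => //; exact: integ_norm.
have [|h1 h2 _] := Rint_dct mh_ mh idom _ Hh.
  move=> k x; rewrite /h_ indicE; have [Gx|nG] := pselect (G x).
    rewrite mem_set// mulr1 fpart (le_trans (ler_normD _ _))// lerD2l.
    by apply: le_trans (ler_norm_sum _ _ _) _; exact: part.
  by rewrite memNset// mulr0 normr0 addr_ge0// fine_ge0.
have fh k : \int[mu]_x `|f k x - h x| = \int[mu]_x `|h_ k x - h x|.
  rewrite /Rintegral; congr fine.
  apply: ge0_ae_eq_integral => //.
  - by apply/measurable_EFinP; apply: measurableT_comp => //; apply: measurable_funB => //; exact: integ_meas.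
  - by apply/measurable_EFinP; apply: measurableT_comp => //; exact: measurable_funB.
  exists (~` G); split; [exact: measurableC|exact: aeG|].
  move=> x /= H; apply: contrapT => /contrapT Gx; apply: H => _.
  by rewrite /h_ indicE mem_set// mulr1.
exists h; split=> //; last first.
  move=> x fx0; have := Hh x.
  have -> : (fun k => h_ k x) = (fun=> 0) by apply/funext => k; rewrite /h_ fx0 mul0r.
  move=> H; apply: (@cvg_unique _ (@norm_hausdorff _ R) _ _ _ _ H); exact: cvg_cst.
move=> k; apply/ler_addgt0Pr => e e0.
have /cvgnP/(_ _ e0)[N HN] := h2.
pose m := maxn N k.
have := HN m (leq_maxl _ _); rewrite subr0 => /(le_lt_trans (ler_norm _)) Hm.
apply: le_trans (Rint_triangle (fi k) (fi m) h1) _.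
rewrite lerD//; last by rewrite fh ltW.
apply: (@le_trans _ _ (\int[mu]_x (\sum_(k <= j < m) `|f j.+1 x - f j x|))).
  apply: Rint_le.
  - by apply: integ_norm; exact: integB.
  - exact: integ_sum.
  - move=> x; rewrite distrC -(telescope_sumr (fun j => f j x)) ?leq_maxr//.
    exact: ler_norm_sum.
rewrite Rint_sum//; apply: le_trans (sum_half_lt k m).
by apply: ler_sum => j _; exact: fc.
Qed.

End L1_complete.

Section compactness.
Context d (T : measurableType d) (R : realType).
Variable mu : {measure set T -> \bar R}.
Variables (un : R -> nat -> T -> R) (C : R).
Hypotheses (C0 : 0 <= C) (un_int : forall tau n, 0 < tau -> integ mu (un tau n)).
Hypothesis un_holder : forall tau n m, 0 < tau -> (m <= n)%N ->
  \int[mu]_x `|un tau n x - un tau m x| <= C * Num.sqrt (tau * (n - m)%:R).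
Hypothesis un_label : forall t0 delta, 0 < t0 -> 0 < delta ->
  exists (I : finType) (c : (T -> R) -> I), forall tau tau' n n',
    0 < tau <= 1 -> 0 < tau' <= 1 -> tau * n%:R <= t0 -> tau' * n'%:R <= t0 ->
    c (un tau n) = c (un tau' n') -> \int[mu]_x `|un tau n x - un tau' n' x| <= delta.

Let U tau t := un tau (Num.truncn (t / tau)).

Let D (f g : T -> R) := \int[mu]_x `|f x - g x|.

Let DC f g : D f g = D g f.
Proof. by apply: eq_Rintegral => x _; rewrite distrC. Qed.

Let D3 f g h : integ mu f -> integ mu g -> integ mu h -> D f h <= D f g + D g h.
Proof. exact: Rint_triangle. Qed.

Let Ui tau t : 0 < tau -> integ mu (U tau t). Proof. exact: un_int. Qed.

Lemma truncn_dist (a b : R) : 0 <= a -> a <= b ->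
  (Num.truncn a <= Num.truncn b)%N /\ (Num.truncn b - Num.truncn a)%:R <= b - a + 1.
Proof.
move=> a0 ab; have ab' := le_truncn ab; split=> //.
have /andP[h1 _] := truncn_itv (le_trans a0 ab); have /andP[_ h2] := truncn_itv a0.
by rewrite natrB// -natr1 in h2 *; lra.
Qed.

(** Rounding both times down may add one step, whence the additional [tau] under the root. *)
Let U_holder_le tau s t : 0 < tau -> 0 <= s <= t ->
  D (U tau t) (U tau s) <= C * Num.sqrt (t - s + tau).
Proof.
move=> tau0 /andP[s0 st].
have a0 : 0 <= s / tau by rewrite divr_ge0// ltW.
have ab : s / tau <= t / tau by rewrite ler_pM2r// invr_gt0.
have [h1 h2] := truncn_dist a0 ab.
apply: le_trans (un_holder tau0 h1) _; rewrite ler_wpM2l// ler_wsqrtr//.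
rewrite (_ : t - s + tau = tau * (t / tau - s / tau + 1)).
  by rewrite ler_wpM2l// ltW.
by field; rewrite gt_eqF.
Qed.

Let U_holder tau s t : 0 < tau -> 0 <= s -> 0 <= t ->
  D (U tau s) (U tau t) <= C * Num.sqrt (`|s - t| + tau).
Proof.
move=> tau0 s0 t0; have [st|ts] := leP s t.
  by rewrite DC distrC ger0_norm ?subr_ge0//; apply: U_holder_le => //; rewrite s0.
by rewrite gtr0_norm ?subr_gt0//; apply: U_holder_le => //; rewrite t0 ltW.
Qed.

(** A set of steps accumulating at 0 stands for a subsequence; the diagonal extraction refines sets,
    and picks numbers only at the end. *)
Let accum (S : set R) := forall e, 0 < e -> exists2 tau, S tau & 0 < tau < e.

(** Each step [tau] is coloured by the colours of its trajectory at the grid times [j * eta]. One of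
    the finitely many classes still accumulates at 0; within it, equal colours cost [delta / 2] at
    grid times and the Hoelder estimate [delta / 4] twice in between. *)
Let refine (S : set R) (t0 delta : R) : accum S -> 0 < t0 -> 0 < delta ->
  exists S', [/\ S' `<=` S, accum S' & forall tau tau' t, S' tau -> S' tau' ->
    0 <= t <= t0 -> D (U tau t) (U tau' t) <= delta].
Proof.
move=> aS t00 delta0; have d20 : 0 < delta / 2 by rewrite divr_gt0.
have [I [c Hc]] := un_label t00 d20.
(* For [tau < eta] the Hoelder bound over one cell is at most [C * sqrt (2 * eta) <= delta / 4]; the
   minimum with 1 respects the range [tau <= 1] of [un_label]. *)
pose eta := Num.min 1 ((delta / 4 / (C + 1)) ^+ 2 / 2).
have q0 : 0 < delta / 4 / (C + 1) by rewrite divr_gt0 ?divr_gt0// ltr_wpDl.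
have eta0 : 0 < eta by rewrite lt_min ltr01 divr_gt0// exprn_gt0.
have Ceta : C * Num.sqrt (eta + eta) <= delta / 4.
  have : Num.sqrt (eta + eta) <= delta / 4 / (C + 1).
    rewrite -[leRHS](gtr0_norm q0) -sqrtr_sqr ler_wsqrtr//.
    have : eta <= (delta / 4 / (C + 1)) ^+ 2 / 2 by rewrite ge_min lexx orbT.
    lra.
  rewrite ler_pdivlMr ?ltr_wpDl// => h; apply: le_trans h.
  by rewrite mulrC ler_wpM2l ?sqrtr_ge0// lerDl.
pose J := (Num.truncn (t0 / eta)).+1.
pose L tau : {ffun 'I_J -> I} := [ffun j : 'I_J => c (U tau (j%:R * eta))].
pose S1 := [set tau | S tau /\ 0 < tau < eta].
have aS1 : accum S1.
  move=> e e0; have [|tau St /andP[t1 t2]] := aS (Num.min e eta).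
    by rewrite lt_min e0.
  by move: t2; rewrite lt_min => /andP[t2 t3]; exists tau; rewrite /S1 /= ?t1.
(* Pigeonhole: otherwise every colour is absent below some threshold, and the smallest threshold
   contradicts the accumulation of [S1]. *)
have [l Hl] : exists l, accum [set tau | S1 tau /\ L tau = l].
  apply: contrapT => /forallNP H.
  have H' l : exists e, 0 < e /\ forall tau, S1 tau -> L tau = l -> ~ (0 < tau < e).
    have := H l; move/existsNP => [e /not_implyP[e0 He]]; exists e; split=> // tau S1t Lt te.
    by apply: He; exists tau.
  have [e He] := choice H'.
  pose em := \big[Num.min/1]_l e l.
  have em0 : 0 < em by apply: lt_bigmin => // l _; case: (He l).
  have [tau S1t /andP[tau0 te]] := aS1 _ em0.
  apply: (He (L tau)).2 S1t erefl _; rewrite tau0 (lt_le_trans te)//.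
  exact: bigmin_le_cond.
exists [set tau | S1 tau /\ L tau = l]; split=> //.
  by move=> tau [[]].
move=> tau tau' t [[_ /andP[tau0 te]] Lt] [[_ /andP[tau'0 te']] Lt'] /andP[t1 t2].
have jJ : (Num.truncn (t / eta) < J)%N by rewrite ltnS le_truncn// ler_pM2r// invr_gt0.
pose j := Ordinal jJ.
set s := j%:R * eta.
have te0 : 0 <= t / eta by rewrite divr_ge0// ltW.
have /andP[j1 j2] := truncn_itv te0.
have st : s <= t by rewrite /s /= -ler_pdivlMr.
have ts : t < s + eta by rewrite /s /= -[X in _ + X]mul1r -mulrDl natr1 -ltr_pdivrMr.
have s0 : 0 <= s by rewrite mulr_ge0// ltW.
have eta1 : eta <= 1 by rewrite ge_min lexx.
have step ta : 0 < ta -> ta < eta -> D (U ta t) (U ta s) <= delta / 4.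
  move=> ta0 tae; apply: le_trans Ceta; apply: le_trans (U_holder ta0 t1 s0) _.
  rewrite ler_wpM2l// ler_wsqrtr// ger0_norm ?subr_ge0//; lra.
have trs ta : 0 < ta -> ta * (Num.truncn (s / ta))%:R <= t0.
  move=> ta0; have : 0 <= s / ta by rewrite divr_ge0// ltW.
  move=> /truncn_itv/andP[h _]; rewrite mulrC -ler_pdivlMr//.
  by rewrite (le_trans h)// ler_pM2r ?invr_gt0// (le_trans st).
have mid : D (U tau s) (U tau' s) <= delta / 2.
  apply: Hc.
  - by rewrite tau0 (le_trans (ltW te)).
  - by rewrite tau'0 (le_trans (ltW te')).
  - exact: trs.
  - exact: trs.
  - have /ffunP/(_ j) : L tau = L tau' by rewrite Lt Lt'.
    by rewrite !ffunE.
have := D3 (Ui t tau0) (Ui s tau0) (Ui t tau'0).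
have := D3 (Ui s tau0) (Ui s tau'0) (Ui t tau'0).
have := step _ tau0 te; have := step _ tau'0 te'; rewrite DC.
lra.
Qed.

Theorem trajectory_compactness : exists (u : R -> T -> R) (tauk : nat -> R),
  [/\ forall t, 0 <= t -> integ mu (u t) /\
        (forall x, (forall tau n, 0 < tau -> un tau n x = 0) -> u t x = 0),
      (forall k, 0 < tauk k) /\ tauk @ \oo --> (0 : R),
      forall t0 delta, 0 < t0 -> 0 < delta -> exists N, forall k t, (N <= k)%N ->
        0 <= t <= t0 ->
        \int[mu]_x `|un (tauk k) (Num.truncn (t / tauk k)) x - u t x| <= delta &
      forall s t, 0 <= s -> 0 <= t ->
        \int[mu]_x `|u s x - u t x| <= C * Num.sqrt `|t - s|].
Proof.
pose hp k : R := 2^-1 ^+ k.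
have hp0 k : 0 < hp k by rewrite exprn_gt0// invr_gt0.
have step (p : nat * set R) : exists S' : set R, accum p.2 ->
    [/\ S' `<=` p.2, accum S' & forall tau tau' t, S' tau -> S' tau' ->
    0 <= t <= p.1.+1%:R -> D (U tau t) (U tau' t) <= hp p.1].
  have [aS|nS] := pselect (accum p.2); last by exists p.2 => /nS.
  have [S' HS'] := refine aS (ltr0Sn R p.1) (hp0 p.1).
  by exists S'.
have [nx Hnx] := choice step.
(* Any two steps in [S k.+1] have trajectories within [2^-k] of each other on [0, k + 1]. *)
pose S := fix S k := if k is k'.+1 then nx (k', S k') else [set tau : R | 0 < tau].
have aS k : accum (S k).
  elim: k => [|k IH]; last by have [] := Hnx (k, S k) IH.
  move=> e e0; exists (e / 2); first by rewrite /S /= divr_gt0.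
  by rewrite divr_gt0//=; lra.
have Ssub k m : (k <= m)%N -> S m `<=` S k.
  elim: m => [|m IH]; first by rewrite leqn0 => /eqP ->.
  rewrite leq_eqVlt => /predU1P[->//|km]; apply: subset_trans (IH km).
  by have [] := Hnx (m, S m) (aS m).
have pick k : exists tau, S k.+1 tau /\ 0 < tau < k.+1%:R^-1.
  have [|tau St te] := aS k.+1 k.+1%:R^-1; first by rewrite invr_gt0.
  by exists tau.
have [tauk Htk] := choice pick.
have tau0 k : 0 < tauk k by case: (Htk k) => _ /andP[].
have close k m t : (k <= m)%N -> 0 <= t <= k.+1%:R ->
    D (U (tauk m) t) (U (tauk k) t) <= hp k.
  move=> km tk; have [_ _ H] := Hnx (k, S k) (aS k); apply: H => //.
    by apply: (@Ssub k.+1 m.+1 km); case: (Htk m).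
  by case: (Htk k).
(* The index is shifted by [Num.truncn t] so that [t] is in the range of [close] from the first term
   on; for [t < 0] the limit is set to 0. *)
have lim_t t : exists h, 0 <= t -> [/\ integ mu h,
    forall k, D (U (tauk (k + Num.truncn t)%N) t) h <= 2 * hp k &
    forall x, (forall tau n, 0 < tau -> un tau n x = 0) -> h x = 0].
  have [t0|t0] := leP 0 t; last by exists (fun=> 0).
  have [||h [hi hD h0]] := @L1_complete _ _ _ mu (fun k => U (tauk (k + Num.truncn t)%N) t).
  - by move=> k; exact: Ui.
  - move=> k; apply: le_trans (close _ _ _ _ _) _; rewrite ?addSn//.
      rewrite t0/=; have /andP[_ /ltW] := truncn_itv t0; move/le_trans; apply.
      by rewrite ler_nat ltnS leq_addl.
    rewrite /hp exprD ler_piMr ?exprn_ge0 ?invr_ge0// exprn_ile1 ?invr_ge0//.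
    by rewrite invf_le1// ler1n.
  - exists h => _; split=> // x Hx; apply: h0 => k; exact: Hx.
have [u Hu] := choice lim_t.
have unif (t0 t : R) (k : nat) : 0 <= t <= t0 -> (Num.truncn t0 <= k)%N ->
    D (U (tauk k) t) (u t) <= 2 * hp (k - Num.truncn t0)%N.
  move=> /andP[t1 t2] kt; have [_ H _] := Hu t t1.
  have tt : (Num.truncn t <= Num.truncn t0)%N by exact: le_truncn.
  have := H (k - Num.truncn t)%N; rewrite subnK; last exact: leq_trans kt.
  move/le_trans; apply; rewrite ler_wpM2l// /hp ler_wiXn2l ?invr_ge0//.
    by rewrite invf_le1// ler1n.
  exact: leq_sub2l.
have hp_small e : 0 < e -> exists N, forall k, (N <= k)%N -> 2 * hp k < e.
  move=> e0; have /cvgnP/(_ _ (divr_gt0 e0 (ltr0n R 2)))[N HN] : hp @ \oo --> (0 : R).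
    by apply: cvg_expr; rewrite ger0_norm ?invr_ge0// invf_lt1// ltr1n.
  exists N => k Nk; have := HN k Nk; rewrite subr0 gtr0_norm// => h; lra.
have tau_small e : 0 < e -> exists N, forall k, (N <= k)%N -> tauk k < e.
  move=> e0; exists (Num.truncn e^-1).+1 => k Nk; have [_ /andP[_ h]] := Htk k.
  apply: lt_trans h _; rewrite invf_plt ?posrE//; apply: lt_le_trans (truncnS_gt _) _.
  by rewrite ler_nat (leq_trans Nk).
have unif_eps t0 delta : 0 < delta -> exists N, forall k t, (N <= k)%N -> 0 <= t <= t0 ->
    D (U (tauk k) t) (u t) <= delta.
  move=> delta0; have [N HN] := hp_small _ delta0; exists (N + Num.truncn t0)%N => k t Nk tt.
  apply: le_trans (unif _ _ _ tt _) _; first by rewrite (leq_trans _ Nk)// leq_addl.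
  by apply/ltW/HN; rewrite leq_subRL ?(leq_trans _ Nk) ?leq_addl// addnC.
exists u, tauk; split.
- by move=> t t0; have [h1 _ h2] := Hu t t0.
- split=> //; apply/cvgnP => e e0; have [N HN] := tau_small _ e0; exists N => k Nk.
  by rewrite subr0 gtr0_norm// HN.
- by move=> t0 delta _ delta0; exact: unif_eps.
- move=> s t s0 t0; apply/ler_addgt0Pr => e e0.
  have e30 : 0 < e / 3 by rewrite divr_gt0.
  have [N1 HN1] := unif_eps (Num.max s t) _ e30.
  (* For [tauk k] below this square, adding it under the root increases the root by at most
     [e / 3 / (C + 1)]. *)
  have q0 : 0 < (e / 3 / (C + 1)) ^+ 2 by rewrite exprn_gt0// divr_gt0// ltr_wpDl.
  have [N2 HN2] := tau_small _ q0.
  pose k := maxn N1 N2.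
  have h1 : D (U (tauk k) s) (u s) <= e / 3.
    by apply: HN1; rewrite ?leq_maxl// s0 le_max lexx.
  have h2 : D (U (tauk k) t) (u t) <= e / 3.
    by apply: HN1; rewrite ?leq_maxl// t0 le_max lexx orbT.
  have h3 := U_holder (tau0 k) s0 t0.
  have h4 : C * Num.sqrt (`|s - t| + tauk k) <= C * Num.sqrt `|t - s| + e / 3.
    apply: (@le_trans _ _ (C * (Num.sqrt `|t - s| + e / 3 / (C + 1)))).
      rewrite ler_wpM2l//.
      have a0 : 0 <= Num.sqrt `|t - s| + e / 3 / (C + 1).
        by rewrite addr_ge0 ?sqrtr_ge0// divr_ge0 ?ltW// ltr_wpDl.
      rewrite -[leRHS](ger0_norm a0) -[leRHS]sqrtr_sqr ler_wsqrtr// sqrrD sqr_sqrtr// distrC.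
      rewrite -addrA lerD2l; apply: le_trans (ltW (HN2 k (leq_maxr _ _))) _.
      by rewrite lerDr mulrn_wge0// mulr_ge0 ?sqrtr_ge0// divr_ge0 ?ltW// ltr_wpDl.
    rewrite mulrDr lerD2l mulrCA ler_piMr ?(ltW e30)// ler_pdivrMr ?ltr_wpDl// mul1r.
    by rewrite lerDl.
  have [us _ _] := Hu s s0; have [ut _ _] := Hu t t0.
  have := D3 us (Ui s (tau0 k)) ut; have := D3 (Ui s (tau0 k)) (Ui t (tau0 k)) ut.
  rewrite (DC (u s) (U (tauk k) s)) => h5 h6; apply: le_trans h6 _.
  lra.
Qed.

End compactness.

(** * Densities of distributional derivatives *)

Lemma dist_add (R : realFieldType) (a b c f g p q w : R) :
  `|a - (f + g)| <= p + q -> `|b - f| <= p -> `|c - g| <= q ->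
  p <= w / 4 -> q <= w / 4 -> `|a - (b + c)| <= w.
Proof. rewrite !ler_norml; lra. Qed.

Section signed_steps.
Context d (T : measurableType d) (R : realType).

(** [f + M] is nonnegative and approximated by [step_approx]; one more term, the constant [- M] on
    the whole space, undoes the shift. *)
Lemma step_approx_signed (f : T -> R) (M e : R) : 0 < e ->
  measurable_fun setT f -> (forall x, `|f x| <= M) ->
  exists (K : nat) (c : nat -> R) (A : nat -> set T), (forall k, measurable (A k)) /\
    forall x, `|f x - \sum_(k < K) c k * \1_(A k) x| <= e.
Proof.
move=> e0 mf fM; pose n := Num.truncn e^-1.
have mf' : measurable_fun setT (fun x => f x + M) by exact: measurable_funD.
have [|K [A [mA HA]]] := @step_approx _ _ _ _ (M + M) n mf'.
  by move=> x; have := fM x; rewrite ler_norml -lerBlDr sub0r lerD2r.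
pose c k : R := if (k < K)%N then k%:R / n.+1%:R else - M.
pose B k : set T := if (k < K)%N then A k else setT.
exists K.+1, c, B; split => [k|x]; first by rewrite /B; case: ifP.
rewrite big_ord_recr/= /c /B ltnn indicT mulr1.
under eq_bigr => k _ do rewrite ltn_ord.
rewrite opprD opprK addrA addrAC; apply: le_trans (HA x) _.
rewrite invf_ple ?posrE//; exact/ltW/truncnS_gt.
Qed.

End signed_steps.

(* A linear functional on test functions bounded by the L^1(mu) norm has a
   density: extend it to indicators by L^1(mu) density of test functions, add
   [mu] to obtain a positive set function, and apply Radon-Nikodym. *)
Section density_exists.
Variables (R : realType) (d : nat) (Omega : set 'rV[R]_d).
Hypothesis oO : open Omega.
Variable mu : {finite_measure set 'rV[R]_d -> \bar R}.
Variable L : ('rV[R]_d -> R) -> R.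
Local Notation test := (test_function Omega).
Hypothesis LD : forall f g, test f -> test g -> L (fun x => f x + g x) = L f + L g.
Hypothesis LZ : forall k f, test f -> L (fun x => k * f x) = k * L f.
Hypothesis Lb : forall f, test f -> `|L f| <= \int[mu]_x `|f x|.

Let mO : measurable Omega := open_measurable_rV oO.

Let integ_test_mu f : test f -> integ mu f.
Proof.
move=> tf; have [K [_ cf _]] := test_cont_supp tf.
have [M _ HM] := cont_supp_bounded cf.
exact: integ_bounded (test_meas tf) HM.
Qed.

Let ind A : 'rV[R]_d -> R := \1_(A `&` Omega).

Let integ_ind' A : measurable A -> integ mu (ind A).
Proof. by move=> mA; apply: integ_ind; exact: measurableI. Qed.

Let dist f A := \int[mu]_x `|f x - ind A x|.

Let LB f g : test f -> test g -> L (fun x => f x - g x) = L f - L g.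
Proof.
move=> tf tg; rewrite -mulN1r -LZ// -LD//; last exact: testZ.
by congr L; apply/funext => x; rewrite mulN1r.
Qed.

Let Ldist f g : test f -> test g -> `|L f - L g| <= \int[mu]_x `|f x - g x|.
Proof. by move=> tf tg; rewrite -LB//; apply: Lb; exact: testB. Qed.

Let dist3 f g A : test f -> test g -> measurable A ->
  \int[mu]_x `|f x - g x| <= dist f A + dist g A.
Proof.
move=> tf tg mA.
have := Rint_triangle (integ_test_mu tf) (integ_ind' mA) (integ_test_mu tg).
move/le_trans; apply; rewrite lerD2l le_eqVlt; apply/orP; left; apply/eqP.
by apply: eq_Rintegral => x _; rewrite distrC.
Qed.

(** McShane's extension formula: [L] is 1-Lipschitz for the L^1(mu) distance, and the supremum
    extends it to indicators with the explicit rate of [ext_setP], without choosing approximating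
    sequences. *)
Definition ext_set A : R := sup [set L f - \int[mu]_x `|f x - \1_(A `&` Omega) x| | f in test].

Let ext_setP A f : measurable A -> test f -> `|ext_set A - L f| <= dist f A.
Proof.
move=> mA tf; have ub : ubound [set L f - dist f A | f in test] (L f + dist f A).
  move=> _ [g tg <-]; have := Ldist tg tf; have := dist3 tg tf mA.
  by move=> h1 h2; have := le_trans (ler_norm _) (le_trans h2 h1); lra.
rewrite ler_distl; apply/andP; split.
  by apply: ub_le_sup; [exists (L f + dist f A)|exists f].
by apply: ge_sup ub; exists (L f - dist f A), f.
Qed.

Let approx A w : measurable A -> 0 < w -> exists f,
  [/\ test f, forall x, 0 <= f x <= 1 & dist f A <= w].
Proof. by move=> mA w0; exact: test_dense. Qed.

Let ext_setU A B : measurable A -> measurable B -> A `&` B = set0 ->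
  ext_set (A `|` B) = ext_set A + ext_set B.
Proof.
move=> mA mB AB0; apply/eqP; rewrite -subr_eq0 -normr_le0; apply/ler_addgt0Pl => w w0.
rewrite addr0; have w4 : 0 < w / 4 by rewrite divr_gt0.
have [f [tf _ hf]] := approx mA w4; have [g [tg _ hg]] := approx mB w4.
have tfg : test (fun x => f x + g x) by exact: testD.
have h1 := ext_setP (measurableU _ _ mA mB) tfg.
have h2 := ext_setP mA tf; have h3 := ext_setP mB tg.
have h4 : dist (fun x => f x + g x) (A `|` B) <= dist f A + dist g B.
  rewrite -RintD; last 2 first.
  - by apply: integ_norm; apply: integB; [exact: integ_test_mu|exact: integ_ind'].
  - by apply: integ_norm; apply: integB; [exact: integ_test_mu|exact: integ_ind'].
  apply: Rint_le => [||x].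
  - by apply: integ_norm; apply: integB; [exact: integ_test_mu|apply: integ_ind'; exact: measurableU].
  - by apply: integD; apply: integ_norm; apply: integB; [exact: integ_test_mu|exact: integ_ind'|exact: integ_test_mu|exact: integ_ind'].
  rewrite (_ : ind (A `|` B) x = ind A x + ind B x); first by rewrite opprD addrACA ler_normD.
  have : ~ (A x /\ B x) by move=> ABx; have : (A `&` B) x by []; rewrite AB0.
  rewrite /ind !indicE !in_setI in_setU -[A x]in_setE -[B x]in_setE.
  by case: (x \in A); case: (x \in B); case: (x \in Omega); rewrite /= ?addr0 ?add0r// => -[].
rewrite LD// in h1.
exact: (dist_add (le_trans h1 h4) h2 h3 hf hg).
Qed.

(** Comparison with the zero test function. Both countable additivity and absolute continuity with
    respect to [mu] follow from this bound. *)
Let ext_set_le A : measurable A -> `|ext_set A| <= fine (mu (A `&` Omega)).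
Proof.
move=> mA; have t0 : test (fun=> 0) by exact: test0.
have := ext_setP mA t0; rewrite (_ : L (fun=> 0) = 0); last first.
  by rewrite -[RHS](mul0r (L (fun=> 0))) -LZ//; congr L; apply/funext => x; rewrite mulr0.
rewrite subr0 => /le_trans; apply; rewrite /dist -Rint_indic; last exact: measurableI.
rewrite le_eqVlt; apply/orP; left; apply/eqP; apply: eq_Rintegral => x _.
by rewrite sub0r normrN ger0_norm// /ind indicE; case: (_ \in _).
Qed.

Let ext_set0 : ext_set set0 = 0.
Proof.
apply/eqP; rewrite -normr_le0; apply: le_trans (ext_set_le measurable0) _.
by rewrite set0I measure0.
Qed.

Definition ext_charge A : \bar R := (ext_set A)%:E.

Let ext_charge0 : ext_charge set0 = 0%E. Proof. by rewrite /ext_charge ext_set0. Qed.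

Let ext_charge_fin A : measurable A -> ext_charge A \is a fin_num. Proof. by []. Qed.

Let ext_set_bigsetU (F : (set 'rV[R]_d)^nat) n : (forall k, measurable (F k)) ->
  trivIset setT F -> ext_set (\big[setU/set0]_(k < n) F k) = \sum_(0 <= k < n) ext_set (F k).
Proof.
move=> mF tF; elim: n => [|n IH]; first by rewrite big_ord0 big_geq.
rewrite big_ord_recr big_nat_recr//= ext_setU ?IH//.
  by apply: bigsetU_measurable => k _.
rewrite big_distrl/=; apply: big1 => k _.
by move/trivIsetP : tF; apply => //; rewrite neq_ltn ltn_ord.
Qed.

Let ext_charge_sigma : semi_sigma_additive ext_charge.
Proof.
move=> F mF tF mU.
rewrite (_ : (fun _ => _) = EFin \o (fun n => \sum_(0 <= k < n) ext_set (F k))); last first.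
  by apply/funext => n /=; rewrite /ext_charge sumEFin.
apply: cvg_EFin; first by near=> n.
set U := \bigcup_n F n; rewrite (_ : fine \o _ = fun n => \sum_(0 <= k < n) ext_set (F k))//.
pose B n := \big[setU/set0]_(k < n) F k.
have mB n : measurable (B n) by apply: bigsetU_measurable => k _.
have BU n : B n `<=` U by exact: bigsetU_bigcup.
have cmu : (fun n => fine (mu (B n))) @ \oo --> fine (mu U).
  have UB : U = \bigcup_n B n.
    apply/seteqP; split=> [x [n _ Fx]|x [n _ Bx]]; last exact: BU Bx.
    by exists n.+1 => //; rewrite /B big_ord_recr/=; right.
  rewrite UB; apply: fine_cvg; rewrite fineK; last by rewrite fin_num_measure// -UB.
  apply: nondecreasing_cvg_mu => //; first by rewrite -UB.
  by move=> n m nm; apply/subsetPset; apply: subset_bigsetU.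
(* By finite additivity the remainder is [ext_set] of the tail, hence at most its [mu]-measure, and
   [mu] is continuous from below. *)
apply: (@cvgn_le _ _ (fun n => fine (mu U) - fine (mu (B n))) _ 0%N) => [n _|].
  rewrite -ext_set_bigsetU// -/(B n) distrC.
  have {1}-> : U = B n `|` (U `\` B n) by rewrite setDUK.
  have mD : measurable (U `\` B n) by exact: measurableD.
  rewrite ext_setU//; last by rewrite setDIK.
  rewrite addrAC subrr add0r; apply: le_trans (ext_set_le mD) _.
  apply: (@le_trans _ _ (fine (mu (U `\` B n)))).
    have mDO : measurable ((U `\` B n) `&` Omega) by exact: measurableI.
    apply: fine_le; rewrite ?fin_num_measure//.
    by apply: le_measure => //; rewrite inE.
  by rewrite measureD// ?ge0_fin_numE -?ge0_fin_numE// ?fin_num_measure// setIidr// fineB// fin_num_measure.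
rewrite -[X in _ --> X](subrr (fine (mu U))); apply: cvgB => //; exact: cvg_cst.
Unshelve. all: by end_near.
Qed.

HB.instance Definition _ := isCharge.Build _ _ _ ext_charge
  ext_charge0 ext_charge_fin ext_charge_sigma.

(** The last clause is the rate at which test functions recover the integral of [h] over a set. It
    depends on [L] only through the bound by [mu], hence is uniform over families of functionals. *)
Lemma density_exists : exists h, [/\ measurable_fun setT h, integ mu h,
  forall f, test f -> L f = \int[mu]_x (f x * h x) &
  forall A f, measurable A -> test f ->
   `|\int[mu]_x (\1_A x * h x) - L f| <= \int[mu]_x `|f x - \1_(A `&` Omega) x|].
Proof.
have numu : ext_charge `<< mu.
  apply/null_content_dominatesP => A mA A0; rewrite /ext_charge; congr EFin.
  apply/eqP; rewrite -normr_le0; apply: le_trans (ext_set_le mA) _.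
  have -> : mu (A `&` Omega) = 0%E.
    apply/eqP; rewrite eq_le measure_ge0 andbT -A0.
    by apply: le_measure => //; rewrite inE//; exact: measurableI.
  by [].
have RNi := Radon_Nikodym_integrable numu.
have RNf x := Radon_Nikodym_fin_num x numu.
pose h x := fine (Radon_Nikodym ext_charge mu x).
have hE x : (h x)%:E = Radon_Nikodym ext_charge mu x by rewrite fineK.
have ih : integ mu h by apply: eq_integrable RNi => // x _ /=; rewrite hE.
have mh := integ_meas ih.
have hA A : measurable A -> \int[mu]_x (\1_A x * h x) = ext_set A.
  move=> mA; have := Radon_Nikodym_integral numu mA.
  rewrite integral_mkcond /Rintegral => /(congr1 fine) /= ->; congr fine.
  apply: eq_integral => x _; rewrite patchE indicE.
  by case: (_ \in _); rewrite ?mul1r ?mul0r// hE.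
exists h; split=> //; last by move=> A f mA tf; rewrite hA//; exact: ext_setP.
move=> f tf; have [K [_ cf _]] := test_cont_supp tf.
have [M M0 fM] := cont_supp_bounded cf; have mf := test_meas tf.
(* The sum of the errors [H1], [H2] and [H3] below in units of [e]. *)
pose C := fine (mu setT) + 2 + \int[mu]_x `|h x|.
have C0 : 0 < C by rewrite ltr_wpDr ?Rint_ge0// ltr_wpDl// fine_ge0.
apply/eqP; rewrite -subr_eq0 -normr_le0; apply/ler_addgt0Pl => w w0; rewrite addr0.
pose e := w / C; have e0 : 0 < e by rewrite divr_gt0.
have [N [c [A [mA HA]]]] := step_approx_signed e0 mf fM.
have sc0 : 0 < \sum_(k < N) `|c k| + 1 by rewrite ltr_wpDl// sumr_ge0.
pose q := e / (\sum_(k < N) `|c k| + 1).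
have q0 : 0 < q by rewrite divr_gt0.
have sq : \sum_(k < N) `|c k| * q <= e.
  by rewrite -mulr_suml mulrA ler_pdivrMr// mulrC ler_pM2l// lerDl.
have [g Hg] := choice (fun k => approx (mA k) q0).
have tg k : test (g k) by case: (Hg k).
pose s x := \sum_(k < N) c k * g k x.
have ts : test s by apply: test_sum => k; exact: testZ.
have Ls : L s = \sum_(k < N) c k * L (g k).
  rewrite /s; elim: (N) => [|m IH].
    under eq_fun do rewrite big_ord0.
    rewrite big_ord0 -[RHS](mul0r (L f)) -LZ//.
    by congr L; apply/funext => x; rewrite mul0r.
  under eq_fun do rewrite big_ord_recr/=.
  rewrite LD; [|by apply: test_sum => k; exact: testZ|exact: testZ].
  by rewrite big_ord_recr/= IH LZ.
pose S x := \sum_(k < N) c k * \1_(A k) x.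
have iA k : integ mu (\1_(A k) : 'rV[R]_d -> R) by exact: integ_ind.
have iS : integ mu S by apply: integ_sum => k; exact: integZ.
have ih' k : integ mu (fun x => \1_(A k) x * h x).
  apply: eq_integrable (integMb (M := 1) ih (integ_meas (iA k)) _) => //.
    by move=> x _ /=; rewrite mulrC.
  by move=> x; rewrite indicE; case: (_ \in _); rewrite ?normr1 ?normr0.
have iSh : integ mu (fun x => \sum_(k < N) c k * (\1_(A k) x * h x)).
  by apply: integ_sum => k; exact: integZ.
have ShE x : S x * h x = \sum_(k < N) c k * (\1_(A k) x * h x).
  by rewrite mulr_suml; apply: eq_bigr => k _; rewrite mulrA.
have SE : \int[mu]_x (S x * h x) = \sum_(k < N) c k * ext_set (A k).
  under eq_Rintegral do rewrite ShE.
  rewrite Rint_sum; last by move=> k; exact: integZ.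
  by apply: eq_bigr => k _; rewrite RintZ// hA.
have H1 : `|L f - L s| <= e * fine (mu setT) + e.
  apply: le_trans (Ldist tf ts) _; rewrite -Rint_cst.
  pose D x := \sum_(k < N) `|c k| * `|g k x - ind (A k) x|.
  have ig k : integ mu (fun x => `|g k x - ind (A k) x|).
    by apply: integ_norm; apply: integB; [exact: integ_test_mu|exact: integ_ind'].
  have iD : integ mu D by apply: integ_sum => k; exact: integZ.
  apply: (@le_trans _ _ (\int[mu]_x (e + D x))).
    apply: Rint_le => [||x].
    - by apply: integ_norm; apply: integB; exact: integ_test_mu.
    - by apply: integD => //; exact: finite_measure_integrable_cst.
    have [Ox|nOx] := pselect (Omega x); last first.
      have z k : g k x = 0 by exact: test_zero_off (tg k) _ nOx.
      rewrite (test_zero_off tf nOx) /s big1 ?subr0 ?normr0; last by move=> k _; rewrite z mulr0.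
      by rewrite addr_ge0 ?(ltW e0)// sumr_ge0// => k _; rewrite mulr_ge0.
    have -> : f x - s x = (f x - S x) + \sum_(k < N) c k * (ind (A k) x - g k x).
      suff -> : \sum_(k < N) c k * (ind (A k) x - g k x) = S x - s x by ring.
      rewrite /S /s -sumrB; apply: eq_bigr => k _; rewrite mulrBr /ind !indicE in_setI.
      by rewrite (mem_set Ox) andbT.
    apply: le_trans (ler_normD _ _) _; apply: lerD; first exact: HA.
    apply: le_trans (ler_norm_sum _ _ _) _; apply: ler_sum => k _.
    by rewrite normrM distrC.
  rewrite RintD//; last exact: finite_measure_integrable_cst.
  rewrite lerD2l Rint_sum; last by move=> k; exact: integZ.
  apply: le_trans sq; apply: ler_sum => k _; rewrite RintZ// ler_wpM2l//.
  by case: (Hg k).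
have H2 : `|L s - \int[mu]_x (S x * h x)| <= e.
  rewrite Ls SE -sumrB; apply: le_trans (ler_norm_sum _ _ _) _.
  apply: le_trans sq; apply: ler_sum => k _; rewrite -mulrBr normrM ler_wpM2l// distrC.
  by have [_ _ gq] := Hg k; exact: le_trans (ext_setP (mA k) (tg k)) gq.
have ifh : integ mu (fun x => f x * h x).
  apply: eq_integrable (integMb (M := M) ih mf fM) => // x _ /=.
  by rewrite mulrC.
have H3 : `|\int[mu]_x (S x * h x) - \int[mu]_x (f x * h x)| <= e * \int[mu]_x `|h x|.
  have iSh' : integ mu (fun x => S x * h x) by under eq_fun do rewrite ShE.
  apply: le_trans (Rint_normB iSh' ifh) _; rewrite -RintZ; last exact: integ_norm.
  apply: Rint_le => [||x].
  - by apply: integ_norm; exact: integB.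
  - by apply: integZ; exact: integ_norm.
  by rewrite -mulrBl normrM ler_wpM2r// distrC; exact: HA.
have -> : w = (e * fine (mu setT) + e) + e + e * \int[mu]_x `|h x|.
  transitivity (e * C); first by rewrite /e divfK// gt_eqF.
  by rewrite /C; ring.
apply: le_trans (ler_distD (\int[mu]_x (S x * h x)) _ _) _; apply: lerD H3.
by apply: le_trans (ler_distD (L s) _ _) _; exact: lerD.
Qed.

End density_exists.

(** * Convex analysis *)

Section dotv.
Variables (R : realType) (d : nat).
Implicit Types x y z : 'rV[R]_d.

Lemma dotvC x y : dotv x y = dotv y x.
Proof. by apply: eq_bigr => i _; rewrite mulrC. Qed.

Lemma dotvDl x y z : dotv (x + y) z = dotv x z + dotv y z.
Proof. by rewrite /dotv -big_split; apply: eq_bigr => i _; rewrite mxE mulrDl. Qed.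

Lemma dotvZl (k : R) x y : dotv (k *: x) y = k * dotv x y.
Proof. by rewrite /dotv mulr_sumr; apply: eq_bigr => i _; rewrite mxE mulrA. Qed.

Lemma dotvNl x y : dotv (- x) y = - dotv x y.
Proof. by rewrite -scaleN1r dotvZl mulN1r. Qed.

Lemma dotvBl x y z : dotv (x - y) z = dotv x z - dotv y z.
Proof. by rewrite dotvDl dotvNl. Qed.

Lemma dotvDr x y z : dotv x (y + z) = dotv x y + dotv x z.
Proof. by rewrite !(dotvC x) dotvDl. Qed.

Lemma dotvZr (k : R) x y : dotv x (k *: y) = k * dotv x y.
Proof. by rewrite !(dotvC x) dotvZl. Qed.

Lemma dotvBr x y z : dotv x (y - z) = dotv x y - dotv x z.
Proof. by rewrite !(dotvC x) dotvBl. Qed.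

Lemma dotv_sqrD x y (t : R) :
  dotv (x + t *: y) (x + t *: y) = dotv x x + 2 * t * dotv x y + t ^+ 2 * dotv y y.
Proof. by rewrite dotvDl !dotvDr !dotvZl !dotvZr (dotvC y x); ring. Qed.

Lemma dotv0l x : dotv 0 x = 0.
Proof. by rewrite -(scale0r 0) dotvZl mul0r. Qed.

Lemma dotvv_ge0 x : 0 <= dotv x x.
Proof. by apply: sumr_ge0 => i _; rewrite -expr2 sqr_ge0. Qed.

Lemma enorm_sqr x : enorm x ^+ 2 = dotv x x.
Proof. by rewrite sqr_sqrtr// dotvv_ge0. Qed.

Lemma enorm_ge0 x : 0 <= enorm x. Proof. exact: sqrtr_ge0. Qed.

Lemma coord_le_enorm x i : `|x 0 i| <= enorm x.
Proof.
rewrite -sqrtr_sqr ler_wsqrtr// /dotv (bigD1 i)//= -expr2 lerDl.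
by apply: sumr_ge0 => j _; rewrite -expr2 sqr_ge0.
Qed.

Lemma norm_le_enorm x : `|x| <= enorm x.
Proof. by apply: norm_le_coord => [|i]; [exact: enorm_ge0|exact: coord_le_enorm]. Qed.

Lemma enorm_eq0 x : enorm x = 0 -> x = 0.
Proof.
by move=> x0; apply/eqP; rewrite -normr_le0 -x0; exact: norm_le_enorm.
Qed.

Lemma dotv_le x y : dotv x y <= enorm x * enorm y.
Proof.
have [x0|x0] := eqVneq (enorm x) 0.
  by rewrite x0 mul0r (enorm_eq0 x0) dotv0l.
have [y0|y0] := eqVneq (enorm y) 0.
  by rewrite y0 mulr0 (enorm_eq0 y0) dotvC dotv0l.
have xy0 : 0 < enorm x * enorm y by rewrite mulr_gt0// lt_neqAle enorm_ge0 eq_sym ?x0 ?y0.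
have := dotvv_ge0 (enorm y *: x - enorm x *: y).
rewrite dotvBl !dotvBr !dotvZl !dotvZr -!enorm_sqr (dotvC y x) => h.
rewrite -(ler_pM2l xy0); lra.
Qed.

Lemma dotv_norm_le x y : `|dotv x y| <= d%:R * (`|x| * enorm y).
Proof.
apply: le_trans (ler_norm_sum _ _ _) _.
apply: (@le_trans _ _ (\sum_(i < d) `|x| * enorm y)).
  apply: ler_sum => i _; rewrite normrM; apply: ler_pM => //; last exact: coord_le_enorm.
  exact: le_coord_norm.
by rewrite sumr_const card_ord mulr_natl.
Qed.

Lemma enormZ (k : R) y : 0 <= k -> enorm (k *: y) = k * enorm y.
Proof.
by move=> k0; rewrite /enorm dotvZl dotvZr mulrA -expr2 sqrtrM ?sqr_ge0// sqrtr_sqr ger0_norm.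
Qed.

Lemma enorm_sup (y : 'rV[R]_d) : exists2 q, enorm q <= 1 & dotv q y = enorm y.
Proof.
have [y0|y0] := eqVneq (enorm y) 0.
  exists 0; last by rewrite dotv0l.
  by rewrite /enorm dotv0l sqrtr0 ler01.
have y1 : 0 < enorm y by rewrite lt_neqAle enorm_ge0 eq_sym y0.
exists ((enorm y)^-1 *: y).
  by rewrite enormZ ?invr_ge0 ?enorm_ge0// mulVf.
by rewrite dotvZl -enorm_sqr expr2 mulKf.
Qed.

Lemma C1_dotv (q : 'rV[R]_d) : C1 (dotv q).
Proof.
apply: C1_sum => i; apply: C1M; first exact: C1_cst.
by have := has_grad_coord R i; eexists; eassumption.
Qed.

Lemma C1_continuous (f : 'rV[R]_d -> R) : C1 f -> continuous f.
Proof. by move=> [g /has_grad_continuous]. Qed.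

Lemma C1_sqdist (a : 'rV[R]_d) : C1 (fun y => dotv (y - a) (y - a)).
Proof.
apply: C1_sum => i.
have c : C1 (fun y : 'rV[R]_d => (y - a) 0 i).
  rewrite (_ : (fun y : 'rV[R]_d => _) = fun y : 'rV[R]_d => y 0 i - a 0 i); last first.
    by apply/funext => y; rewrite !mxE.
  apply: C1B; last exact: C1_cst.
  by have := has_grad_coord R i; eexists; eassumption.
exact: C1M.
Qed.

End dotv.

(** Second countability of the graph: [f] may be discontinuous, so a dense set of points would not
    approximate its values. A point is chosen in every rational box that meets the graph. *)
Lemma countable_dense_graph (R : realType) (d : nat) (S : set 'rV[R]_d)
    (f : 'rV[R]_d -> R) q0 : S q0 ->
  exists qs : nat -> 'rV[R]_d, [/\ qs 0%N = q0, forall k, S (qs k) &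
    forall q e, S q -> 0 < e -> exists k, `|q - qs k| < e /\ `|f q - f (qs k)| < e].
Proof.
move=> Sq0; pose I := ('rV[rat]_d * rat * nat)%type.
pose P (t : I) q := [/\ S q, forall i, `|q 0 i - ratr (t.1.1 0 i)| < t.2.+1%:R^-1 &
  `|f q - ratr t.1.2| < t.2.+1%:R^-1].
have Hc (t : I) : exists q, S q /\ ((exists q', P t q') -> P t q).
  have [[q' h]|h] := pselect (exists q', P t q').
    by exists q'; split => //; case: h.
  by exists q0.
have [c Hc'] := choice Hc.
(* Index 0 is reserved for [q0]; codes are shifted by one. *)
pose qs (n : nat) := if n is k.+1 then (if unpickle k is Some t then c t else q0) else q0.
exists qs; split => //.
  by case=> // k /=; case: unpickle => // t; case: (Hc' t).
move=> q e Sq e0; pose n := Num.truncn (e / 2)^-1.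
have e20 : 0 < e / 2 by rewrite divr_gt0.
have n0 : 0 < n.+1%:R^-1 :> R by rewrite invr_gt0.
have ne : n.+1%:R^-1 < e / 2 :> R by rewrite invf_plt ?posrE// truncnS_gt.
have dq (y : R) : exists r : rat, `|y - ratr r| < n.+1%:R^-1.
  have [z [yz [r _ rz]]] : ball y (n.+1%:R^-1 : R) `&` range (@ratr R) !=set0.
    by apply: dense_rat; [exists y; exact: ballxx|exact: ball_open].
  by exists r; rewrite rz.
have [r Hr] := choice (fun i => dq (q 0 i)); have [s Hs] := dq (f q).
pose t : I := (\row_i r i, s, n).
have Pq : P t q by split => // i; rewrite mxE.
have [_ /(_ (ex_intro _ q Pq))[_ h1 h2]] := Hc' t.
have near (a b z : R) : `|a - z| < n.+1%:R^-1 -> `|b - z| < n.+1%:R^-1 -> `|a - b| < e.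
  move=> az bz; apply: le_lt_trans (ler_distD z _ _) _.
  by rewrite [e]splitr ltrD// ?(lt_trans az)// distrC (lt_trans bz).
exists (pickle t).+1; rewrite /= pickleK; split; last exact: near h2.
apply: (@le_lt_trans _ _ (n.+1%:R^-1 + n.+1%:R^-1)); last by rewrite [e]splitr ltrD.
apply: norm_le_coord => [|i]; first by rewrite addr_ge0 ?ltW.
rewrite !mxE; apply: le_trans (ler_distD (ratr (t.1.1 0 i)) _ _) _.
by rewrite lerD ?ltW//; [case: Pq|rewrite distrC].
Qed.

Lemma lte_between (R : realType) (x y : \bar R) : (x < y)%E ->
  exists2 a : R, (x < a%:E)%E & (a%:E < y)%E.
Proof.
case: x y => [r| |] [s| |]//.
- by rewrite lte_fin => rs; exists ((r + s) / 2); rewrite lte_fin; lra.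
- by move=> _; exists (r + 1); rewrite ?ltry// lte_fin ltrDl.
- by move=> _; exists (s - 1); rewrite ?ltNyr// lte_fin ltrBlDr ltrDl.
- by move=> _; exists 0; rewrite ?ltNyr ?ltry.
Qed.

Section convex.
Variables (R : realType) (d : nat) (F : 'rV[R]_d -> \bar R).
Hypothesis (F_ge0 : forall xi, (0 <= F xi)%E).
Hypothesis (F0 : F 0 = 0%E).

Definition fdom q := (conjugate F q < +oo)%E.
Definition fstar q : R := fine (conjugate F q).

Lemma conjugate_ge0 q : (0 <= conjugate F q)%E.
Proof.
apply: ereal_sup_ubound; exists 0 => //.
by rewrite F0 dotvC dotv0l sube0.
Qed.

Lemma fstarE q : fdom q -> conjugate F q = (fstar q)%:E.
Proof. by move=> h; rewrite fineK// ge0_fin_numE// conjugate_ge0. Qed.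

Lemma fstar_ge0 q : 0 <= fstar q.
Proof. by apply: fine_ge0; exact: conjugate_ge0. Qed.

Lemma conjugate_le q (M : R) : (forall p, ((dotv q p)%:E - F p <= M%:E)%E) ->
  fdom q /\ fstar q <= M.
Proof.
move=> h; have hs : (conjugate F q <= M%:E)%E by apply: ge_ereal_sup => _ [p _ <-].
have dq : fdom q by apply: le_lt_trans hs _; rewrite ltry.
by split => //; rewrite -lee_fin -fstarE.
Qed.

Lemma fdom0 : fdom 0 /\ fstar 0 = 0.
Proof.
have [|h1 h2] := @conjugate_le 0 0.
  by move=> p; rewrite dotv0l sub0e oppe_le0.
by split => //; apply/eqP; rewrite eq_le h2 fstar_ge0.
Qed.

Lemma fenchel_young q p : fdom q -> ((dotv q p - fstar q)%:E <= F p)%E.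
Proof.
move=> dq; have : ((dotv q p)%:E - F p <= conjugate F q)%E.
  by apply: ereal_sup_ubound; exists p.
rewrite (fstarE dq); case: (F p) (F_ge0 p) => [r| |]//= _; last by rewrite leey.
by rewrite -EFinB !lee_fin; lra.
Qed.

Lemma recession_ge q p : fdom q -> ((dotv q p)%:E <= recession F p)%E.
Proof. by move=> dq; apply: ereal_sup_ubound; exists q. Qed.

Lemma recession_ge0 p : (0 <= recession F p)%E.
Proof. by have := recession_ge p (proj1 fdom0); rewrite dotv0l. Qed.

(** Coercivity read on the dual side. In this form it bounds derivatives by energy: vectors of
    length up to [c] may be tested at a cost of at most [c']. *)
Lemma fdom_ball (c c' : R) : (forall xi, ((c * enorm xi - c')%:E <= F xi)%E) ->
  forall q, enorm q <= c -> fdom q /\ fstar q <= c'.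
Proof.
move=> Fc q qc; apply: conjugate_le => p; have := Fc p.
case: (F p) (F_ge0 p) => [r| |]//= _; last by rewrite leNye.
rewrite -EFinB !lee_fin => h.
have : dotv q p <= c * enorm p.
  by apply: le_trans (dotv_le q p) _; rewrite ler_wpM2r// enorm_ge0.
lra.
Qed.

Hypothesis F_lsc : lower_semicontinuous F.

Lemma lsc_measurable (G : 'rV[R]_d -> \bar R) : lower_semicontinuous G -> measurable_fun setT G.
Proof.
move=> lG; apply: (measurability _ (ErealGenOInfty.measurableE R)) => _ [_ [x ->] <-].
rewrite setTI; apply: open_measurable_rV; rewrite preimage_itvoy.
exact: (proj1 (lower_semicontinuousP G)).
Qed.

Lemma F_measurable : measurable_fun setT F.
Proof. exact: lsc_measurable. Qed.

Lemma recession_measurable : measurable_fun setT (recession F).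
Proof.
apply: lsc_measurable => p a /ereal_sup_gt[_ [q dq <-]]; rewrite lte_fin => aq.
have cq := C1_continuous (C1_dotv q) (x := p).
exists [set y | a < dotv q y]; first exact: (cvgr_gt _ cq).
move=> y /= ay.
by apply: lt_le_trans (recession_ge y dq); rewrite lte_fin.
Qed.

Hypothesis F_convex : econvex F.

(** A proximal point exists: the value at 0 is [lam |x|^2] because [F] vanishes there, and outside
    the compact set [K] the penalty alone exceeds it. *)
Lemma moreau_yosida_min (lam : R) x : 0 < lam -> exists p, forall y,
  (F p + (lam * dotv (p - x) (p - x))%:E <= F y + (lam * dotv (y - x) (y - x))%:E)%E.
Proof.
move=> lam0; pose c y := lam * dotv (y - x) (y - x).
pose K := [set y : 'rV[R]_d | `|y - x| <= enorm x].
have cK : compact K by exact: compact_closed_ball.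
pose m := ereal_inf [set (F y + (c y)%:E)%E | y in K].
have K0 : K 0 by rewrite /K /= sub0r normrN norm_le_enorm.
have cc : continuous c.
  by apply: C1_continuous; apply: C1M; [exact: C1_cst|exact: C1_sqdist].
have P0 : (F 0 + (c 0)%:E)%E = (lam * dotv x x)%:E.
  by rewrite F0 add0e /c sub0r dotvNl dotvC dotvNl opprK.
have outside y : ~ K y -> (F 0 + (c 0)%:E <= F y + (c y)%:E)%E.
  move/negP; rewrite -ltNge => Ky; rewrite P0; apply: (@le_trans _ _ (c y)%:E).
    rewrite lee_fin ler_pM2l// -!enorm_sqr ler_sqr ?nnegrE ?enorm_ge0//.
    by apply: le_trans (ltW Ky) _; exact: norm_le_enorm.
  by rewrite leeDr.
suff [p Kp pm] : exists2 p, K p & (F p + (c p)%:E <= m)%E.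
  exists p => y; apply: le_trans pm _; have [Ky|nKy] := pselect (K y).
    by apply: ereal_inf_lbound; exists y.
  by apply: le_trans (outside y nKy); apply: ereal_inf_lbound; exists 0.
have mfin : (m < +oo)%E.
  by apply: (@le_lt_trans _ _ (F 0 + (c 0)%:E)%E); [apply: ereal_inf_lbound; exists 0|rewrite P0 ltry].
(* The sublevel sets above the infimum generate a filter on [K]; lower semicontinuity makes any
   cluster point a minimizer. *)
pose B (a : R) := [set y | K y /\ (F y + (c y)%:E <= a%:E)%E].
pose D := [set a : R | (m < a%:E)%E].
have Dinh : exists a, D a.
  rewrite /D /=; case: (m) mfin => [r| |]// _; last by exists 0; rewrite ltNyr.
  by exists (r + 1); rewrite lte_fin ltrDl.
have Bne a : D a -> B a !=set0.
  by move=> /ereal_inf_lt[_ [y Ky <-] ya]; exists y; split => //; exact: ltW.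
have FF : ProperFilter (filter_from D B).
  apply: filter_from_proper => //; apply: filter_from_filter => // a b Da Db.
  exists (Num.min a b); first by rewrite /D /= /Num.min; case: ifP.
  move=> y [Ky]; rewrite EFin_min le_min => /andP[ya yb]; by split.
have FK : filter_from D B K by case: Dinh => a Da; exists a => // y [].
have [p [Kp clp]] := cK _ FF FK.
exists p => //; rewrite leNgt; apply/negP => mp.
have [a ma ap] := lte_between mp.
have [b b1 b2] : exists2 b : R, a - c p < b & (b%:E < F p)%E.
  have : ((a - c p)%:E < F p)%E.
    by rewrite EFinB lteBlDr.
  by move/lte_between => [b]; rewrite lte_fin => h1 h2; exists b.
have [V nV HV] := F_lsc b2.
have n2 : \forall y \near p, a - b < c y.
  by apply: (cvgr_gt _ (cc p)); lra.
have Fa : filter_from D B (B a) by exists a.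
have nU : nbhs p [set y | (b%:E < F y)%E /\ a - b < c y].
  by apply: filterS (filterI nV n2) => y [/HV].
have [y [[Ky ya] [yb yc]]] := clp _ _ Fa nU.
have : (a%:E < F y + (c y)%:E)%E.
  rewrite (_ : a = b + (a - b)); last by rewrite addrC subrK.
  by rewrite EFinD; apply: lteD => //; rewrite lte_fin.
by rewrite ltNge ya.
Qed.

(** Fenchel-Moreau through a proximal point [p] in place of a separation theorem: [q = lam (x - p)]
    is a subgradient at [p], and [lam |x - p|^2 + F p] exceeds [a], either by lower semicontinuity
    when [p] is within [r] of [x] or because [lam * r^2 = |a| + 1]. *)
Lemma biconjugate x (a : R) : (a%:E < F x)%E -> exists2 q, fdom q & a < dotv q x - fstar q.
Proof.
move=> aF; have [V /nbhs_ballP[r /= r0 Hr] HV] := F_lsc aF.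
pose lam := (`|a| + 1) / r ^+ 2.
have lam0 : 0 < lam by rewrite divr_gt0 ?exprn_gt0// ltr_wpDl.
have lam20 : 0 < lam / 2 by rewrite divr_gt0.
have [p pm] := moreau_yosida_min x lam20.
have [f0 f0E] : exists f0 : R, F p = f0%:E.
  have := pm 0; rewrite F0 add0e; case: (F p) (F_ge0 p) => [s| |]// _; first by exists s.
have f00 : 0 <= f0 by have := F_ge0 p; rewrite f0E lee_fin.
pose q := lam *: (x - p).
(* Minimality of [p] is tested against [t y + (1 - t) p] and divided by [t]; the quadratic remainder
   [t * A] is at most [w]. *)
have sub y : ((f0 + dotv q (y - p))%:E <= F y)%E.
  case Ey : (F y) (F_ge0 y) => [fy| |]// _; last by rewrite leey.
  rewrite lee_fin; apply/ler_addgt0Pl => w w0.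
  pose A := lam / 2 * dotv (y - p) (y - p).
  have A0 : 0 <= A by rewrite mulr_ge0 ?(ltW lam20) ?dotvv_ge0.
  pose t := Num.min 1 (w / (A + 1)).
  have t0 : 0 < t by rewrite lt_min ltr01 divr_gt0// ltr_wpDl.
  have t1 : t <= 1 by rewrite ge_min lexx.
  have tA : t * A <= w.
    apply: (@le_trans _ _ (w / (A + 1) * A)).
      by rewrite ler_wpM2r// ge_min lexx orbT.
    by rewrite mulrAC ler_pdivrMr ?ltr_wpDl// ler_pM2l// lerDl.
  have := F_convex y p (t := t); rewrite (ltW t0) t1 => /(_ isT).
  rewrite Ey f0E -!EFinM -EFinD.
  have := pm (t *: y + (1 - t) *: p).
  case: (F (t *: y + (1 - t) *: p)) (F_ge0 (t *: y + (1 - t) *: p)) => [z| |]// _.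
  rewrite f0E -!EFinD !lee_fin => h1 h2.
  have e1 : t *: y + (1 - t) *: p - x = (p - x) + t *: (y - p).
    by apply/rowP => i; rewrite !mxE; ring.
  rewrite e1 dotv_sqrD in h1.
  have qE : dotv q (y - p) = - (lam * dotv (p - x) (y - p)).
    by rewrite /q dotvZl -mulrN -dotvNl opprB.
  rewrite qE; set X := dotv (p - x) (y - p) in h1 *.
  have h3 : 0 <= t * (fy - f0 + lam * X + t * A).
    by rewrite /A; lra.
  rewrite pmulr_rge0// in h3; lra.
have [|dq fq] := @conjugate_le q (dotv q p - f0).
  move=> y; have := sub y; case: (F y) (F_ge0 y) => [s| |]//= _; last by rewrite leNye.
  by rewrite -EFinB !lee_fin dotvBr => h; lra.
exists q => //.
have h : lam * dotv (x - p) (x - p) + f0 <= dotv q x - fstar q.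
  have -> : lam * dotv (x - p) (x - p) = dotv q x - dotv q p by rewrite -dotvBr dotvZl.
  lra.
apply: lt_le_trans _ h.
have [xp|xp] := ltP `|x - p| r.
  have := Hr p; rewrite -ball_normE => /(_ xp)/HV; rewrite f0E lte_fin => af.
  by rewrite (lt_le_trans af)// lerDr mulr_ge0 ?(ltW lam0) ?dotvv_ge0.
apply: (@lt_le_trans _ _ (lam * r ^+ 2)).
  by rewrite /lam divfK ?gt_eqF ?exprn_gt0//; have := ler_norm a; lra.
rewrite -[leLHS]addr0; apply: lerD => //; rewrite ler_pM2l// -enorm_sqr.
rewrite ler_sqr ?nnegrE ?enorm_ge0 ?(ltW r0)//.
exact: le_trans (norm_le_enorm _).
Qed.

(** Density in the graph of F^* makes one family serve all [x] and all weights [l], even where F^*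
    is discontinuous on its domain. Starting with 0, where F^* vanishes, keeps the suprema
    nonnegative. *)
Lemma conjugate_countable : exists qs : nat -> 'rV[R]_d, [/\ qs 0%N = 0,
  forall k, fdom (qs k) & forall q x (l w : R), fdom q -> 0 < w -> exists k,
   dotv q x - l * fstar q <= dotv (qs k) x - l * fstar (qs k) + w].
Proof.
have [qs [h0 h1 h2]] := @countable_dense_graph R d fdom fstar 0 (proj1 fdom0).
exists qs; split => // q x l w dq w0.
pose C := d%:R * enorm x + `|l| + 1.
have C0 : 0 < C by rewrite ltr_wpDl// addr_ge0// mulr_ge0// enorm_ge0.
have [k [k1 k2]] := h2 q (w / C) dq (divr_gt0 w0 C0); exists k.
rewrite -lerBlDl.
rewrite (_ : dotv q x - l * fstar q - (dotv (qs k) x - l * fstar (qs k)) =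
  dotv (q - qs k) x - l * (fstar q - fstar (qs k))); last by rewrite dotvBl; ring.
apply: (@le_trans _ _ (d%:R * (`|q - qs k| * enorm x) + `|l| * `|fstar q - fstar (qs k)|)).
  apply: lerD; first exact: le_trans (ler_norm _) (dotv_norm_le _ _).
  by rewrite -normrM -normrN ler_norm.
apply: (@le_trans _ _ (w / C * (d%:R * enorm x + `|l|))).
  rewrite mulrDr mulrCA; apply: lerD.
    by rewrite ler_wpM2r ?mulr_ge0 ?enorm_ge0// ltW.
  by rewrite mulrC ler_wpM2r// ltW.
by rewrite mulrAC ler_pdivrMr// ler_pM2l// lerDl.
Qed.

End convex.

(** * Bounded functionals and countable suprema *)

Section bounded_functionals.
Context d (T : measurableType d) (R : realType).
Implicit Types (f g k : T -> R) (J : (T -> R) -> R).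

(** Such a functional is determined by its values on indicators, and positive as soon as these are.
    This replaces integration against signed measures. *)
Definition bounded_functional J :=
  [/\ forall f g M, measurable_fun setT f -> measurable_fun setT g ->
    (forall x, `|f x| <= M) -> (forall x, `|g x| <= M) ->
    J (fun x => f x + g x) = J f + J g,
  forall f (a : R) M, measurable_fun setT f -> (forall x, `|f x| <= M) ->
    J (fun x => a * f x) = a * J f &
  exists C : R, forall f M, measurable_fun setT f -> (forall x, `|f x| <= M) -> `|J f| <= C * M].

Lemma bounded_functional_add J J' : bounded_functional J -> bounded_functional J' ->
  bounded_functional (fun f => J f + J' f).
Proof.
move=> [JD JZ [C JC]] [JD' JZ' [C' JC']]; split.
- by move=> f g M mf mg fM gM; rewrite (JD _ _ M)// (JD' _ _ M)// addrACA.
- by move=> f a' M mf fM; rewrite (JZ _ _ M)// (JZ' _ _ M)// mulrDr.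
- exists (C + C') => f M mf fM; rewrite mulrDl; apply: le_trans (ler_normD _ _) _.
  by rewrite lerD ?JC ?JC'.
Qed.

Lemma bounded_functional_scale (a : R) J : bounded_functional J ->
  bounded_functional (fun f => a * J f).
Proof.
move=> [JD JZ [C JC]]; split.
- by move=> f g M mf mg fM gM; rewrite (JD _ _ M)// mulrDr.
- by move=> f a' M mf fM; rewrite (JZ _ _ M)// mulrCA.
- exists (`|a| * C) => f M mf fM; rewrite normrM -mulrA.
  by rewrite ler_wpM2l// JC.
Qed.

Lemma bounded_functional_sub J J' : bounded_functional J -> bounded_functional J' ->
  bounded_functional (fun f => J f - J' f).
Proof.
move=> bJ bJ'; have := bounded_functional_add bJ (bounded_functional_scale (-1) bJ').
by under eq_fun do rewrite mulN1r.
Qed.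

Lemma bounded_functional_sum (I : Type) (s : seq I) (J : I -> (T -> R) -> R) :
  (forall i, bounded_functional (J i)) ->
  bounded_functional (fun f => \sum_(i <- s) J i f).
Proof.
move=> bJ; elim: s => [|i s IH].
  split=> *; rewrite ?big_nil ?addr0 ?mulr0//.
  by exists 0 => f M _ _; rewrite big_nil normr0 mul0r.
under eq_fun do rewrite big_cons; exact: bounded_functional_add.
Qed.

Lemma bounded_functional_density (mu : {measure set T -> \bar R}) k : integ mu k ->
  bounded_functional (fun f => \int[mu]_x (f x * k x)).
Proof.
move=> ik; have ifk f M : measurable_fun setT f -> (forall x, `|f x| <= M) ->
    integ mu (fun x => f x * k x).
  move=> mf fM; apply: eq_integrable (integMb (M := M) ik mf fM) => // x _ /=.
  by rewrite mulrC.
split.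
- move=> f g M mf mg fM gM; rewrite -RintD ?(ifk _ M)//.
  by apply: eq_Rintegral => x _; rewrite mulrDl.
- move=> f a M mf fM; rewrite -RintZ ?(ifk _ M)//.
  by apply: eq_Rintegral => x _; rewrite mulrA.
- exists (\int[mu]_x `|k x|) => f M mf fM; apply: le_trans (Rint_norm (ifk _ _ mf fM)) _.
  rewrite mulrC -RintZ; last exact: integ_norm.
  apply: Rint_le => [||x]; first by apply: integ_norm; exact: ifk fM.
    by apply: integZ; exact: integ_norm.
  by rewrite normrM ler_wpM2r.
Qed.

Lemma bounded_functional_int (mu : {finite_measure set T -> \bar R}) :
  bounded_functional (fun f => \int[mu]_x f x).
Proof.
have i1 : integ mu (fun=> 1) by exact: finite_measure_integrable_cst.
have := bounded_functional_density i1.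
rewrite (_ : (fun f => \int[mu]_x (f x * 1)) = fun f => \int[mu]_x f x)//.
by apply/funext => f; apply: eq_Rintegral => x _; rewrite mulr1.
Qed.

Lemma bounded_functional_ge0 J : bounded_functional J ->
  (forall A, measurable A -> 0 <= J \1_A) ->
  forall f M, measurable_fun setT f -> (forall x, 0 <= f x <= M) -> 0 <= J f.
Proof. by move=> [JD JZ [C JC]] JA f M mf fM; exact: functional_ge0 JD JZ JC JA f M mf fM. Qed.

Lemma bounded_functional_eq J J' : bounded_functional J -> bounded_functional J' ->
  (forall A, measurable A -> J \1_A = J' \1_A) ->
  forall f M, measurable_fun setT f -> (forall x, `|f x| <= M) -> J f = J' f.
Proof.
move=> bJ bJ' JJ'.
have ge0 f M : measurable_fun setT f -> (forall x, 0 <= f x <= M) -> J f = J' f.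
  move=> mf fM; apply/le_anti/andP; split; rewrite -subr_ge0.
    apply: (bounded_functional_ge0 (bounded_functional_sub bJ' bJ) _ mf fM) => A mA.
    by rewrite JJ'// subrr.
  apply: (bounded_functional_ge0 (bounded_functional_sub bJ bJ') _ mf fM) => A mA.
  by rewrite JJ'// subrr.
move=> f M mf fM.
pose N := `|M|; have fN x : `|f x| <= N by exact: le_trans (fM x) (ler_norm _).
have mfN : measurable_fun setT (fun x => f x + N) by exact: measurable_funD.
have h1 : J (fun x => f x + N) = J' (fun x => f x + N).
  apply: (ge0 _ (N + N)) => // x; have := fN x.
  by rewrite ler_norml -lerBlDr sub0r lerD2r.
have h2 : J (fun=> N) = J' (fun=> N) by apply: (ge0 _ N) => // x; rewrite normr_ge0 lexx.
have bN (x : T) : `|N| <= N by rewrite normr_id.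
case: bJ bJ' => [JD _ _] [JD' _ _].
by move: h1; rewrite (JD f (fun=> N) N)// (JD' f (fun=> N) N)// h2 => /addIr.
Qed.

End bounded_functionals.

(** Both sides are bounded functionals with the same values on indicators, so the Hahn decomposition
    chosen in [charge_integral] does not matter. *)
Lemma charge_integralE (R : realType) (n : nat) (nu : {charge set 'rV[R]_n -> \bar R})
    (J : ('rV[R]_n -> R) -> R) : bounded_functional J ->
  (forall A, measurable A -> nu A = (J \1_A)%:E) ->
  forall (f : 'rV[R]_n -> R) (M : R), measurable_fun setT f -> (forall x, `|f x| <= M) ->
    charge_integral nu f = J f.
Proof.
move=> bJ nuJ; rewrite /charge_integral; case: cid => P exN; case: cid => N PN f M mf fM.
pose jp : {finite_measure set _ -> \bar R} := jordan_pos PN.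
pose jn : {finite_measure set _ -> \bar R} := jordan_neg PN.
have b1 := bounded_functional_sub (bounded_functional_int jp) (bounded_functional_int jn).
apply: (bounded_functional_eq b1 bJ _ mf fM) => A mA.
rewrite !Rint_indic//; apply/EFin_inj; rewrite -nuJ// (jordan_decomp PN mA).
by rewrite EFinB !fineK ?fin_num_measure// /cadd/= cscaleN1.
Qed.

Lemma measurable_ltr d (T : measurableType d) (R : realType) (f g : T -> R) :
  measurable_fun setT f -> measurable_fun setT g -> measurable [set x | f x < g x].
Proof.
move=> mf mg; rewrite (_ : [set x | _] = (fun x => g x - f x) @^-1` `]0, +oo[); last first.
  by apply/seteqP; split => x /=; rewrite in_itv/= andbT subr_gt0.
rewrite -[X in measurable X]setTI.
by apply: (measurable_funB mg mf) => //; exact: measurable_itv.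
Qed.

Section countable_sup.
Context d (T : measurableType d) (R : realType).
Variables (mu : {finite_measure set T -> \bar R}) (G : nat -> T -> R).
Hypotheses (Gi : forall k, integ mu (G k)) (G0 : forall x, G 0%N x = 0).

(** The maximum starts from 0, which changes nothing in the limit since [G 0] vanishes, and gives a
    nonnegative increasing sequence for monotone convergence. *)
Fixpoint fmax n x : R := if n is k.+1 then Num.max (fmax k x) (G k x) else 0.

Definition csup x : \bar R := ereal_sup (range (fun k => (G k x)%:E)).

Lemma fmax_ge0 n x : 0 <= fmax n x.
Proof. by elim: n => //= n IH; rewrite le_max IH. Qed.

Lemma fmax_nd x m n : (m <= n)%N -> fmax m x <= fmax n x.
Proof.
elim: n => [|n IH]; first by rewrite leqn0 => /eqP ->.
rewrite leq_eqVlt => /predU1P[->//|]; rewrite ltnS => /IH /= h.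
by rewrite le_max h.
Qed.

Lemma csup_ge0 x : (0 <= csup x)%E.
Proof. by apply: ereal_sup_ubound; exists 0%N => //; rewrite G0. Qed.

Lemma csupE x : csup x = lim ((fmax n x)%:E @[n --> \oo])%E.
Proof.
have nd : nondecreasing_seq (fun n => (fmax n x)%:E).
  by move=> m n mn; rewrite lee_fin; exact: fmax_nd.
rewrite (cvg_lim _ (ereal_nondecreasing_cvgn nd))//.
apply/eqP; rewrite eq_le; apply/andP; split; apply: ge_ereal_sup => _ [n _ <-].
  apply: (@le_trans _ _ (fmax n.+1 x)%:E); first by rewrite lee_fin /= le_max lexx orbT.
  by apply: ereal_sup_ubound; exists n.+1.
elim: n => [|n IH]; first exact: csup_ge0.
rewrite /= EFin_max ge_max IH/=.
by apply: ereal_sup_ubound; exists n.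
Qed.

Lemma fmax_meas n : measurable_fun setT (fmax n).
Proof.
elim: n => [|n IH] /=; first exact: measurable_cst.
by apply: measurable_maxr => //; exact: integ_meas (Gi n).
Qed.

Lemma fmax_integ n : integ mu (fmax n).
Proof.
apply: (@integ_le _ _ _ _ _ (fun x => \sum_(k < n) `|G k x|)).
- exact: fmax_meas.
- by apply: integ_sum => k; apply: integ_norm; exact: Gi.
move=> x; rewrite ger0_norm ?fmax_ge0// ger0_norm ?sumr_ge0//.
elim: n => [|n IH] /=; first by rewrite big_ord0.
rewrite big_ord_recr/= ge_max; apply/andP; split; first by rewrite ler_wpDr.
by apply: le_trans (ler_norm _) _; rewrite lerDr sumr_ge0.
Qed.

Lemma csup_meas : measurable_fun setT csup.
Proof.
have -> : csup = fun x => lim ((fmax n x)%:E @[n --> \oo])%E by apply/funext => x; exact: csupE.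
apply: (emeasurable_fun_cvg (fun n x => (fmax n x)%:E)).
  by move=> n; apply/measurable_EFinP; exact: fmax_meas.
move=> x _; apply: ereal_nondecreasing_is_cvgn => m n mn.
by rewrite lee_fin; exact: fmax_nd.
Qed.

Lemma int_csup_le (K : R) : (forall n, \int[mu]_x fmax n x <= K) ->
  (\int[mu]_x csup x <= K%:E)%E.
Proof.
move=> HK; have := @cvg_monotone_convergence _ _ _ mu setT measurableT
  (fun n x => (fmax n x)%:E).
under eq_integral do rewrite -csupE.
have h1 n : measurable_fun setT (fun x => (fmax n x)%:E).
  by apply/measurable_EFinP; exact: fmax_meas.
have h2 n x : setT x -> (0 <= (fmax n x)%:E)%E by rewrite lee_fin fmax_ge0.
have h3 x : setT x -> {homo (fun n => (fmax n x)%:E) : n m / (n <= m)%N >-> (n <= m)%E}.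
  by move=> _ m n mn; rewrite lee_fin; exact: fmax_nd.
move=> /(_ h1 h2 h3) c; rewrite -(cvg_lim _ c)//.
apply: lime_le; first by apply/cvg_ex; eexists; exact: c.
apply: nearW => n; rewrite -Rint_EFin ?lee_fin ?HK//; exact: fmax_integ.
Qed.

Lemma int_csup_gt (K : R) : (K%:E < \int[mu]_x csup x)%E -> exists n, K < \int[mu]_x fmax n x.
Proof.
move=> h; have [//|nx] := pselect (exists n, K < \int[mu]_x fmax n x).
have : (\int[mu]_x csup x <= K%:E)%E.
  by apply: int_csup_le => n; rewrite leNgt; apply/negP => kn; apply: nx; exists n.
by rewrite leNgt h.
Qed.

(** The space is split according to the function that attains the maximum; the integral of [fmax]
    becomes a finite sum of integrals over fixed sets, which passes to setwise limits. *)
Lemma fmax_partition n : exists A : nat -> set T, [/\ forall k, measurable (A k),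
  trivIset setT A & forall x, fmax n x = \sum_(k < n) \1_(A k) x * G k x].
Proof.
elim: n => [|n [A [mA tA HA]]].
  exists (fun=> set0); split => //; first by apply/trivIsetP => i j _ _ _; rewrite set0I.
  by move=> x; rewrite big_ord0.
pose D := [set x | fmax n x < G n x].
have mD : measurable D.
  by apply: measurable_ltr; [exact: fmax_meas|exact: integ_meas (Gi n)].
exists (fun k => if (k < n)%N then A k `\` D else if k == n then D else set0); split.
- by move=> k; case: ifP => _; [exact: measurableD|case: ifP].
- apply/trivIsetP => i j _ _ ij; apply/seteqP; split => // x [].
  have [hi|hi] := ltnP i n; have [hj|hj] := ltnP j n.
  + move=> [Ai _] [Aj _]; move/trivIsetP : tA => /(_ i j I I ij).
    by move/seteqP => [+ _]; apply.
  + by move=> [_ nD]; case: ifP.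
  + by case: ifP => // _ Dx [].
  + case: ifP => // /eqP ei _; case: ifP => // /eqP ej _.
    by move: ij; rewrite ei ej eqxx.
move=> x; rewrite big_ord_recr/= ltnn eqxx.
under eq_bigr => k _ do rewrite ltn_ord.
have [Dx|nDx] := pselect (D x).
  rewrite indicE mem_set// mul1r big1 ?add0r; last first.
    by move=> k _; rewrite indicE memNset ?mul0r// => -[].
  by rewrite max_r// ltW.
rewrite [\1_D x]indicE memNset// mul0r addr0 max_l; last by rewrite leNgt; exact/negP.
rewrite HA; apply: eq_bigr => k _; rewrite !indicE in_setD (memNset nDx) andbT//.
Qed.

End countable_sup.

Lemma ae_ge0_of_sets d (T : measurableType d) (R : realType)
    (mu : {measure set T -> \bar R}) (f : T -> R) : integ mu f ->
  (forall A, measurable A -> 0 <= \int[mu]_x (\1_A x * f x)) ->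
  {ae mu, forall x, 0 <= f x}.
Proof.
move=> fi fA; have mf := integ_meas fi.
pose A := [set x | f x < 0].
have mA : measurable A.
  exact: measurable_ltr.
have [_ ni _] := Rint_split fi.
have E x : \1_A x * f x = - Num.max (- f x) 0.
  rewrite indicE; have [Ax|nAx] := pselect (A x).
    by rewrite mem_set// mul1r max_l ?opprK// oppr_ge0 ltW.
  rewrite memNset// mul0r max_r ?oppr0// oppr_le0 leNgt; exact/negP.
have I0 : \int[mu]_x Num.max (- f x) 0 = 0.
  apply/eqP; rewrite eq_le Rint_ge0 ?andbT; last by move=> x; rewrite le_max lexx orbT.
  have := fA A mA; under eq_Rintegral do rewrite E -mulN1r.
  by rewrite RintZ// mulN1r oppr_ge0.
have : (\int[mu]_x `|(Num.max (- f x) 0)%:E| = 0)%E.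
  under eq_integral => x _ do rewrite gee0_abs ?lee_fin ?le_max ?lexx ?orbT//.
  by rewrite -Rint_EFin// I0.
have mn : measurable_fun setT (EFin \o (fun x => Num.max (- f x) 0)).
  by apply/measurable_EFinP; exact: integ_meas ni.
move/(ae_eq_integral_abs mu measurableT mn).
apply: filterS => x /(_ I) [] h; have : Num.max (- f x) 0 = 0 by [].
by move=> hm; rewrite -oppr_le0 -hm le_max lexx.
Qed.

(** * Energy measures *)

(** [f1], [f2] are the values of F^* at the two vectors, [X1], [X2] the mollified energy densities.
    Because the weights are complementary, each [X] and each [f] receives total weight 1. *)
Lemma convex_pair (R : realFieldType) (t a1 a2 b1 b2 f1 f2 X1 X2 : R) : 0 <= t <= 1 ->
  a1 - f1 <= X1 -> a2 - f2 <= X1 -> b1 - f1 <= X2 -> b2 - f2 <= X2 ->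
  t * a1 + (1 - t) * b1 + ((1 - t) * a2 + t * b2) - f1 - f2 <= X1 + X2.
Proof.
move=> /andP[t0]; rewrite -subr_ge0 => t1 h1 h2 h3 h4.
have := ler_wpM2l t0 h1; have := ler_wpM2l t1 h2.
have := ler_wpM2l t1 h3; have := ler_wpM2l t0 h4; lra.
Qed.

Lemma min_dist (R : realFieldType) (a b a' b' : R) :
  `|Num.min a b - Num.min a' b'| <= `|a - a'| + `|b - b'|.
Proof.
have : - `|a - a'| <= a - a' <= `|a - a'| by rewrite -ler_norml.
have : - `|b - b'| <= b - b' <= `|b - b'| by rewrite -ler_norml.
have := normr_ge0 (a - a'); have := normr_ge0 (b - b').
set X := `|a - a'|; set Y := `|b - b'|; rewrite ler_norml => Y0 X0.
move=> /andP[y1 y2] /andP[x1 x2].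
by case: (leP a b) => h1; case: (leP a' b') => h2; apply/andP; split; lra.
Qed.

Lemma max_sub_min (R : realDomainType) (a b : R) : Num.max a b = a + b - Num.min a b.
Proof. by rewrite -[a + b]addr_max_min addrK. Qed.

Lemma sum_le2 (R : realFieldType) (a b w : R) : a <= w -> b <= w -> a + b <= 2 * w.
Proof. lra. Qed.

Lemma sum_le4 (R : realFieldType) (a b z s w : R) : a <= w -> b <= w ->
  z <= s + 2 * w -> a + b + z <= s + 4 * w.
Proof. lra. Qed.

Lemma pair_sum_le (R : realFieldType) (a b a' b' qa pb I E s w : R) :
  a <= a' + qa -> b <= b' + pb -> a' + b' - I <= E -> E <= s + w ->
  a + b - I <= s + (w + (qa + pb)).
Proof. lra. Qed.

Lemma Dpair_sum_le (R : realFieldType) (a b c w s f E : R) :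
  a <= c * (b + w) -> c * b <= E + f -> E <= s + w -> a <= s + f + (w + c * w).
Proof. lra. Qed.

Section lattice.
Variables (R : realType) (d : nat) (Omega : set 'rV[R]_d).
Hypotheses (oO : open Omega) (bO : bounded_set Omega).
Local Notation leb := (lebesgue_rV R d).
Local Notation lam := (lamO oO bO).

(** The distributional derivative of [u] in direction [i], paired with [phi]. *)
Definition Dpair (u : 'rV[R]_d -> R) i (phi : 'rV[R]_d -> R) : R :=
  - \int[leb]_x (u x * partial i phi x).

Lemma integ_lamO f : integ leb f -> integ lam f.
Proof.
move=> fi; apply/(L1_integP oO bO (integ_meas fi)).
by apply: integrableS fi => //; exact: open_measurable_rV.
Qed.

Lemma Dpair_C1 V i phi : test_function Omega phi -> C1 V ->
  Dpair V i phi = \int[leb]_x (partial i V x * phi x).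
Proof. by move=> tp cV; rewrite /Dpair (Rint_by_parts i tp cV) opprK. Qed.

Lemma Dpair_close (V v g phi : 'rV[R]_d -> R) (M : R) i : test_function Omega phi ->
  (forall x, `|partial i phi x| <= M) -> measurable_fun setT V ->
  integ lam v -> integ lam g -> (forall x, `|V x - v x| <= g x) ->
  `|Dpair V i phi - Dpair v i phi| <= M * \int[lam]_x g x.
Proof.
move=> tp pM mV vi gi Vg.
have [K [KO _ cdp]] := test_cont_supp tp.
have zp : zero_off Omega (partial i phi).
  move=> x nOx; have [_ _ h] := cdp i; apply: h => /KO; exact: nOx.
have mp : measurable_fun setT (partial i phi).
  by apply: continuous_measurable_rV; have [] := cdp i.
have Vi : integ lam V.
  apply: (@integ_le _ _ _ _ _ (fun x => `|v x| + `|g x|)) => //.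
    by apply: integD; exact: integ_norm.
  move=> x; rewrite [leRHS]ger0_norm ?addr_ge0// addrC -lerBlDr.
  by apply: le_trans (lerB_dist _ _) (le_trans (Vg x) (ler_norm _)).
have zo f : zero_off Omega (fun x => f x * partial i phi x).
  by move=> x nOx; rewrite zp// mulr0.
rewrite /Dpair !(Rint_zero_off oO bO (zo _)) opprK addrC distrC.
have iV : integ lam (fun x => V x * partial i phi x) by exact: integMb pM.
have iv : integ lam (fun x => v x * partial i phi x) by exact: integMb pM.
apply: le_trans (Rint_normB iV iv) _.
rewrite -RintZ//; apply: Rint_le => [||x]; first by apply: integ_norm; exact: integB.
  exact: integZ.
by rewrite -mulrBl normrM mulrC ler_pM.
Qed.

Variable F : 'rV[R]_d -> \bar R.
Hypothesis (F_ge0 : forall xi, (0 <= F xi)%E).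
Hypothesis (F0 : F 0 = 0%E).
Variables c c' : R.
Hypotheses (c0 : 0 < c) (Fc : forall xi, ((c * enorm xi - c')%:E <= F xi)%E).

Definition subenergy u (e : {finite_measure set 'rV[R]_d -> \bar R}) :=
  forall q phi, fdom F q -> test_function Omega phi -> (forall x, 0 <= phi x) ->
    \sum_i q 0 i * Dpair u i phi - fstar F q * \int[leb]_x phi x <= \int[e]_x phi x.

(* Mollifying both functions, the gradients of a smooth minimum and of the
   corresponding maximum are complementary convex combinations of the two
   gradients. *)
Lemma pair_moll u m e1 e2 phi w : 0 < w -> test_function Omega phi ->
  integ leb u -> zero_off Omega u -> integ leb m -> zero_off Omega m ->
  subenergy u e1 -> subenergy m e2 ->
  exists V W E : 'rV[R]_d -> R,
  [/\ C1 V /\ C1 W,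
    forall x q p, phi x != 0 -> fdom F q -> fdom F p ->
      \sum_i q 0 i * partial i V x + \sum_i p 0 i * partial i W x
      - fstar F q - fstar F p <= E x,
    (forall x, 0 <= E x) /\ integ leb (fun x => `|phi x| * E x),
    \int[leb]_x (`|phi x| * E x) <=
      \int[e1]_x `|phi x| + \int[e2]_x `|phi x| + w &
    forall i, `|Dpair V i phi - Dpair (fun x => Num.min (u x) (m x)) i phi| <= w /\
      `|Dpair W i phi - Dpair (fun x => Num.max (u x) (m x)) i phi| <= w].
Proof.
move=> w0 tp ui zu mi zm su sm.
have [K [KO cp cdp]] := test_cont_supp tp.
have [r1 r10 Hr1] := compact_margin oO (let: And3 h _ _ := cp in h) KO.
have [Mp Mp0 HMp] := cont_supp_bounded cp.
have [M [M0 HM]] : exists M, 0 <= M /\ forall i x, `|partial i phi x| <= M.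
  have [Mi HMi] := choice (fun i => let: ex_intro2 a b c := cont_supp_bounded (cdp i)
    in ex_intro (fun M => 0 <= M /\ forall x, `|partial i phi x| <= M) a (conj b c)).
  exists (\sum_i Mi i); split; first by apply: sumr_ge0 => i _; case: (HMi i).
  move=> i x; have [_ h] := HMi i; apply: le_trans (h x) _.
  by rewrite (bigD1 i)//= lerDl; apply: sumr_ge0 => j _; case: (HMi j).
pose a0 := fine (lam setT).
have a00 : 0 <= a0 by exact: fine_ge0.
pose t1 := fine (e1 setT); pose t2 := fine (e2 setT).
have t10 : 0 <= t1 by exact: fine_ge0.
have t20 : 0 <= t2 by exact: fine_ge0.
(* With [w1 = w / D], each pairing changes by at most [M * (w1 * a0 + 4 * w1)] and the two energies
   together by at most [w1 * (t1 + t2)]. *)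
pose D := M * (a0 + 4) + (t1 + t2) + 1.
have Ma : 0 <= M * (a0 + 4) by rewrite mulr_ge0// addr_ge0.
have D0 : 0 < D by rewrite ltr_wpDl// !addr_ge0.
pose w1 := w / D.
have w10 : 0 < w1 by rewrite divr_gt0.
have wD : D * w1 = w by rewrite mulrC divfK// gt_eqF.
have w1M : M * (w1 * a0 + 4 * w1) <= w.
  have -> : M * (w1 * a0 + 4 * w1) = M * (a0 + 4) * w1 by ring.
  by rewrite -wD ler_pM2r// /D -addrA lerDl !addr_ge0.
have w1t : w1 * t1 + w1 * t2 <= w.
  by rewrite -mulrDr mulrC -wD ler_pM2r// /D addrAC lerDr addr_ge0.
have [r2 r20 Hr2] := cont_supp_unif cp w10.
have [r3 r30 Hr3] := moll_cvg_L1 oO bO ui zu w10.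
have [r4 r40 Hr4] := moll_cvg_L1 oO bO mi zm w10.
pose r := Num.min (Num.min r1 r2) (Num.min (Num.min r3 r4) w1).
have r0 : 0 < r by rewrite !lt_min r10 r20 r30 r40 w10.
pose eps := r / 2.
have e0 : 0 < eps by rewrite divr_gt0.
have er : eps < r by rewrite ltr_pdivrMr// ltr_pMr// ltr1n.
move: er; rewrite /r !lt_min => /andP[/andP[er1 er2] /andP[/andP[er3 er4] ew]].
pose A := moll eps u; pose B := moll eps m.
have gA := has_grad_moll e0 ui; have gB := has_grad_moll e0 mi.
have [th th01 gV] := has_grad_smin e0 gA gB.
pose V x := smin eps (A x) (B x); pose W x := A x + B x - V x.
have cA : C1 A by eexists; exact: gA.
have cB : C1 B by eexists; exact: gB.
have cV : C1 V by eexists; exact: gV.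
have cW : C1 W by apply: C1B => //; exact: C1D.
(* The mollified energy measures: testing [subenergy] with the kernel, whose mass is 1, bounds the
   gradients at [x] by these terms. *)
pose E x := \int[e1]_y rho eps (y - x) + \int[e2]_y rho eps (y - x).
have E0 x : 0 <= E x by rewrite addr_ge0// Rint_ge0// => y; exact: rho_ge0.
have ap0 x : 0 <= `|phi x| by [].
have iap : integ leb (fun x => `|phi x|) by apply: integ_norm; exact: integ_test tp.
have mollap x : `|moll eps (fun x => `|phi x|) x - `|phi x| | <= w1.
  apply: moll_unif => //; first exact: ltW.
  move=> y z yz; apply: le_trans (ler_dist_dist _ _) _.
  by apply/ltW/Hr2; exact: lt_trans er2.
have imoll (e : {finite_measure set 'rV[R]_d -> \bar R}) :
    integ e (moll eps (fun x => `|phi x|)).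
  apply: (@integ_bounded _ _ _ _ _ (Mp + w1)); first exact: moll_meas.
  move=> x; have -> : moll eps (fun x => `|phi x|) x =
    `|phi x| + (moll eps (fun x => `|phi x|) x - `|phi x|) by rewrite addrC subrK.
  by apply: le_trans (ler_normD _ _) _; apply: lerD; rewrite ?normr_id.
have Ie (e : {finite_measure set 'rV[R]_d -> \bar R}) :
    integ leb (fun x => `|phi x| * \int[e]_y rho eps (y - x)) /\
    \int[leb]_x (`|phi x| * \int[e]_y rho eps (y - x)) <=
    \int[e]_x `|phi x| + w1 * fine (e setT).
  have [h1 h2] := Rint_moll_measure e0 iap ap0 (imoll e); split => //.
  have ie : integ e (fun x => `|phi x|).
    apply: (@integ_bounded _ _ _ _ _ Mp) => [|x]; last by rewrite normr_id.
    by apply: measurableT_comp => //; exact: test_meas tp.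
  rewrite h2 -Rint_cst -RintD//; last exact: finite_measure_integrable_cst.
  apply: Rint_le => // [|x]; first by apply: integD => //; exact: finite_measure_integrable_cst.
  by have := mollap x; rewrite ler_distl => /andP[_].
have EE x : `|phi x| * E x = `|phi x| * \int[e1]_y rho eps (y - x) +
   `|phi x| * \int[e2]_y rho eps (y - x) by rewrite mulrDr.
have [I1 I1'] := Ie e1; have [I2 I2'] := Ie e2.
exists V, W, E; split => //.
- move=> x q p px dq dp.
  have Kx : K x by apply: contrapT => nK; have [_ _ /(_ x nK) z] := cp; rewrite z eqxx in px.
  have trho : test_function Omega (fun y => rho eps (y - x)).
    by apply: rho_test_shift => // y yx; apply: (Hr1 x) => //; exact: le_lt_trans er1.
  have pV i : partial i V x = th x * partial i A x + (1 - th x) * partial i B x.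
    by rewrite (has_grad_partial i gV) (has_grad_partial i gA) (has_grad_partial i gB).
  have pW i : partial i W x = (1 - th x) * partial i A x + th x * partial i B x.
    have -> : partial i W x = partial i A x + partial i B x - partial i V x.
      have gW := has_gradB (has_gradD gA gB) gV.
      by rewrite (has_grad_partial i gW) (has_grad_partial i gV) (has_grad_partial i gA)
        (has_grad_partial i gB).
    by rewrite pV; ring.
  have pA i : partial i A x = Dpair u i (fun y => rho eps (y - x)) by exact: partial_moll.
  have pB i : partial i B x = Dpair m i (fun y => rho eps (y - x)) by exact: partial_moll.
  pose sA (q : 'rV[R]_d) := \sum_i q 0 i * partial i A x.
  pose sB (q : 'rV[R]_d) := \sum_i q 0 i * partial i B x.
  have hA q' : fdom F q' -> sA q' - fstar F q' <= \int[e1]_y rho eps (y - x).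
    move=> dq'; have := su q' _ dq' trho (fun y => rho_ge0 e0 _).
    by rewrite Rint_rho// mulr1 /sA; under [X in _ -> X - _ <= _]eq_bigr do rewrite pA.
  have hB q' : fdom F q' -> sB q' - fstar F q' <= \int[e2]_y rho eps (y - x).
    move=> dq'; have := sm q' _ dq' trho (fun y => rho_ge0 e0 _).
    by rewrite Rint_rho// mulr1 /sB; under [X in _ -> X - _ <= _]eq_bigr do rewrite pB.
  have -> : \sum_i q 0 i * partial i V x = th x * sA q + (1 - th x) * sB q.
    rewrite /sA /sB !mulr_sumr -big_split/=; apply: eq_bigr => i _.
    by rewrite pV; ring.
  have -> : \sum_i p 0 i * partial i W x = (1 - th x) * sA p + th x * sB p.
    rewrite /sA /sB !mulr_sumr -big_split/=; apply: eq_bigr => i _.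
    by rewrite pW; ring.
  exact: (convex_pair (th01 x) (hA q dq) (hA p dp) (hB q dq) (hB p dp)).
- by split => //; under eq_fun do rewrite EE; exact: integD.
- under eq_Rintegral do rewrite EE.
  rewrite RintD//; apply: le_trans (lerD I1' I2') _.
  by rewrite addrACA lerD2l.
move=> i.
have iu := integ_lamO ui; have im := integ_lamO mi.
have iA := integ_lamO (proj1 (moll_L1 e0 ui)); have iB := integ_lamO (proj1 (moll_L1 e0 mi)).
pose gA' x := `|A x - u x|; pose gB' x := `|B x - m x|.
have igA : integ lam gA' by apply: integ_norm; exact: integB.
have igB : integ lam gB' by apply: integ_norm; exact: integB.
have iw : integ lam (fun=> w1) by exact: finite_measure_integrable_cst.
pose g1 x := w1 + (gA' x + gB' x).
(* [W] is [A + B - V], so its error contains those of [A], [B] and of the smooth minimum. *)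
pose g2 x := (gA' x + gB' x) + g1 x.
have ig1 : integ lam g1 by apply: integD => //; exact: integD.
have ig2 : integ lam g2 by apply: integD => //; exact: integD.
have vV x : `|V x - Num.min (u x) (m x)| <= g1 x.
  apply: le_trans (ler_distD (Num.min (A x) (B x)) _ _) _; apply: lerD (min_dist _ _ _ _).
  by apply: le_trans (smin_dist _ _ (ltW e0)) (ltW ew).
have wW x : `|W x - Num.max (u x) (m x)| <= g2 x.
  rewrite max_sub_min.
  have -> : W x - (u x + m x - Num.min (u x) (m x)) =
    ((A x - u x) + (B x - m x)) + (Num.min (u x) (m x) - V x) by rewrite /W; ring.
  apply: le_trans (ler_normD _ _) _; apply: lerD; first exact: ler_normD.
  by rewrite distrC.
have imin : integ lam (fun x => Num.min (u x) (m x)).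
  apply: (@integ_le _ _ _ _ _ (fun x => `|u x| + `|m x|)).
  - by apply: measurable_minr; [exact: integ_meas iu|exact: integ_meas im].
  - by apply: integD; exact: integ_norm.
  - move=> x; rewrite [leRHS]ger0_norm ?addr_ge0//.
    by case: (leP (u x) (m x)) => _; rewrite ?lerDl ?lerDr.
have imax : integ lam (fun x => Num.max (u x) (m x)).
  apply: (@integ_le _ _ _ _ _ (fun x => `|u x| + `|m x|)).
  - by apply: measurable_maxr; [exact: integ_meas iu|exact: integ_meas im].
  - by apply: integD; exact: integ_norm.
  - move=> x; rewrite [leRHS]ger0_norm ?addr_ge0//.
    by case: (leP (u x) (m x)) => _; rewrite ?lerDl ?lerDr.
have mV : measurable_fun setT V by apply: continuous_measurable_rV; exact: C1_continuous.
have mW : measurable_fun setT W by apply: continuous_measurable_rV; exact: C1_continuous.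
have bA : \int[lam]_x gA' x <= w1 by apply: Hr3; rewrite e0 er3.
have bB : \int[lam]_x gB' x <= w1 by apply: Hr4; rewrite e0 er4.
have b1 : \int[lam]_x g1 x <= w1 * a0 + 2 * w1.
  rewrite /g1 RintD//; last exact: integD.
  by rewrite RintD// Rint_cst lerD2l; exact: sum_le2.
have b2 : \int[lam]_x g2 x <= w1 * a0 + 4 * w1.
  rewrite /g2 RintD//; last exact: integD.
  by rewrite RintD//; apply: sum_le4 bA bB b1.
split.
  apply: le_trans (Dpair_close tp (HM i) mV imin ig1 vV) _; apply: le_trans w1M.
  by rewrite ler_wpM2l// (le_trans b1)// lerD2l ler_wpM2r ?ler_nat// ltW.
apply: le_trans (Dpair_close tp (HM i) mW imax ig2 wW) _; apply: le_trans w1M.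
by rewrite ler_wpM2l.
Qed.

Let mul_integ V phi i : test_function Omega phi -> C1 V ->
  integ leb (fun x => partial i V x * phi x).
Proof.
move=> tp /C1P cV; have [K [_ [cK cp p0] _]] := test_cont_supp tp.
apply: (@integ_cont_supp _ _ K); split => //.
  by move=> x; apply: (@continuousM _ _ (partial i V) phi); [exact: cV.2|exact: cp].
by move=> x /p0 ->; rewrite mulr0.
Qed.

(** The pointwise inequality of [pair_moll] is integrated against [phi]. Afterwards the functions
    appear only in the linear pairings [Dpair], which pass to the limit in L^1. *)
Lemma pair_subenergy u m e1 e2 q p phi : test_function Omega phi -> (forall x, 0 <= phi x) ->
  fdom F q -> fdom F p ->
  integ leb u -> zero_off Omega u -> integ leb m -> zero_off Omega m ->
  subenergy u e1 -> subenergy m e2 ->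
  \sum_i q 0 i * Dpair (fun x => Num.min (u x) (m x)) i phi +
  \sum_i p 0 i * Dpair (fun x => Num.max (u x) (m x)) i phi -
  (fstar F q + fstar F p) * \int[leb]_x phi x <= \int[e1]_x phi x + \int[e2]_x phi x.
Proof.
move=> tp p0 dq dp ui zu mi zm su sm; apply/ler_addgt0Pr => w w0.
pose C := 1 + (\sum_i `|q 0 i| + \sum_i `|p 0 i|).
have C0 : 0 < C by rewrite ltr_pwDl// addr_ge0// sumr_ge0.
have w'0 : 0 < w / C by rewrite divr_gt0.
have [V [W [E [[cV cW] PE [E0 iE] bE cl]]]] := pair_moll w'0 tp ui zu mi zm su sm.
have ap x : `|phi x| = phi x by rewrite ger0_norm.
have ip : integ leb phi by exact: integ_test tp.
have core : \sum_i q 0 i * Dpair V i phi + \sum_i p 0 i * Dpair W i phi -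
   (fstar F q + fstar F p) * \int[leb]_x phi x <= \int[leb]_x (`|phi x| * E x).
  pose f x := \sum_i (q 0 i * (partial i V x * phi x) + p 0 i * (partial i W x * phi x)).
  have iqV i : integ leb (fun x => q 0 i * (partial i V x * phi x)).
    by apply: integZ; exact: mul_integ.
  have ipW i : integ leb (fun x => p 0 i * (partial i W x * phi x)).
    by apply: integZ; exact: mul_integ.
  have if_ : integ leb f by apply: integ_sum => i; exact: integD.
  have -> : \sum_i q 0 i * Dpair V i phi + \sum_i p 0 i * Dpair W i phi = \int[leb]_x f x.
    rewrite Rint_sum; last by move=> i; exact: integD.
    rewrite -big_split/=; apply: eq_bigr => i _.
    rewrite RintD// !RintZ; [|exact: mul_integ|exact: mul_integ].
    by rewrite !Dpair_C1.
  rewrite -RintZ// -RintB//; last exact: integZ.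
  apply: Rint_le => // [|x]; first by apply: integB => //; exact: integZ.
  rewrite ap; have [p00|pn0] := eqVneq (phi x) 0.
    rewrite /f p00 mulr0 mul0r subr0 big1// => i _; by rewrite !mulr0 addr0.
  have -> : f x = (\sum_i q 0 i * partial i V x + \sum_i p 0 i * partial i W x) * phi x.
    rewrite /f -big_split/= mulr_suml; apply: eq_bigr => i _.
    by rewrite mulrDl !mulrA.
  rewrite -mulrBl mulrC ler_wpM2l// opprD addrA; exact: PE.
have h1 : \sum_i q 0 i * Dpair (fun x => Num.min (u x) (m x)) i phi <=
    \sum_i q 0 i * Dpair V i phi + \sum_i `|q 0 i| * (w / C).
  rewrite -big_split/=; apply: ler_sum => i _; rewrite -lerBlDl -mulrBr.
  apply: le_trans (ler_norm _) _; rewrite normrM ler_wpM2l// distrC; by case: (cl i).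
have h2 : \sum_i p 0 i * Dpair (fun x => Num.max (u x) (m x)) i phi <=
    \sum_i p 0 i * Dpair W i phi + \sum_i `|p 0 i| * (w / C).
  rewrite -big_split/=; apply: ler_sum => i _; rewrite -lerBlDl -mulrBr.
  apply: le_trans (ler_norm _) _; rewrite normrM ler_wpM2l// distrC; by case: (cl i).
have wC : w = w / C + (\sum_i `|q 0 i| * (w / C) + \sum_i `|p 0 i| * (w / C)).
  rewrite -!mulr_suml -mulrDl -[X in X + _]mul1r -mulrDl mulrC divfK// gt_eqF//.
rewrite [in leRHS]wC.
have bE' : \int[leb]_x (`|phi x| * E x) <= \int[e1]_x phi x + \int[e2]_x phi x + w / C.
  apply: le_trans bE _; rewrite !lerD2r le_eqVlt; apply/orP; left; apply/eqP.
  by congr (_ + _); apply: eq_Rintegral => x _; rewrite ap.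
exact: pair_sum_le h1 h2 core bE'.
Qed.

(** One function is tested with plus or minus [c] times a basis vector and the other with 0; by
    [fdom_ball] this costs at most [c'] per unit of volume. *)
Lemma pair_Dpair_bound u m e1 e2 phi i : test_function Omega phi ->
  integ leb u -> zero_off Omega u -> integ leb m -> zero_off Omega m ->
  subenergy u e1 -> subenergy m e2 ->
  let K := \int[e1]_x `|phi x| + \int[e2]_x `|phi x| + c' * \int[leb]_x `|phi x| in
  c * `|Dpair (fun x => Num.min (u x) (m x)) i phi| <= K /\
  c * `|Dpair (fun x => Num.max (u x) (m x)) i phi| <= K.
Proof.
move=> tp ui zu mi zm su sm K.
have iap : integ leb (fun x => `|phi x|) by apply: integ_norm; exact: integ_test tp.
have [d0 f0] := fdom0 F_ge0 F0.
have dq (s : R) : `|s| <= c -> fdom F (s *: delta_mx 0 i) /\ fstar F (s *: delta_mx 0 i) <= c'.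
  move=> sc; apply: (fdom_ball F_ge0 F0 Fc).
  rewrite /enorm dotvZl dotvZr mulrA -expr2.
  rewrite (_ : dotv _ _ = 1) ?mulr1 ?sqrtr_sqr//.
  rewrite /dotv (bigD1 i)//= !mxE !eqxx mulr1 big1 ?addr0// => j /negPf ji.
  by rewrite !mxE eqxx ji mulr0.
have sumE (s : R) (U : 'I_d -> R) : \sum_j (s *: delta_mx 0 i : 'rV[R]_d) 0 j * U j = s * U i.
  rewrite (bigD1 i)//= !mxE !eqxx mulr1 big1 ?addr0// => j /negPf ji.
  by rewrite !mxE eqxx ji mulr0 mul0r.
have sum0 (U : 'I_d -> R) : \sum_j (0 : 'rV[R]_d) 0 j * U j = 0.
  by apply: big1 => j _; rewrite mxE mul0r.
suff H w : 0 < w -> c * `|Dpair (fun x => Num.min (u x) (m x)) i phi| <= K + w /\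
    c * `|Dpair (fun x => Num.max (u x) (m x)) i phi| <= K + w.
  by split; apply/ler_addgt0Pr => w w0; have [] := H w w0.
move=> w0; pose C := 1 + c.
have C0 : 0 < C by rewrite ltr_pwDl// ltW.
have w'0 : 0 < w / C by rewrite divr_gt0.
have [V [W [E [[cV cW] PE [E0 iE] bE cl]]]] := pair_moll w'0 tp ui zu mi zm su sm.
have ca : `|c| <= c by rewrite gtr0_norm.
have caN : `|- c| <= c by rewrite normrN gtr0_norm.
have [d1 f1] := dq c ca; have [d2 f2] := dq (- c) caN.
have pV x : phi x != 0 -> c * `|partial i V x| <= E x + c'.
  move=> px; have := PE x _ _ px d1 d0; have := PE x _ _ px d2 d0.
  rewrite !sumE sum0 f0 addr0 !subr0 mulNr => h1 h2.
  by case: (ger0P (partial i V x)) => _; rewrite ?mulrN; lra.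
have pW x : phi x != 0 -> c * `|partial i W x| <= E x + c'.
  move=> px; have := PE x _ _ px d0 d1; have := PE x _ _ px d0 d2.
  rewrite !sumE sum0 f0 add0r subr0 mulNr => h1 h2.
  by case: (ger0P (partial i W x)) => _; rewrite ?mulrN; lra.
have main U : C1 U -> (forall x, phi x != 0 -> c * `|partial i U x| <= E x + c') ->
    c * `|Dpair U i phi| <= \int[leb]_x (`|phi x| * E x) + c' * \int[leb]_x `|phi x|.
  move=> cU pU; rewrite Dpair_C1//; have iU := mul_integ i tp cU.
  apply: (@le_trans _ _ (c * \int[leb]_x `|partial i U x * phi x|)).
    by rewrite ler_pM2l//; exact: Rint_norm.
  rewrite -!RintZ//; last exact: integ_norm.
  rewrite -RintD//; last exact: integZ.
  apply: Rint_le => [||x]; first by apply: integZ; exact: integ_norm.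
    by apply: integD => //; exact: integZ.
  rewrite normrM mulrA [c' * _]mulrC -mulrDr mulrC.
  have [->|pn0] := eqVneq (phi x) 0; first by rewrite normr0 !mul0r.
  by rewrite ler_wpM2l// pU.
have fin U v : `|Dpair U i phi - Dpair v i phi| <= w / C ->
    c * `|Dpair U i phi| <= \int[leb]_x (`|phi x| * E x) + c' * \int[leb]_x `|phi x| ->
    c * `|Dpair v i phi| <= K + w.
  move=> h1 h2.
  have h3 : `|Dpair v i phi| <= `|Dpair U i phi| + w / C.
    by rewrite addrC -lerBlDr; apply: le_trans h1; rewrite distrC; exact: lerB_dist.
  have h4 := ler_wpM2l (ltW c0) h3.
  have wC : w = w / C + c * (w / C).
    by rewrite -[X in X + _]mul1r -mulrDl mulrC divfK// gt_eqF.
  rewrite [in leRHS]wC /K; exact: Dpair_sum_le h4 h2 bE.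
have [h1 h2] := cl i.
by split; [apply: fin h1 _|apply: fin h2 _]; apply: main.
Qed.

End lattice.

(** * Set integrals and the variation of a vector measure *)

Section set_integrals.
Context d (T : measurableType d) (R : realType) (mu : {measure set T -> \bar R}).

Lemma integ_indicM (f : T -> R) A : measurable A -> integ mu f ->
  integ mu (fun x => \1_A x * f x).
Proof.
move=> mA fi; apply: eq_integrable (integMb (M := 1) fi _ _) => //.
- by move=> x _ /=; rewrite mulrC.
- exact: measurable_indic.
- by move=> x; rewrite indicE; case: (_ \in _); rewrite ?normr1 ?normr0.
Qed.

Lemma int_setE (f : T -> R) A : measurable A -> integ mu f ->
  (\int[mu]_(x in A) (f x)%:E)%E = (\int[mu]_x (\1_A x * f x))%:E.
Proof.
move=> mA fi; rewrite integral_mkcond Rint_EFin; last exact: integ_indicM.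
apply: eq_integral => x _; rewrite patchE indicE.
by case: (_ \in _); rewrite ?mul1r ?mul0r.
Qed.

Lemma int_set_ge0 (f : T -> \bar R) A :
  (\int[mu]_(x in A) f x)%E = (\int[mu]_x ((\1_A x)%:E * f x))%E.
Proof.
rewrite integral_mkcond; apply: eq_integral => x _; rewrite patchE indicE.
by case: (_ \in _); rewrite ?mul1e ?mul0e.
Qed.

Lemma Rint_le_int (f : T -> R) (g : T -> \bar R) : integ mu f ->
  measurable_fun setT g -> (forall x, 0 <= g x)%E -> (forall x, (f x)%:E <= g x)%E ->
  ((\int[mu]_x f x)%:E <= \int[mu]_x g x)%E.
Proof.
move=> fi mg g0 fg; have [pi _ _] := Rint_split fi.
apply: (@le_trans _ _ (\int[mu]_x Num.max (f x) 0)%:E).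
  by rewrite lee_fin; apply: Rint_le => // x; rewrite le_max lexx.
rewrite Rint_EFin//; apply: ge0_le_integral => //.
- by move=> x _; rewrite lee_fin le_max lexx orbT.
- by apply/measurable_EFinP; exact: integ_meas pi.
- by move=> x _; rewrite EFin_max ge_max fg g0.
Qed.

End set_integrals.

Lemma enorm_le_sum (R : realType) n (y : 'rV[R]_n) : enorm y <= \sum_i `|y 0 i|.
Proof.
have [q q1 <-] := enorm_sup y.
apply: le_trans (ler_norm _) (le_trans (ler_norm_sum _ _ _) _).
apply: ler_sum => i _; rewrite normrM ler_piMl// (le_trans (coord_le_enorm q i))//.
Qed.

Lemma measurable_enorm d (T : measurableType d) (R : realType) n (k : T -> 'rV[R]_n) :
  (forall i, measurable_fun setT (fun x => k x 0 i)) ->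
  measurable_fun setT (fun x => enorm (k x)).
Proof.
move=> mk; have ms : measurable_fun setT (@Num.sqrt R).
  by apply: continuous_measurable_fun; exact: sqrt_continuous.
have md : measurable_fun setT (fun x => dotv (k x) (k x)).
  by apply: measurable_sum => i; exact: measurable_funM.
exact: (measurableT_comp ms md).
Qed.

Section variation.
Variables (R : realType) (n : nat).
Variables (mu : {finite_measure set 'rV[R]_n -> \bar R}) (k : 'rV[R]_n -> 'rV[R]_n).
Hypothesis ki : forall i, integ mu (fun x => k x 0 i).

Definition density_charge : vector_charge R n := fun i => induced_charge (ki i).

Lemma density_chargeE i A : measurable A ->
  density_charge i A = (\int[mu]_x (\1_A x * k x 0 i))%:E.
Proof. by move=> mA; rewrite -int_setE//; exact: ki. Qed.

Lemma integ_enorm : integ mu (fun x => enorm (k x)).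
Proof.
apply: (@integ_le _ _ _ _ _ (fun x => \sum_i `|k x 0 i|)).
- by apply: measurable_enorm => i; exact: integ_meas (ki i).
- by apply: integ_sum => i; apply: integ_norm; exact: ki.
- by move=> x; rewrite ger0_norm ?enorm_ge0// ger0_norm ?sumr_ge0// enorm_le_sum.
Qed.

Lemma integ_dotv q : integ mu (fun x => dotv q (k x)).
Proof. by apply: integ_sum => i; apply: integZ; exact: ki. Qed.

Lemma dotv_density q A : measurable A ->
  dotv q (\row_i fine (density_charge i A)) = \int[mu]_x (\1_A x * dotv q (k x)).
Proof.
move=> mA; transitivity (\int[mu]_x \sum_i q 0 i * (\1_A x * k x 0 i)); last first.
  by apply: eq_Rintegral => x _; rewrite /dotv mulr_sumr; apply: eq_bigr => i _; rewrite mulrCA.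
rewrite Rint_sum; last by move=> i; apply: integZ; apply: integ_indicM => //; exact: ki.
apply: eq_bigr => i _; rewrite mxE density_chargeE//= RintZ//.
by apply: integ_indicM => //; exact: ki.
Qed.

Lemma enorm_density_le A : measurable A ->
  ((enorm (\row_i fine (density_charge i A)))%:E <= \int[mu]_(x in A) (enorm (k x))%:E)%E.
Proof.
move=> mA; have [q q1 <-] := enorm_sup (\row_i fine (density_charge i A)).
rewrite dotv_density// int_setE//; last exact: integ_enorm.
rewrite lee_fin; apply: Rint_le => [||x].
- by apply: integ_indicM => //; exact: integ_dotv.
- by apply: integ_indicM => //; exact: integ_enorm.
rewrite ler_wpM2l//; apply: le_trans (dotv_le _ _) _.
by rewrite ler_piMl ?enorm_ge0.
Qed.

(** For the lower bound, [|k|] is a countable supremum of [dotv q k] over unit vectors; finitely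
    many [q] suffice up to [w] in the integral, and the pieces on which one of them is maximal form
    a competing partition. *)
Lemma variation_density A : measurable A ->
  charge_variation_vec density_charge A = (\int[mu]_(x in A) (enorm (k x))%:E)%E.
Proof.
move=> mA; apply/eqP; rewrite eq_le; apply/andP; split.
  apply: ge_ereal_sup => _ [P [mP tP <-] <-].
  rewrite ge0_integral_bigcup//=; last 2 first.
  - apply: measurable_funTS; apply/measurable_EFinP; exact: integ_meas integ_enorm.
  - by move=> x _; rewrite lee_fin enorm_ge0.
  apply: lee_nneseries => [j _ _|j _]; first by rewrite lee_fin enorm_ge0.
  exact: enorm_density_le.
rewrite int_setE//; last exact: integ_enorm.
apply/lee_addgt0Pr => w w0; rewrite -leeBlDr// -EFinB.
pose S := [set q : 'rV[R]_n | enorm q <= 1].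
have S0 : S 0 by rewrite /S /= /enorm dotv0l sqrtr0 ler01.
have [r [r0 rS rd]] := @countable_dense_graph R n S (fun=> 0) 0 S0.
pose G j x := \1_A x * dotv (r j) (k x).
have Gi j : integ mu (G j) by apply: integ_indicM => //; exact: integ_dotv.
have G0 x : G 0%N x = 0 by rewrite /G r0 dotv0l mulr0.
have GE x : csup G x = (\1_A x * enorm (k x))%:E.
  apply/eqP; rewrite eq_le; apply/andP; split.
    apply: ge_ereal_sup => _ [j _ <-]; rewrite lee_fin ler_wpM2l//.
    by apply: le_trans (dotv_le _ _) _; rewrite ler_piMl ?enorm_ge0//; exact: rS.
  have [Ax|nAx] := pselect (A x); last by rewrite indicE memNset// mul0r csup_ge0.
  have [q q1 qE] := enorm_sup (k x).
  apply/lee_addgt0Pr => e e0; pose C := n%:R * enorm (k x) + 1.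
  have C0 : 0 < C by rewrite ltr_wpDl// mulr_ge0// enorm_ge0.
  have [j [jq _]] := rd q (e / C) q1 (divr_gt0 e0 C0).
  apply: (@le_trans _ _ ((G j x)%:E + e%:E)%E); last first.
    by rewrite leeD2r//; apply: ereal_sup_ubound; exists j.
  rewrite -EFinD lee_fin /G indicE mem_set// !mul1r -qE -lerBlDl -dotvBl.
  apply: le_trans (ler_norm _) (le_trans (dotv_norm_le _ _) _).
  apply: (@le_trans _ _ (e / C * (n%:R * enorm (k x)))).
    by rewrite mulrCA ler_wpM2r ?mulr_ge0 ?enorm_ge0// ltW.
  by rewrite mulrAC ler_pdivrMr// ler_pM2l// lerDl.
have iA : integ mu (fun x => \1_A x * enorm (k x)).
  by apply: integ_indicM => //; exact: integ_enorm.
have [N HN] : exists N, \int[mu]_x (\1_A x * enorm (k x)) - w < \int[mu]_x fmax G N x.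
  apply: (int_csup_gt Gi G0); under eq_integral do rewrite GE.
  by rewrite -Rint_EFin// lte_fin ltrBlDr ltrDl.
have [B [mB tB HB]] := fmax_partition Gi N.
have mAB j : measurable (B j `&` A) by exact: measurableI.
(* Piece 0 collects what the sets [B i] leave of [A], because a partition must exhaust [A]; hence
   the index shift. *)
pose P j := if j is i.+1 then B i `&` A else A `\` \bigcup_i B i.
have mP j : measurable (P j).
  by case: j => [|j] //=; apply: measurableD => //; exact: bigcup_measurable.
have tP : trivIset setT P.
  apply/trivIsetP => -[|i] [|j] _ _ //= ij; apply/seteqP; split => // x [].
  - by move=> [_ nB] [Bx _]; apply: nB; exists j.
  - by move=> [Bx _] [_ nB]; apply: nB; exists i.
  move=> [Bi _] [Bj _]; move/trivIsetP : tB => /(_ i j I I ij).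
  by move/seteqP => [+ _]; apply.
have UP : \bigcup_j P j = A.
  apply/seteqP; split => [x [[|j] _ []//]|x Ax].
  have [[j _ Bx]|nB] := pselect ((\bigcup_i B i) x); first by exists j.+1.
  by exists 0%N.
apply: (@le_trans _ _ (\sum_(j <oo) (enorm (\row_i fine (density_charge i (P j))))%:E)%E); last first.
  by apply: ereal_sup_ubound; exists P.
apply: le_trans (@nneseries_lim_ge _ _ xpredT 0%N N.+1 _); last first.
  by move=> j _ _; rewrite lee_fin enorm_ge0.
rewrite sumEFin lee_fin; apply: le_trans (ltW HN) _.
rewrite big_nat_recl// ler_wpDl ?enorm_ge0//= big_mkord.
under eq_Rintegral do rewrite HB.
rewrite Rint_sum; last by move=> j; exact: integ_indicM.
apply: ler_sum => j _.
rewrite (_ : \int[mu]_x _ = dotv (r j) (\row_i fine (density_charge i (B j `&` A)))).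
  by apply: le_trans (dotv_le _ _) _; rewrite ler_piMl ?enorm_ge0//; exact: rS.
rewrite dotv_density//; apply: eq_Rintegral => x _.
by rewrite /G mulrA !indicE in_setI; case: (x \in B j); rewrite /= ?mul1r ?mul0r.
Qed.

End variation.

(** Reduces a possibly infinite factor to its finite minorants, which are what [biconjugate] and the
    supremum in [recession] provide. *)
Lemma mule_le_of_lt (R : realType) (x y : \bar R) (s : R) : (0 <= x)%E -> 0 <= s ->
  (0 <= y)%E -> (forall a : R, (a%:E < x)%E -> ((a * s)%:E <= y)%E) -> (x * s%:E <= y)%E.
Proof.
move=> x0; rewrite le_eqVlt => /predU1P[<-|s0] y0 H; first by rewrite mule0.
rewrite leNgt; apply/negP => /lte_between[b yb bx].
have : ((b / s)%:E < x)%E by rewrite EFinM lte_pdivrMr.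
by move/H; rewrite divfK ?gt_eqF// leNgt yb.
Qed.

Lemma measurable_invr (R : realType) : measurable_fun setT (fun x : R => x^-1).
Proof.
have m0 : measurable [set 0 : R] by exact: measurable_set1.
rewrite (_ : [set: R] = [set 0] `|` ~` [set 0]); last by rewrite setUv.
apply/measurable_funU => //; first exact: measurableC.
split; first exact: measurable_fun_set1.
apply: open_continuous_measurable_fun.
  by apply: closed_openC; exact/accessible_closed_set1/hausdorff_accessible/Rhausdorff.
move=> x /set_mem /= /eqP x0; exact: (cvgV x0 (@cvg_id _ (nbhs x))).
Qed.

(** * The energy as the integral of a supremum *)

Section representation.
Variables (R : realType) (d : nat) (Omega : set 'rV[R]_d).
Hypotheses (oO : open Omega) (bO : bounded_set Omega).
Local Notation leb := (lebesgue_rV R d).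
Local Notation lam := (lamO oO bO).
Variable F : 'rV[R]_d -> \bar R.
Hypothesis (F_ge0 : forall xi, (0 <= F xi)%E).
Hypothesis (F0 : F 0 = 0%E).
Hypotheses (F_lsc : lower_semicontinuous F) (F_convex : econvex F).
Variable qs : nat -> 'rV[R]_d.
Hypotheses (qs0 : qs 0%N = 0) (qsd : forall k, fdom F (qs k)).
Hypothesis qs_dense : forall q x (l w : R), fdom F q -> 0 < w -> exists k,
   dotv q x - l * fstar F q <= dotv (qs k) x - l * fstar F (qs k) + w.

Variables (mu : {finite_measure set 'rV[R]_d -> \bar R}) (l : 'rV[R]_d -> R).
Hypotheses (li : integ mu l) (l0 : forall x, 0 <= l x) (lz : zero_off Omega l).
Hypothesis lamE : forall A, measurable A -> lam A = (\int[mu]_x (\1_A x * l x))%:E.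

Implicit Types h : 'rV[R]_d -> 'rV[R]_d.

(** The supremum over [k] is the perspective of [F]: [l F(h / l)] where [l > 0] and the recession
    function at [h] where [l = 0]. It treats the two parts of the energy at once. *)
Definition affine_fam h k x : R := dotv (qs k) (h x) - l x * fstar F (qs k).

Lemma affine_fam_integ (h : 'rV[R]_d -> 'rV[R]_d) : (forall i, integ mu (fun x => h x 0 i)) ->
  forall k, integ mu (affine_fam h k).
Proof.
move=> hi k; apply: integB; first exact: integ_dotv.
by under eq_fun do rewrite mulrC; exact: integZ.
Qed.

Lemma affine_fam0 h x : affine_fam h 0%N x = 0.
Proof. by rewrite /affine_fam qs0 dotv0l (proj2 (fdom0 F_ge0 F0)) mulr0 subrr. Qed.

Lemma affine_le_csup h q x : fdom F q ->
  ((dotv q (h x) - l x * fstar F q)%:E <= csup (affine_fam h) x)%E.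
Proof.
move=> dq; apply/lee_addgt0Pr => w w0; have [k hk] := qs_dense (h x) (l x) dq w0.
apply: (@le_trans _ _ ((affine_fam h k x)%:E + w%:E)%E); first by rewrite -EFinD lee_fin.
by rewrite leeD2r//; apply: ereal_sup_ubound; exists k.
Qed.

Let ml : measurable_fun setT (EFin \o l).
Proof. by apply/measurable_EFinP; exact: integ_meas li. Qed.

Let le0 x : (0 <= (EFin \o l) x)%E. Proof. by rewrite lee_fin. Qed.

Let lam_mdens A : measurable A -> lam A = mdens mu ml le0 A.
Proof. by move=> mA; rewrite lamE// -int_setE. Qed.

Lemma int_lam (g : 'rV[R]_d -> \bar R) : measurable_fun setT g -> (forall x, 0 <= g x)%E ->
  (\int[lam]_x g x = \int[mu]_x (g x * (l x)%:E))%E.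
Proof.
move=> mg g0; rewrite -(ge0_integral_mdens mu ml le0)//.
by apply: eq_measure_integral => A mA _; exact: lam_mdens.
Qed.

Let integ_lamP f : measurable_fun setT f -> integ lam f <-> integ mu (fun x => f x * l x).
Proof.
move=> mf; rewrite -(integ_mdens mu ml le0)// /integ.
split=> fi; apply/integrableP; split; try exact/measurable_EFinP.
  have /integrableP[_] := fi; rewrite (@eq_measure_integral _ _ _ _ (mdens mu ml le0))//.
  by move=> A mA _; exact: lam_mdens.
have /integrableP[_] := fi; rewrite (@eq_measure_integral _ _ _ _ lam)//.
by move=> A mA _; exact: (esym (lam_mdens mA)).
Qed.

Let Rint_lam f : integ lam f -> \int[lam]_x f x = \int[mu]_x (f x * l x).
Proof.
move=> fi; have mf := integ_meas fi.
have fi' : integ (mdens mu ml le0) f by apply/integ_mdens => //; exact/integ_lamP.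
rewrite -(Rint_mdens_integ fi') /Rintegral; congr fine.
by apply: eq_measure_integral => A mA _; exact: lam_mdens.
Qed.

Variables (v : 'rV[R]_d -> R) (h : 'rV[R]_d -> 'rV[R]_d).
Hypotheses (vi : integ leb v) (vz : zero_off Omega v).
Hypotheses (hi : forall i, integ mu (fun x => h x 0 i)) (hz : forall x, ~ Omega x -> h x = 0).
Hypothesis hE : forall i phi, test_function Omega phi ->
  Dpair v i phi = \int[mu]_x (phi x * h x 0 i).

Let mO : measurable Omega := open_measurable_rV oO.

Let L1v : L1 Omega v. Proof. exact: integrableS vi. Qed.

Let Du := density_charge hi.

Lemma Rint_OmegaM u phi i : zero_off Omega u ->
  \int[leb]_(x in Omega) (u x * partial i phi x) = \int[leb]_x (u x * partial i phi x).
Proof.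
move=> uz; rewrite Rintegral_mkcond; apply: eq_Rintegral => x _; rewrite patchE.
case: ifPn => // /negP nO; rewrite uz ?mul0r//.
by move=> Ox; apply: nO; rewrite inE.
Qed.

Let Du_distr : distributional_derivative Omega v Du.
Proof.
split=> [i A mA|i phi tp].
  rewrite !density_chargeE//; last exact: measurableI.
  congr EFin; apply: eq_Rintegral => x _; rewrite !indicE in_setI.
  have [Ox|nOx] := pselect (Omega x); first by rewrite (mem_set Ox) andbT.
  by rewrite hz// mxE !mulr0.
rewrite Rint_OmegaM//; have := hE i tp; rewrite /Dpair => /(congr1 -%R); rewrite opprK => ->.
have [K [_ cp _]] := test_cont_supp tp; have [M M0 HM] := cont_supp_bounded cp.
rewrite (charge_integralE (bounded_functional_density (hi i)) _ (test_meas tp) HM)//.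
by move=> A mA; rewrite density_chargeE.
Qed.

(** [Z] carries the singular part: it is Lebesgue null, and off [Z] the derivative has density
    [h / l] with respect to Lebesgue measure on Omega. *)
Let Z : set 'rV[R]_d := Omega `&` [set x | l x = 0].
Let mZ : measurable Z.
Proof.
apply: measurableI => //.
rewrite (_ : [set x | l x = 0] = ~` [set x | 0 < l x]).
  by apply: measurableC; apply: measurable_ltr => //; exact: integ_meas li.
apply/seteqP; split => x /=; first by move=> ->; rewrite ltxx.
by move=> /negP; rewrite -leNgt => h1; apply/le_anti; rewrite h1 l0.
Qed.

Let s x : 'rV[R]_d := (\1_Z x : R) *: h x.
Let si i : integ mu (fun x => s x 0 i).
Proof. by under eq_fun do rewrite mxE; exact: integ_indicM. Qed.
Let Ds := density_charge si.
Let ms : measurable_fun setT (EFin \o (fun x => enorm (s x))).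
Proof. by apply/measurable_EFinP; exact: integ_meas (integ_enorm si). Qed.
Let se0 x : (0 <= (EFin \o (fun x => enorm (s x))) x)%E.
Proof. by rewrite lee_fin enorm_ge0. Qed.
Let sigma : {measure set 'rV[R]_d -> \bar R} := mdens mu ms se0.
(** With the convention that 0 has inverse 0, [eta] and [G] vanish where the quotient is undefined,
    and the product formulas [eta_s] and [G_l] remain true there. *)
Let eta x : 'rV[R]_d := (enorm (s x))^-1 *: s x.
Let G x : 'rV[R]_d := (l x)^-1 *: h x.

Let eta_s x i : eta x 0 i * enorm (s x) = s x 0 i.
Proof.
rewrite mxE; have [e0|e0] := eqVneq (enorm (s x)) 0; last by rewrite mulrAC mulVf// mul1r.
by rewrite e0 mulr0 (enorm_eq0 e0) mxE.
Qed.

Let mh i : measurable_fun setT (fun x => h x 0 i). Proof. exact: integ_meas (hi i). Qed.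

Let mG i : measurable_fun setT (fun x => G x 0 i).
Proof.
under eq_fun do rewrite mxE; apply: measurable_funM => //.
have mil : measurable_fun setT (fun x : R => x^-1) by exact: measurable_invr.
exact: (measurableT_comp mil (integ_meas li)).
Qed.

Let meta i : measurable_fun setT (fun x => eta x 0 i).
Proof.
under eq_fun do rewrite mxE; apply: measurable_funM; last exact: integ_meas (si i).
have mil : measurable_fun setT (fun x : R => x^-1) by exact: measurable_invr.
exact: (measurableT_comp mil (integ_meas (integ_enorm si))).
Qed.

Let G_l x i : Omega x -> G x 0 i * l x = h x 0 i - s x 0 i.
Proof.
move=> Ox; rewrite !mxE; have [z|nz] := eqVneq (l x) 0.
  by rewrite z mulr0 indicE mem_set// mul1r subrr.
by rewrite mulrAC mulVf// mul1r indicE memNset ?mul0r ?subr0// => -[_ /=/eqP]; rewrite (negPf nz).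
Qed.

Let G_l' x i : G x 0 i * l x = h x 0 i - s x 0 i.
Proof.
have [Ox|nOx] := pselect (Omega x); first exact: G_l.
by rewrite !mxE hz// mxE mulr0 mul0r mulr0 subr0.
Qed.

Let Gi i : integ lam (fun x => G x 0 i).
Proof.
apply/(integ_lamP (mG i)); under eq_fun do rewrite G_l'; exact: integB.
Qed.

Lemma representation_decomposition :
  radon_nikodym_decomposition Omega Du G Ds sigma eta.
Proof.
split.
- by move=> i; apply/(L1_integP oO bO (mG i)); exact: Gi.
- move=> i A mA; rewrite !density_chargeE//.
  rewrite (_ : (\int[leb]_(x in A `&` Omega) _ = (\int[lam]_x (\1_A x * G x 0 i))%:E)%E).
    have iAG := integ_indicM mA (Gi i).
    rewrite (Rint_lam iAG).
    rewrite -EFinD -RintD.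
    + congr EFin; apply: eq_Rintegral => x _.
      by rewrite -mulrA G_l' -mulrDr subrK.
    + by apply/(integ_lamP (integ_meas iAG)).
    + exact: integ_indicM.
  rewrite setIC integral_mkcondr int_lamO_patch Rint_EFin; last exact: integ_indicM.
  have E x : Omega x -> ((fun x => (G x 0 i)%:E) \_ A \_ Omega) x = (\1_A x * G x 0 i)%:E.
    by move=> Ox; rewrite !patchE mem_set// indicE; case: (x \in A); rewrite ?mul1r ?mul0r.
  have E' x : ~ Omega x -> (\1_A x * G x 0 i)%:E = 0%E.
    by move=> nOx; rewrite mxE hz// mxE !mulr0.
  apply: eq_integral => x _; have [Ox|nOx] := pselect (Omega x); first exact: E.
  by rewrite E'// patchE memNset.
- exists Z; split => //.
    have : lam Z = 0%E.
      rewrite lamE//; congr EFin; rewrite (_ : \int[mu]_x _ = \int[mu]_x (0 : R)).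
        by rewrite Rint_cst mul0r.
      apply: eq_Rintegral => x _; rewrite indicE; have [Zx|nZx] := pselect (Z x).
        by rewrite mem_set// mul1r; case: Zx.
      by rewrite memNset// mul0r.
    rewrite lamOE setIidl//; by move=> x [].
  move=> i A mA; rewrite !density_chargeE//; last exact: measurableI.
  congr EFin; apply: eq_Rintegral => x _; rewrite !mxE [\1_A x]indicE [\1_(A `&` Z) x]indicE in_setI.
  rewrite [\1_Z x]indicE; by case: (x \in Z); rewrite ?andbT// mul0r !mulr0.
- by move=> A mA; rewrite /Ds variation_density.
have ieta i : integ sigma (fun x => eta x 0 i).
  by apply/(integ_mdens mu ms se0 (meta i)); under eq_fun do rewrite eta_s.
move=> i; split; first exact: ieta.
move=> A mA; rewrite density_chargeE// int_setE//.
have iA := integ_indicM mA (ieta i).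
rewrite (Rint_mdens_integ iA); congr EFin; apply: eq_Rintegral => x _.
by rewrite -mulrA eta_s.
Qed.

(** The decomposition built from [h] and [l] is a candidate in the infimum defining the energy. Its
    integrand is below the supremum: by the definition of [recession] on [Z], by [biconjugate] where
    [l > 0], and trivially outside Omega. *)
Lemma representation : BV Omega v /\
  (bulk_energy Omega F v <= \int[mu]_x csup (affine_fam h) x)%E.
Proof.
split; first by split => //; exists Du.
have GM : measurable_fun setT G by exact: measurable_rV.
have EM : measurable_fun setT eta by exact: measurable_rV.
have mFG : measurable_fun setT (fun x => F (G x)).
  exact: (measurableT_comp (F_measurable F_lsc) GM).
have mRE : measurable_fun setT (fun x => recession F (eta x)).
  exact: (measurableT_comp (recession_measurable F) EM).
have R0 p : (0 <= recession F p)%E by exact: recession_ge0.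
apply: ereal_inf_le; eexists.
  by exists Du, G, Ds, sigma, eta; split; [exact: Du_distr|exact: representation_decomposition|reflexivity].
rewrite (int_lamO oO bO mFG)// int_lam//.
apply: (@le_trans _ _ (\int[mu]_x (F (G x) * (l x)%:E) +
    \int[mu]_x (recession F (eta x) * (enorm (s x))%:E))%E).
  rewrite leeD2l// -(ge0_integral_mdens mu ms se0)//.
  by apply: ge0_subset_integral => //; exact: measurableT.
have m1 : measurable_fun setT (fun x => F (G x) * (l x)%:E)%E by exact: emeasurable_funM.
have m2 : measurable_fun setT (fun x => recession F (eta x) * (enorm (s x))%:E)%E.
  by apply: emeasurable_funM.
have p1 x : (0 <= F (G x) * (l x)%:E)%E by rewrite mule_ge0// lee_fin.
have p2 x : (0 <= recession F (eta x) * (enorm (s x))%:E)%E.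
  by rewrite mule_ge0// lee_fin enorm_ge0.
rewrite -ge0_integralD//.
have c0 x : (0 <= csup (affine_fam h) x)%E by apply: csup_ge0 => y; exact: affine_fam0.
apply: ge0_le_integral => //.
- by move=> x _; rewrite adde_ge0.
- exact: emeasurable_funD.
- by apply: csup_meas (affine_fam_integ hi) _ => x; exact: affine_fam0.
move=> x _; have [Zx|nZx] := pselect (Z x).
  have lx : l x = 0 by case: Zx.
  have sx : s x = h x by rewrite /s indicE mem_set// scale1r.
  rewrite lx mule0 add0e; apply: mule_le_of_lt => //; first exact: enorm_ge0.
  move=> a /ereal_sup_gt[_ [q dq <-]]; rewrite lte_fin => aq.
  apply: le_trans (affine_le_csup h x dq); rewrite lx mul0r subr0 lee_fin.
  apply: (@le_trans _ _ (dotv q (eta x) * enorm (s x))).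
    by rewrite ler_wpM2r ?enorm_ge0// ltW.
  rewrite -sx /eta dotvZr; have [e0|e0] := eqVneq (enorm (s x)) 0.
    by rewrite e0 mulr0 (enorm_eq0 e0) dotvC dotv0l.
  by rewrite mulrAC mulVf// mul1r.
have sx : s x = 0 by rewrite /s indicE memNset// scale0r.
rewrite sx /enorm dotv0l sqrtr0 mule0 adde0; apply: mule_le_of_lt => // a aF.
have [q dq aq] := biconjugate F_ge0 F0 F_lsc F_convex aF.
apply: le_trans (affine_le_csup h x dq); rewrite lee_fin.
have [lx|lx] := eqVneq (l x) 0.
  have nO : ~ Omega x by move=> Ox; apply: nZx.
  by rewrite lx mulr0 mul0r subr0 hz// dotvC dotv0l.
apply: (@le_trans _ _ ((dotv q (G x) - fstar F q) * l x)).
  by rewrite ler_wpM2r// ltW.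
by rewrite mulrBl mulrC -dotvZr /G scalerA divff// scale1r mulrC [l x * _]mulrC.
Qed.

End representation.

Section finite_measures.
Context d (T : measurableType d) (R : realType).

Lemma finite_measure_of (m : {measure set T -> \bar R}) : (m setT < +oo)%E ->
  exists mu : {finite_measure set T -> \bar R}, forall A, mu A = m A.
Proof.
move=> mfin; exists (mfrestr measurableT mfin) => A.
by rewrite -[in RHS](setIT A).
Qed.

Lemma finite_measure_sum (m1 m2 : {measure set T -> \bar R}) : (m1 setT + m2 setT < +oo)%E ->
  exists mu : {finite_measure set T -> \bar R}, forall A, (mu A = m1 A + m2 A)%E.
Proof.
move=> fin; have E A : (measure_add m1 m2 : {measure set T -> \bar R}) A = (m1 A + m2 A)%E.
  exact: measure_addE.
have [|mu Hmu] := @finite_measure_of (measure_add m1 m2); first by rewrite E.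
by exists mu => A; rewrite Hmu E.
Qed.

Lemma finite_measure_add (m1 m2 : {finite_measure set T -> \bar R}) :
  exists mu : {finite_measure set T -> \bar R}, forall A, (mu A = m1 A + m2 A)%E.
Proof.
by apply: finite_measure_sum; rewrite lte_add_pinfty// ltey_eq fin_num_measure.
Qed.

Lemma finite_measure0 : exists mu : {finite_measure set T -> \bar R}, forall A, mu A = 0%E.
Proof.
have [|mu Hmu] := @finite_measure_of (mzero : {measure set T -> \bar R}).
  by rewrite [ltLHS](_ : _ = 0%E) ?ltry.
by exists mu => A; rewrite Hmu.
Qed.

Lemma Rint_measure_add (m1 m2 mu : {finite_measure set T -> \bar R}) (f : T -> R) (M : R) :
  (forall A, (mu A = m1 A + m2 A)%E) -> measurable_fun setT f -> (forall x, `|f x| <= M) ->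
  \int[mu]_x f x = \int[m1]_x f x + \int[m2]_x f x.
Proof.
move=> muE mf fM; apply: (bounded_functional_eq (bounded_functional_int mu)
  (bounded_functional_add (bounded_functional_int m1) (bounded_functional_int m2)) _ mf fM).
by move=> A mA; rewrite !Rint_indic// muE fineD// fin_num_measure.
Qed.

Lemma measure_density (nu mu : {finite_measure set T -> \bar R}) :
  (forall A, measurable A -> nu A <= mu A)%E ->
  exists k, [/\ integ mu k, forall x, 0 <= k x &
    forall A, measurable A -> nu A = (\int[mu]_x (\1_A x * k x))%:E].
Proof.
move=> num; have dom : nu `<< mu.
  apply/null_content_dominatesP => A mA A0; apply/eqP.
  by rewrite eq_le measure_ge0 andbT -A0 num.
pose f := Radon_Nikodym_SigmaFinite.f nu mu.
have ff x : f x \is a fin_num by exact: Radon_Nikodym_SigmaFinite.f_fin_num.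
have fi := Radon_Nikodym_SigmaFinite.f_integrable dom.
have ki : integ mu (fine \o f).
  by apply: eq_integrable fi => // x _ /=; rewrite fineK.
exists (fine \o f); split => // [x|A mA].
  by apply: fine_ge0; exact: Radon_Nikodym_SigmaFinite.f_ge0.
rewrite -int_setE// (Radon_Nikodym_SigmaFinite.f_integral dom)//.
by apply: eq_integral => x _ /=; rewrite fineK.
Qed.

End finite_measures.

(** * Energy measures of functions of finite energy *)

Section energy_measure.
Variables (R : realType) (d : nat) (Omega : set 'rV[R]_d).
Hypotheses (oO : open Omega) (bO : bounded_set Omega).
Local Notation leb := (lebesgue_rV R d).
Local Notation lam := (lamO oO bO).
Variable F : 'rV[R]_d -> \bar R.
Hypothesis (F_ge0 : forall xi, (0 <= F xi)%E).
Hypothesis (F0 : F 0 = 0%E).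
Hypotheses (F_lsc : lower_semicontinuous F).
Let mO : measurable Omega := open_measurable_rV oO.

Lemma recession0 : recession F 0 = 0%E.
Proof.
apply/eqP; rewrite eq_le recession_ge0// andbT.
by apply: ge_ereal_sup => _ [q _ <-]; rewrite dotvC dotv0l.
Qed.

Lemma bulk_energy_ge0 u : (0 <= bulk_energy Omega F u)%E.
Proof.
apply: le_ereal_inf_tmp => _ [Du [G [Ds [sigma [eta [_ _ ->]]]]]].
by rewrite adde_ge0// integral_ge0// => x _; exact: recession_ge0.
Qed.

(** The strict bound selects, in the infimum defining the energy, a decomposition of energy below
    [a]; its energy density is the measure sought. *)
Lemma energy_measure u (a : R) : zero_off Omega u -> (bulk_energy Omega F u < a%:E)%E ->
  exists e : {finite_measure set 'rV[R]_d -> \bar R},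
    fine (e setT) <= a /\ subenergy Omega F u e.
Proof.
move=> uz /ereal_inf_lt[_ [Du [G [Ds [sigma [eta [dD rn ->]]]]]] Ea].
have [DuO DuE] := dD; have [GL DuG [N [mN N0 DsN]] _ eta_s] := rn.
(* [G] and [eta] are arbitrary outside Omega; putting them to 0 there adds no energy, as [F] and its
   recession function vanish at 0. *)
pose G' x : 'rV[R]_d := \row_i ((fun x => G x 0 i) \_ Omega) x.
pose eta' x : 'rV[R]_d := (\1_Omega x : R) *: eta x.
have G'E x i : G' x 0 i = ((fun x => G x 0 i) \_ Omega) x by rewrite mxE.
have iG i : integ lam (fun x => G' x 0 i).
  by under eq_fun do rewrite G'E; apply: L1_patch; exact: GL.
have iE0 i : integ sigma (fun x => eta x 0 i) by case: (eta_s i).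
have iE i : integ sigma (fun x => eta' x 0 i).
  by under eq_fun do rewrite mxE; exact: integ_indicM.
have mG : measurable_fun setT G' by apply: measurable_rV => i; exact: integ_meas (iG i).
have mE : measurable_fun setT eta' by apply: measurable_rV => i; exact: integ_meas (iE i).
have mFG : measurable_fun setT (F \o G').
  exact: (measurableT_comp (F_measurable F_lsc) mG).
have mRE : measurable_fun setT (recession F \o eta').
  exact: (measurableT_comp (recession_measurable F) mE).
have FG0 x : (0 <= (F \o G') x)%E by exact: F_ge0.
have RE0 x : (0 <= (recession F \o eta') x)%E by exact: recession_ge0.
pose m1 : {measure set 'rV[R]_d -> \bar R} := mdens lam mFG FG0.
pose m2 : {measure set 'rV[R]_d -> \bar R} := mdens sigma mRE RE0.
have m1T : m1 setT = (\int[leb]_(x in Omega) F (G x))%E.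
  rewrite /m1 /= /mdens (int_lamO_patch oO bO); apply: eq_integral => x _.
  rewrite patchE /=; case: ifPn => Ox.
    by congr F; apply/rowP => i; rewrite G'E patchE Ox.
  rewrite (_ : G' x = 0) ?F0//; apply/rowP => i.
  by rewrite G'E patchE (negPf Ox) mxE.
have m2T : m2 setT = (\int[sigma]_(x in Omega) recession F (eta x))%E.
  rewrite /m2 /= /mdens [RHS]integral_mkcond; apply: eq_integral => x _.
  rewrite patchE /= /eta' indicE; case: ifPn => Ox; first by rewrite scale1r.
  by rewrite scale0r recession0.
rewrite -m1T -m2T in Ea.
have [|e He] := @finite_measure_sum _ _ _ m1 m2; first by rewrite (lt_trans Ea)// ltry.
exists e; split.
  rewrite He -lee_fin fineK ?ltW// ge0_fin_numE; first by rewrite (lt_trans Ea)// ltry.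
  by rewrite adde_ge0.
move=> q phi dq tp p0.
have [K [_ cp _]] := test_cont_supp tp; have [M M0 HM] := cont_supp_bounded cp.
have mp := test_meas tp.
pose J i f := \int[lam]_x (f x * G' x 0 i) + \int[sigma]_x (f x * eta' x 0 i).
have bJ i : bounded_functional (J i).
  by apply: bounded_functional_add; exact: bounded_functional_density.
have Jset i A : measurable A -> Du i A = (J i \1_A)%:E.
  move=> mA; rewrite DuO//; have mAO : measurable (A `&` Omega) by exact: measurableI.
  rewrite DuG// /J EFinD -int_setE// -int_setE//; congr (_ + _)%E.
    rewrite -setIA setIid (int_setE mA (iG i)) Rint_EFin; last exact: integ_indicM.
    rewrite setIC integral_mkcondr int_lamO_patch; apply: eq_integral => x _.
    rewrite patchE; case: ifPn => Ox.
      by rewrite patchE indicE G'E patchE Ox; case: (_ \in A); rewrite ?mul1r ?mul0r.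
    by rewrite G'E patchE (negPf Ox) mulr0.
  case: (eta_s i) => _ ->//; rewrite integral_mkcondr; apply: eq_integral => x _.
  by rewrite patchE mxE indicE; case: ifPn => _; rewrite ?mul1r ?mul0r.
have pJ i : Dpair u i phi = J i phi.
  rewrite /Dpair -(Rint_OmegaM _ _ uz) DuE// opprK.
  exact: (charge_integralE (bJ i) (Jset i) mp HM).
have -> : \int[leb]_x phi x = \int[lam]_x phi x.
  by apply: Rint_zero_off; exact: test_zero_off tp.
rewrite -subr_ge0.
(* The defect of the inequality is a bounded functional of the test function, so it need only be
   nonnegative on indicators, where [fenchel_young] and [recession_ge] apply under the integral. *)
pose H f := \int[e]_x f x - (\sum_i q 0 i * J i f - fstar F q * \int[lam]_x f x).
have -> : \int[e]_x phi x - (\sum_i q 0 i * Dpair u i phi - fstar F q * \int[lam]_x phi x) = H phi.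
  by rewrite /H; congr (_ - (_ - _)); apply: eq_bigr => i _; rewrite pJ.
have bH : bounded_functional H.
  apply: bounded_functional_sub; first exact: bounded_functional_int.
  apply: bounded_functional_sub.
    by apply: bounded_functional_sum => i; exact: bounded_functional_scale.
  by apply: bounded_functional_scale; exact: bounded_functional_int.
apply: (bounded_functional_ge0 bH _ mp (M := M)); last first.
  by move=> x; rewrite p0 (le_trans (ler_norm _)).
move=> A mA; rewrite /H subr_ge0 !Rint_indic//.
pose f1 x := \1_A x * (dotv q (G' x) - fstar F q).
pose f2 x := \1_A x * dotv q (eta' x).
have id1 : integ lam (fun x => dotv q (G' x)) by apply: integ_sum => i; exact: integZ.
have id2 : integ sigma (fun x => dotv q (eta' x)) by apply: integ_sum => i; exact: integZ.
have icst : integ lam (fun=> fstar F q) by exact: finite_measure_integrable_cst.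
have if1 : integ lam f1 by apply: integ_indicM => //; exact: integB.
have if2 : integ sigma f2 by exact: integ_indicM.
have E1 : \sum_i q 0 i * J i \1_A - fstar F q * fine (lam A) =
    \int[lam]_x f1 x + \int[sigma]_x f2 x.
  have sumI (mm : {measure set 'rV[R]_d -> \bar R}) (g : 'rV[R]_d -> 'rV[R]_d) :
      (forall i, integ mm (fun x => g x 0 i)) ->
      \int[mm]_x (\1_A x * dotv q (g x)) = \sum_i q 0 i * \int[mm]_x (\1_A x * g x 0 i).
    move=> gi; transitivity (\int[mm]_x \sum_i q 0 i * (\1_A x * g x 0 i)).
      by apply: eq_Rintegral => x _; rewrite /dotv mulr_sumr; apply: eq_bigr => i _; rewrite mulrCA.
    rewrite Rint_sum; last by move=> i; apply: integZ; exact: integ_indicM.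
    by apply: eq_bigr => i _; rewrite RintZ//; exact: integ_indicM.
  rewrite (_ : \int[lam]_x f1 x =
    \int[lam]_x (\1_A x * dotv q (G' x)) - fstar F q * fine (lam A)).
    rewrite sumI// sumI// addrAC -big_split/=; congr (_ - _).
    by apply: eq_bigr => i _; rewrite -mulrDr.
  rewrite /f1; under eq_Rintegral do rewrite mulrBr.
  rewrite RintB; [|exact: integ_indicM|exact: integ_indicM].
  congr (_ - _); under eq_Rintegral do rewrite mulrC.
  by rewrite RintZ ?Rint_indic//; exact: integ_ind.
rewrite E1 -lee_fin fineK ?fin_num_measure// He EFinD; apply: leeD.
  rewrite /m1 /= /mdens int_set_ge0; apply: Rint_le_int => //.
  - by apply: emeasurable_funM => //; exact/measurable_EFinP.
  - by move=> x; rewrite mule_ge0// lee_fin.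
  - move=> x; rewrite /f1 EFinM lee_wpmul2l ?lee_fin//.
    exact: fenchel_young.
rewrite /m2 /= /mdens int_set_ge0; apply: Rint_le_int => //.
- by apply: emeasurable_funM => //; exact/measurable_EFinP.
- by move=> x; rewrite mule_ge0// lee_fin.
- move=> x; rewrite /f2 EFinM lee_wpmul2l ?lee_fin//.
  exact: recession_ge.
Qed.

(** The derivative of a constant vanishes and F^* is nonnegative, so any finite measure qualifies,
    in particular the zero measure. *)
Lemma subenergy_cst (c : R) (e : {finite_measure set 'rV[R]_d -> \bar R}) :
  subenergy Omega F (fun x => c * \1_Omega x) e.
Proof.
move=> q phi dq tp p0.
rewrite big1 ?sub0r; last first.
  move=> i _; rewrite (_ : Dpair _ _ _ = 0) ?mulr0//.
  rewrite /Dpair (_ : \int[leb]_x _ = \int[leb]_x (c * partial i phi x)).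
    by rewrite RintZ ?(Rint_partial0 i tp) ?mulr0 ?oppr0//; exact: integ_partial tp.
  apply: eq_Rintegral => x _; rewrite -mulrA; congr (_ * _).
  have [K [KO _ cdp]] := test_cont_supp tp; have [_ _ z] := cdp i.
  rewrite indicE; have [Ox|nOx] := pselect (Omega x); first by rewrite mem_set// mul1r.
  by rewrite memNset// mul0r z// => /KO.
apply: (@le_trans _ _ 0).
  by rewrite oppr_le0 mulr_ge0 ?fstar_ge0// Rint_ge0.
exact: Rint_ge0.
Qed.

End energy_measure.

(** * Densities for the minimum and the maximum of two functions *)

Section densities.
Variables (R : realType) (d : nat) (Omega : set 'rV[R]_d).
Hypotheses (oO : open Omega) (bO : bounded_set Omega).
Local Notation leb := (lebesgue_rV R d).
Local Notation lam := (lamO oO bO).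
Let mO : measurable Omega := open_measurable_rV oO.

(* Approximate the indicator of [A] in [L^1(|g| mu)]. *)
Lemma test_ae_ge0 (mu : {finite_measure set 'rV[R]_d -> \bar R}) g : integ mu g ->
  (forall phi, test_function Omega phi -> (forall x, 0 <= phi x) ->
     0 <= \int[mu]_x (phi x * g x)) ->
  {ae mu, forall x, Omega x -> 0 <= g x}.
Proof.
move=> gi Hg; pose ng x := `|g x|.
have ngi : integ mu ng by exact: integ_norm.
have mng : measurable_fun setT (EFin \o ng) by apply/measurable_EFinP; exact: integ_meas ngi.
have ng0 x : (0 <= (EFin \o ng) x)%E by rewrite lee_fin normr_ge0.
pose nu0 : {measure set 'rV[R]_d -> \bar R} := mdens mu mng ng0.
have [|nu Hnu] := @finite_measure_of _ _ _ nu0.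
  by rewrite ltey_eq (mdens_finite mng ng0 ngi).
have nuE (f : 'rV[R]_d -> R) : measurable_fun setT f -> (forall x, 0 <= f x) ->
    \int[nu]_x f x = \int[mu]_x (f x * ng x).
  move=> mf f0; rewrite -(Rint_mdens mu mng ng0)// /Rintegral; congr fine.
  by apply: eq_measure_integral => A mA _; exact: Hnu.
have iOg : integ mu (fun x => \1_Omega x * g x) by exact: integ_indicM.
suff H A : measurable A -> 0 <= \int[mu]_x (\1_A x * (\1_Omega x * g x)).
  apply: filterS (ae_ge0_of_sets iOg H) => x + Ox.
  by rewrite indicE mem_set// mul1r.
move=> mA.
have mAO : measurable (A `&` Omega) by exact: measurableI.
have -> : \int[mu]_x (\1_A x * (\1_Omega x * g x)) = \int[mu]_x (\1_(A `&` Omega) x * g x).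
  apply: eq_Rintegral => x _; rewrite !indicE in_setI.
  by case: (x \in A); case: (x \in Omega); rewrite ?mul1r ?mul0r.
rewrite leNgt; apply/negP => neg.
have w0 : 0 < - (\int[mu]_x (\1_(A `&` Omega) x * g x)) / 2 by rewrite divr_gt0// oppr_gt0.
have [phi [tp p01 pd]] := test_dense oO nu mA w0.
have mp := test_meas tp.
have pg : integ mu (fun x => phi x * g x).
  apply: eq_integrable (integMb (M := 1) gi mp _) => //.
    by move=> x _ /=; rewrite mulrC.
  by move=> x; have /andP[? ?] := p01 x; rewrite ger0_norm.
have Ag : integ mu (fun x => \1_(A `&` Omega) x * g x) by exact: integ_indicM.
have := Hg phi tp (fun x => proj1 (andP (p01 x))).
have : `|\int[mu]_x (phi x * g x) - \int[mu]_x (\1_(A `&` Omega) x * g x)| <=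
    - (\int[mu]_x (\1_(A `&` Omega) x * g x)) / 2.
  apply: le_trans (Rint_normB pg Ag) (le_trans _ pd).
  rewrite nuE//; last first.
    apply: measurableT_comp => //; apply: measurable_funB => //.
  by rewrite le_eqVlt; apply/orP; left; apply/eqP/eq_Rintegral => x _; rewrite -mulrBl normrM.
by rewrite ler_norml => /andP[_]; lra.
Qed.

(** [h] is the density of the derivative of [v]. The last clause is a rate that depends on [v] only
    through [mu] and [K], which makes setwise convergence of densities follow from convergence of
    pairings. *)
Definition represents (mu : {finite_measure set 'rV[R]_d -> \bar R}) (K : R)
    (v : 'rV[R]_d -> R) (h : 'rV[R]_d -> 'rV[R]_d) :=
  [/\ forall i, integ mu (fun x => h x 0 i), forall x, ~ Omega x -> h x = 0,
    forall i phi, test_function Omega phi -> Dpair v i phi = \int[mu]_x (phi x * h x 0 i) &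
    forall i A phi, measurable A -> test_function Omega phi ->
      `|\int[mu]_x (\1_A x * h x 0 i) - Dpair v i phi| <=
      K * \int[mu]_x `|phi x - \1_(A `&` Omega) x| ].

Lemma Dpair_density (mu : {finite_measure set 'rV[R]_d -> \bar R}) (K : R) v : 0 < K ->
  integ leb v ->
  (forall i phi, test_function Omega phi -> `|Dpair v i phi| <= K * \int[mu]_x `|phi x|) ->
  exists h, represents mu K v h.
Proof.
move=> K0 vi vb; have Kn0 : K != 0 by rewrite gt_eqF.
have vpi f i : test_function Omega f -> integ leb (fun x => v x * partial i f x).
  move=> tf; have [C [_ _ cdp]] := test_cont_supp tf.
  have [M M0 HM] := cont_supp_bounded (cdp i).
  apply: (integMb (M := M)) => //; apply: continuous_measurable_rV.
  by have [] := cdp i.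
have D1 i : exists g, [/\ measurable_fun setT g, integ mu g,
    forall f, test_function Omega f -> Dpair v i f / K = \int[mu]_x (f x * g x) &
    forall A f, measurable A -> test_function Omega f ->
    `|\int[mu]_x (\1_A x * g x) - Dpair v i f / K| <= \int[mu]_x `|f x - \1_(A `&` Omega) x|].
  apply: (density_exists oO (mu := mu) (L := fun f => Dpair v i f / K)).
  - move=> f g tf tg; rewrite -mulrDl; congr (_ / _).
    rewrite /Dpair -opprD -RintD; [|exact: vpi|exact: vpi]; congr (- _).
    apply: eq_Rintegral => x _; rewrite (partialD i (test_C1 tf) (test_C1 tg)).
    by rewrite mulrDr.
  - move=> k f tf; rewrite mulrA; congr (_ / _).
    rewrite /Dpair mulrN -RintZ; last exact: vpi; congr (- _).
    apply: eq_Rintegral => x _; rewrite (partialZ i k (test_C1 tf)).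
    by rewrite mulrCA.
  - move=> f tf; rewrite normrM normfV (gtr0_norm K0) ler_pdivrMr// mulrC.
    exact: vb.
have [g Hg] := choice D1.
have gi i : integ mu (g i) by case: (Hg i).
exists (fun x => \row_i (\1_Omega x * (K * g i x))); split.
- by move=> i; under eq_fun do rewrite mxE; apply: integ_indicM => //; exact: integZ.
- by move=> x nOx; apply/rowP => i; rewrite !mxE indicE memNset// mul0r.
- move=> i phi tp; have [_ _ H _] := Hg i.
  have fgi : integ mu (fun x => phi x * g i x).
    have [C [_ cp _]] := test_cont_supp tp; have [M M0 HM] := cont_supp_bounded cp.
    apply: eq_integrable (integMb (M := M) (gi i) (test_meas tp) HM) => // x _ /=.
    by rewrite mulrC.
  rewrite -[LHS](divfK Kn0) H// mulrC -RintZ//; apply: eq_Rintegral => x _.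
  rewrite mxE indicE; have [Ox|nOx] := pselect (Omega x).
    by rewrite mem_set// mul1r mulrCA.
  by rewrite (test_zero_off tp)// !mul0r mulr0.
move=> i A phi mA tp; have [_ _ _ H] := Hg i.
have mAO : measurable (A `&` Omega) by exact: measurableI.
have -> : \int[mu]_x (\1_A x * (\row_i (\1_Omega x * (K * g i x)) : 'rV[R]_d) 0 i) =
    K * \int[mu]_x (\1_(A `&` Omega) x * g i x).
  rewrite -RintZ; last exact: integ_indicM.
  apply: eq_Rintegral => x _; rewrite mxE !indicE in_setI.
  by case: (x \in A); case: (x \in Omega); rewrite ?mul1r ?mul0r ?mulr0.
have -> : Dpair v i phi = K * (Dpair v i phi / K) by rewrite mulrC divfK.
rewrite -mulrBr normrM (gtr0_norm K0) ler_pM2l//.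
by apply: le_trans (H _ _ mAO tp) _; rewrite -setIA setIid.
Qed.

Section pair.
Variable F : 'rV[R]_d -> \bar R.
Hypothesis (F_ge0 : forall xi, (0 <= F xi)%E).
Hypothesis (F0 : F 0 = 0%E).
Hypotheses (F_lsc : lower_semicontinuous F) (F_convex : econvex F).
Variables c c' : R.
Hypotheses (c0 : 0 < c) (c'0 : 0 <= c') (Fc : forall xi, ((c * enorm xi - c')%:E <= F xi)%E).
Variable qs : nat -> 'rV[R]_d.
Hypotheses (qs0 : qs 0%N = 0) (qsd : forall k, fdom F (qs k)).
Hypothesis qs_dense : forall q x (l w : R), fdom F q -> 0 < w -> exists k,
   dotv q x - l * fstar F q <= dotv (qs k) x - l * fstar F (qs k) + w.
Variables e1 e2 e12 mu : {finite_measure set 'rV[R]_d -> \bar R}.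
Hypotheses (e12E : forall A, (e12 A = e1 A + e2 A)%E) (muE : forall A, (mu A = e12 A + lam A)%E).
Variable l : 'rV[R]_d -> R.
Hypotheses (li : integ mu l) (l0 : forall x, 0 <= l x).
Hypothesis lamE : forall A, measurable A -> lam A = (\int[mu]_x (\1_A x * l x))%:E.

(** Then [c * K] is at least 1 and at least [c'], the coefficients in [pair_Dpair_bound]. *)
Let K := (2 + c') / c.
Let K0 : 0 < K. Proof. by rewrite divr_gt0// ltr_wpDr. Qed.

Lemma abs_int_sum phi : test_function Omega phi ->
  \int[e1]_x `|phi x| + \int[e2]_x `|phi x| + \int[leb]_x `|phi x| = \int[mu]_x `|phi x|.
Proof.
move=> tp; have [C [CO cp _]] := test_cont_supp tp; have [M M0 HM] := cont_supp_bounded cp.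
have ma : measurable_fun setT (fun x => `|phi x|) by apply: measurableT_comp => //; exact: test_meas tp.
have HM' x : `| `|phi x| | <= M by rewrite normr_id.
rewrite (Rint_measure_add muE ma HM') (Rint_measure_add e12E ma HM'); congr (_ + _).
by apply: Rint_zero_off => x nOx; rewrite (test_zero_off tp nOx) normr0.
Qed.

Let Rint_abs_ge0 (m : {measure set 'rV[R]_d -> \bar R}) (phi : 'rV[R]_d -> R) : 0 <= \int[m]_x `|phi x|.
Proof. exact: Rint_ge0. Qed.

Let bound3 (D a b z : R) : 0 <= a -> 0 <= b -> 0 <= z -> c * D <= a + b + c' * z ->
  D <= K * (a + b + z).
Proof.
move=> a0 b0 z0 h; rewrite /K mulrAC ler_pdivlMr// mulrC; apply: le_trans h _.
have h1 := mulr_ge0 c'0 a0; have h2 := mulr_ge0 c'0 b0.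
by rewrite !mulrDr !mulrDl; lra.
Qed.

Section lattice_pair.
Variables u m : 'rV[R]_d -> R.
Hypotheses (ui : integ leb u) (uz : zero_off Omega u) (mi : integ leb m) (mz : zero_off Omega m).
Hypotheses (su : subenergy Omega F u e1) (sm : subenergy Omega F m e2).

Let mn x := Num.min (u x) (m x).
Let mx x := Num.max (u x) (m x).

Lemma lattice_integ : integ leb mn /\ integ leb mx.
Proof.
have um : integ leb (fun x => `|u x| + `|m x|) by apply: integD; exact: integ_norm.
have mu' := integ_meas ui; have mm := integ_meas mi.
split; (apply: integ_le; [|exact: um|move=> x]).
- exact: measurable_minr.
- rewrite [leRHS]ger0_norm ?addr_ge0// /mn.
  by case: (leP (u x) (m x)) => _; rewrite ?lerDl ?lerDr.
- exact: measurable_maxr.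
- rewrite [leRHS]ger0_norm ?addr_ge0// /mx.
  by case: (leP (u x) (m x)) => _; rewrite ?lerDl ?lerDr.
Qed.

Lemma lattice_zero_off : zero_off Omega mn /\ zero_off Omega mx.
Proof. by split=> x nOx; rewrite /mn /mx uz// mz// ?minxx ?maxxx. Qed.

Local Notation cs h := (csup (affine_fam F qs l h)).

(** Almost everywhere, and for all pairs of the countable family at once, an affine function of [hn]
    plus one of [hx] is below the density of [e12]. The two indices being independent, both suprema
    can be taken. *)
Lemma pair_density : exists hn hx, [/\ represents mu K mn hn, represents mu K mx hx &
  (\int[mu]_x cs hn x + \int[mu]_x cs hx x <= e12 setT)%E].
Proof.
have [ni xi] := lattice_integ; have [nz xz] := lattice_zero_off.
have bnd i phi : test_function Omega phi -> `|Dpair mn i phi| <= K * \int[mu]_x `|phi x| /\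
    `|Dpair mx i phi| <= K * \int[mu]_x `|phi x|.
  move=> tp; have [h1 h2] := pair_Dpair_bound oO bO F_ge0 F0 c0 Fc i tp ui uz mi mz su sm.
  by rewrite -abs_int_sum//; split; apply: bound3.
have [hn Hn] := Dpair_density K0 ni (fun i phi tp => proj1 (bnd i phi tp)).
have [hx Hx] := Dpair_density K0 xi (fun i phi tp => proj2 (bnd i phi tp)).
exists hn, hx; split => //.
have [ihn hnz hnE _] := Hn; have [ihx hxz hxE _] := Hx.
have emu A : measurable A -> (e12 A <= mu A)%E by move=> mA; rewrite muE leeDl.
have [k [ki k0 kE]] := measure_density emu.
have aff (hh : 'rV[R]_d -> 'rV[R]_d) := @affine_fam_integ R d F qs mu l li hh.
have ae1 i j : {ae mu, forall x, affine_fam F qs l hn i x + affine_fam F qs l hx j x <= k x}.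
  pose g x := k x - (affine_fam F qs l hn i x + affine_fam F qs l hx j x).
  have gi : integ mu g by apply: integB => //; apply: integD; exact: aff.
  suff : {ae mu, forall x, Omega x -> 0 <= g x}.
    apply: filterS => x; rewrite /g subr_ge0; have [Ox|nOx] := pselect (Omega x).
      exact.
    move=> _; rewrite /affine_fam hnz// hxz// ![dotv _ 0]dotvC !dotv0l !sub0r -opprD.
    by rewrite (le_trans _ (k0 x))// oppr_le0 addr_ge0// mulr_ge0// fstar_ge0.
  apply: test_ae_ge0 => // phi tp p0.
  have [C [CO cp _]] := test_cont_supp tp; have [M M0 HM] := cont_supp_bounded cp.
  have mp := test_meas tp.
  have mulI f : integ mu f -> integ mu (fun x => phi x * f x).
    move=> fi; apply: eq_integrable (integMb (M := M) fi mp HM) => // x _ /=.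
    by rewrite mulrC.
  have kphi : \int[mu]_x (phi x * k x) = \int[e1]_x phi x + \int[e2]_x phi x.
    rewrite -(Rint_measure_add e12E mp HM).
    apply/esym/(bounded_functional_eq (bounded_functional_int e12) (bounded_functional_density ki) _ mp HM).
    by move=> A mA; rewrite Rint_indic// kE.
  have lphi : \int[mu]_x (phi x * l x) = \int[leb]_x phi x.
    rewrite (Rint_zero_off oO bO (test_zero_off tp)).
    apply/esym/(bounded_functional_eq (bounded_functional_int lam) (bounded_functional_density li) _ mp HM).
    by move=> A mA; rewrite Rint_indic//; have /(congr1 fine) := lamE mA.
  have affE (v : 'rV[R]_d -> R) (hh : 'rV[R]_d -> 'rV[R]_d) q : (forall i, integ mu (fun x => hh x 0 i)) ->
      (forall i phi, test_function Omega phi -> Dpair v i phi = \int[mu]_x (phi x * hh x 0 i)) ->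
      \int[mu]_x (phi x * (dotv q (hh x) - l x * fstar F q)) =
      \sum_i q 0 i * Dpair v i phi - fstar F q * \int[leb]_x phi x.
    move=> ih hE; transitivity (\int[mu]_x (\sum_i q 0 i * (phi x * hh x 0 i) - fstar F q * (phi x * l x))).
      apply: eq_Rintegral => x _; rewrite mulrBr /dotv mulr_sumr; congr (_ - _).
        by apply: eq_bigr => a _; rewrite mulrCA.
      by ring.
    rewrite RintB; last 2 first.
    - by apply: integ_sum => a; apply: integZ; exact: mulI.
    - by apply: integZ; exact: mulI.
    rewrite Rint_sum; last by move=> a; apply: integZ; exact: mulI.
    rewrite RintZ ?lphi; last exact: mulI.
    by congr (_ - _); apply: eq_bigr => a _; rewrite RintZ ?hE//; exact: mulI.
  rewrite /g; under eq_Rintegral do rewrite mulrBr mulrDr.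
  have i1 := mulI _ (aff _ ihn i); have i2 := mulI _ (aff _ ihx j).
  rewrite RintB; [|exact: mulI|exact: integD].
  rewrite RintD// kphi (affE mn)// (affE mx)// subr_ge0.
  have := pair_subenergy oO bO tp p0 (qsd i) (qsd j) ui uz mi mz su sm.
  by rewrite mulrDl opprD addrACA.
have ae2 : {ae mu, forall x, (cs hn x + cs hx x <= (k x)%:E)%E}.
  have : {ae mu, forall x, forall i, forall j,
      affine_fam F qs l hn i x + affine_fam F qs l hx j x <= k x}.
    by apply: ae_foralln => i; apply: ae_foralln => j; exact: ae1.
  apply: filterS => x H.
  have h1 j : (cs hn x <= (k x - affine_fam F qs l hx j x)%:E)%E.
    by apply: ge_ereal_sup => _ [i _ <-]; rewrite lee_fin lerBrDr.
  (* Finiteness of the first supremum, needed to move it across the inequality; it follows from the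
     index 0, whose affine function vanishes. *)
  have fn : cs hn x \is a fin_num.
    rewrite ge0_fin_numE; last by apply: csup_ge0 => y; exact: affine_fam0.
    by apply: le_lt_trans (h1 0%N) _; rewrite ltry.
  rewrite -(fineK fn) addeC -leeBrDr// -EFinB; apply: ge_ereal_sup => _ [j _ <-].
  by rewrite lee_fin lerBrDr addrC -lerBrDr -lee_fin fineK.
have cs0 hh x : (0 <= cs hh x)%E by apply: csup_ge0 => y; exact: affine_fam0.
have mcs (hh : 'rV[R]_d -> 'rV[R]_d) : (forall i, integ mu (fun x => hh x 0 i)) -> measurable_fun setT (cs hh).
  by move=> ih; apply: csup_meas (aff _ ih) _ => x; exact: affine_fam0.
rewrite -ge0_integralD//; [|exact: mcs|exact: mcs].
have -> : e12 setT = (\int[mu]_x (k x)%:E)%E.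
  rewrite kE// -int_setE//.
apply: ae_ge0_le_integral => //.
- by move=> x _; rewrite adde_ge0.
- by apply: emeasurable_funD; exact: mcs.
- by move=> x _; rewrite lee_fin.
- by apply/measurable_EFinP; exact: integ_meas ki.
- by apply: filterS ae2 => x + _.
Qed.

End lattice_pair.
End pair.

End densities.

(** * Submodularity and truncation *)

(** The flag lets one argument treat truncation from above and from below. *)
Definition lat (R : realDomainType) (b : bool) (x y : R) : R :=
  if b then Num.min x y else Num.max x y.

Lemma disjoint_sum_le d (T : measurableType d) (R : realType) (A : nat -> set T)
    (G : nat -> T -> R) n x (z : \bar R) : trivIset setT A -> (0 <= z)%E ->
  (forall k, ((G k x)%:E <= z)%E) -> ((\sum_(k < n) \1_(A k) x * G k x)%:E <= z)%E.
Proof.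
move=> tA z0 Gz; have [[j Aj]|nA] := pselect (exists j : 'I_n, A j x); last first.
  rewrite big1// => j _; rewrite indicE memNset ?mul0r// => Aj; apply: nA; by exists j.
rewrite (bigD1 j)//= indicE mem_set// mul1r big1 ?addr0// => i ij.
rewrite indicE memNset ?mul0r// => Ai.
move/trivIsetP : tA => /(_ i j I I); rewrite -val_eqE in ij => /(_ ij).
by move/seteqP => [/(_ x (conj Ai Aj))].
Qed.

Lemma quarter_dist (R : realFieldType) (a b p q e : R) : `|a - p| <= e / 4 ->
  `|b - q| <= e / 4 -> `|p - q| <= e / 4 -> 0 < e -> `|a - b| < e.
Proof. by rewrite !ler_norml ltr_norml; lra. Qed.

Lemma third_sum (R : realFieldType) (x y E w s : R) :
  0 < w -> x + y <= E + w / 3 + 0 -> E - w / 3 < s -> s <= x -> y <= w.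
Proof. lra. Qed.

Lemma mul_div_quarter (R : realFieldType) (z e : R) : 0 < z -> z * (e / (4 * z)) = e / 4.
Proof. by move=> z0; field; rewrite gt_eqF. Qed.

Section submodularity.
Variables (R : realType) (d : nat) (Omega : set 'rV[R]_d).
Hypotheses (oO : open Omega) (bO : bounded_set Omega).
Local Notation leb := (lebesgue_rV R d).
Local Notation lam := (lamO oO bO).
Let mO : measurable Omega := open_measurable_rV oO.
Variable F : 'rV[R]_d -> \bar R.
Hypothesis (F_ge0 : forall xi, (0 <= F xi)%E).
Hypothesis (F0 : F 0 = 0%E).
Hypotheses (F_lsc : lower_semicontinuous F) (F_convex : econvex F).
Variables c c' : R.
Hypotheses (c0 : 0 < c) (c'0 : 0 <= c') (Fc : forall xi, ((c * enorm xi - c')%:E <= F xi)%E).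
Let K := (2 + c') / c.
Let K0 : 0 < K. Proof. by rewrite divr_gt0// ltr_wpDr. Qed.

(** [mu = e1 + e2 + lam] dominates the energy measures and the volume, so derivatives, energy and
    volume all become densities against the same measure. *)
Lemma common_density (e1 e2 : {finite_measure set 'rV[R]_d -> \bar R}) :
  exists (e12 mu : {finite_measure set 'rV[R]_d -> \bar R}) l,
  [/\ forall A, (e12 A = e1 A + e2 A)%E, forall A, (mu A = e12 A + lam A)%E,
    integ mu l, forall x, 0 <= l x &
    forall A, measurable A -> lam A = (\int[mu]_x (\1_A x * l x))%:E].
Proof.
have [e12 e12E] := finite_measure_add e1 e2.
have [mu muE] := finite_measure_add e12 lam.
have [l [li l0 lE]] : exists k, [/\ integ mu k, forall x, 0 <= k x &
    forall A, measurable A -> lam A = (\int[mu]_x (\1_A x * k x))%:E].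
  by apply: measure_density => A mA; rewrite muE leeDr.
by exists e12, mu, l.
Qed.

Lemma total_sum (e1 e2 e12 : {finite_measure set 'rV[R]_d -> \bar R}) (a b : R) :
  (forall A, (e12 A = e1 A + e2 A)%E) -> fine (e1 setT) <= a -> fine (e2 setT) <= b ->
  (e12 setT <= (a + b)%:E)%E.
Proof.
move=> E h1 h2; rewrite E -[e1 _]fineK ?fin_num_measure// -[e2 _]fineK ?fin_num_measure//.
by rewrite -EFinD lee_fin lerD.
Qed.

Lemma fin_split (x y : \bar R) (a : R) : (0 <= x)%E -> (0 <= y)%E -> (x + y <= a%:E)%E ->
  [/\ (x <= (fine x)%:E)%E, (y <= (fine y)%:E)%E & fine x + fine y <= a].
Proof.
move=> x0 y0 h.
have fx : x \is a fin_num.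
  by rewrite ge0_fin_numE// (le_lt_trans _ (ltry a))// (le_trans _ h)// leeDl.
have fy : y \is a fin_num.
  by rewrite ge0_fin_numE// (le_lt_trans _ (ltry a))// (le_trans _ h)// leeDr.
by rewrite !fineK// -lee_fin EFinD !fineK.
Qed.

(** [representation] turns the two suprema of [pair_density] into bounds for the two energies. Real
    majorants [x] and [y] are returned, so that later comparisons are linear inequalities between
    reals. *)
Theorem submodular b u m (a a' : R) : integ leb u -> zero_off Omega u ->
  integ leb m -> zero_off Omega m ->
  (bulk_energy Omega F u < a%:E)%E -> (bulk_energy Omega F m < a'%:E)%E ->
  exists x y : R, [/\ BV Omega (fun z => lat b (u z) (m z)) /\
      (bulk_energy Omega F (fun z => lat b (u z) (m z)) <= x%:E)%E,
    BV Omega (fun z => lat (~~ b) (u z) (m z)) /\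
      (bulk_energy Omega F (fun z => lat (~~ b) (u z) (m z)) <= y%:E)%E &
    x + y <= a + a'].
Proof.
move=> ui uz mi mz ua ma.
have [e1 [e1T su]] := energy_measure oO bO F_ge0 F0 F_lsc uz ua.
have [e2 [e2T sm]] := energy_measure oO bO F_ge0 F0 F_lsc mz ma.
have [e12 [mu [l [e12E muE li l0 lE]]]] := common_density e1 e2.
have [qs [qs0 qsd qsD]] := conjugate_countable F_ge0 F0.
have [hn [hx [Rn Rx hs]]] := pair_density F_ge0 F0 c0 c'0 Fc qs0 qsd e12E muE li l0 lE ui uz mi mz su sm.
have [ni xi] := lattice_integ ui mi; have [nz xz] := lattice_zero_off uz mz.
have [n1 n2 n3 _] := Rn; have [x1 x2 x3 _] := Rx.
have reN := representation F_ge0 F0 F_lsc F_convex qs0 qsD li l0 lE ni nz n1 n2 n3.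
have reX := representation F_ge0 F0 F_lsc F_convex qs0 qsD li l0 lE xi xz x1 x2 x3.
have cs0 h : (0 <= \int[mu]_x csup (affine_fam F qs l h) x)%E.
  by apply: integral_ge0 => x _; apply: csup_ge0 => y; exact: affine_fam0.
have [fn fx fs] := fin_split (cs0 hn) (cs0 hx) (le_trans hs (total_sum e12E e1T e2T)).
pose sn := fine (\int[mu]_x csup (affine_fam F qs l hn) x)%E.
pose sx := fine (\int[mu]_x csup (affine_fam F qs l hx) x)%E.
case: b; [exists sn, sx|exists sx, sn]; split; rewrite /lat/=.
- by have [? h] := reN; split => //; exact: le_trans h fn.
- by have [? h] := reX; split => //; exact: le_trans h fx.
- exact: fs.
- by have [? h] := reX; split => //; exact: le_trans h fx.
- by have [? h] := reN; split => //; exact: le_trans h fn.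
- by rewrite addrC.
Qed.

(* The energies of the two truncations at level [k n] add up to at most the
   energy of [u], and one of the truncations converges to [u]: by lower
   semicontinuity the energy of the other vanishes. *)
Theorem truncation_energy b u (k : nat -> R) (w : R) : integ leb u -> zero_off Omega u ->
  (bulk_energy Omega F u < +oo)%E ->
  (fun n => \int[lam]_x `|lat b (u x) (k n * \1_Omega x) - u x|) @ \oo --> (0 : R) -> 0 < w ->
  exists N, forall n, (N <= n)%N ->
    (bulk_energy Omega F (fun z => lat (~~ b) (u z) (k n * \1_Omega z)) <= w%:E)%E.
Proof.
move=> ui uz ufin ku w0.
pose E := fine (bulk_energy Omega F u).
have uE : bulk_energy Omega F u = E%:E by rewrite fineK// ge0_fin_numE ?bulk_energy_ge0.
have w30 : 0 < w / 3 by rewrite divr_gt0.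
have ua : (bulk_energy Omega F u < (E + w / 3)%:E)%E by rewrite uE lte_fin ltrDl.
have [e1 [e1T su]] := energy_measure oO bO F_ge0 F0 F_lsc uz ua.
(* The zero measure is an energy measure of every constant, so [mu] is the same for all levels
   [k n]. *)
have [e2 e2E] := @finite_measure0 _ 'rV[R]_d R.
have e2T : fine (e2 setT) <= 0 by rewrite e2E.
have [e12 [mu [l [e12E muE li l0 lE]]]] := common_density e1 e2.
have [qs [qs0 qsd qsD]] := conjugate_countable F_ge0 F0.
have aff (h : 'rV[R]_d -> 'rV[R]_d) := @affine_fam_integ R d F qs mu l li h.
have aff0 h x := affine_fam0 F_ge0 F0 qs0 l h x.
have iOk n : integ leb (fun x => k n * \1_Omega x).
  apply: integZ; apply/(integ_zero_off oO bO).
    by move=> x nOx; rewrite indicE memNset.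
  exact: integ_ind.
have zOk n : zero_off Omega (fun x => k n * \1_Omega x).
  by move=> x nOx; rewrite indicE memNset// mulr0.
have pairs n : exists hb hb', [/\ represents Omega mu K (fun x => lat b (u x) (k n * \1_Omega x)) hb,
   represents Omega mu K (fun x => lat (~~ b) (u x) (k n * \1_Omega x)) hb' &
   (\int[mu]_x csup (affine_fam F qs l hb) x + \int[mu]_x csup (affine_fam F qs l hb') x <= e12 setT)%E].
  have sc : subenergy Omega F (fun x => k n * \1_Omega x) e2 by exact: subenergy_cst.
  have [hn [hx [Rn Rx hs]]] := pair_density F_ge0 F0 c0 c'0 Fc qs0 qsd e12E muE li l0 lE ui uz
    (iOk n) (zOk n) su sc.
  by case: (b); [exists hn, hx|exists hx, hn]; split => //; rewrite addeC.
have [hb Hb] := choice pairs; have [hb' Hb'] := choice Hb.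
have bndu i phi : test_function Omega phi -> `|Dpair u i phi| <= K * \int[mu]_x `|phi x|.
  move=> tp; have [h _] := pair_Dpair_bound oO bO F_ge0 F0 c0 Fc i tp ui uz ui uz su su.
  have E' : (fun x => Num.min (u x) (u x)) = u by apply/funext => x; rewrite minxx.
  rewrite E' in h; rewrite -(abs_int_sum e12E muE tp).
  have z0 (m : {measure set 'rV[R]_d -> \bar R}) : 0 <= \int[m]_x `|phi x| by exact: Rint_ge0.
  move: (z0 e1) (z0 e2) (z0 leb) h; move: (\int[e1]_x _) (\int[e2]_x _) (\int[leb]_x _).
  move=> x y z x0 y0 zz0 h; rewrite /K mulrAC ler_pdivlMr// mulrC; apply: le_trans h _.
  have h1 := mulr_ge0 c'0 x0; have h2 := mulr_ge0 c'0 y0.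
  by rewrite !mulrDr !mulrDl; lra.
have [hu [u1 u2 u3 u4]] := Dpair_density oO K0 ui bndu.
have [_ reU] := representation F_ge0 F0 F_lsc F_convex qs0 qsD li l0 lE ui uz u1 u2 u3.
(* Finitely many affine functions already see the energy of [u] up to [w / 3]; on the resulting
   fixed partition only set integrals of the densities are needed. *)
have [N HN] : exists N, E - w / 3 < \int[mu]_x fmax (affine_fam F qs l hu) N x.
  apply: (int_csup_gt (aff _ u1) (aff0 hu)); apply: lt_le_trans reU.
  by rewrite uE lte_fin ltrBlDr ltrDl.
have [A [mA tA HA]] := fmax_partition (aff _ u1) N.
have h1 n i : integ mu (fun x => hb n x 0 i) by have [[h _ _ _] _ _] := Hb' n; exact: h.
have setE (h : 'rV[R]_d -> 'rV[R]_d) j B : measurable B -> (forall i, integ mu (fun x => h x 0 i)) ->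
    \int[mu]_x (\1_B x * affine_fam F qs l h j x) =
    \sum_i qs j 0 i * \int[mu]_x (\1_B x * h x 0 i) - fstar F (qs j) * \int[mu]_x (\1_B x * l x).
  move=> mB ih; have iB i : integ mu (fun x => \1_B x * h x 0 i) by exact: integ_indicM.
  transitivity (\int[mu]_x (\sum_i qs j 0 i * (\1_B x * h x 0 i) - fstar F (qs j) * (\1_B x * l x))).
    apply: eq_Rintegral => x _; rewrite /affine_fam mulrBr /dotv mulr_sumr; congr (_ - _).
      by apply: eq_bigr => a _; rewrite mulrCA.
    by ring.
  have iBl : integ mu (fun x => \1_B x * l x) by exact: integ_indicM.
  rewrite RintB; [|by apply: integ_sum => a; exact: integZ|exact: integZ].
  rewrite Rint_sum ?RintZ//; last by move=> a; exact: integZ.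
  by congr (_ - _); apply: eq_bigr => a _; rewrite RintZ.
have cvg_set B i : measurable B ->
    (fun n => \int[mu]_x (\1_B x * hb n x 0 i)) @ \oo --> \int[mu]_x (\1_B x * hu x 0 i).
  move=> mB; apply/cvgnP => e e0; have d0 : 0 < e / (4 * K) by rewrite divr_gt0// mulr_gt0.
  (* One [phi] serves every [n], since all truncations share [mu] and [K] in [represents]; it
     remains to let the pairing with [phi] converge. *)
  have [phi [tp p01 pd]] := test_dense oO mu mB d0.
  have [C [CO _ cdp]] := test_cont_supp tp; have [M M0 HM] := cont_supp_bounded (cdp i).
  have M1 : 0 < M + 1 by rewrite ltr_wpDl.
  have /cvgnP/(_ (e / (4 * (M + 1)))) [|n0 Hn0] := ku.
    by rewrite divr_gt0// mulr_gt0.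
  exists n0 => n nn0.
  have [[_ _ _ b4] _ _] := Hb' n.
  have t1 := b4 i B phi mB tp; have t2 := u4 i B phi mB tp.
  have iv : integ leb (fun x => lat b (u x) (k n * \1_Omega x)).
    have [? ?] := lattice_integ ui (iOk n); by rewrite /lat; case: (b).
  have t3 : `|Dpair (fun x => lat b (u x) (k n * \1_Omega x)) i phi - Dpair u i phi| <=
      M * \int[lam]_x `|lat b (u x) (k n * \1_Omega x) - u x|.
    apply: (Dpair_close tp HM (integ_meas iv) (integ_lamO oO bO ui)) => //.
    by apply: integ_norm; apply: integB; apply: integ_lamO.
  have t4 := Hn0 n nn0; rewrite subr0 ger0_norm in t4; last exact: Rint_ge0.
  have Kd : K * \int[mu]_x `|phi x - \1_(B `&` Omega) x| <= e / 4.
    apply: le_trans (ler_wpM2l (ltW K0) pd) _.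
    by rewrite mul_div_quarter.
  have Md : M * \int[lam]_x `|lat b (u x) (k n * \1_Omega x) - u x| <= e / 4.
    apply: (@le_trans _ _ ((M + 1) * (e / (4 * (M + 1))))).
      by apply: ler_pM => //; [exact: Rint_ge0|rewrite lerDl|exact: ltW].
    by rewrite mul_div_quarter.
  exact: quarter_dist (le_trans t1 Kd) (le_trans t2 Kd) (le_trans t3 Md) e0.
pose S (h : 'rV[R]_d -> 'rV[R]_d) := \sum_(j < N) \int[mu]_x (\1_(A j) x * affine_fam F qs l h j x).
have iS (h : 'rV[R]_d -> 'rV[R]_d) : (forall i, integ mu (fun x => h x 0 i)) ->
    forall j, integ mu (fun x => \1_(A j) x * affine_fam F qs l h j x).
  by move=> ih j; apply: integ_indicM => //; exact: aff.
have Sint (h : 'rV[R]_d -> 'rV[R]_d) : (forall i, integ mu (fun x => h x 0 i)) ->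
    S h = \int[mu]_x \sum_(j < N) \1_(A j) x * affine_fam F qs l h j x.
  by move=> ih; rewrite Rint_sum//; exact: iS.
have Su : E - w / 3 < S hu.
  by rewrite Sint//; under eq_Rintegral do rewrite -HA.
have cS : (fun n => S (hb n)) @ \oo --> S hu.
  apply: cvg_big => [|j _]; first exact: add_continuous.
  rewrite setE//; under eq_fun do rewrite setE//.
  apply: cvgB; last exact: cvg_cst.
  apply: cvg_big => [|i _]; first exact: add_continuous.
  by apply: cvgM; [exact: cvg_cst|exact: cvg_set].
have /cvgnP/(_ (S hu - (E - w / 3))) [|n0 Hn0] := cS; first by rewrite subr_gt0.
exists n0 => n nn0; have Sn : E - w / 3 < S (hb n).
  have := Hn0 n nn0; rewrite ltr_norml => /andP[]; lra.
have [Rb Rb' hs] := Hb' n; have [r1 r2 r3 _] := Rb'.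
have [ni xi] := lattice_integ ui (iOk n); have [nz xz] := lattice_zero_off uz (zOk n).
have i' : integ leb (fun x => lat (~~ b) (u x) (k n * \1_Omega x)) by rewrite /lat; case: (b).
have z' : zero_off Omega (fun x => lat (~~ b) (u x) (k n * \1_Omega x)) by rewrite /lat; case: (b).
have [_ re'] := representation F_ge0 F0 F_lsc F_convex qs0 qsD li l0 lE i' z' r1 r2 r3.
have cs0 h : (0 <= \int[mu]_x csup (affine_fam F qs l h) x)%E.
  by apply: integral_ge0 => x _; apply: csup_ge0 => y; exact: affine_fam0.
have [fb fb' fs] := fin_split (cs0 (hb n)) (cs0 (hb' n)) (le_trans hs (total_sum e12E e1T e2T)).
have Sb : S (hb n) <= fine (\int[mu]_x csup (affine_fam F qs l (hb n)) x)%E.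
  rewrite -lee_fin; apply: le_trans fb; rewrite Sint//; apply: Rint_le_int => //.
  - by apply: integ_sum => j; exact: iS.
  - by apply: csup_meas (aff _ (h1 n)) _ => x; exact: affine_fam0.
  - by move=> x; apply: csup_ge0 => y; exact: affine_fam0.
  move=> x; apply: disjoint_sum_le => //; first by apply: csup_ge0 => y; exact: affine_fam0.
  by move=> j; apply: ereal_sup_ubound; exists j.
(* Both truncations together cost at most [E + w / 3], and the first one alone more than
   [E - w / 3]. *)
apply: le_trans re' (le_trans fb' _); rewrite lee_fin.
exact: third_sum w0 fs Sn Sb.
Qed.

End submodularity.

(** * The minimizing movement scheme *)

Lemma sum_sqr_le (R : rcfType) (D : nat -> R) (n : nat) : (forall k, 0 <= D k) ->
  (\sum_(k < n) D k) ^+ 2 <= n%:R * \sum_(k < n) D k ^+ 2.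
Proof.
move=> D0; elim: n => [|n IH]; first by rewrite !big_ord0 expr0n mul0r.
rewrite !big_ord_recr/=; set S := \sum_(k < n) D k; set Q := \sum_(k < n) D k ^+ 2.
rewrite -/S -/Q in IH; have S0 : 0 <= S by exact: sumr_ge0.
have Q0 : 0 <= Q by apply: sumr_ge0 => k _; exact: sqr_ge0.
have dn := D0 n; set e := D n in dn *.
have n0 : 0 <= n%:R :> R by [].
(* The inequality between the means of [Q] and [n * e^2], after bounding [S^2] by [n * Q]. *)
have key : 2 * (S * e) <= Q + n%:R * e ^+ 2.
  rewrite -ler_sqr ?nnegrE ?mulr_ge0 ?addr_ge0 ?mulr_ge0 ?sqr_ge0//.
  have h : S ^+ 2 * e ^+ 2 <= n%:R * Q * e ^+ 2 by rewrite ler_wpM2r// sqr_ge0.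
  have h' := sqr_ge0 (Q - n%:R * e ^+ 2).
  rewrite !exprMn; move: h h'; set X := S ^+ 2 * e ^+ 2 => h h'.
  have -> : (Q + n%:R * e ^+ 2) ^+ 2 = (Q - n%:R * e ^+ 2) ^+ 2 + 4 * (n%:R * Q * e ^+ 2) by ring.
  rewrite -/X; lra.
rewrite -[n.+1%:R]natr1; have -> : (S + e) ^+ 2 = S ^+ 2 + 2 * (S * e) + e ^+ 2 by ring.
have -> : (n%:R + 1) * (Q + e ^+ 2) = n%:R * Q + (Q + n%:R * e ^+ 2) + e ^+ 2 by ring.
by rewrite lerD2r lerD.
Qed.

Lemma telescope_le (R : realDomainType) (P D : nat -> R) (c : R) :
  (forall n, P n.+1 + c * D n ^+ 2 <= P n) ->
  forall n, P n + c * \sum_(k < n) D k ^+ 2 <= P 0%N.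
Proof.
move=> h; elim=> [|n IH]; first by rewrite big_ord0 mulr0 addr0.
apply: le_trans IH; rewrite big_ord_recr/= mulrDr addrA addrAC.
by rewrite lerD2r.
Qed.

Lemma sum_shift_le (R : realDomainType) (D : nat -> R) (m n : nat) : (m <= n)%N ->
  (forall k, 0 <= D k) -> \sum_(j < n - m) D (m + j)%N <= \sum_(k < n) D k.
Proof.
move=> mn D0; rewrite -(big_mkord xpredT D) (@big_cat_nat _ _ _ m)//=.
have -> : \sum_(m <= i < n) D i = \sum_(0 <= i < n - m) D (i + m)%N.
  by rewrite -{1}[m]add0n big_addn.
rewrite ler_wpDl ?sumr_ge0// big_mkord.
by apply: ler_sum => j _; rewrite addnC.
Qed.

Lemma lee_sqr0 (R : realDomainType) (x y : \bar R) (k : R) :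
  (x <= y + (k * 0 ^+ 2)%:E)%E -> (x <= y)%E.
Proof. by rewrite expr0n mulr0 adde0. Qed.

(** * Independence of the values outside Omega *)

Section restriction.
Variables (R : realType) (d : nat) (Omega : set 'rV[R]_d).
Hypothesis oO : open Omega.
Variables (F : 'rV[R]_d -> \bar R) (bc : boundary_condition R d).
Implicit Types u v : 'rV[R]_d -> R.
Local Notation leb := (lebesgue_rV R d).
Let mO : measurable Omega := open_measurable_rV oO.

Lemma L1_congr u v : {in Omega, u =1 v} -> L1 Omega u -> L1 Omega v.
Proof. by move=> uv; apply: eq_integrable => // x Ox /=; rewrite uv. Qed.

Lemma distributional_derivative_congr u v Du : {in Omega, u =1 v} ->
  distributional_derivative Omega u Du -> distributional_derivative Omega v Du.
Proof.
move=> uv [h1 h2]; split => // i phi tp; rewrite -h2//.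
by apply: eq_Rintegral => x Ox; rewrite uv.
Qed.

Let in_sym u v : {in Omega, u =1 v} -> {in Omega, v =1 u}.
Proof. by move=> uv x Ox; rewrite uv. Qed.

Lemma BV_congr u v : {in Omega, u =1 v} -> BV Omega u -> BV Omega v.
Proof.
move=> uv [h [Du dD]]; split; first exact: L1_congr h.
by exists Du; exact: distributional_derivative_congr dD.
Qed.

Lemma bulk_energy_congr u v : {in Omega, u =1 v} -> bulk_energy Omega F u = bulk_energy Omega F v.
Proof.
move=> uv; congr ereal_inf; apply/seteqP; split => e [Du [G [Ds [sigma [eta [h1 h2 h3]]]]]];
  exists Du, G, Ds, sigma, eta; split => //.
  exact: distributional_derivative_congr h1.
by apply: distributional_derivative_congr h1; exact: in_sym.
Qed.

Lemma trace_congr u v : {in Omega, u =1 v} -> trace Omega u = trace Omega v.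
Proof.
move=> uv; apply/funext => x; rewrite /trace; congr xget; apply/funext => z.
suff E : (fun r : R => r ^- d * \int[leb]_(y in Omega `&` [set y | enorm (y - x) < r]) `|u y - z|) =
    fun r : R => r ^- d * \int[leb]_(y in Omega `&` [set y | enorm (y - x) < r]) `|v y - z|.
  by rewrite /is_trace E.
apply/funext => r; congr (_ * _).
by apply: eq_Rintegral => y; rewrite inE => -[Oy _]; rewrite uv//; exact: mem_set.
Qed.

Lemma Phi_congr u v : {in Omega, u =1 v} -> Phi Omega F bc u = Phi Omega F bc v.
Proof.
move=> uv; rewrite /Phi (bulk_energy_congr uv).
have -> : `[< BV Omega u >] = `[< BV Omega v >].
  by apply: asbool_equiv_eq; split; apply: BV_congr => //; exact: in_sym.
have -> : boundary_energy Omega F bc u = boundary_energy Omega F bc v.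
  by rewrite /boundary_energy (trace_congr uv).
by [].
Qed.

Hypothesis F_ge0 : forall xi, (0 <= F xi)%E.
Hypothesis F0 : F 0 = 0%E.

Lemma Phi_bulk u : (Phi Omega F bc u < +oo)%E ->
  BV Omega u /\ (bulk_energy Omega F u <= Phi Omega F bc u)%E.
Proof.
rewrite /Phi; case: asboolP => // bv _; split => //.
rewrite leeDl// /boundary_energy; case: bc => // g.
by apply: integral_ge0 => x _; exact: recession_ge0.
Qed.

Lemma Phi_ge0 u : (0 <= Phi Omega F bc u)%E.
Proof.
have [h|h] := ltP (Phi Omega F bc u) +oo%E; last by rewrite (le_trans _ h)// leey.
by have [_ /(le_trans _)] := Phi_bulk h; apply; exact: bulk_energy_ge0.
Qed.

End restriction.

Section scheme.
Variables (R : realType) (d : nat) (Omega : set 'rV[R]_d).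
Hypotheses (oO : open Omega) (bO : bounded_set Omega).
Local Notation leb := (lebesgue_rV R d).
Local Notation lam := (lamO oO bO).
Variables (F : 'rV[R]_d -> \bar R) (bc : boundary_condition R d).
Hypothesis F_ge0 : forall xi, (0 <= F xi)%E.
Hypothesis F0 : F 0 = 0%E.
Variables (u0 : 'rV[R]_d -> R) (tau : R) (un : nat -> 'rV[R]_d -> R).
Hypotheses (u0L : L1 Omega u0) (u0f : (Phi Omega F bc u0 < +oo)%E) (tau0 : 0 < tau).
Hypothesis scheme : minimizing_movement Omega F bc tau u0 un.

(** Only the restriction of an iterate to Omega is determined; this representative can be integrated
    over the whole space and mollified. *)
Definition ext0 n : 'rV[R]_d -> R := un n \_ Omega.

Let eqO (v : 'rV[R]_d -> R) : {in Omega, v \_ Omega =1 v}.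
Proof. by move=> x Ox; rewrite patchE Ox. Qed.

Let unL n : L1 Omega (un n).
Proof. by case: scheme => e0 h; case: n => [|n]; [rewrite e0|case: (h n)]. Qed.

Lemma patch_integ v : L1 Omega v -> integ leb (v \_ Omega) /\ zero_off Omega (v \_ Omega).
Proof.
move=> vL; have z : zero_off Omega (v \_ Omega) by move=> x nOx; rewrite patchE memNset.
by split => //; apply/(integ_zero_off oO bO z); exact: L1_patch.
Qed.

Lemma ext0_integ n : integ leb (ext0 n) /\ zero_off Omega (ext0 n).
Proof. exact: patch_integ. Qed.

Definition dist1 (f g : 'rV[R]_d -> R) := \int[lam]_x `|f x - g x|.

Let L1norm_dist u v f g : {in Omega, u =1 f} -> {in Omega, v =1 g} -> integ leb f -> integ leb g ->
  L1norm Omega (fun x => u x - v x) = dist1 f g.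
Proof.
move=> uf vg fi gi; rewrite (@L1norm_eq _ _ _ _ (fun x => f x - g x)); last first.
  by move=> x Ox; rewrite uf// vg.
by rewrite (L1norm_lamO (oO := oO) (bO := bO))//; apply: integB; apply: integ_lamO.
Qed.

Lemma ext0_min n v : integ leb v ->
  (Phi Omega F bc (ext0 n.+1) + ((2 * tau)^-1 * dist1 (ext0 n.+1) (ext0 n) ^+ 2)%:E <=
   Phi Omega F bc v + ((2 * tau)^-1 * dist1 v (ext0 n) ^+ 2)%:E)%E.
Proof.
move=> vi; have [i1 _] := ext0_integ n.+1; have [i2 _] := ext0_integ n.
have vL : L1 Omega v by apply: integrableS vi => //; exact: open_measurable_rV.
case: scheme => _ /(_ n)[_ /(_ v vL)].
rewrite (L1norm_dist (f := ext0 n.+1) (g := ext0 n))//; last 2 first.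
- by move=> x Ox; rewrite /ext0 eqO.
- by move=> x Ox; rewrite /ext0 eqO.
have -> : L1norm Omega (fun x => v x - un n x) = dist1 v (ext0 n).
  apply: L1norm_dist => //; by move=> x Ox; rewrite /ext0 eqO.
have -> // : Phi Omega F bc (un n.+1) = Phi Omega F bc (ext0 n.+1).
by apply: Phi_congr => // x Ox; rewrite /ext0 eqO.
Qed.

Let tau20 : 0 < (2 * tau)^-1. Proof. by rewrite invr_gt0 mulr_gt0. Qed.

Definition energy n : R := fine (Phi Omega F bc (ext0 n)).

Let dist1_self f : dist1 f f = 0.
Proof.
rewrite /dist1; under eq_Rintegral do rewrite subrr normr0.
by rewrite Rint_cst mul0r.
Qed.

Let finPhi v : (Phi Omega F bc v < +oo)%E -> Phi Omega F bc v = (fine (Phi Omega F bc v))%:E.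
Proof. by move=> h; rewrite fineK// ge0_fin_numE// Phi_ge0. Qed.

Lemma ext0_Phi0 : Phi Omega F bc (ext0 0) = Phi Omega F bc u0.
Proof. by case: scheme => e0 _; rewrite /ext0 e0; apply: Phi_congr => //; exact: eqO. Qed.

Lemma ext0_descent n : (Phi Omega F bc (ext0 n.+1) +
  ((2 * tau)^-1 * dist1 (ext0 n.+1) (ext0 n) ^+ 2)%:E <= Phi Omega F bc (ext0 n))%E.
Proof.
have := ext0_min n (proj1 (ext0_integ n)); rewrite (dist1_self (ext0 n)).
exact: lee_sqr0.
Qed.

Lemma ext0_fin n : (Phi Omega F bc (ext0 n) < +oo)%E.
Proof.
elim: n => [|n IH]; first by rewrite ext0_Phi0.
apply: le_lt_trans IH; apply: le_trans (ext0_descent n).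
by apply: leeDl; rewrite lee_fin mulr_ge0 ?sqr_ge0// ltW.
Qed.

Lemma energyE n : Phi Omega F bc (ext0 n) = (energy n)%:E.
Proof. exact/finPhi/ext0_fin. Qed.

Lemma energy_ge0 n : 0 <= energy n.
Proof. by rewrite fine_ge0// Phi_ge0. Qed.

Lemma energy_step n :
  energy n.+1 + (2 * tau)^-1 * dist1 (ext0 n.+1) (ext0 n) ^+ 2 <= energy n.
Proof. by have := ext0_descent n; rewrite (energyE n.+1) (energyE n) -EFinD lee_fin. Qed.

Lemma energy_sum n : energy n +
  (2 * tau)^-1 * \sum_(k < n) dist1 (ext0 k.+1) (ext0 k) ^+ 2 <= energy 0%N.
Proof.
exact: (@telescope_le _ energy (fun k => dist1 (ext0 k.+1) (ext0 k))) energy_step n.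
Qed.

Lemma energy_le n : energy n <= energy 0%N.
Proof.
apply: le_trans (energy_sum n); rewrite lerDl mulr_ge0 ?(ltW tau20)//.
by apply: sumr_ge0 => k _; exact: sqr_ge0.
Qed.

Lemma dist1_ge0 f g : 0 <= dist1 f g. Proof. exact: Rint_ge0. Qed.

(** Cauchy-Schwarz over the [n - m] increments: the sum of their squares is at most [2 * tau] times
    the initial energy, by telescoping. *)
Lemma ext0_holder n m : (m <= n)%N ->
  dist1 (ext0 n) (ext0 m) <= Num.sqrt (2 * energy 0%N) * Num.sqrt (tau * (n - m)%:R).
Proof.
move=> mn; pose D k := dist1 (ext0 (m + k).+1) (ext0 (m + k)).
have lamI k : integ lam (ext0 k) by apply: integ_lamO; case: (ext0_integ k).
have tri k : dist1 (ext0 (m + k)) (ext0 m) <= \sum_(j < k) D j.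
  elim: k => [|k IH]; first by rewrite addn0 dist1_self big_ord0.
  rewrite big_ord_recr/= addnS addrC.
  by apply: le_trans (Rint_triangle (lamI _) (lamI (m + k)%N) (lamI _)) _; rewrite lerD2l.
have := tri (n - m)%N; rewrite subnKC// => /le_trans; apply.
have D0 k : 0 <= D k by exact: dist1_ge0.
have S0 : 0 <= \sum_(j < n - m) D j by exact: sumr_ge0.
rewrite -sqrtrM; last by rewrite mulr_ge0// energy_ge0.
rewrite -[leLHS](ger0_norm S0) -sqrtr_sqr ler_wsqrtr//.
apply: le_trans (sum_sqr_le _ D0) _.
have -> : 2 * energy 0%N * (tau * (n - m)%:R) = (n - m)%:R * (2 * tau * energy 0%N) by ring.
rewrite ler_wpM2l// -ler_pdivrMl ?mulr_gt0//.
have := energy_sum n; rewrite -{1}(subnKC mn) => h.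
apply: le_trans h; rewrite -[leLHS]add0r; apply: lerD; first exact: energy_ge0.
rewrite ler_pM2l//.
exact: (@sum_shift_le _ (fun k => dist1 (ext0 k.+1) (ext0 k) ^+ 2) m n mn (fun k => sqr_ge0 _)).
Qed.

End scheme.

(** * Tails under the Neumann condition *)

Section exhaustion.
Variables (R : realType) (d : nat) (Omega : set 'rV[R]_d).
Hypotheses (oO : open Omega) (bO : bounded_set Omega).
Local Notation leb := (lebesgue_rV R d).
Let mO : measurable Omega := open_measurable_rV oO.

(** The sets [inner (1 / (n + 1))] exhaust the open set Omega, and [|f|] dominates. *)
Lemma int_inner_exhaust f (w : R) : integ leb f -> 0 < w ->
  exists2 r, 0 < r & \int[leb]_x (`|f x| * \1_(Omega `\` inner Omega r) x) <= w.
Proof.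
move=> fi w0; pose r (n : nat) : R := n.+1%:R^-1.
have r0 n : 0 < r n by rewrite invr_gt0.
have mI n : measurable (Omega `\` inner Omega (r n)).
  by apply: measurableD => //; apply: open_measurable_rV; exact: inner_open.
pose g n x := `|f x| * \1_(Omega `\` inner Omega (r n)) x.
have mf := integ_meas (integ_norm fi).
have bI n x : `|\1_(Omega `\` inner Omega (r n)) x| <= 1 :> R.
  by rewrite indicE; case: (_ \in _); rewrite ?normr1 ?normr0.
have [|||||_ h _] := @Rint_dct _ _ _ leb g (fun=> 0) (fun x => `|f x|).
- by move=> n; apply: measurable_funM => //; exact: measurable_indic.
- exact: measurable_cst.
- exact: integ_norm.
- move=> n x; rewrite normrM normr_id ler_piMr//.
- move=> x; apply/cvgnP => e e0.
  have [Ox|nOx] := pselect (Omega x); last first.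
    by exists 0%N => n _; rewrite /g indicE memNset ?mulr0 ?subr0 ?normr0// => -[/nOx].
  have /nbhs_ballP[s /= s0 Hs] := open_nbhs_nbhs (conj oO Ox).
  exists (Num.truncn s^-1) => n nn; rewrite /g indicE memNset ?mulr0 ?subr0 ?normr0//.
  move=> [_ nI]; apply: nI; exists s.
    rewrite /r invf_plt ?posrE//; apply: lt_le_trans (truncnS_gt _) _.
    by rewrite ler_nat ltnS.
  by move=> y yx; apply: Hs; rewrite -ball_normE /= distrC.
have /cvgnP/(_ w w0)[n /(_ n (leqnn n))] := h.
rewrite subr0 => hn; exists (r n) => //; apply/ltW; apply: le_lt_trans hn.
rewrite (le_trans _ (ler_norm _))// le_eqVlt; apply/orP; left; apply/eqP.
by apply: eq_Rintegral => x _; rewrite subr0 /g normrM normr_id [X in _ = _ * X]ger0_norm.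
Qed.

End exhaustion.

Section order_flag.
Variable R : realType.
Implicit Types (x y p m : R) (s : bool).

(** [ord s x m] makes [m] a barrier for [x], below it if [s] is true and above it otherwise; [lat s]
    moves a barrier past a new value. *)
Definition ord s x y := if s then y <= x else x <= y.

Lemma lat_ord s x m : ord s x (lat s x m).
Proof. by rewrite /ord /lat; case: s; rewrite ?ge_min ?le_max lexx. Qed.

(** On its way from [p] to [x] the segment meets the barrier [m] exactly when [x] has crossed it,
    and the length splits there. The equality makes the distance gained by the competitor exactly
    the motion of the barrier. *)
Lemma lat_dist s x m p : ord s p m ->
  `|x - p| = `|lat (~~ s) x m - p| + `|lat s x m - m|.
Proof.
rewrite /ord /lat; case: s => /=.
  case: (leP x m) => xm mp; last by rewrite subrr normr0 addr0.
  by rewrite !ler0_norm ?subr_le0// ?(le_trans xm)//; ring.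
case: (leP x m) => xm mp; first by rewrite subrr normr0 addr0.
by rewrite !ger0_norm ?subr_ge0// ?(ltW xm)// ?(le_trans mp (ltW xm))//; ring.
Qed.

(** Used in place of Cauchy-Schwarz, so that the bound on the total motion of the barrier is
    additive over the steps. *)
Lemma amgm (t lm : R) : 0 < lm -> t <= lm / 2 + t ^+ 2 / (2 * lm).
Proof.
move=> l0; rewrite -subr_ge0.
have -> : lm / 2 + t ^+ 2 / (2 * lm) - t = (t - lm) ^+ 2 / (2 * lm).
  by field; rewrite gt_eqF.
by rewrite divr_ge0 ?sqr_ge0// mulr_ge0// ltW.
Qed.

End order_flag.

Section neumann_tails.
Variables (R : realType) (d : nat) (Omega : set 'rV[R]_d).
Hypotheses (oO : open Omega) (bO : bounded_set Omega).
Local Notation leb := (lebesgue_rV R d).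
Local Notation lam := (lamO oO bO).
Variable F : 'rV[R]_d -> \bar R.
Hypothesis F_ge0 : forall xi, (0 <= F xi)%E.
Hypothesis F0 : F 0 = 0%E.
Hypotheses (F_lsc : lower_semicontinuous F) (F_convex : econvex F).
Variables c c' : R.
Hypotheses (c0 : 0 < c) (c'0 : 0 <= c') (Fc : forall xi, ((c * enorm xi - c')%:E <= F xi)%E).
Variables (u0 : 'rV[R]_d -> R).
Hypotheses (u0L : L1 Omega u0) (u0f : (Phi Omega F Neumann u0 < +oo)%E).

Local Notation dist1 := (dist1 oO bO).

Lemma lat_integ s u m : integ leb u -> integ leb m -> integ leb (fun x => lat s (u x) (m x)).
Proof. by move=> ui mi; have [? ?] := lattice_integ ui mi; rewrite /lat; case: s. Qed.

Lemma lat_zero_off s (u m : 'rV[R]_d -> R) : zero_off Omega u -> zero_off Omega m ->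
  zero_off Omega (fun x => lat s (u x) (m x)).
Proof. by move=> uz mz; have [? ?] := lattice_zero_off uz mz; rewrite /lat; case: s. Qed.

Lemma neumann_Phi v : BV Omega v -> Phi Omega F Neumann v = bulk_energy Omega F v.
Proof. by move=> bv; rewrite /Phi asboolT// /boundary_energy adde0. Qed.

Section one_scheme.
Variables (tau : R) (un : nat -> 'rV[R]_d -> R).
Hypothesis tau0 : 0 < tau.
Hypothesis scheme : minimizing_movement Omega F Neumann tau u0 un.
Local Notation U := (ext0 Omega un).

(* Compare [u^(n+1)] with the competitor [lat (~~ s) (u^(n+1)) m] and use submodularity. *)
Lemma tail_step s n m (a eps : R) : integ leb m -> zero_off Omega m -> 0 < eps ->
  (bulk_energy Omega F m <= a%:E)%E -> (forall x, ord s (U n x) (m x)) ->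
  (bulk_energy Omega F (fun x => lat s (U n.+1 x) (m x)) <=
   (a + 2 * eps - (2 * tau)^-1 * dist1 (fun x => lat s (U n.+1 x) (m x)) m ^+ 2)%:E)%E.
Proof.
move=> mi mz eps0 ma om.
have [ui uz] := ext0_integ oO bO u0L scheme n.+1; have [pi _] := ext0_integ oO bO u0L scheme n.
have Ufin := ext0_fin oO bO u0L u0f tau0 scheme n.+1.
have [UBV _] := Phi_bulk F_ge0 F0 Ufin.
have UE := energyE oO bO F_ge0 F0 u0L u0f tau0 scheme n.+1.
set b := energy _ _ _ _ _ in UE.
have ub : (bulk_energy Omega F (U n.+1) < (b + eps)%:E)%E.
  by rewrite -(neumann_Phi UBV) UE lte_fin ltrDl.
have mb : (bulk_energy Omega F m < (a + eps)%:E)%E.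
  by apply: le_lt_trans ma _; rewrite lte_fin ltrDl.
have [y [x [[_ ym] [vBV xv] xy]]] :=
  submodular oO bO F_ge0 F0 F_lsc F_convex c0 c'0 Fc s ui uz mi mz ub mb.
apply: le_trans ym _; rewrite lee_fin.
have := ext0_min oO bO u0L scheme n (lat_integ (~~ s) ui mi).
rewrite UE (neumann_Phi vBV); set v := fun z => lat (~~ s) _ _.
set m' := fun z => lat s _ _.
have dE : dist1 (U n.+1) (U n) = dist1 v (U n) + dist1 m' m.
  have vi := integ_lamO oO bO (lat_integ (~~ s) ui mi).
  have m'i := integ_lamO oO bO (lat_integ s ui mi).
  rewrite /dist1 -RintD; last 2 first.
  - by apply: integ_norm; apply: integB => //; exact: integ_lamO.
  - by apply: integ_norm; apply: integB => //; exact: integ_lamO.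
  by apply: eq_Rintegral => z _; exact: lat_dist (om z).
rewrite dE; move: (dist1_ge0 oO bO v (U n)) (dist1_ge0 oO bO m' m).
move: (dist1 v (U n)) (dist1 m' m) => p q p0 q0 h.
have h2 : b + (2 * tau)^-1 * (p + q) ^+ 2 <= x + (2 * tau)^-1 * p ^+ 2.
  by rewrite -lee_fin !EFinD; apply: le_trans h _; rewrite leeD2r.
have t0 : 0 < (2 * tau)^-1 by rewrite invr_gt0 mulr_gt0.
(* Squares of nonnegative lengths are superadditive: cutting off the part [q] of the path saves at
   least [q^2]. *)
have h3 : (2 * tau)^-1 * p ^+ 2 + (2 * tau)^-1 * q ^+ 2 <= (2 * tau)^-1 * (p + q) ^+ 2.
  rewrite -mulrDr ler_pM2l// sqrrD lerD2r lerDl mulrn_wge0// mulr_ge0//.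
move: h2 h3 xy; set T := (2 * tau)^-1; lra.
Qed.

(** [Q] accumulates the squared motions of the barrier and [n%:R * (2 * eps)] the losses of the
    strict bounds in [submodular]. The weight [lm] stays free until the time horizon is known. *)
Lemma tail_induction s m0 (a eps lm : R) : integ leb m0 -> zero_off Omega m0 -> 0 < eps ->
  0 < lm -> (bulk_energy Omega F m0 <= a%:E)%E -> (forall x, ord s (U 0%N x) (m0 x)) ->
  forall n, exists m Q, [/\ integ leb m /\ zero_off Omega m,
    (bulk_energy Omega F m <= (a + n%:R * (2 * eps) - (2 * tau)^-1 * Q)%:E)%E,
    forall x, ord s (U n x) (m x) &
    dist1 m m0 <= n%:R * (lm / 2) + Q / (2 * lm)].
Proof.
move=> m0i m0z eps0 lm0 m0a om; elim=> [|n [m [Q [[mi mz] mb mo md]]]].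
  exists m0, 0; split => //; first by rewrite mul0r addr0 mulr0 subr0.
  rewrite !mul0r addr0 /dist1; under eq_Rintegral do rewrite subrr normr0.
  by rewrite Rint_cst mul0r.
have [ui uz] := ext0_integ oO bO u0L scheme n.+1.
pose m' x := lat s (U n.+1 x) (m x).
have m'i : integ leb m' by exact: lat_integ.
exists m', (Q + dist1 m' m ^+ 2); split.
- by split => //; exact: lat_zero_off.
- apply: le_trans (tail_step mi mz eps0 mb mo) _; rewrite lee_fin -/m'.
  by rewrite -natr1; move: (dist1 m' m) => q; lra.
- by move=> x; exact: lat_ord.
have := Rint_triangle (integ_lamO oO bO m'i) (integ_lamO oO bO mi) (integ_lamO oO bO m0i).
move/le_trans; apply; rewrite -/(dist1 m' m) -/(dist1 m m0).
have := amgm (dist1 m' m) lm0; move: md; move: (dist1 m' m) (dist1 m m0) => p q.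
by rewrite -natr1 mulrDl [(Q + _) / _]mulrDl => h1 h2; lra.
Qed.

End one_scheme.

Lemma neumann_tail s (w t0 : R) : 0 < w -> 0 < t0 -> exists m0, integ leb m0 /\
  forall tau un, 0 < tau -> minimizing_movement Omega F Neumann tau u0 un ->
  forall n, tau * n%:R <= t0 -> exists m, [/\ integ leb m,
    forall x, ord s (ext0 Omega un n x) (m x) & dist1 m m0 <= w].
Proof.
(* With [lm = kap * tau] the first part of the distance is at most [kap * t0 / 2 = w / 2].
   Nonnegative energy gives [Q <= 4 * tau * a], so the second is at most [2 * a / kap = w / 2]. *)
move=> w0 t00; pose kap := w / t0; pose a := kap * w / 4.
have kap0 : 0 < kap by rewrite divr_gt0.
have a0 : 0 < a by rewrite divr_gt0// mulr_gt0.
pose v0 : 'rV[R]_d -> R := u0 \_ Omega.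
have [v0i v0z] : integ leb v0 /\ zero_off Omega v0 by exact: patch_integ.
have v0E : {in Omega, v0 =1 u0} by move=> x Ox; rewrite /v0 patchE Ox.
have v0f : (bulk_energy Omega F v0 < +oo)%E.
  have [_ h] := Phi_bulk F_ge0 F0 u0f.
  by rewrite (bulk_energy_congr F v0E) (le_lt_trans h).
(* The cutting level is multiplied by the indicator of Omega below, to remain zero outside; its sign
   puts the barrier on the side required by [s]. *)
pose k n : R := if s then - n%:R else n%:R.
have kO n : integ leb (fun x => k n * \1_Omega x).
  apply: integZ; apply/(integ_zero_off oO bO).
    by move=> x nOx; rewrite indicE memNset.
  by apply: integ_ind; exact: open_measurable_rV.
have kz n : zero_off Omega (fun x => k n * \1_Omega x).
  by move=> x nOx; rewrite indicE memNset// mulr0.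
have cvg : (fun n => \int[lam]_x `|lat (~~ s) (v0 x) (k n * \1_Omega x) - v0 x|) @ \oo --> (0 : R).
  have vl := integ_lamO oO bO v0i.
  have [|||||_ h _] := @Rint_dct _ _ _ lam (fun n x => lat (~~ s) (v0 x) (k n * \1_Omega x)) v0
      (fun x => `|v0 x|).
  - by move=> n; exact: integ_meas (lat_integ (~~ s) v0i (kO n)).
  - exact: integ_meas vl.
  - exact: integ_norm.
  - move=> n x; have n0 : 0 <= n%:R * \1_Omega x :> R by rewrite mulr_ge0.
    rewrite /lat /k; case: (s) => /=.
      rewrite mulNr; case: (leP (v0 x) (- (n%:R * \1_Omega x))) => h //.
      have v1 : v0 x <= 0 by rewrite (le_trans h)// oppr_le0.
      by rewrite normrN (ger0_norm n0) ler0_norm// lerNr.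
    case: (leP (v0 x) (n%:R * \1_Omega x)) => h //.
    by rewrite (ger0_norm n0) (le_trans (ltW h))// ler_norm.
  - move=> x; apply/cvgnP => e e0; exists (Num.truncn `|v0 x|).+1 => n nn.
    suff -> : lat (~~ s) (v0 x) (k n * \1_Omega x) = v0 x by rewrite subrr normr0.
    have [Ox|nOx] := pselect (Omega x); last first.
      by rewrite kz// v0z// /lat; case: (~~ s); rewrite ?minxx ?maxxx.
    have nv : `|v0 x| <= n%:R.
      by apply/ltW/(lt_le_trans (truncnS_gt _)); rewrite ler_nat.
    rewrite indicE mem_set// mulr1 /lat /k; case: (s) => /=.
      by rewrite max_l// lerNl (le_trans _ nv)// -normrN ler_norm.
    by rewrite min_l// (le_trans (ler_norm _)).
  exact: h.
have [N HN] := truncation_energy F_ge0 F0 F_lsc F_convex c0 c'0 Fc (b := ~~ s) v0i v0z v0f cvg a0.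
pose m0 x := lat s (v0 x) (k N * \1_Omega x).
have m0i : integ leb m0 by exact: lat_integ.
have m0z : zero_off Omega m0 by exact: lat_zero_off.
have m0a : (bulk_energy Omega F m0 <= a%:E)%E by have := HN N (leqnn N); rewrite negbK.
exists m0; split => // tau un tau0 scheme n nt.
have U0 : ext0 Omega un 0 = v0 by case: scheme => e0 _; rewrite /ext0 e0.
have om : forall x, ord s (ext0 Omega un 0 x) (m0 x) by move=> x; rewrite U0; exact: lat_ord.
(* [n] is already fixed here, so the losses of all [n] steps together are at most [a]. *)
pose eps := a / (2 * n.+1%:R).
have eps0 : 0 < eps by rewrite divr_gt0// mulr_gt0.
have lm0 : 0 < kap * tau by rewrite mulr_gt0.
have [m [Q [[mi mz] mb mo md]]] := tail_induction tau0 scheme m0i m0z eps0 lm0 m0a om n.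
exists m; split => //; apply: le_trans md _.
have neps : n%:R * (2 * eps) <= a.
  have E (z b t : R) : z != 0 -> t * (2 * (b / (2 * z))) = b * t / z.
    by move=> z0; field.
  rewrite /eps E ?pnatr_eq0//.
  by rewrite ler_pdivrMr// ler_pM2l// ler_nat.
have Q1 : Q <= 2 * tau * (2 * a).
  have h : 0 <= a + n%:R * (2 * eps) - (2 * tau)^-1 * Q.
    by rewrite -lee_fin; apply: le_trans mb; exact: bulk_energy_ge0.
  by rewrite -ler_pdivrMl ?mulr_gt0//; lra.
have Q2 : Q / (2 * (kap * tau)) <= w / 2.
  have kt : 0 < 2 * (kap * tau) by rewrite mulr_gt0.
  rewrite ler_pdivrMr//; apply: le_trans Q1 _.
  by rewrite le_eqVlt; apply/orP; left; apply/eqP; rewrite /a; field.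
have L1' : n%:R * (kap * tau / 2) <= w / 2.
  have -> : n%:R * (kap * tau / 2) = kap * (tau * n%:R) / 2 by ring.
  rewrite ler_pM2r// /kap; apply: (@le_trans _ _ (w / t0 * t0)); last by rewrite divfK ?gt_eqF.
  by rewrite ler_pM2l// divr_gt0.
lra.
Qed.

(** Each iterate lies between two barriers that are L^1-close to fixed integrable functions, and so
    inherits their small mass near the boundary. *)
Lemma neumann_tight (w t0 : R) : 0 < w -> 0 < t0 -> exists2 r, 0 < r &
  forall tau un, 0 < tau -> minimizing_movement Omega F Neumann tau u0 un ->
  forall n, tau * n%:R <= t0 ->
    \int[leb]_x (`|ext0 Omega un n x| * \1_(Omega `\` inner Omega r) x) <= w.
Proof.
move=> w0 t00; have w40 : 0 < w / 4 by rewrite divr_gt0.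
have [m0 [m0i Hm]] := neumann_tail false w40 t00.
have [k0 [k0i Hk]] := neumann_tail true w40 t00.
pose f x := `|m0 x| + `|k0 x|.
have fi : integ leb f by apply: integD; exact: integ_norm.
have w20 : 0 < w / 2 by rewrite divr_gt0.
have [r r0 Hr] := int_inner_exhaust oO fi w20.
exists r => // tau un tau0 scheme n nt.
have [m [mi mo md]] := Hm tau un tau0 scheme n nt.
have [k [ki ko kd]] := Hk tau un tau0 scheme n nt.
have [ui uz] := ext0_integ oO bO u0L scheme n.
have mA : measurable (Omega `\` inner Omega r).
  by apply: measurableD; apply: open_measurable_rV => //; exact: inner_open.
have zA (g : 'rV[R]_d -> R) : zero_off Omega (fun x => g x * \1_(Omega `\` inner Omega r) x).
  by move=> x nOx; rewrite indicE memNset ?mulr0// => -[].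
have iA g : integ lam g -> integ lam (fun x => g x * \1_(Omega `\` inner Omega r) x).
  move=> gi; apply: (integMb (M := 1)) => //.
  by move=> x; rewrite indicE; case: (_ \in _); rewrite ?normr1 ?normr0.
rewrite (Rint_zero_off oO bO (zA _)).
rewrite (Rint_zero_off oO bO (zA _)) in Hr.
have li g : integ leb g -> integ lam g by exact: integ_lamO.
have idm : integ lam (fun x => `|m x - m0 x|) by apply: integ_norm; apply: integB; exact: li.
have idk : integ lam (fun x => `|k x - k0 x|) by apply: integ_norm; apply: integB; exact: li.
have ifA : integ lam (fun x => `|f x| * \1_(Omega `\` inner Omega r) x).
  by apply: iA; apply: integ_norm; exact: li.
apply: (@le_trans _ _ (\int[lam]_x (`|f x| * \1_(Omega `\` inner Omega r) x + (`|m x - m0 x| + `|k x - k0 x|)))).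
  apply: Rint_le => [||x].
  - by apply: iA; apply: integ_norm; exact: li.
  - by apply: integD => //; exact: integD.
  have uf : `|ext0 Omega un n x| <= f x + (`|m x - m0 x| + `|k x - k0 x|).
    have := mo x; have := ko x; rewrite /ord /f; move: (ext0 Omega un n x) => u ku um.
    have h1 : `|m x| <= `|m0 x| + `|m x - m0 x| by rewrite addrC -lerBlDr lerB_dist.
    have h2 : `|k x| <= `|k0 x| + `|k x - k0 x| by rewrite addrC -lerBlDr lerB_dist.
    rewrite addrACA; apply: le_trans (lerD h1 h2).
    have := ler_norm (m x); have := ler_norm (- k x); rewrite normrN.
    have := normr_ge0 (m x); have := normr_ge0 (k x).
    by rewrite ler_norml; lra.
  rewrite indicE; case: (_ \in _); rewrite ?mulr1 ?mulr0 ?add0r ?addr_ge0//.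
  by apply: le_trans uf _; rewrite lerD2r ler_norm.
rewrite RintD//; last exact: integD.
rewrite RintD//; have -> : w = w / 2 + (w / 4 + w / 4) by field.
by rewrite !lerD.
Qed.

End neumann_tails.

(** * Tails in a Lipschitz domain *)

Lemma quarter_half (R : realType) (r a b q : R) :
  0 < r -> a <= q -> q <= r / 4 -> b < r / 2 -> a + b < r.
Proof. lra. Qed.

Lemma grid_gap (R : realType) (y m h n : R) :
  y - m <= h -> 0 < y - n -> n < m + h.
Proof. lra. Qed.

Section lipschitz_tightness.
Variables (R : realType) (d : nat) (Omega : set 'rV[R]_d).
Hypotheses (oO : open Omega) (bO : bounded_set Omega).
Local Notation leb := (lebesgue_rV R d).
Let mO : measurable Omega := open_measurable_rV oO.
Implicit Types (x y z e : 'rV[R]_d).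

Lemma enorm_leD x y : enorm (x + y) <= enorm x + enorm y.
Proof.
have [q q1 <-] := enorm_sup (x + y); rewrite dotvDr; apply: lerD.
  by apply: le_trans (dotv_le _ _) _; rewrite ler_piMl ?enorm_ge0.
by apply: le_trans (dotv_le _ _) _; rewrite ler_piMl ?enorm_ge0.
Qed.

Lemma enormN x : enorm (- x) = enorm x.
Proof. by rewrite /enorm dotvNl dotvC dotvNl opprK. Qed.

Lemma enormZ_abs (t : R) x : enorm (t *: x) = `|t| * enorm x.
Proof. by rewrite /enorm dotvZl dotvZr mulrA -expr2 sqrtrM ?sqr_ge0// sqrtr_sqr. Qed.

Lemma enorm_le_norm x : enorm x <= d%:R * `|x|.
Proof. by apply: le_trans (enorm_le_sum x) (sum_coord_le x). Qed.

Lemma open_enorm_ball x (r : R) : open [set y | enorm (y - x) < r].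
Proof.
have cf : continuous (fun y : 'rV[R]_d => enorm (y - x)).
  move=> y; apply: (@continuous_comp _ _ _ (fun y : 'rV[R]_d => dotv (y - x) (y - x)) Num.sqrt).
    exact: C1_continuous (C1_sqdist x) y.
  exact: sqrt_continuous.
have -> : [set y | enorm (y - x) < r] = (fun y => enorm (y - x)) @^-1` [set t | t < r] by [].
by apply: (open_comp _ (@open_lt _ r)) => y _; exact: cf.
Qed.

Section chart.
Variables (x e : 'rV[R]_d) (gamma : 'rV[R]_d -> R) (L r : R).
Hypotheses (e1 : enorm e = 1) (r0 : 0 < r).
Hypothesis gL : forall y z, `|gamma y - gamma z| <= L * enorm (y - z).
Hypothesis chart : forall y, enorm (y - x) < r -> Omega y <-> dotv y e < gamma (y - dotv y e *: e).

Let V : set 'rV[R]_d := [set y | enorm (y - x) < r / 2].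
(** The height of the graph above [y] in direction [e]: positive inside Omega, and lowered by
    exactly [t] when [y] moves by [t *: e]. *)
Let depth y : R := gamma (y - dotv y e *: e) - dotv y e.

Let ee : dotv e e = 1. Proof. by rewrite -enorm_sqr e1 expr1n. Qed.

Let depth_shift y (t : R) : depth (y + t *: e) = depth y - t.
Proof.
rewrite /depth dotvDl dotvZl ee mulr1 opprD addrA; congr (gamma _ - _ - _).
by rewrite scalerDl opprD addrACA subrr addr0.
Qed.

Let shift_ball y (t : R) : V y -> `|t| < r / 2 -> enorm (y + t *: e - x) < r.
Proof.
move=> Vy tr; have -> : y + t *: e - x = (y - x) + t *: e by rewrite addrAC.
apply: le_lt_trans (enorm_leD _ _) _; rewrite [ltRHS]splitr; apply: ltrD => //.
by rewrite enormZ_abs e1 mulr1.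
Qed.

Let depth_gt0 y : enorm (y - x) < r -> Omega y <-> 0 < depth y.
Proof. by move=> yr; rewrite (chart yr) /depth subr_gt0. Qed.

Let L' := `|L| + 1.

(** The factor 2 bounds the Lipschitz constant of the projection along [e] by the triangle
    inequality; the 1 comes from [dotv y e]. *)
Let depth_lip y z : depth y <= depth z + (2 * L' + 1) * enorm (y - z).
Proof.
pose p y := y - dotv y e *: e.
have zy : dotv z e - dotv y e <= enorm (y - z).
  rewrite -dotvBl -[enorm (y - z)]enormN opprB; apply: le_trans (dotv_le _ _) _.
  by rewrite e1 mulr1.
have p2 : enorm (p y - p z) <= 2 * enorm (y - z).
  have -> : p y - p z = (y - z) + (- dotv (y - z) e) *: e.
    by rewrite /p dotvBl; apply/rowP => i; rewrite !mxE; ring.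
  apply: le_trans (enorm_leD _ _) _; rewrite [leRHS]mulr_natl mulr2n lerD2l.
  rewrite enormZ_abs e1 mulr1 normrN ler_norml; apply/andP; split.
    rewrite lerNl -dotvNl -[enorm (y - z)]enormN; apply: le_trans (dotv_le _ _) _.
    by rewrite e1 mulr1.
  by apply: le_trans (dotv_le _ _) _; rewrite e1 mulr1.
have := gL (p y) (p z); rewrite ler_norml => /andP[_ g1].
have g2 : L * enorm (p y - p z) <= L' * (2 * enorm (y - z)).
  apply: (@le_trans _ _ (L' * enorm (p y - p z))).
    by rewrite ler_wpM2r ?enorm_ge0// /L' ler_wpDr// ler_norm.
  by rewrite ler_wpM2l// addr_ge0.
rewrite /depth -/(p y) -/(p z); move: zy g1 g2 => h1 h2 h3.
have -> : (2 * L' + 1) * enorm (y - z) = L' * (2 * enorm (y - z)) + enorm (y - z) by ring.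
lra.
Qed.

(* With [E] the part of [Omega \ inner s] in the chart, the [N] translates
   [E - k h e] are disjoint and lie in [Omega], and each carries the mass of
   [|u|] on [E] up to [w / 2]. *)
Lemma chart_tight (B w : R) : 0 <= B -> 0 < w -> exists2 rho, 0 < rho &
  forall u s, BVbounded Omega B u -> 0 < s <= rho ->
    \int[leb]_y (`|u y| * \1_(V `&` (Omega `\` inner Omega s)) y) <= w.
Proof.
(* Enough disjoint translates for the average share [B / N] of the total mass to be at most
   [w / 2]. *)
move=> B0 w0; pose N := (Num.truncn (B / (w / 2))).+1.
have w20 : 0 < w / 2 by rewrite divr_gt0.
have N0 : 0 < N%:R :> R by rewrite ltr0n.
have BN : B / N%:R <= w / 2.
  by rewrite ler_pdivrMr// mulrC -ler_pdivrMr//; apply/ltW/truncnS_gt.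
pose D := B * d%:R + 1.
have D0 : 0 < D by rewrite ltr_wpDl// mulr_ge0.
(* [N * h < r / 2] keeps the translates in the chart, and [N * h < w / 2 / D] makes the BV bound for
   each translation at most [w / 2]. *)
pose h := Num.min (r / 2) (w / 2 / D) / N%:R / 2.
have m0 : 0 < Num.min (r / 2) (w / 2 / D) by rewrite lt_min !divr_gt0.
have h0 : 0 < h by rewrite !divr_gt0.
have h0' := ltW h0.
have kh0 (k : nat) : 0 <= k%:R * h by exact: mulr_ge0.
have Nh : N%:R * h < Num.min (r / 2) (w / 2 / D).
  have Z (t m : R) : t != 0 -> t * (m / t / 2) = m / 2 by move=> t0; field.
  by rewrite /h Z ?gt_eqF// ltr_pdivrMr// ltr_pMr// ltr1n.
move: Nh; rewrite lt_min => /andP[Nhr Nhw].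
have L0 : 0 < 2 * L' + 1 by rewrite ltr_wpDl// mulr_ge0// addr_ge0.
(* A displacement of Euclidean length at most [q] changes the depth by at most [h], and [r / 4]
   keeps the displaced point in the chart. *)
pose q := Num.min (h / (2 * L' + 1)) (r / 4).
have q0 : 0 < q by rewrite lt_min !divr_gt0.
(* The 2 allows for the radius [2 * s] below, and [d + 1] for passing from the sup norm to the
   Euclidean norm. *)
pose rho := q / (2 * (d%:R + 1)).
have d1 : 0 < 2 * (d%:R + 1) :> R by rewrite mulr_gt0// ltr_wpDl.
have rho0 : 0 < rho by rewrite divr_gt0.
have drho : d%:R * (2 * rho) <= q.
  have -> : d%:R * (2 * rho) = q * (2 * d%:R) / (2 * (d%:R + 1)) by rewrite /rho; ring.
  by rewrite ler_pdivrMr// ler_pM2l// ler_pM2l// lerDl.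
exists rho => // u s [ui uz uB uv] /andP[s0 sr].
set E := V `&` _.
have Edepth y : E y -> 0 < depth y <= h.
  move=> [Vy [Oy nI]].
  have yr : enorm (y - x) < r by apply: lt_trans Vy _; rewrite ltr_pdivrMr// ltr_pMr// ltr1n.
  rewrite (proj1 (depth_gt0 yr) Oy)/=.
  (* [y] fails the condition of [inner s] with the radius [2 * s], so a point outside Omega is
     nearby; its depth is nonpositive. *)
  have [z [zy nOz]] : exists z, `|z - y| < 2 * s /\ ~ Omega z.
    apply: contrapT => H; apply: nI; exists (2 * s).
      by rewrite mulr_natl mulr2n ltrDl.
    by move=> z zy; apply: contrapT => nOz; apply: H; exists z.
  have zq : enorm (y - z) <= q.
    rewrite -enormN opprB; apply: le_trans (enorm_le_norm _) _; apply: le_trans drho.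
    by rewrite ler_wpM2l// (le_trans (ltW zy))// ler_pM2l.
  have qr : q <= r / 4 by rewrite ge_min lexx orbT.
  have zr : enorm (z - x) < r.
    have -> : z - x = (z - y) + (y - x) by rewrite addrA subrK.
    apply: le_lt_trans (enorm_leD _ _) _; rewrite -[enorm (z - y)]enormN opprB.
    have Vy' : enorm (y - x) < r / 2 by [].
    exact: (quarter_half r0 zq qr Vy').
  have dz : depth z <= 0 by rewrite leNgt; apply/negP => /(proj2 (depth_gt0 zr)).
  apply: le_trans (depth_lip y z) _; rewrite -[h]add0r; apply: lerD => //.
  rewrite mulrC -ler_pdivlMr//; apply: le_trans zq _; by rewrite ge_min lexx.
have oV : open V by exact: open_enorm_ball.
have mE : measurable E.
  apply: measurableI; first exact: open_measurable_rV.
  by apply: measurableD => //; apply: open_measurable_rV; exact: inner_open.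
pose a (k : nat) : 'rV[R]_d := (- (k%:R * h)) *: e.
have kN (k : 'I_N) (t : R) : 0 <= t <= 1 -> `|t * - (k%:R * h)| < r / 2.
  move=> /andP[t0 t1]; rewrite normrM normrN (ger0_norm t0) (ger0_norm (kh0 k)).
  apply: le_lt_trans Nhr; apply: (@le_trans _ _ (k%:R * h)).
    by apply: ler_piMl.
  by rewrite ler_pM2r// ler_nat ltnW.
have trans (k : 'I_N) : \int[leb]_y (`|u (y + a k) - u y| * \1_(V `&` Omega) y) <= w / 2.
  apply: (@le_trans _ _ (B * \sum_i `|(a k) 0 i|)).
    apply: translation_L1 ui B0 uv (openI oV oO) _ => y t [Vy Oy] t01.
    rewrite /a scalerA; have sb := shift_ball Vy (kN k t t01).
    apply/(depth_gt0 sb); rewrite depth_shift.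
    have yr : enorm (y - x) < r by apply: lt_trans Vy _; rewrite ltr_pdivrMr// ltr_pMr// ltr1n.
    have /andP[t0 _] := t01.
    rewrite mulrN opprK; apply: ltr_wpDr; first exact: mulr_ge0 t0 (kh0 k).
    exact: (proj1 (depth_gt0 yr) Oy).
  apply: (@le_trans _ _ (D * (N%:R * h))); last first.
    by rewrite mulrC -ler_pdivlMr//; exact: ltW.
  have -> : D * (N%:R * h) = B * (d%:R * (N%:R * h)) + N%:R * h by rewrite /D; ring.
  rewrite ler_wpDr// ler_wpM2l//.
  apply: le_trans (sum_coord_le _) _; rewrite ler_wpM2l//.
  apply: le_trans (norm_le_enorm _) _; rewrite enormZ_abs e1 mulr1 normrN.
  by rewrite ger0_norm// ler_pM2r// ler_nat ltnW.
have iu : integ leb (fun y => `|u y|) by exact: integ_norm.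
have i1 (A : set 'rV[R]_d) f : measurable A -> integ leb f -> integ leb (fun y => f y * \1_A y).
  move=> mA fi; apply: (integMb (M := 1)) => //.
  by move=> y; rewrite indicE; case: (_ \in _); rewrite ?normr1 ?normr0.
pose A (k : nat) : set 'rV[R]_d := [set y | E (y - a k)].
have mA k : measurable (A k).
  rewrite -[A k]setTI; apply: (measurable_addr (- a k)) => //.
have ush k : integ leb (fun y => u (y + a k)) by exact: integ_shift.
have shiftE (k : 'I_N) : \int[leb]_y (`|u y| * \1_E y) <= \int[leb]_y (`|u y| * \1_(A k) y) + w / 2.
  have -> : \int[leb]_y (`|u y| * \1_(A k) y) = \int[leb]_y (`|u (y + a k)| * \1_E y).
    rewrite -(Rint_shift (a k) (i1 _ _ (mA k) iu)); apply: eq_Rintegral => y _.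
    congr (_ * _); rewrite !indicE; congr (nat_of_bool _)%:R.
    by apply/idP/idP; rewrite !inE /A /= addrK.
  have j1 : integ leb (fun y => `|u (y + a k)| * \1_E y) by apply: i1 => //; exact: integ_norm.
  have j2 : integ leb (fun y => `|u (y + a k) - u y| * \1_(V `&` Omega) y).
    by apply: i1; [exact: measurableI (open_measurable_rV oV) mO|apply: integ_norm; exact: integB].
  apply: (@le_trans _ _ (\int[leb]_y (`|u (y + a k)| * \1_E y + `|u (y + a k) - u y| * \1_(V `&` Omega) y))).
    apply: Rint_le => [||y]; [exact: i1|exact: integD|].
    have [Ey|nEy] := pselect (E y); last first.
      by rewrite indicE memNset// mulr0 mulr0 add0r mulr_ge0.
    have Ay : (V `&` Omega) y by case: Ey => Vy [Oy _].
    rewrite !indicE !mem_set// !mulr1 distrC addrC -lerBlDr; exact: lerB_dist.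
  by rewrite RintD// lerD2l.
(* The points of the translate [A k] have depth in ]k h, (k + 1) h]. *)
have tA : trivIset setT A.
  apply/trivIsetP => i j _ _ ij; apply/seteqP; split => // y [] /Edepth + /Edepth.
  have dE k : y - a k = y + (k%:R * h) *: e by rewrite /a scaleNr opprK.
  rewrite !dE !depth_shift => /andP[i1' i2] /andP[j1 j2].
  have lt1 (m n : nat) : depth y - m%:R * h <= h -> 0 < depth y - n%:R * h -> (n <= m)%N.
    move=> k1 k2; rewrite leqNgt; apply/negP => mn.
    have : (m%:R + 1) * h <= n%:R * h by rewrite ler_pM2r// natr1 ler_nat.
    by apply/negP; rewrite -ltNge mulrDl mul1r; exact: (grid_gap k1 k2).
  by move/eqP: ij; apply; apply/eqP; rewrite eqn_leq (lt1 _ _ j2 i1') (lt1 _ _ i2 j1).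
have sumA : \sum_(k < N) \int[leb]_y (`|u y| * \1_(A k) y) <= B.
  apply: le_trans uB; rewrite -Rint_sum; last by move=> k; exact: i1.
  apply: Rint_le => // [|y]; first by apply: integ_sum => k; exact: i1.
  rewrite -mulr_sumr ler_piMr//.
  have le1 : ((\sum_(k < N) \1_(A k) y * 1)%:E <= (1 : R)%:E)%E.
    by apply: (@disjoint_sum_le _ _ R A (fun _ _ => 1) N y (1 : R)%:E tA) => [|k]; rewrite lee_fin.
  by move: le1; rewrite lee_fin; under eq_bigr do rewrite mulr1.
have : N%:R * \int[leb]_y (`|u y| * \1_E y) <= B + N%:R * (w / 2).
  rewrite -[N in N%:R * _]card_ord -sum1_card natr_sum mulr_suml.
  under eq_bigr do rewrite mul1r.
  apply: (@le_trans _ _ (\sum_(k < N) (\int[leb]_y (`|u y| * \1_(A k) y) + w / 2))).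
    by apply: ler_sum => k _; exact: shiftE.
  rewrite big_split/= lerD// sumr_const card_ord mulr_natl//.
rewrite mulrC -ler_pdivlMr// mulrDl [N%:R * _ / _]mulrAC divff ?gt_eqF// mul1r.
move/le_trans; apply; rewrite [leRHS]splitr lerD2r.
exact: BN.
Qed.

End chart.

Hypothesis lD : lipschitz_domain Omega.

Let chart_nbhs (B : R) x : 0 <= B -> exists r, boundary Omega x -> 0 < r /\
  forall w, 0 < w -> exists2 rho, 0 < rho & forall u s, BVbounded Omega B u ->
    0 < s <= rho -> \int[leb]_y (`|u y| *
      \1_([set y | enorm (y - x) < r] `&` (Omega `\` inner Omega s)) y) <= w.
Proof.
move=> B0; have [bx|nbx] := pselect (boundary Omega x); last by exists 0.
have [e [gamma [L [r [e1 r0 gL ch]]]]] := lD bx.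
exists (r / 2) => _; split; first exact: divr_gt0.
by move=> w w0; exact: (chart_tight e1 r0 gL ch B0 w0).
Qed.

Let bounded_closure : bounded_set (closure Omega).
Proof.
have [M [Mr HM]] := bO; exists M; split=> // x Mx y /= cy.
have cN : closed [set z : 'rV[R]_d | `|z| <= x].
  by apply: (@closed_comp _ _ (fun z : 'rV[R]_d => `|z|) [set t | t <= x]) => [z _|];
    [exact: norm_continuous|exact: closed_le].
exact: (cN y (closure_subset (fun z Oz => HM x Mx z Oz) cy)).
Qed.

Let sub_boundedr (A B : set 'rV[R]_d) : A `<=` B -> bounded_set B -> bounded_set A.
Proof. by move=> AB [M [Mr HM]]; exists M; split=> // x Mx y /AB; exact: HM. Qed.

Lemma compact_boundary : compact (boundary Omega).
Proof.
apply: bounded_closed_compact; last first.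
  by apply: closedI; [exact: closed_closure|apply: open_closedC; exact: open_interior].
by apply: (sub_boundedr _ bounded_closure) => x [].
Qed.

(** Finitely many charts cover the compact boundary. What they leave of the closure is a compact
    subset of Omega, which keeps a positive distance from the complement. *)
Lemma lipschitz_tight (B w : R) : 0 <= B -> 0 < w -> exists2 s, 0 < s &
  forall u, BVbounded Omega B u ->
    \int[leb]_y (`|u y| * \1_(Omega `\` inner Omega s) y) <= w.
Proof.
move=> B0 w0; have [r Hr] := choice (fun x => chart_nbhs x B0).
pose V x : set 'rV[R]_d := [set y | enorm (y - x) < r x].
(* Induction on the list of charts, halving the allowed mass and taking the smaller width each
   time. *)
have fin_tight (l : seq 'rV[R]_d) : (forall x, x \in l -> boundary Omega x) ->
    forall w, 0 < w -> exists2 rho, 0 < rho & forall u s, BVbounded Omega B u ->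
    0 < s <= rho -> \int[leb]_y (`|u y| *
      \1_((\bigcup_(x in [set` l]) V x) `&` (Omega `\` inner Omega s)) y) <= w.
  elim: l => [|x l IH] bl v v0.
    exists 1 => // u s _ _; rewrite /Rintegral integral0_eq ?ltW// => y _.
    by rewrite indicE memNset ?mulr0// => -[[]].
  have v20 : 0 < v / 2 by exact: divr_gt0.
  have [rho1 rho10 H1] := (Hr x (bl _ (mem_head _ _))).2 _ v20.
  have [rho2 rho20 H2] := IH (fun z zl => bl _ (mem_behead (zl : z \in behead (x :: l)))) _ v20.
  exists (Num.min rho1 rho2); first by rewrite lt_min rho10.
  move=> u s bu /andP[s0]; rewrite le_min => /andP[s1 s2].
  have [iu _ _ _] := bu.
  have mI (A : set 'rV[R]_d) : open A ->
      integ leb (fun y => `|u y| * \1_(A `&` (Omega `\` inner Omega s)) y).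
    move=> oA; apply: (integMb (M := 1)) => //.
    - exact: integ_norm.
    - apply/measurable_indicP/measurableI; first exact: open_measurable_rV.
      by apply: measurableD => //; apply: open_measurable_rV; exact: inner_open.
    - by move=> y; rewrite indicE; case: (_ \in _); rewrite ?normr1 ?normr0.
  have oV z : open (V z) by exact: open_enorm_ball.
  rewrite [v]splitr; apply: le_trans (lerD (H1 u s bu _) (H2 u s bu _)); try exact/andP.
  have iW := mI (\bigcup_(z in [set` l]) V z) (bigcup_open (fun z _ => oV z)).
  have iV := mI _ (oV x); rewrite -(RintD iV iW).
  apply: Rint_le => [||y]; first by apply: mI; exact: bigcup_open.
    exact: integD iV iW.
  rewrite -mulrDr ler_wpM2l// !indicE.
  have [yE|nE] := pselect (((\bigcup_(x0 in [set` x :: l]) V x0) `&`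
    (Omega `\` inner Omega s)) y); last by rewrite memNset//= addr_ge0.
  have [[z zl Vz] Oy] := yE; rewrite mem_set//.
  move: zl; rewrite /= inE => /orP[/eqP zx|zl].
    by rewrite mem_set ?lerDl//; split => //; rewrite -zx.
  by rewrite [X in _ <= _ + (nat_of_bool X)%:R]mem_set ?lerDr//; split => //; exists z.
have := compact_boundary; rewrite compact_cover => /(_ _ (boundary Omega) V).
have bV x : boundary Omega x -> V x x.
  by move=> bx; rewrite /V/= subrr -(scale0r (0 : 'rV[R]_d)) enormZ_abs normr0 mul0r; have [] := Hr x bx.
case => [x _|x bx|D DO cD]; first exact: open_enorm_ball.
  by exists x => //; exact: bV.
have [rho rho0 Hrho] := fin_tight (finmap.enum_fset D) (fun x xD => set_mem (DO x xD)) w w0.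
pose W := \bigcup_(x in [set` finmap.enum_fset D]) V x.
have oW : open W by apply: bigcup_open => x _; exact: open_enorm_ball.
have cK : compact (closure Omega `\` W).
  apply: bounded_closed_compact.
    by apply: (sub_boundedr _ bounded_closure) => x [].
  by apply: closedI; [exact: closed_closure|exact: open_closedC].
have KO : closure Omega `\` W `<=` Omega.
  move=> x [cx nW]; apply: contrapT => nO; apply: nW; apply: cD; split => //.
  by move=> /interior_subset.
have [m m0 Hm] := compact_margin oO cK KO.
(* [inner] asks for a radius strictly above its parameter, hence [m / 2] rather than [m]. *)
exists (Num.min rho (m / 2)); first by rewrite lt_min rho0 divr_gt0.
move=> u bu; apply: le_trans (Hrho u (Num.min rho (m / 2)) bu _); last first.
  by rewrite ge_min lexx lt_min rho0 divr_gt0.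
rewrite le_eqVlt; apply/orP; left; apply/eqP; apply: eq_Rintegral => y _.
congr (_ * _); congr (\1_ _ y); apply/seteqP; split; last by move=> z [].
move=> z [Oz nI]; split => //; apply: contrapT => nW; apply: nI; exists m.
  by rewrite gt_min [_ / 2 < _]ltr_pdivrMr// ltr_pMr// ltr1n orbT.
by move=> t tz; apply: (Hm z) => //; split => //; exact: subset_closure.
Qed.

End lipschitz_tightness.

(** * Bounds uniform in the step *)

Section scheme_bounds.
Variables (R : realType) (d : nat) (Omega : set 'rV[R]_d).
Hypotheses (oO : open Omega) (bO : bounded_set Omega).
Local Notation leb := (lebesgue_rV R d).
Local Notation lam := (lamO oO bO).
Variables (F : 'rV[R]_d -> \bar R) (bc : boundary_condition R d).
Hypothesis F_ge0 : forall xi, (0 <= F xi)%E.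
Hypothesis F0 : F 0 = 0%E.
Hypothesis F_lsc : lower_semicontinuous F.
Variables c c' : R.
Hypotheses (c0 : 0 < c) (c'0 : 0 <= c').
Hypothesis Fc : forall xi, ((c * enorm xi - c')%:E <= F xi)%E.

(** The estimate for pairs is applied to [u] and itself, whose minimum is [u]; the energy measure is
    counted twice, hence [a + a]. *)
Lemma bulk_var_le u (a : R) : integ leb u -> zero_off Omega u ->
  (bulk_energy Omega F u < a%:E)%E ->
  var_le Omega u ((a + a + c' * fine (lam setT)) / c).
Proof.
move=> ui uz ua i phi M tp pM.
have [e [ea ue]] := energy_measure oO bO F_ge0 F0 F_lsc uz ua.
have M0 : 0 <= M by apply: le_trans (pM 0).
have [+ _] := pair_Dpair_bound oO bO F_ge0 F0 c0 Fc i tp ui uz ui uz ue ue.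
have -> : (fun x => Num.min (u x) (u x)) = u by apply/funext => x; rewrite minxx.
rewrite /Dpair normrN => h; rewrite mulrAC ler_pdivlMr// mulrC.
have mp : measurable_fun setT (fun x => `|phi x|).
  by apply: measurableT_comp => //; exact: test_meas tp.
have pM' x : `| `|phi x| | <= M by rewrite normr_id.
have he : \int[e]_x `|phi x| <= M * a.
  apply: le_trans (ler_norm _) _; apply: (le_trans (@Rint_bound _ _ R e _ M mp pM')).
  exact: ler_wpM2l M0 _ _ ea.
have hl : \int[leb]_x `|phi x| <= M * fine (lam setT).
  rewrite (Rint_zero_off oO bO); last by move=> x nx; rewrite (test_zero_off tp nx) normr0.
  by apply: le_trans (ler_norm _) _; exact: (@Rint_bound _ _ R lam _ M mp pM').
apply: le_trans h _.
have -> : (a + a + c' * fine (lam setT)) * M = M * a + M * a + c' * (M * fine (lam setT)) by ring.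
by rewrite !lerD// ler_wpM2l.
Qed.

Variable u0 : 'rV[R]_d -> R.
Hypotheses (u0L : L1 Omega u0) (u0f : (Phi Omega F bc u0 < +oo)%E).

Let E0 := fine (Phi Omega F bc u0).

Lemma scheme_BVbounded t0 : exists2 B, 0 <= B & forall tau un, 0 < tau ->
  minimizing_movement Omega F bc tau u0 un -> forall n, tau * n%:R <= t0 ->
  BVbounded Omega B (ext0 Omega un n).
Proof.
pose B1 := \int[lam]_x `|(u0 \_ Omega) x| + Num.sqrt (2 * E0) * Num.sqrt t0.
(* [E0 + 1] is a strict upper bound of all the energies, as [bulk_var_le] requires. *)
pose B2 := (E0 + 1 + (E0 + 1) + c' * fine (lam setT)) / c.
have B2le : B2 <= Num.max 0 (Num.max B1 B2) by rewrite !le_max lexx !orbT.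
exists (Num.max 0 (Num.max B1 B2)); first by rewrite le_max lexx.
move=> tau un tau0 scheme n nt.
have [ui uz] := ext0_integ oO bO u0L scheme n.
have [vi vz] := ext0_integ oO bO u0L scheme 0.
have e0 : energy Omega F bc un 0 = E0 by rewrite /energy (ext0_Phi0 oO scheme).
split; [exact: ui|exact: uz| |].
  rewrite le_max; apply/orP; right; rewrite le_max; apply/orP; left.
  rewrite (Rint_zero_off oO bO); last by move=> x nx; rewrite uz ?normr0.
  have un0 : ext0 Omega un 0 = u0 \_ Omega by rewrite /ext0; case: scheme => ->.
  have li g : integ leb g -> integ lam g by exact: integ_lamO.
  apply: (@le_trans _ _ (\int[lam]_x (`|(u0 \_ Omega) x| + `|ext0 Omega un n x - ext0 Omega un 0 x|))).
    apply: Rint_le => [||x]; first by apply: integ_norm; exact: li.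
      by apply: integD; apply: integ_norm; [rewrite -un0; exact: li|apply: integB; exact: li].
    rewrite un0; apply: le_trans (ler_normD _ _); by rewrite addrC subrK.
  rewrite RintD; last 2 first.
  - by apply: integ_norm; rewrite -un0; exact: li.
  - by apply: integ_norm; apply: integB; exact: li.
  rewrite lerD2l; apply: le_trans (ext0_holder oO bO F_ge0 F0 u0L u0f tau0 scheme (leq0n n)) _.
  by rewrite e0 subn0; exact: (ler_wpM2l (sqrtr_ge0 _) (ler_wsqrtr nt)).
move=> i phi M tp pM.
have ua : (bulk_energy Omega F (ext0 Omega un n) < (E0 + 1)%:E)%E.
  apply: le_lt_trans (Phi_bulk F_ge0 F0 (ext0_fin oO bO u0L u0f tau0 scheme n)).2 _.
  rewrite (energyE oO bO F_ge0 F0 u0L u0f tau0 scheme) lte_fin.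
  apply: le_lt_trans (energy_le oO bO F_ge0 F0 u0L u0f tau0 scheme n) _.
  by rewrite e0 ltrDl.
apply: le_trans (bulk_var_le ui uz ua i tp pM) _.
exact: (ler_wpM2r (le_trans (normr_ge0 _) (pM 0)) B2le).
Qed.

Hypothesis F_convex : econvex F.
Hypothesis bcA : boundary_assumptions Omega F bc u0.

Lemma scheme_tight t0 w : 0 < t0 -> 0 < w -> exists2 r, 0 < r & forall tau un, 0 < tau ->
  minimizing_movement Omega F bc tau u0 un -> forall n, tau * n%:R <= t0 ->
  \int[leb]_x (`|ext0 Omega un n x| * \1_(Omega `\` inner Omega r) x) <= w.
Proof.
move=> t00 w0; case: bc u0f bcA (scheme_BVbounded t0) => [uf _ _|g uf [lD _ _ _] [B B0 HB]].
  exact: (neumann_tight oO bO F_ge0 F0 F_lsc F_convex c0 c'0 Fc u0L uf w0 t00).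
have [r r0 Hr] := lipschitz_tight oO bO lD B0 w0.
by exists r => // tau un tau0 sch n nt; apply: Hr; exact: HB tau0 sch n nt.
Qed.

(** The colouring has to be common to all steps and all iterates up to time [t0], so total
    boundedness is applied to the set of all of them. *)
Lemma scheme_label t0 delta : 0 < t0 -> 0 < delta ->
  exists (I : finType) (l : ('rV[R]_d -> R) -> I), forall tau tau' un un' n n',
    0 < tau -> 0 < tau' ->
    minimizing_movement Omega F bc tau u0 un ->
    minimizing_movement Omega F bc tau' u0 un' ->
    tau * n%:R <= t0 -> tau' * n'%:R <= t0 ->
    l (ext0 Omega un n) = l (ext0 Omega un' n') ->
    \int[lam]_x `|ext0 Omega un n x - ext0 Omega un' n' x| <= delta.
Proof.
move=> t00 delta0; have [B B0 HB] := scheme_BVbounded t0.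
pose S : set ('rV[R]_d -> R) := [set v | exists tau un n, [/\ 0 < tau,
  minimizing_movement Omega F bc tau u0 un, tau * n%:R <= t0 & v = ext0 Omega un n]].
have SB v : S v -> BVbounded Omega B v.
  by move=> [tau [un [n [tau0 sch nt ->]]]]; exact: HB tau0 sch n nt.
have St w : 0 < w -> exists2 r, 0 < r & forall v, S v ->
    \int[leb]_x (`|v x| * \1_(Omega `\` inner Omega r) x) <= w.
  move=> w0; have [r r0 Hr] := scheme_tight t00 w0; exists r => //.
  by move=> v [tau [un [n [tau0 sch nt ->]]]]; exact: Hr tau0 sch n nt.
have [I [l Hl]] := label_tight oO bO B0 SB St delta0.
exists I, l => tau tau' un un' n n' tau0 tau'0 sch sch' nt nt' ll.
have [_ z] := ext0_integ oO bO u0L sch n; have [_ z'] := ext0_integ oO bO u0L sch' n'.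
rewrite -(Rint_zero_off oO bO); last by move=> x nx; rewrite z// z'// subrr normr0.
by apply: Hl => //; [exists tau, un, n|exists tau', un', n'].
Qed.

End scheme_bounds.

(** * Uniform convergence in time and conclusion *)

Lemma Lnorm_itv_le (R : realType) (T b : R) (f : R -> R) : 0 <= b ->
  (forall t, 0 <= t <= T -> `|f t| <= b) ->
  (Lnorm (mrestr lebesgue_measure (measurable_itv `[0%R, T])) +oo (EFin \o f) <= b%:E)%E.
Proof.
move=> b0 fb; rewrite unlock; case: ifPn => _; last by rewrite lee_fin.
apply/ess_sup_inf.ess_supP; exists (~` `[0, T]%classic); split.
- exact: measurableC.
- rewrite -[LHS]/(lebesgue_measure (~` `[0, T]%classic `&` `[0, T]%classic)).
  by rewrite setICl measure0.
move=> t /= nt; rewrite in_itv/= => t0T; apply: nt; rewrite lee_fin; exact: fb.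
Qed.

Theorem theorem2p3 (R : realType) (d : nat) (d_gt0 : (0 < d)%N)
    (Omega : set 'rV[R]_d)
    (Omega_bounded : bounded_set Omega) (Omega_connected : connected Omega)
    (Omega_open : open Omega)
    (F : 'rV[R]_d -> \bar R)
    (F_ge0 : forall xi, (0 <= F xi)%E) (F_convex : econvex F)
    (F_lsc : lower_semicontinuous F) (F0 : F 0 = 0%E)
    (F_coercive : exists c c' : R, [/\ 0 < c, 0 <= c' &
      forall xi, ((c * enorm xi - c')%:E <= F xi)%E])
    (bc : boundary_condition R d)
    (u0 : 'rV[R]_d -> R)
    (bc_assumptions : boundary_assumptions Omega F bc u0)
    (u0_L1 : L1 Omega u0) (u0_finite : (Phi Omega F bc u0 < +oo)%E)
    (un : R -> nat -> 'rV[R]_d -> R)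
    (un_scheme : forall tau, 0 < tau ->
      minimizing_movement Omega F bc tau u0 (un tau)) :
  let utau (tau t : R) : 'rV[R]_d -> R := un tau (Num.truncn (t / tau)) in
  exists (u : R -> 'rV[R]_d -> R) (tauk : nat -> R),
    [/\ (forall t, 0 <= t -> L1 Omega (u t)) /\
        (forall t, 0 <= t ->
          (fun s => L1norm Omega (fun x => u s x - u t x))
            @ within `[0, +oo[ (nbhs t) --> (0 : R)),
        (forall k, 0 < tauk k) /\ tauk @ \oo --> (0 : R),
        forall T, 0 < T ->
          (fun k => Lnorm (mrestr lebesgue_measure (measurable_itv `[0, T])) +oo%E
            (fun t => (L1norm Omega (fun x => utau (tauk k) t x - u t x))%:E))
            @ \oo --> (0%E : \bar R) &
        forall s t, 0 <= s -> 0 <= t ->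
          L1norm Omega (fun x => u s x - u t x) <=
            Num.sqrt (2 * fine (Phi Omega F bc u0)) * Num.sqrt `|t - s|].
Proof.
move=> utau; have [c [c' [c0 c'0 Fc]]] := F_coercive.
pose E0 := fine (Phi Omega F bc u0).
pose lam := lamO Omega_open Omega_bounded.
pose C := Num.sqrt (2 * E0).
pose vn tau n := ext0 Omega (un tau) n.
have vi tau n : 0 < tau -> integ (lebesgue_rV R d) (vn tau n) /\ zero_off Omega (vn tau n).
  by move=> tau0; exact: (ext0_integ Omega_open Omega_bounded u0_L1 (un_scheme tau tau0) n).
have li tau n : 0 < tau -> integ lam (vn tau n).
  by move=> /(vi _ n)[i _]; exact: integ_lamO.
have [|tau n|tau n m tau0 mn|t0 delta t00 delta0|u [tauk [uP tauk0 uc uH]]] :=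
    @trajectory_compactness _ _ R lam vn C.
- exact: sqrtr_ge0.
- exact: li.
- have := ext0_holder Omega_open Omega_bounded F_ge0 F0 u0_L1 u0_finite tau0 (un_scheme tau tau0) mn.
  by rewrite /energy (ext0_Phi0 Omega_open (un_scheme tau tau0)).
- have [I [l Hl]] := scheme_label Omega_open Omega_bounded F_ge0 F0 F_lsc c0 c'0 Fc u0_L1
    u0_finite F_convex bc_assumptions t00 delta0.
  exists I, l => tau tau' n n' /andP[tau0 _] /andP[tau'0 _] nt nt' ll.
  exact: (Hl tau tau' (un tau) (un tau') n n' tau0 tau'0 (un_scheme _ tau0) (un_scheme _ tau'0) nt nt' ll).
have uN s t : 0 <= s -> 0 <= t ->
    L1norm Omega (fun x => u s x - u t x) = \int[lam]_x `|u s x - u t x|.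
  move=> s0 t0; apply: L1norm_lamO.
  by apply: integB; [exact: (uP s s0).1|exact: (uP t t0).1].
have uN' k t : 0 <= t -> L1norm Omega (fun x => utau (tauk k) t x - u t x) =
    \int[lam]_x `|vn (tauk k) (Num.truncn (t / tauk k)) x - u t x|.
  move=> t0; rewrite -(L1norm_lamO (oO := Omega_open) (bO := Omega_bounded)).
    by apply: L1norm_eq => x xO; rewrite /vn /ext0 patchE xO.
  by apply: integB; [apply: li; exact: tauk0.1|exact: (uP t t0).1].
exists u, tauk; split => //.
- split => [t t0|t t0].
    by apply/(L1_integP Omega_open Omega_bounded); [exact: integ_meas (uP t t0).1|exact: (uP t t0).1].
  (* Continuity is squeezed out of the Hoelder bound; restricting the filter to nonnegative times
     matters because [u] is controlled only there. *)
  have cC : (fun s : R => C * Num.sqrt `|t - s|) @ within `[0, +oo[%classic (nbhs t) --> (0 : R).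
    apply: cvg_within_filter.
    have cv : C * Num.sqrt `|t - s| @[s --> t] --> C * Num.sqrt `|t - t|.
      apply: cvgM; first exact: cvg_cst.
      apply: (@continuous_comp _ _ _ (fun s : R => `|t - s|) Num.sqrt t); last exact: sqrt_continuous.
      by apply: cvg_norm; apply: cvgB; [exact: cvg_cst|exact: cvg_id].
    by rewrite subrr normr0 sqrtr0 mulr0 in cv.
  apply: (@squeeze_cvgr _ _ _ _ (fun=> 0) (fun s => C * Num.sqrt `|t - s|)) => //; last exact: cvg_cst.
  apply: filterS (withinT _ _) => s; rewrite /= in_itv/= andbT => s0.
  by rewrite uN// uH// Rint_ge0.
(* The norms are extended reals: they are at most 1, hence finite, from some index on, and only then
   is the limit taken in the reals. *)
- move=> T T0; apply/fine_cvgP; split.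
    have [N HN] := uc T 1 T0 ltr01; exists N => // k Nk.
    rewrite fin_numElt; apply/andP; split; first by apply: lt_le_trans (Lnorm_ge0 _ _ _).
    apply: (@le_lt_trans _ _ 1%:E); last exact: ltry.
    apply: (@Lnorm_itv_le R T 1 (fun t => L1norm Omega _)) => // t /andP[t0 tT].
    by rewrite uN'// ger0_norm ?Rint_ge0//; apply: HN => //; rewrite t0.
  apply/cvgrPdist_le => e e0; have [N HN] := uc T e T0 e0; exists N => // k Nk /=.
  rewrite sub0r normrN ger0_norm ?fine_ge0 ?Lnorm_ge0//.
  have h : (Lnorm (mrestr lebesgue_measure (measurable_itv `[0%R, T])) +oo
      (fun t => (L1norm Omega (fun x => utau (tauk k) t x - u t x))%:E) <= e%:E)%E.
    apply: (@Lnorm_itv_le R T e (fun t => L1norm Omega _)) => [|t /andP[t0 tT]]; first exact: ltW.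
    by rewrite uN'// ger0_norm ?Rint_ge0//; apply: HN => //; rewrite t0.
  rewrite -lee_fin fineK// fin_numElt (le_lt_trans h (ltry _)) andbT.
  by apply: lt_le_trans (Lnorm_ge0 _ _ _).
- by move=> s t s0 t0; rewrite uN//; exact: uH.
Qed.
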